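(* Every meromorphic almost periodic function $f$ on a horizontal strip $S$ is a quotient $f=g/h$ of two analytic almost periodic functions $g,h$ on $S$ (with $h\not\equiv0$).
   Context: A (horizontal) strip is a set $S=\{z\in\mathbb C: a<\operatorname{Im} z<b\}$ with $-\infty\le a<b\le\infty$. For $S'=\{z: \alpha<\operatorname{Im} z<\beta\}$, the notation $S'\subset\subset S$ means $a<\alpha<\beta<b$. $\rho$ denotes the spherical metric on $\overline{\mathbb C}=\mathbb C\cup\{\infty\}$. A set $E\subset\mathbb R$ is relatively dense if there is $L>0$ such that every segment $[t,t+L]$, $t\in\mathbb R$, meets $E$. A meromorphic function $f$ on $S$ is called a meromorphic almost periodic function on $S$ if for every $S'\subset\subset S$ and every $\varepsilon>0$ the set $\{\tau\in\mathbb R:\rho(f(z+\tau),f(z))<\varepsilon\ \ \forall z\in S'\}$ is relatively dense in $\mathbb R$. An analytic function $f$ on $S$ is called an analytic almost periodic function on $S$ if for every $S'\subset\subset S$ and every $\varepsilon>0$ the set $\{\tau\in\mathbb R:|f(z+\tau)-f(z)|<\varepsilon\ \ \forall z\in S'\}$ is relatively dense in $\mathbb R$. *)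

(* Defs.v *)
(* Stdlib reals with Coquelicot's complex numbers. *)
From Stdlib Require Import Reals.
From Coquelicot Require Import Coquelicot.
Open Scope R_scope.

Definition strip (a b : Rbar) (z : C) : Prop :=
  Rbar_lt a (Im z) /\ Rbar_lt (Im z) b.

(* Bounds lying strictly between [a] and [b] are necessarily real, so the
   substrips compactly inside are indexed by real [alpha] and [beta]. *)
Definition inner_strip (alpha beta : R) (a b : Rbar) : Prop :=
  Rbar_lt a alpha /\ alpha < beta /\ Rbar_lt beta b.

Inductive Cbar : Type :=
  | Cfin : C -> Cbar
  | Cinf : Cbar.

Definition affine_part (w : Cbar) : C :=
  match w with
  | Cfin z => z
  | Cinf => RtoC 0
  end.

(* Length of the chord joining the stereographic images on the unit sphere
   of R^3. *)
Definition chord (u v : Cbar) : R :=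
  match u, v with
  | Cfin z, Cfin w =>
      2 * Cmod (z - w)%C / (sqrt (1 + Cmod z ^ 2) * sqrt (1 + Cmod w ^ 2))
  | Cfin z, Cinf | Cinf, Cfin z => 2 / sqrt (1 + Cmod z ^ 2)
  | Cinf, Cinf => 0
  end.

(* Great-circle distance on the unit sphere: a chord of length d subtends an
   arc of length 2 asin (d / 2). *)
Definition rho (u v : Cbar) : R := 2 * asin (chord u v / 2).

Definition relatively_dense (E : R -> Prop) : Prop :=
  exists L : R, 0 < L /\
    forall t : R, exists tau : R, t <= tau <= t + L /\ E tau.

Definition C_differentiable (f : C -> C) (z : C) : Prop :=
  @ex_derive C_AbsRing C_NormedModule f z.

(* Meant for open [D], on which complex differentiability at every point is
   analyticity. *)
Definition analytic_on (D : C -> Prop) (f : C -> C) : Prop :=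
  forall z : C, D z -> C_differentiable f z.

(* Meant for open [D]: analytic up to isolated singularities, which are poles
   and are exactly the points with value [Cinf]. The placeholder value of
   [affine_part] at [Cinf] plays no role, since near each point of [D] that
   value can only be taken at the point itself. *)
Definition meromorphic_on (D : C -> Prop) (f : C -> Cbar) : Prop :=
  forall z0 : C, D z0 ->
    locally' z0 (fun z : C =>
      f z <> Cinf /\ C_differentiable (fun x : C => affine_part (f x)) z) /\
    match f z0 with
    | Cfin _ => C_differentiable (fun x : C => affine_part (f x)) z0
    | Cinf => filterlim (fun z : C => Cmod (affine_part (f z)))
                (locally' z0) (Rbar_locally p_infty)
    end.

Definition meromorphic_almost_periodic (a b : Rbar) (f : C -> Cbar) : Prop :=
  meromorphic_on (strip a b) f /\
  forall alpha beta : R, inner_strip alpha beta a b ->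
  forall eps : R, 0 < eps ->
    relatively_dense (fun tau : R =>
      forall z : C, strip alpha beta z ->
        rho (f (z + RtoC tau)%C) (f z) < eps).

Definition analytic_almost_periodic (a b : Rbar) (f : C -> C) : Prop :=
  analytic_on (strip a b) f /\
  forall alpha beta : R, inner_strip alpha beta a b ->
  forall eps : R, 0 < eps ->
    relatively_dense (fun tau : R =>
      forall z : C, strip alpha beta z ->
        Cmod (f (z + RtoC tau) - f z)%C < eps).

(* [f = g / h] as meromorphic functions on [D]. For [D] open and connected and
   [h] analytic, the zeros of [h] are isolated, so the values of a meromorphic
   [f] there (poles, or removed singularities at common zeros of [g] and [h])
   are determined by the equality off these zeros. *)
Definition is_quotient_on (D : C -> Prop) (f : C -> Cbar) (g h : C -> C)
    : Prop :=
  (exists z : C, D z /\ h z <> RtoC 0) /\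
  forall z : C, D z -> h z <> RtoC 0 -> f z = Cfin (g z / h z)%C.

(* Main.v *)
(* The denominator [h] is an infinite product over the poles [a] of [f] of
   factors [1 - chi a * E (z - a)], where [E w = exp (- kappa w ^ 2 - i mu w)] is
   entire, decays fast along horizontal lines and satisfies [E 0 = 1]. Such an
   [h] vanishes at the poles with sufficient multiplicity; its superfluous zeros
   do no harm, since they are also zeros of [g = f * h]. The poles are grouped in
   the cells of rows of equally spaced squares. In a cell their number is bounded,
   and the poles there depend continuously on [f], so that an integral almost
   period of [f] moves the product over a row only a little. The cutoff [chi]
   lets a pole enter or leave a cell without a jump. Rows at height [y] outside
   a compact substrip contribute factors close to 1 on it when [|mu|] is large and
   of the right sign, which makes the product over all rows converge. Finally [g]
   is almost periodic because every point is surrounded by a small contour on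
   which [f] is bounded, uniformly in the substrip. *)
Require Import Defs.
From Stdlib Require Import Reals Lra Lia List Classical ClassicalEpsilon ZArith.
From Coquelicot Require Import Coquelicot.
Open Scope R_scope.

(** * Complex differentiability *)

(** The difficulty is uniformity: the number of poles in a cell, the distance they move under an
    almost period and the size of [f] on contours must be controlled by constants that do not depend
    on the cell. This is done without normal families. Near poles [f] is replaced by [1/f], analytic
    and bounded by 2 on small squares, together with an explicit lower bound [m s] for its maximum
    on every smaller square of radius [s]. Dividing out zeros one at a time under the maximum
    principle then yields all constants: the number of zeros, lower bounds for the zero-free factor,
    and the continuity of the zeros. The list of poles of a cell is an arbitrary choice, made
    separately for each cell; choices may disagree near the rim, but the cutoff vanishes there, and
    unique factorization shows that the product depends on [f] alone. Nontriviality of [h] needs a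
    second mechanism besides [mu]: in a thin row through a point [z0] where [f] is finite, the poles
    keep a positive horizontal distance from [z0], and there a large [kappa] makes the kernels
    small. *)

Definition cder (F : C -> C) (z l : C) : Prop :=
  forall eps, 0 < eps -> exists delta, 0 < delta /\ forall w,
    Cmod (w - z)%C < delta ->
    Cmod (F w - F z - l * (w - z))%C <= eps * Cmod (w - z)%C.

Definition holo (F : C -> C) (z : C) : Prop := exists l, cder F z l.

Definition ccont (F : C -> C) (z : C) : Prop :=
  forall eps, 0 < eps -> exists delta, 0 < delta /\ forall w,
    Cmod (w - z)%C < delta -> Cmod (F w - F z)%C < eps.

Definition near_eq (F G : C -> C) (z : C) : Prop :=
  exists delta, 0 < delta /\ forall w, Cmod (w - z)%C < delta -> F w = G w.

Lemma Cmod_minus_sym (z w : C) : Cmod (z - w)%C = Cmod (w - z)%C.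
Proof. rewrite <- (Cmod_opp (z - w)). f_equal. ring. Qed.

Lemma Cmod_triangle_minus (z w : C) : Cmod (z - w)%C <= Cmod z + Cmod w.
Proof.
  unfold Cminus. rewrite <- (Cmod_opp w). apply Cmod_triangle.
Qed.

Lemma Cmod_triangle_rev (z w : C) : Cmod z - Cmod w <= Cmod (z - w)%C.
Proof.
  assert (H := Cmod_triangle (z - w) w).
  replace (z - w + w)%C with z in H by ring. lra.
Qed.

Lemma Cmod_diag (z : C) : Cmod (z - z)%C = 0.
Proof. replace (z - z)%C with (RtoC 0) by ring. apply Cmod_0. Qed.

Lemma im_le_Cmod (z : C) : Rabs (Im z) <= Cmod z.
Proof.
  apply Rle_trans with (2 := Rmax_Cmod z). apply Rmax_r.
Qed.

Lemma Cmod_le_re_im (z : C) : Cmod z <= Rabs (Re z) + Rabs (Im z).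
Proof.
  assert (E : z = (RtoC (Re z) + Ci * RtoC (Im z))%C)
    by (destruct z as [x y]; unfold RtoC, Ci, Cplus, Cmult, Re, Im; simpl; f_equal; ring).
  rewrite E at 1. eapply Rle_trans. apply Cmod_triangle.
  rewrite Cmod_mult, Cmod_Ci, !Cmod_R. lra.
Qed.

Lemma Cmod_neq0 (z : C) : z <> RtoC 0 -> 0 < Cmod z.
Proof. intros H. apply Cmod_gt_0, H. Qed.

(** The only contact with Coquelicot's derivative: hypotheses on [f] are unpacked and the conclusion
    is repacked through it. Everything between uses the epsilon-delta form, which has no quotient
    and so admits [w = z]. *)
Lemma C_differentiable_holo (F : C -> C) (z : C) : C_differentiable F z <-> holo F z.
Proof.
  split.
  - intros [l [_ D]]. exists l. intros eps Heps.
    assert (D' := D z (fun P H => H) (mkposreal eps Heps)).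
    destruct D' as [d Hd]. exists d. split. apply cond_pos.
    intros w Hw. specialize (Hd w Hw). simpl in Hd.
    change (Cmod (F w - F z - (w - z) * l)%C <= eps * Cmod (w - z)%C) in Hd.
    replace (l * (w - z))%C with ((w - z) * l)%C by ring. exact Hd.
  - intros [l D]. exists l. split.
    + apply is_linear_scal_l.
    + intros x Hx.
      (* Differentiability is stated at every limit of the filter [locally z]; such a limit can only
         be [z]. *)
      apply (@is_filter_lim_locally_unique C_AbsRing (AbsRing_NormedModule C_AbsRing)) in Hx.
      subst x.
      intros eps. destruct (D eps (cond_pos eps)) as [d [Hd H]].
      exists (mkposreal d Hd). intros w Hw. specialize (H w Hw).
      change (Cmod (F w - F z - (w - z) * l)%C <= eps * Cmod (w - z)%C).
      replace ((w - z) * l)%C with (l * (w - z))%C by ring. exact H.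
Qed.

Lemma cder_local_bound (F : C -> C) (z l : C) : cder F z l ->
  exists delta, 0 < delta /\ forall w, Cmod (w - z)%C < delta ->
    Cmod (F w - F z)%C <= (Cmod l + 1) * Cmod (w - z)%C.
Proof.
  intros D. destruct (D 1 Rlt_0_1) as [d [Hd H]]. exists d. split; [exact Hd|].
  intros w Hw. specialize (H w Hw).
  replace (F w - F z)%C with ((F w - F z - l * (w - z)) + l * (w - z))%C by ring.
  eapply Rle_trans. apply Cmod_triangle. rewrite Cmod_mult. lra.
Qed.

Lemma holo_ccont (F : C -> C) (z : C) : holo F z -> ccont F z.
Proof.
  intros [l D] eps Heps. destruct (cder_local_bound F z l D) as [d [Hd H]].
  assert (Hl := Cmod_ge_0 l).
  exists (Rmin d (eps / (Cmod l + 1))). split.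
  - apply Rmin_pos; [exact Hd|]. apply Rdiv_lt_0_compat; lra.
  - intros w Hw. eapply Rle_lt_trans. apply H.
    + eapply Rlt_le_trans. apply Hw. apply Rmin_l.
    + assert (Hw2 : Cmod (w - z)%C < eps / (Cmod l + 1))
        by (eapply Rlt_le_trans; [apply Hw|apply Rmin_r]).
      apply Rmult_lt_compat_l with (r := Cmod l + 1) in Hw2; [|lra].
      replace ((Cmod l + 1) * (eps / (Cmod l + 1))) with eps in Hw2 by (field; lra).
      exact Hw2.
Qed.

Lemma cder_ext_near (F G : C -> C) (z l : C) : near_eq F G z -> cder F z l -> cder G z l.
Proof.
  intros [d [Hd E]] D eps Heps. destruct (D eps Heps) as [d' [Hd' H]].
  exists (Rmin d d'). split. apply Rmin_pos; assumption.
  intros w Hw. rewrite <- !E.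
  - apply H. eapply Rlt_le_trans. apply Hw. apply Rmin_r.
  - rewrite Cmod_diag. exact Hd.
  - eapply Rlt_le_trans. apply Hw. apply Rmin_l.
Qed.

Lemma holo_ext_near (F G : C -> C) (z : C) : near_eq F G z -> holo F z -> holo G z.
Proof. intros E [l D]. exists l. apply (cder_ext_near F); assumption. Qed.

Lemma near_eq_refl (F G : C -> C) (z : C) : (forall w, F w = G w) -> near_eq F G z.
Proof. intros H. exists 1. split. lra. intros w _. apply H. Qed.

Lemma holo_ext (F G : C -> C) (z : C) : (forall w, F w = G w) -> holo F z -> holo G z.
Proof. intros H. apply holo_ext_near, near_eq_refl, H. Qed.

Lemma cder_const (c z : C) : cder (fun _ => c) z (RtoC 0).
Proof.
  intros eps Heps. exists 1. split. lra. intros w _.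
  replace (c - c - 0 * (w - z))%C with (RtoC 0) by ring. rewrite Cmod_0.
  apply Rmult_le_pos. lra. apply Cmod_ge_0.
Qed.

Lemma cder_id (z : C) : cder (fun w => w) z (RtoC 1).
Proof.
  intros eps Heps. exists 1. split. lra. intros w _.
  replace (w - z - 1 * (w - z))%C with (RtoC 0) by ring. rewrite Cmod_0.
  apply Rmult_le_pos. lra. apply Cmod_ge_0.
Qed.

Lemma cder_plus (F G : C -> C) (z l m : C) :
  cder F z l -> cder G z m -> cder (fun w => F w + G w)%C z (l + m)%C.
Proof.
  intros DF DG eps Heps.
  destruct (DF (eps / 2)) as [d1 [Hd1 H1]]; [lra|].
  destruct (DG (eps / 2)) as [d2 [Hd2 H2]]; [lra|].
  exists (Rmin d1 d2). split. apply Rmin_pos; assumption.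
  intros w Hw.
  assert (A1 := H1 w (Rlt_le_trans _ _ _ Hw (Rmin_l _ _))).
  assert (A2 := H2 w (Rlt_le_trans _ _ _ Hw (Rmin_r _ _))).
  replace (F w + G w - (F z + G z) - (l + m) * (w - z))%C
    with ((F w - F z - l * (w - z)) + (G w - G z - m * (w - z)))%C by ring.
  eapply Rle_trans. apply Cmod_triangle. lra.
Qed.

Lemma cder_mult (F G : C -> C) (z l m : C) :
  cder F z l -> cder G z m -> cder (fun w => F w * G w)%C z (l * G z + F z * m)%C.
Proof.
  intros DF DG eps Heps.
  destruct (cder_local_bound F z l DF) as [d0 [Hd0 H0]].
  assert (CG := holo_ccont G z (ex_intro _ m DG)).
  set (A := Cmod l + 1). set (B := Cmod (G z) + Cmod (F z) + 1).
  assert (HA : 0 < A) by (unfold A; generalize (Cmod_ge_0 l); lra).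
  assert (HB : 0 < B) by (unfold B; generalize (Cmod_ge_0 (G z)) (Cmod_ge_0 (F z)); lra).
  destruct (DF (eps / (3 * B))) as [d1 [Hd1 H1]]; [apply Rdiv_lt_0_compat; lra|].
  destruct (DG (eps / (3 * B))) as [d2 [Hd2 H2]]; [apply Rdiv_lt_0_compat; lra|].
  destruct (CG (eps / (3 * A))) as [d3 [Hd3 H3]]; [apply Rdiv_lt_0_compat; lra|].
  exists (Rmin (Rmin d0 d1) (Rmin d2 d3)). split. repeat apply Rmin_pos; assumption.
  intros w Hw.
  assert (Hw0 : Cmod (w - z)%C < d0 /\ Cmod (w - z)%C < d1 /\ Cmod (w - z)%C < d2 /\ Cmod (w - z)%C < d3).
  { repeat split; eapply Rlt_le_trans; try apply Hw; unfold Rmin; repeat destruct Rle_dec; lra. }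
  destruct Hw0 as [W0 [W1 [W2 W3]]].
  specialize (H0 w W0). specialize (H1 w W1). specialize (H2 w W2). specialize (H3 w W3).
  replace (F w * G w - F z * G z - (l * G z + F z * m) * (w - z))%C
    with (((F w - F z - l * (w - z)) * G z + F z * (G w - G z - m * (w - z)))
          + (F w - F z) * (G w - G z))%C by ring.
  set (D := Cmod (w - z)%C) in *. assert (HD : 0 <= D) by apply Cmod_ge_0.
  eapply Rle_trans. apply Cmod_triangle. rewrite Cmod_mult.
  assert (E1 : Cmod ((F w - F z - l * (w - z)) * G z + F z * (G w - G z - m * (w - z)))%C
               <= eps / (3 * B) * D * B).
  { eapply Rle_trans. apply Cmod_triangle. rewrite !Cmod_mult.
    apply Rle_trans with (eps / (3 * B) * D * Cmod (G z) + Cmod (F z) * (eps / (3 * B) * D)).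
    - apply Rplus_le_compat.
      + apply Rmult_le_compat_r. apply Cmod_ge_0. exact H1.
      + apply Rmult_le_compat_l. apply Cmod_ge_0. exact H2.
    - set (t := eps / (3 * B) * D).
      assert (0 <= t)
        by (apply Rmult_le_pos; [left; apply Rdiv_lt_0_compat; lra|exact HD]).
      apply Rle_trans with (t * (Cmod (G z) + Cmod (F z))); [right; ring|].
      apply Rmult_le_compat_l; [assumption|]. unfold B. lra. }
  assert (E2 : Cmod (F w - F z)%C * Cmod (G w - G z)%C <= (A * D) * (eps / (3 * A))).
  { apply Rmult_le_compat; try apply Cmod_ge_0. exact H0. lra. }
  replace (eps / (3 * B) * D * B) with (eps * D / 3) in E1 by (field; lra).
  replace (A * D * (eps / (3 * A))) with (eps * D / 3) in E2 by (field; lra).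
  assert (0 <= eps * D) by (apply Rmult_le_pos; lra).
  lra.
Qed.

Lemma cder_comp (F G : C -> C) (z l m : C) :
  cder F z l -> cder G (F z) m -> cder (fun w => G (F w)) z (m * l)%C.
Proof.
  intros DF DG eps Heps.
  destruct (cder_local_bound F z l DF) as [d0 [Hd0 H0]].
  set (A := Cmod l + 1). set (B := Cmod m + 1).
  assert (HA : 0 < A) by (unfold A; generalize (Cmod_ge_0 l); lra).
  assert (HB : 0 < B) by (unfold B; generalize (Cmod_ge_0 m); lra).
  destruct (DF (eps / (2 * B))) as [d1 [Hd1 H1]]; [apply Rdiv_lt_0_compat; lra|].
  destruct (DG (eps / (2 * A))) as [d2 [Hd2 H2]]; [apply Rdiv_lt_0_compat; lra|].
  exists (Rmin (Rmin d0 d1) (d2 / A)). split.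
  { repeat apply Rmin_pos; try assumption. apply Rdiv_lt_0_compat; assumption. }
  intros w Hw.
  assert (Hw0 : Cmod (w - z)%C < d0 /\ Cmod (w - z)%C < d1 /\ Cmod (w - z)%C < d2 / A).
  { repeat split; eapply Rlt_le_trans; try apply Hw; unfold Rmin; repeat destruct Rle_dec; lra. }
  destruct Hw0 as [W0 [W1 W2]]. specialize (H0 w W0). specialize (H1 w W1).
  fold A in H0.
  assert (W3 : Cmod (F w - F z)%C < d2).
  { eapply Rle_lt_trans. apply H0. apply Rmult_lt_compat_l with (r := A) in W2; [|lra].
    replace (A * (d2 / A)) with d2 in W2 by (field; lra). exact W2. }
  specialize (H2 _ W3).
  set (D := Cmod (w - z)%C) in *. assert (HD : 0 <= D) by apply Cmod_ge_0.
  replace (G (F w) - G (F z) - m * l * (w - z))%C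
    with ((G (F w) - G (F z) - m * (F w - F z)) + m * (F w - F z - l * (w - z)))%C by ring.
  eapply Rle_trans. apply Cmod_triangle. rewrite Cmod_mult.
  assert (E1 : eps / (2 * A) * Cmod (F w - F z)%C <= eps / (2 * A) * (A * D)).
  { apply Rmult_le_compat_l. left. apply Rdiv_lt_0_compat; lra. exact H0. }
  replace (eps / (2 * A) * (A * D)) with (eps * D / 2) in E1 by (field; lra).
  assert (E2 : Cmod m * Cmod (F w - F z - l * (w - z))%C <= B * (eps / (2 * B) * D)).
  { apply Rmult_le_compat; try apply Cmod_ge_0. unfold B; lra. exact H1. }
  replace (B * (eps / (2 * B) * D)) with (eps * D / 2) in E2 by (field; lra).
  lra.
Qed.

Lemma cder_inv (z : C) : z <> RtoC 0 -> cder Cinv z (- / (z * z))%C.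
Proof.
  intros Hz eps Heps. assert (P := Cmod_neq0 z Hz).
  set (a := Cmod z) in *.
  exists (Rmin (a / 2) (eps * a * a * a / 2)). split.
  { apply Rmin_pos; [lra|]. assert (0 < eps * a * a * a) by (repeat apply Rmult_lt_0_compat; lra). lra. }
  intros w Hw.
  assert (W1 := Rlt_le_trans _ _ _ Hw (Rmin_l _ _)).
  assert (W2 := Rlt_le_trans _ _ _ Hw (Rmin_r _ _)).
  assert (Pw : a / 2 < Cmod w).
  { assert (T := Cmod_triangle_rev z (z - w)).
    replace (z - (z - w))%C with w in T by ring.
    rewrite (Cmod_minus_sym z w) in T. fold a in T. lra. }
  assert (Hw0 : w <> RtoC 0) by (apply Cmod_gt_0; lra).
  replace (/ w - / z - - / (z * z) * (w - z))%C
    with ((w - z) * (w - z) * / (z * z * w))%C by (field; auto).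
  rewrite !Cmod_mult, Cmod_inv by (repeat apply Cmult_neq_0; assumption).
  rewrite !Cmod_mult. fold a. set (D := Cmod (w - z)%C) in *.
  assert (HD : 0 <= D) by apply Cmod_ge_0.
  rewrite (Rmult_comm eps D). rewrite Rmult_assoc. apply Rmult_le_compat_l; [exact HD|].
  apply Rmult_le_reg_r with (a * a * Cmod w).
  { repeat apply Rmult_lt_0_compat; lra. }
  rewrite Rmult_assoc, Rinv_l, Rmult_1_r by (apply Rgt_not_eq; repeat apply Rmult_lt_0_compat; lra).
  apply Rle_trans with (eps * a * a * a / 2). lra.
  assert (0 < eps * (a * a)) by (repeat apply Rmult_lt_0_compat; lra). nra.
Qed.

Lemma holo_const (c z : C) : holo (fun _ => c) z.
Proof. eexists. apply cder_const. Qed.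

Lemma holo_id (z : C) : holo (fun w => w) z.
Proof. eexists. apply cder_id. Qed.

Lemma holo_plus (F G : C -> C) (z : C) : holo F z -> holo G z -> holo (fun w => F w + G w)%C z.
Proof. intros [l D] [m E]. eexists. apply cder_plus; eassumption. Qed.

Lemma holo_mult (F G : C -> C) (z : C) : holo F z -> holo G z -> holo (fun w => F w * G w)%C z.
Proof. intros [l D] [m E]. eexists. apply cder_mult; eassumption. Qed.

Lemma holo_comp (F G : C -> C) (z : C) : holo F z -> holo G (F z) -> holo (fun w => G (F w)) z.
Proof. intros [l D] [m E]. eexists. apply (cder_comp F G); eassumption. Qed.

Lemma holo_inv (F : C -> C) (z : C) : holo F z -> F z <> RtoC 0 -> holo (fun w => / F w)%C z.
Proof.
  intros D H. apply (holo_comp F Cinv); [exact D|]. eexists. apply cder_inv, H.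
Qed.

Lemma holo_opp (F : C -> C) (z : C) : holo F z -> holo (fun w => - F w)%C z.
Proof.
  intros D. apply (holo_ext (fun w => (- (1)) * F w)%C).
  - intros w. ring.
  - apply holo_mult; [apply holo_const|exact D].
Qed.

Lemma holo_minus (F G : C -> C) (z : C) : holo F z -> holo G z -> holo (fun w => F w - G w)%C z.
Proof. intros D E. unfold Cminus. apply holo_plus; [exact D|apply holo_opp, E]. Qed.

Lemma holo_div (F G : C -> C) (z : C) :
  holo F z -> holo G z -> G z <> RtoC 0 -> holo (fun w => F w / G w)%C z.
Proof. intros D E H. unfold Cdiv. apply holo_mult; [exact D|apply holo_inv; assumption]. Qed.

Lemma holo_pow (F : C -> C) (n : nat) (z : C) : holo F z -> holo (fun w => F w ^ n)%C z.
Proof.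
  intros D. induction n as [|n IH]; simpl.
  - apply holo_const.
  - apply (holo_mult F (fun w => F w ^ n)%C); assumption.
Qed.

Lemma ccont_plus (F G : C -> C) (z : C) : ccont F z -> ccont G z -> ccont (fun w => F w + G w)%C z.
Proof.
  intros CF CG eps Heps.
  destruct (CF (eps / 2)) as [d1 [Hd1 H1]]; [lra|].
  destruct (CG (eps / 2)) as [d2 [Hd2 H2]]; [lra|].
  exists (Rmin d1 d2). split. apply Rmin_pos; assumption.
  intros w Hw.
  assert (A1 := H1 w (Rlt_le_trans _ _ _ Hw (Rmin_l _ _))).
  assert (A2 := H2 w (Rlt_le_trans _ _ _ Hw (Rmin_r _ _))).
  replace (F w + G w - (F z + G z))%C with ((F w - F z) + (G w - G z))%C by ring.
  eapply Rle_lt_trans. apply Cmod_triangle. lra.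
Qed.

Lemma ccont_mult (F G : C -> C) (z : C) : ccont F z -> ccont G z -> ccont (fun w => F w * G w)%C z.
Proof.
  intros CF CG eps Heps.
  set (B := Cmod (G z) + Cmod (F z) + 1).
  assert (HB : 0 < B) by (unfold B; generalize (Cmod_ge_0 (G z)) (Cmod_ge_0 (F z)); lra).
  set (e := Rmin 1 (eps / (2 * B))).
  assert (He : 0 < e) by (apply Rmin_pos; [lra|apply Rdiv_lt_0_compat; lra]).
  assert (He1 : e <= 1) by apply Rmin_l.
  assert (He2 : e * B <= eps / 2).
  { apply Rle_trans with (eps / (2 * B) * B).
    - apply Rmult_le_compat_r. lra. apply Rmin_r.
    - right. field. lra. }
  destruct (CF e He) as [d1 [Hd1 H1]]. destruct (CG e He) as [d2 [Hd2 H2]].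
  exists (Rmin d1 d2). split. apply Rmin_pos; assumption.
  intros w Hw.
  assert (A1 := H1 w (Rlt_le_trans _ _ _ Hw (Rmin_l _ _))).
  assert (A2 := H2 w (Rlt_le_trans _ _ _ Hw (Rmin_r _ _))).
  replace (F w * G w - F z * G z)%C
    with ((F w - F z) * G z + F z * (G w - G z) + (F w - F z) * (G w - G z))%C by ring.
  eapply Rle_lt_trans. apply Cmod_triangle.
  eapply Rle_lt_trans. apply Rplus_le_compat_r. apply Cmod_triangle.
  rewrite !Cmod_mult.
  set (p := Cmod (F w - F z)%C) in *. set (q := Cmod (G w - G z)%C) in *.
  assert (0 <= p) by apply Cmod_ge_0. assert (0 <= q) by apply Cmod_ge_0.
  assert (0 <= Cmod (G z)) by apply Cmod_ge_0. assert (0 <= Cmod (F z)) by apply Cmod_ge_0.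
  unfold B in *. nra.
Qed.

(** * Integrals over rectangles and Goursat's theorem *)

Definition CI (f : R -> C) (a b : R) : C :=
  (RInt (fun t => Re (f t)) a b, RInt (fun t => Im (f t)) a b).

Definition cint (f : R -> C) (a b : R) : Prop :=
  ex_RInt (fun t => Re (f t)) a b /\ ex_RInt (fun t => Im (f t)) a b.

Lemma C_ext (z w : C) : Re z = Re w -> Im z = Im w -> z = w.
Proof. destruct z, w. unfold Re, Im. simpl. intros -> ->. reflexivity. Qed.

Lemma CI_ext (f g : R -> C) (a b : R) : a <= b ->
  (forall t, a <= t <= b -> f t = g t) -> CI f a b = CI g a b.
Proof.
  intros Hab H. unfold CI. f_equal; apply RInt_ext; intros t Ht;
    rewrite Rmin_left, Rmax_right in Ht by exact Hab; rewrite H by lra; reflexivity.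
Qed.

Lemma cint_plus (f g : R -> C) (a b : R) : cint f a b -> cint g a b ->
  cint (fun t => f t + g t)%C a b.
Proof.
  intros [F1 F2] [G1 G2]. split.
  - apply (ex_RInt_ext (fun t => plus (Re (f t)) (Re (g t)))).
    intros; reflexivity. apply @ex_RInt_plus; assumption.
  - apply (ex_RInt_ext (fun t => plus (Im (f t)) (Im (g t)))).
    intros; reflexivity. apply @ex_RInt_plus; assumption.
Qed.

Lemma CI_plus (f g : R -> C) (a b : R) : cint f a b -> cint g a b ->
  CI (fun t => f t + g t)%C a b = (CI f a b + CI g a b)%C.
Proof.
  intros [F1 F2] [G1 G2]. unfold CI, Cplus. simpl. f_equal.
  - apply (@RInt_plus R_CompleteNormedModule); assumption.
  - apply (@RInt_plus R_CompleteNormedModule); assumption.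
Qed.

Lemma CI_scal (c : C) (f : R -> C) (a b : R) : cint f a b ->
  CI (fun t => c * f t)%C a b = (c * CI f a b)%C.
Proof.
  intros [F1 F2]. unfold CI, Cmult. simpl.
  apply (@RInt_correct R_CompleteNormedModule) in F1.
  apply (@RInt_correct R_CompleteNormedModule) in F2. f_equal; apply is_RInt_unique.
  - exact (is_RInt_minus _ _ _ _ _ _ (is_RInt_scal _ _ _ (fst c) _ F1) (is_RInt_scal _ _ _ (snd c) _ F2)).
  - exact (is_RInt_plus _ _ _ _ _ _ (is_RInt_scal _ _ _ (fst c) _ F2) (is_RInt_scal _ _ _ (snd c) _ F1)).
Qed.

Lemma CI_Chasles (f : R -> C) (a b c : R) : cint f a b -> cint f b c ->
  CI f a c = (CI f a b + CI f b c)%C.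
Proof.
  intros [F1 F2] [G1 G2]. unfold CI, Cplus. simpl. f_equal;
    symmetry; apply (@RInt_Chasles R_CompleteNormedModule); assumption.
Qed.

Lemma RInt_abs_le_const (f : R -> R) (a b M : R) : a <= b -> ex_RInt f a b ->
  (forall t, a <= t <= b -> Rabs (f t) <= M) -> Rabs (RInt f a b) <= M * (b - a).
Proof.
  intros Hab I H.
  assert (A := @norm_RInt_le_const R_NormedModule f a b (RInt f a b) M Hab H
    (@RInt_correct R_CompleteNormedModule f a b I)).
  change (norm (RInt f a b)) with (Rabs (RInt f a b)) in A. lra.
Qed.

(** The factor 2 comes from estimating real and imaginary parts separately. Later uses either let
    the bound tend to 0 or remove constants by taking powers. *)
Lemma CI_bound (f : R -> C) (a b M : R) : a <= b -> cint f a b ->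
  (forall t, a <= t <= b -> Cmod (f t) <= M) -> Cmod (CI f a b) <= 2 * M * (b - a).
Proof.
  intros Hab [I1 I2] H. eapply Rle_trans. apply Cmod_le_re_im.
  assert (A : Rabs (Re (CI f a b)) <= M * (b - a)).
  { apply (RInt_abs_le_const (fun t => Re (f t))); try assumption.
    intros t Ht. eapply Rle_trans. apply re_le_Cmod. apply H, Ht. }
  assert (B : Rabs (Im (CI f a b)) <= M * (b - a)).
  { apply (RInt_abs_le_const (fun t => Im (f t))); try assumption.
    intros t Ht. eapply Rle_trans. apply im_le_Cmod. apply H, Ht. }
  lra.
Qed.

(** Counterclockwise boundary integral; the factor [Ci] is dz/dy on the vertical sides. On
    rectangles, real Riemann integrals in the coordinates suffice. *)
Definition rect (F : C -> C) (x1 x2 y1 y2 : R) : C :=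
  (CI (fun x => F (x, y1)) x1 x2 + Ci * CI (fun y => F (x2, y)) y1 y2
   - CI (fun x => F (x, y2)) x1 x2 - Ci * CI (fun y => F (x1, y)) y1 y2)%C.

Definition inrect (x1 x2 y1 y2 : R) (z : C) : Prop :=
  x1 <= Re z <= x2 /\ y1 <= Im z <= y2.

Definition bdry (x1 x2 y1 y2 : R) (z : C) : Prop :=
  inrect x1 x2 y1 y2 z /\ (Re z = x1 \/ Re z = x2 \/ Im z = y1 \/ Im z = y2).

Lemma Cmod_vert (x y y' : R) : Cmod ((x, y') - (x, y))%C = Rabs (y' - y).
Proof.
  replace ((x, y') - (x, y))%C with (Ci * RtoC (y' - y))%C.
  - rewrite Cmod_mult, Cmod_Ci, Cmod_R. ring.
  - unfold Cminus, Cplus, Copp, Cmult, Ci, RtoC. simpl. f_equal; ring.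
Qed.

Lemma Cmod_horiz (x x' y : R) : Cmod ((x', y) - (x, y))%C = Rabs (x' - x).
Proof.
  replace ((x', y) - (x, y))%C with (RtoC (x' - x))%C.
  - apply Cmod_R.
  - unfold Cminus, Cplus, Copp, RtoC. simpl. f_equal; ring.
Qed.

Lemma continuous_real (u : R -> R) (t : R) :
  (forall eps, 0 < eps -> exists d, 0 < d /\ forall s, Rabs (s - t) < d -> Rabs (u s - u t) < eps) ->
  continuous u t.
Proof.
  intros H. apply filterlim_locally. intros eps.
  destruct (H eps (cond_pos eps)) as [d [Hd K]].
  exists (mkposreal d Hd). intros s Hs. apply K, Hs.
Qed.

Lemma cint_curve (f : R -> C) (a b : R) : a <= b ->
  (forall t, a <= t <= b -> forall eps, 0 < eps -> exists d, 0 < d /\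
     forall s, Rabs (s - t) < d -> Cmod (f s - f t)%C < eps) -> cint f a b.
Proof.
  intros Hab H. split; apply @ex_RInt_continuous; intros t Ht;
    rewrite Rmin_left, Rmax_right in Ht by exact Hab; apply continuous_real; intros eps Heps;
    destruct (H t Ht eps Heps) as [d [Hd K]]; exists d; (split; [exact Hd|]); intros s Hs;
    (eapply Rle_lt_trans; [|apply (K s Hs)]).
  - replace (Re (f s) - Re (f t)) with (Re (f s - f t)%C) by (unfold Re; reflexivity).
    apply re_le_Cmod.
  - replace (Im (f s) - Im (f t)) with (Im (f s - f t)%C) by (unfold Im; reflexivity).
    apply im_le_Cmod.
Qed.

Lemma cint_vert (F : C -> C) (x a b : R) : a <= b ->
  (forall y, a <= y <= b -> ccont F (x, y)) -> cint (fun y => F (x, y)) a b.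
Proof.
  intros Hab H. apply cint_curve; [exact Hab|]. intros t Ht eps Heps.
  destruct (H t Ht eps Heps) as [d [Hd K]]. exists d. split; [exact Hd|].
  intros s Hs. apply K. rewrite Cmod_vert. exact Hs.
Qed.

Lemma cint_horiz (F : C -> C) (y a b : R) : a <= b ->
  (forall x, a <= x <= b -> ccont F (x, y)) -> cint (fun x => F (x, y)) a b.
Proof.
  intros Hab H. apply cint_curve; [exact Hab|]. intros t Ht eps Heps.
  destruct (H t Ht eps Heps) as [d [Hd K]]. exists d. split; [exact Hd|].
  intros s Hs. apply K. rewrite Cmod_horiz. exact Hs.
Qed.

Ltac inbox := unfold bdry, inrect, Re, Im in *; simpl in *; intuition lra.

Lemma rect_cint (F : C -> C) (x1 x2 y1 y2 : R) : x1 <= x2 -> y1 <= y2 ->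
  (forall z, bdry x1 x2 y1 y2 z -> ccont F z) ->
  cint (fun x => F (x, y1)) x1 x2 /\ cint (fun y => F (x2, y)) y1 y2 /\
  cint (fun x => F (x, y2)) x1 x2 /\ cint (fun y => F (x1, y)) y1 y2.
Proof.
  intros Hx Hy H. split; [|split; [|split]].
  - apply cint_horiz; [exact Hx|]. intros t Ht; apply H; inbox.
  - apply cint_vert; [exact Hy|]. intros t Ht; apply H; inbox.
  - apply cint_horiz; [exact Hx|]. intros t Ht; apply H; inbox.
  - apply cint_vert; [exact Hy|]. intros t Ht; apply H; inbox.
Qed.

Lemma rect_ext (F G : C -> C) (x1 x2 y1 y2 : R) : x1 <= x2 -> y1 <= y2 ->
  (forall z, bdry x1 x2 y1 y2 z -> F z = G z) -> rect F x1 x2 y1 y2 = rect G x1 x2 y1 y2.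
Proof.
  intros Hx Hy H. unfold rect.
  rewrite (CI_ext (fun x => F (x, y1)) (fun x => G (x, y1))),
    (CI_ext (fun x => F (x, y2)) (fun x => G (x, y2))),
    (CI_ext (fun y => F (x1, y)) (fun y => G (x1, y))),
    (CI_ext (fun y => F (x2, y)) (fun y => G (x2, y))); try assumption; try reflexivity;
    intros t Ht; apply H; inbox.
Qed.

Lemma rect_plus (F G : C -> C) (x1 x2 y1 y2 : R) : x1 <= x2 -> y1 <= y2 ->
  (forall z, bdry x1 x2 y1 y2 z -> ccont F z) -> (forall z, bdry x1 x2 y1 y2 z -> ccont G z) ->
  rect (fun z => F z + G z)%C x1 x2 y1 y2 = (rect F x1 x2 y1 y2 + rect G x1 x2 y1 y2)%C.
Proof.
  intros Hx Hy HF HG.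
  destruct (rect_cint F x1 x2 y1 y2 Hx Hy HF) as [F1 [F2 [F3 F4]]].
  destruct (rect_cint G x1 x2 y1 y2 Hx Hy HG) as [G1 [G2 [G3 G4]]].
  unfold rect. rewrite !CI_plus by assumption. ring.
Qed.

Lemma rect_scal (c : C) (F : C -> C) (x1 x2 y1 y2 : R) : x1 <= x2 -> y1 <= y2 ->
  (forall z, bdry x1 x2 y1 y2 z -> ccont F z) ->
  rect (fun z => c * F z)%C x1 x2 y1 y2 = (c * rect F x1 x2 y1 y2)%C.
Proof.
  intros Hx Hy HF.
  destruct (rect_cint F x1 x2 y1 y2 Hx Hy HF) as [F1 [F2 [F3 F4]]].
  unfold rect. rewrite !CI_scal by assumption. ring.
Qed.

Lemma rect_bound (F : C -> C) (x1 x2 y1 y2 M : R) : x1 <= x2 -> y1 <= y2 ->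
  (forall z, bdry x1 x2 y1 y2 z -> ccont F z) ->
  (forall z, bdry x1 x2 y1 y2 z -> Cmod (F z) <= M) ->
  Cmod (rect F x1 x2 y1 y2) <= 4 * M * ((x2 - x1) + (y2 - y1)).
Proof.
  intros Hx Hy HF HM.
  destruct (rect_cint F x1 x2 y1 y2 Hx Hy HF) as [F1 [F2 [F3 F4]]].
  assert (B1 := CI_bound _ _ _ M Hx F1). assert (B2 := CI_bound _ _ _ M Hy F2).
  assert (B3 := CI_bound _ _ _ M Hx F3). assert (B4 := CI_bound _ _ _ M Hy F4).
  unfold rect.
  eapply Rle_trans. apply Cmod_triangle_minus.
  eapply Rle_trans. apply Rplus_le_compat_r. apply Cmod_triangle_minus.
  eapply Rle_trans. do 2 apply Rplus_le_compat_r. apply Cmod_triangle.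
  rewrite !Cmod_mult, !Cmod_Ci.
  assert (B1' : Cmod (CI (fun x => F (x, y1)) x1 x2) <= 2 * M * (x2 - x1))
    by (apply B1; intros t Ht; apply HM; inbox).
  assert (B2' : Cmod (CI (fun y => F (x2, y)) y1 y2) <= 2 * M * (y2 - y1))
    by (apply B2; intros t Ht; apply HM; inbox).
  assert (B3' : Cmod (CI (fun x => F (x, y2)) x1 x2) <= 2 * M * (x2 - x1))
    by (apply B3; intros t Ht; apply HM; inbox).
  assert (B4' : Cmod (CI (fun y => F (x1, y)) y1 y2) <= 2 * M * (y2 - y1))
    by (apply B4; intros t Ht; apply HM; inbox).
  lra.
Qed.

Lemma rect_split_x (F : C -> C) (x1 xm x2 y1 y2 : R) : x1 <= xm <= x2 -> y1 <= y2 ->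
  (forall z, bdry x1 x2 y1 y2 z -> ccont F z) ->
  rect F x1 x2 y1 y2 = (rect F x1 xm y1 y2 + rect F xm x2 y1 y2)%C.
Proof.
  intros Hx Hy H. unfold rect.
  rewrite (CI_Chasles (fun x => F (x, y1)) x1 xm x2), (CI_Chasles (fun x => F (x, y2)) x1 xm x2);
    try (apply cint_horiz; [lra|]; intros t Ht; apply H; inbox).
  ring.
Qed.

Lemma rect_split_y (F : C -> C) (x1 x2 y1 ym y2 : R) : x1 <= x2 -> y1 <= ym <= y2 ->
  (forall z, bdry x1 x2 y1 y2 z -> ccont F z) ->
  rect F x1 x2 y1 y2 = (rect F x1 x2 y1 ym + rect F x1 x2 ym y2)%C.
Proof.
  intros Hx Hy H. unfold rect.
  rewrite (CI_Chasles (fun y => F (x1, y)) y1 ym y2), (CI_Chasles (fun y => F (x2, y)) y1 ym y2);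
    try (apply cint_vert; [lra|]; intros t Ht; apply H; inbox).
  ring.
Qed.

Lemma ccont_affine (A B z : C) : ccont (fun w => A + B * w)%C z.
Proof.
  apply holo_ccont. apply (holo_plus (fun _ => A) (fun w => B * w)%C).
  apply holo_const. apply (holo_mult (fun _ => B) (fun w => w)).
  apply holo_const. apply holo_id.
Qed.

Lemma RInt_affine (p q a b : R) : RInt (fun t => p + q * t) a b = p * (b - a) + q * (b * b - a * a) / 2.
Proof.
  apply is_RInt_unique.
  replace (p * (b - a) + q * (b * b - a * a) / 2)
    with (minus (p * b + q * (b * b) / 2) (p * a + q * (a * a) / 2))
    by (unfold minus, plus, opp; simpl; field).
  apply (@is_RInt_derive R_CompleteNormedModule (fun t => p * t + q * (t * t) / 2) (fun t => p + q * t)).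
  - intros t _. auto_derive; [exact I|]. field.
  - intros t _. apply continuous_real. intros eps Heps.
    exists (eps / (Rabs q + 1)). assert (0 <= Rabs q) by apply Rabs_pos. split.
    + apply Rdiv_lt_0_compat; lra.
    + intros s Hs. replace (p + q * s - (p + q * t)) with (q * (s - t)) by ring.
      rewrite Rabs_mult. apply Rmult_lt_compat_r with (r := Rabs q + 1) in Hs; [|lra].
      replace (eps / (Rabs q + 1) * (Rabs q + 1)) with eps in Hs by (field; lra).
      assert (0 <= Rabs (s - t)) by apply Rabs_pos. nra.
Qed.

Lemma RInt_affine_gen (f : R -> R) (p q a b : R) : (forall t, f t = p + q * t) ->
  RInt f a b = p * (b - a) + q * (b * b - a * a) / 2.
Proof.
  intros H. rewrite <- RInt_affine. apply RInt_ext. intros t _. apply H.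
Qed.

(** Goursat's argument subtracts the affine approximation of the integrand; this evaluation shows
    that the subtraction changes nothing. *)
Lemma rect_affine (A B : C) (x1 x2 y1 y2 : R) : rect (fun w => A + B * w)%C x1 x2 y1 y2 = RtoC 0.
Proof.
  destruct A as [a1 a2]. destruct B as [b1 b2].
  unfold rect, CI, Re, Im, Cplus, Cmult; simpl.
  rewrite (RInt_affine_gen (fun t => a1 + (b1 * t - b2 * y1)) (a1 - b2 * y1) b1) by (intros; ring).
  rewrite (RInt_affine_gen (fun t => a1 + (b1 * t - b2 * y2)) (a1 - b2 * y2) b1) by (intros; ring).
  rewrite (RInt_affine_gen (fun t => a2 + (b1 * y1 + b2 * t)) (a2 + b1 * y1) b2) by (intros; ring).
  rewrite (RInt_affine_gen (fun t => a2 + (b1 * y2 + b2 * t)) (a2 + b1 * y2) b2) by (intros; ring).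
  rewrite (RInt_affine_gen (fun t => a1 + (b1 * x2 - b2 * t)) (a1 + b1 * x2) (- b2)) by (intros; ring).
  rewrite (RInt_affine_gen (fun t => a1 + (b1 * x1 - b2 * t)) (a1 + b1 * x1) (- b2)) by (intros; ring).
  rewrite (RInt_affine_gen (fun t => a2 + (b1 * t + b2 * x2)) (a2 + b2 * x2) b1) by (intros; ring).
  rewrite (RInt_affine_gen (fun t => a2 + (b1 * t + b2 * x1)) (a2 + b2 * x1) b1) by (intros; ring).
  apply C_ext; unfold Re, Im, Cplus, Cminus, Copp, Cmult, Ci, RtoC; simpl; field.
Qed.

Definition quarter (i : nat) (r : R * R * R * R) : R * R * R * R :=
  match r with (a, b, c, d) =>
    let m := (a + b) / 2 in let n := (c + d) / 2 in
    match i with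
    | 0%nat => (a, m, c, n) | 1%nat => (m, b, c, n)
    | 2%nat => (a, m, n, d) | _ => (m, b, n, d)
    end
  end.

(** If [P] failed on the whole rectangle, some quarter would fail again and again; the failing
    rectangles shrink to a point, near which the local hypothesis gives [P]. *)
Lemma bisection_principle (P : R -> R -> R -> R -> Prop) (x1 x2 y1 y2 : R) :
  x1 <= x2 -> y1 <= y2 ->
  (forall a b c d, x1 <= a <= b -> b <= x2 -> y1 <= c <= d -> d <= y2 ->
     P a ((a + b) / 2) c ((c + d) / 2) -> P ((a + b) / 2) b c ((c + d) / 2) ->
     P a ((a + b) / 2) ((c + d) / 2) d -> P ((a + b) / 2) b ((c + d) / 2) d -> P a b c d) ->
  (forall x y, x1 <= x <= x2 -> y1 <= y <= y2 -> exists delta, 0 < delta /\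
     forall a b c d, x1 <= a <= x -> x <= b <= x2 -> y1 <= c <= y -> y <= d <= y2 ->
       b - a < delta -> d - c < delta -> P a b c d) ->
  P x1 x2 y1 y2.
Proof.
  intros Hx Hy Hadd Hloc.
  apply NNPP. intros HN.
  set (Q := fun r : R * R * R * R => match r with (a, b, c, d) => P a b c d end).
  (* The fourth quarter is taken without a test: if the first three satisfy [P], additivity forces
     it to fail whenever the parent fails. *)
  set (step := fun r =>
    if excluded_middle_informative (Q (quarter 0 r)) then
      if excluded_middle_informative (Q (quarter 1 r)) then
        if excluded_middle_informative (Q (quarter 2 r)) then quarter 3 r else quarter 2 r
      else quarter 1 r
    else quarter 0 r).
  set (s := fix s (n : nat) := match n with O => (x1, x2, y1, y2) | S k => step (s k) end).
  set (A := fun n => fst (fst (fst (s n)))). set (B := fun n => snd (fst (fst (s n)))).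
  set (C' := fun n => snd (fst (s n))). set (D := fun n => snd (s n)).
  assert (Es : forall n, s n = (A n, B n, C' n, D n)).
  { intros n. unfold A, B, C', D. destruct (s n) as [[[? ?] ?] ?]. reflexivity. }
  assert (Inv : forall n, (x1 <= A n /\ A n <= B n /\ B n <= x2) /\ (y1 <= C' n /\ C' n <= D n /\ D n <= y2) /\
     ~ P (A n) (B n) (C' n) (D n) /\ B n - A n = (x2 - x1) / 2 ^ n /\ D n - C' n = (y2 - y1) / 2 ^ n /\
     (A n <= A (S n) /\ B (S n) <= B n /\ C' n <= C' (S n) /\ D (S n) <= D n)).
  { assert (St : forall n, (x1 <= A n /\ A n <= B n /\ B n <= x2) -> (y1 <= C' n /\ C' n <= D n /\ D n <= y2) ->
      ~ P (A n) (B n) (C' n) (D n) -> B n - A n = (x2 - x1) / 2 ^ n -> D n - C' n = (y2 - y1) / 2 ^ n ->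
      ((x1 <= A (S n) /\ A (S n) <= B (S n) /\ B (S n) <= x2) /\
       (y1 <= C' (S n) /\ C' (S n) <= D (S n) /\ D (S n) <= y2) /\
       ~ P (A (S n)) (B (S n)) (C' (S n)) (D (S n)) /\
       B (S n) - A (S n) = (x2 - x1) / 2 ^ S n /\ D (S n) - C' (S n) = (y2 - y1) / 2 ^ S n) /\
      (A n <= A (S n) /\ B (S n) <= B n /\ C' n <= C' (S n) /\ D (S n) <= D n)).
    { intros n H1 H2 H3 H4 H5.
      assert (Hs : s (S n) = step (A n, B n, C' n, D n)) by (rewrite <- Es; reflexivity).
      assert (Hsn := Es (S n)). rewrite Hs in Hsn. unfold step in Hsn.
      assert (p2 : 0 < 2 ^ n) by (apply pow_lt; lra).
      assert (E4 : (x2 - x1) / 2 ^ S n = (B n - A n) / 2) by (rewrite H4; simpl; field; lra).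
      assert (E5 : (y2 - y1) / 2 ^ S n = (D n - C' n) / 2) by (rewrite H5; simpl; field; lra).
      rewrite E4, E5.
      destruct (excluded_middle_informative (Q (quarter 0 (A n, B n, C' n, D n)))) as [q0|q0];
      [destruct (excluded_middle_informative (Q (quarter 1 (A n, B n, C' n, D n)))) as [q1|q1];
      [destruct (excluded_middle_informative (Q (quarter 2 (A n, B n, C' n, D n)))) as [q2|q2]|]|];
      unfold quarter in *; unfold Q in *; injection Hsn as <- <- <- <-;
      (repeat split; try lra; try assumption).
      intros q3. apply H3. apply Hadd; try lra; assumption. }
    assert (Base : forall n, (x1 <= A n /\ A n <= B n /\ B n <= x2) /\ (y1 <= C' n /\ C' n <= D n /\ D n <= y2) /\
      ~ P (A n) (B n) (C' n) (D n) /\ B n - A n = (x2 - x1) / 2 ^ n /\ D n - C' n = (y2 - y1) / 2 ^ n).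
    { induction n as [|n [I1 [I2 [I3 [I4 I5]]]]].
      - unfold A, B, C', D; simpl. repeat split; try lra; assumption.
      - apply St; assumption. }
    intros n. destruct (Base n) as [I1 [I2 [I3 [I4 I5]]]].
    split; [exact I1|split; [exact I2|split; [exact I3|split; [exact I4|split; [exact I5|]]]]].
    apply St; assumption. }
  assert (Mon : forall n m, (n <= m)%nat -> A n <= A m /\ B m <= B n /\ C' n <= C' m /\ D m <= D n).
  { intros n m H. induction H as [|m H IH]. lra.
    destruct (Inv m) as [_ [_ [_ [_ [_ I]]]]]. lra. }
  (* The common point of the nested intervals is the supremum of the left ends. *)
  assert (Lim : forall U V : nat -> R, (forall n m, (n <= m)%nat -> U n <= U m /\ V m <= V n) ->
    (forall n, U n <= V n) -> exists x, forall n, U n <= x <= V n).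
  { intros U V M HUV.
    destruct (completeness (fun u => exists n, u = U n)) as [x [Hub Hlub]].
    - exists (V 0%nat). intros u [n ->].
      apply Rle_trans with (V n). apply HUV. apply (M 0%nat n). lia.
    - exists (U 0%nat). exists 0%nat. reflexivity.
    - exists x. intros n. split.
      + apply Hub. exists n. reflexivity.
      + apply Hlub. intros u [k ->].
        destruct (Nat.le_ge_cases n k) as [H|H]; destruct (M _ _ H) as [M1 M2].
        * apply Rle_trans with (V k); [apply HUV|exact M2].
        * apply Rle_trans with (U n); [exact M1|apply HUV]. }
  destruct (Lim A B) as [x Hxx].
  { intros n m H. destruct (Mon n m H) as [? [? _]]. split; assumption. }
  { intros n. apply Inv. }
  destruct (Lim C' D) as [y Hyy].
  { intros n m H. destruct (Mon n m H) as [_ [_ [? ?]]]. split; assumption. }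
  { intros n. apply Inv. }
  destruct (Hloc x y) as [delta [Hd Hl]].
  { exact (Hxx 0%nat). } { exact (Hyy 0%nat). }
  set (w := (x2 - x1) + (y2 - y1) + 1).
  destruct (pow_lt_1_zero (/ 2)) with (y := delta / w) as [n Hn].
  { rewrite Rabs_pos_eq; lra. }
  { apply Rdiv_lt_0_compat; unfold w; lra. }
  specialize (Hn n (Nat.le_refl n)).
  rewrite Rabs_pos_eq in Hn by (apply pow_le; lra).
  rewrite pow_inv in Hn.
  assert (p2 : 0 < / 2 ^ n) by (apply Rinv_0_lt_compat, pow_lt; lra).
  assert (Hw : w * / 2 ^ n < delta).
  { apply Rmult_lt_compat_l with (r := w) in Hn; [|unfold w; lra].
    replace (w * (delta / w)) with delta in Hn by (field; unfold w; lra). exact Hn. }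
  destruct (Inv n) as [I1 [I2 [I3 [I4 [I5 _]]]]].
  apply I3. assert (Hxn := Hxx n). assert (Hyn := Hyy n).
  apply Hl; try lra.
  - rewrite I4. unfold Rdiv. unfold w in Hw. nra.
  - rewrite I5. unfold Rdiv. unfold w in Hw. nra.
Qed.

(** A bound by [4 * eps] times the squared half perimeter is stable under quartering, since the four
    quarters have half the half perimeter each. It holds locally because [F] differs from an affine
    function by at most [eps] times the distance. *)
Theorem Goursat (F : C -> C) (x1 x2 y1 y2 : R) : x1 <= x2 -> y1 <= y2 ->
  (forall z, inrect x1 x2 y1 y2 z -> holo F z) -> rect F x1 x2 y1 y2 = RtoC 0.
Proof.
  intros Hx Hy HF.
  assert (HC : forall z, inrect x1 x2 y1 y2 z -> ccont F z) by (intros z Hz; apply holo_ccont, HF, Hz).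
  assert (Key : forall eps, 0 < eps ->
    Cmod (rect F x1 x2 y1 y2) <= 4 * eps * ((x2 - x1) + (y2 - y1)) ^ 2).
  { intros eps Heps.
    apply (bisection_principle (fun a b c d => Cmod (rect F a b c d) <= 4 * eps * ((b - a) + (d - c)) ^ 2));
      try assumption.
    - intros a b c d Ha Hb Hc Hd Q1 Q2 Q3 Q4.
      rewrite (rect_split_x F a ((a + b) / 2) b c d); [|lra|lra|intros z Hz; apply HC; inbox].
      rewrite (rect_split_y F a ((a + b) / 2) c ((c + d) / 2) d); [|lra|lra|intros z Hz; apply HC; inbox].
      rewrite (rect_split_y F ((a + b) / 2) b c ((c + d) / 2) d); [|lra|lra|intros z Hz; apply HC; inbox].
      eapply Rle_trans. apply Cmod_triangle.
      eapply Rle_trans. apply Rplus_le_compat; apply Cmod_triangle. nra.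
    - intros x y Hxx Hyy.
      destruct (HF (x, y)) as [l D]; [inbox|].
      destruct (D eps Heps) as [delta [Hd H]].
      exists (delta / 2). split; [lra|]. intros a b c d Ha Hb Hc Hdd Hba Hdc.
      assert (E : rect F a b c d =
        rect (fun w => F w + ((- F (x, y) + l * (x, y)) + (- l) * w))%C a b c d).
      { rewrite (rect_plus F (fun w => (- F (x, y) + l * (x, y)) + (- l) * w)%C).
        - rewrite rect_affine. ring.
        - lra.
        - lra.
        - intros z Hz. apply HC. inbox.
        - intros z Hz. apply ccont_affine. }
      rewrite E.
      replace (4 * eps * (b - a + (d - c)) ^ 2)
        with (4 * (eps * ((b - a) + (d - c))) * ((b - a) + (d - c))) by ring.
      apply rect_bound; try lra.
      + intros z Hz. apply ccont_plus. apply HC; inbox. apply ccont_affine.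
      + intros z Hz.
        replace (F z + (- F (x, y) + l * (x, y) + - l * z))%C with (F z - F (x, y) - l * (z - (x, y)))%C by ring.
        assert (Hzz : Cmod (z - (x, y))%C <= (b - a) + (d - c)).
        { eapply Rle_trans. apply Cmod_le_re_im.
          assert (Rabs (Re (z - (x, y))%C) <= b - a) by (apply Rabs_le; inbox).
          assert (Rabs (Im (z - (x, y))%C) <= d - c) by (apply Rabs_le; inbox). lra. }
        eapply Rle_trans. apply H. lra. apply Rmult_le_compat_l; lra. }
  apply Cmod_eq_0. apply Rle_antisym; [|apply Cmod_ge_0].
  apply le_epsilon. intros e He. rewrite Rplus_0_l.
  set (w := (x2 - x1) + (y2 - y1)) in *. assert (Hw : 0 <= w) by (unfold w; lra).
  assert (0 < 4 * (w + 1) ^ 2) by (apply Rmult_lt_0_compat; [lra|apply pow_lt; lra]).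
  eapply Rle_trans. apply (Key (e / (4 * (w + 1) ^ 2))). apply Rdiv_lt_0_compat; lra.
  apply Rle_trans with (4 * (e / (4 * (w + 1) ^ 2)) * (w + 1) ^ 2).
  - apply Rmult_le_compat_l. assert (0 < e / (4 * (w + 1) ^ 2)) by (apply Rdiv_lt_0_compat; lra). lra.
    apply pow_incr. lra.
  - right. field. lra.
Qed.

(** * Cauchy's formula and its consequences *)

Definition inside (x1 x2 y1 y2 : R) (z : C) : Prop :=
  x1 < Re z < x2 /\ y1 < Im z < y2.

Definition bddnear (F : C -> C) (p : C) : Prop :=
  exists M d, 0 < d /\ forall w, w <> p -> Cmod (w - p)%C < d -> Cmod (F w) <= M.

Lemma neq_of_re (z w : C) : Re z <> Re w -> z <> w.
Proof. intros H E. apply H. f_equal. exact E. Qed.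

Lemma neq_of_im (z w : C) : Im z <> Im w -> z <> w.
Proof. intros H E. apply H. f_equal. exact E. Qed.

Lemma bdry_inside_neq (x1 x2 y1 y2 : R) (z w : C) :
  bdry x1 x2 y1 y2 z -> inside x1 x2 y1 y2 w -> z <> w.
Proof. intros [_ Hz] [H1 H2] E. subst w. lra. Qed.

(** The frame between the two rectangles splits into four rectangles that avoid [p], and Goursat's
    theorem applies to each. *)
Lemma rect_shrink (F : C -> C) (x1 x2 y1 y2 : R) (p : C) (e : R) : 0 < e ->
  x1 <= Re p - e -> Re p + e <= x2 -> y1 <= Im p - e -> Im p + e <= y2 ->
  (forall z, inrect x1 x2 y1 y2 z -> z <> p -> holo F z) ->
  rect F x1 x2 y1 y2 = rect F (Re p - e) (Re p + e) (Im p - e) (Im p + e).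
Proof.
  intros He H1 H2 H3 H4 HF.
  assert (HC : forall z, inrect x1 x2 y1 y2 z -> z <> p -> ccont F z)
    by (intros; apply holo_ccont, HF; assumption).
  set (px := Re p) in *. set (py := Im p) in *.
  assert (HR : forall z, (Re z <> px \/ Im z <> py) -> z <> p).
  { intros z [Hz|Hz]; [apply neq_of_re|apply neq_of_im]; exact Hz. }
  rewrite (rect_split_x F x1 (px - e) x2); [|lra|lra|].
  2:{ intros z [Hz Hz']. apply HC; [exact Hz|]. apply HR. unfold inrect in Hz. lra. }
  rewrite (rect_split_x F (px - e) (px + e) x2); [|lra|lra|].
  2:{ intros z [[Hz1 Hz2] Hz']. apply HC; [split; lra|]. apply HR. lra. }
  rewrite (rect_split_y F (px - e) (px + e) y1 (py - e) y2); [|lra|lra|].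
  2:{ intros z [[Hz1 Hz2] Hz']. apply HC; [split; lra|]. apply HR. lra. }
  rewrite (rect_split_y F (px - e) (px + e) (py - e) (py + e) y2); [|lra|lra|].
  2:{ intros z [[Hz1 Hz2] Hz']. apply HC; [split; lra|]. apply HR. lra. }
  rewrite (Goursat F x1 (px - e) y1 y2); [|lra|lra|].
  2:{ intros z [Hz1 Hz2]. apply HF; [split; lra|]. apply HR. lra. }
  rewrite (Goursat F (px + e) x2 y1 y2); [|lra|lra|].
  2:{ intros z [Hz1 Hz2]. apply HF; [split; lra|]. apply HR. lra. }
  rewrite (Goursat F (px - e) (px + e) y1 (py - e)); [|lra|lra|].
  2:{ intros z [Hz1 Hz2]. apply HF; [split; lra|]. apply HR. lra. }
  rewrite (Goursat F (px - e) (px + e) (py + e) y2); [|lra|lra|].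
  2:{ intros z [Hz1 Hz2]. apply HF; [split; lra|]. apply HR. lra. }
  ring.
Qed.

Lemma inside_margin (x1 x2 y1 y2 : R) (p : C) : inside x1 x2 y1 y2 p ->
  exists e, 0 < e /\ forall e', 0 < e' <= e ->
    x1 <= Re p - e' /\ Re p + e' <= x2 /\ y1 <= Im p - e' /\ Im p + e' <= y2.
Proof.
  intros [H1 H2].
  exists (Rmin (Rmin (Re p - x1) (x2 - Re p)) (Rmin (Im p - y1) (y2 - Im p))). split.
  - repeat apply Rmin_pos; lra.
  - intros e' [He' He]. revert He. unfold Rmin. repeat destruct Rle_dec; intros; lra.
Qed.

(** The contour can be shrunk to a square of side [2 * e] around [p], where a bounded integrand
    contributes only O(e). *)
Lemma Goursat_punctured (F : C -> C) (x1 x2 y1 y2 : R) (p : C) : inside x1 x2 y1 y2 p ->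
  (forall z, inrect x1 x2 y1 y2 z -> z <> p -> holo F z) -> bddnear F p ->
  rect F x1 x2 y1 y2 = RtoC 0.
Proof.
  intros Hp HF [M [d [Hd HM]]].
  destruct (inside_margin x1 x2 y1 y2 p Hp) as [e0 [He0 Hm]].
  apply Cmod_eq_0. apply Rle_antisym; [|apply Cmod_ge_0].
  apply le_epsilon. intros eps Heps. rewrite Rplus_0_l.
  set (M' := Rabs M + 1). assert (HM' : 0 < M') by (unfold M'; generalize (Rabs_pos M); lra).
  assert (MM : M <= M') by (unfold M'; generalize (Rle_abs M); lra).
  set (e := Rmin e0 (Rmin (d / 4) (eps / (16 * M')))).
  assert (He : 0 < e) by (repeat apply Rmin_pos; try lra; apply Rdiv_lt_0_compat; lra).
  assert (E1 : e <= e0) by apply Rmin_l.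
  assert (E2 : e <= d / 4) by (eapply Rle_trans; [apply Rmin_r|apply Rmin_l]).
  assert (E3 : e <= eps / (16 * M')) by (eapply Rle_trans; [apply Rmin_r|apply Rmin_r]).
  destruct (Hm e (conj He E1)) as [A1 [A2 [A3 A4]]].
  rewrite (rect_shrink F x1 x2 y1 y2 p e) by assumption.
  assert (HN : forall z, bdry (Re p - e) (Re p + e) (Im p - e) (Im p + e) z -> z <> p).
  { intros z Hz. apply (bdry_inside_neq _ _ _ _ _ _ Hz). split; lra. }
  eapply Rle_trans. apply (rect_bound F _ _ _ _ M'); try lra.
  - intros z Hz. apply holo_ccont, HF; [|apply HN, Hz].
    destruct Hz as [[Z1 Z2] _]. split; lra.
  - intros z Hz. eapply Rle_trans; [|exact MM]. apply HM. apply HN, Hz.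
    destruct Hz as [[Z1 Z2] _].
    eapply Rle_lt_trans. apply Cmod_le_re_im.
    assert (Rabs (Re (z - p)%C) <= e) by (apply Rabs_le; unfold Re in *; simpl; lra).
    assert (Rabs (Im (z - p)%C) <= e) by (apply Rabs_le; unfold Im in *; simpl; lra). lra.
  - apply Rle_trans with (16 * M' * e). right; ring.
    apply Rle_trans with (16 * M' * (eps / (16 * M'))).
    apply Rmult_le_compat_l; lra. right. field. lra.
Qed.

(** A vertical or horizontal line halfway between the punctures separates them. Two punctures occur
    in Cauchy's formula for a function that already has one. *)
Lemma Goursat_two_punctures (F : C -> C) (x1 x2 y1 y2 : R) (p q : C) : p <> q ->
  inside x1 x2 y1 y2 p -> inside x1 x2 y1 y2 q ->
  (forall z, inrect x1 x2 y1 y2 z -> z <> p -> z <> q -> holo F z) ->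
  bddnear F p -> bddnear F q -> rect F x1 x2 y1 y2 = RtoC 0.
Proof.
  intros Hpq Hp Hq HF Bp Bq.
  assert (HB : forall z, bdry x1 x2 y1 y2 z -> ccont F z).
  { intros z Hz. apply holo_ccont, HF. apply Hz. apply (bdry_inside_neq _ _ _ _ _ _ Hz Hp).
    apply (bdry_inside_neq _ _ _ _ _ _ Hz Hq). }
  assert (Sx : forall a b : C, inside x1 x2 y1 y2 a -> inside x1 x2 y1 y2 b ->
    (forall z, inrect x1 x2 y1 y2 z -> z <> a -> z <> b -> holo F z) ->
    bddnear F a -> bddnear F b -> Re a < Re b -> rect F x1 x2 y1 y2 = RtoC 0).
  { intros a b [A1 A2] [B1 B2] HFab Ba Bb Hab.
    rewrite (rect_split_x F x1 ((Re a + Re b) / 2) x2); [|lra|lra|exact HB].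
    rewrite (Goursat_punctured F x1 ((Re a + Re b) / 2) y1 y2 a); [|split; lra| |exact Ba].
    rewrite (Goursat_punctured F ((Re a + Re b) / 2) x2 y1 y2 b); [|split; lra| |exact Bb].
    - ring.
    - intros z [Z1 Z2] Hz. apply HFab; [split; lra| |exact Hz]. apply neq_of_re. lra.
    - intros z [Z1 Z2] Hz. apply HFab; [split; lra|exact Hz|]. apply neq_of_re. lra. }
  assert (Sy : forall a b : C, inside x1 x2 y1 y2 a -> inside x1 x2 y1 y2 b ->
    (forall z, inrect x1 x2 y1 y2 z -> z <> a -> z <> b -> holo F z) ->
    bddnear F a -> bddnear F b -> Im a < Im b -> rect F x1 x2 y1 y2 = RtoC 0).
  { intros a b [A1 A2] [B1 B2] HFab Ba Bb Hab.
    rewrite (rect_split_y F x1 x2 y1 ((Im a + Im b) / 2) y2); [|lra|lra|exact HB].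
    rewrite (Goursat_punctured F x1 x2 y1 ((Im a + Im b) / 2) a); [|split; lra| |exact Ba].
    rewrite (Goursat_punctured F x1 x2 ((Im a + Im b) / 2) y2 b); [|split; lra| |exact Bb].
    - ring.
    - intros z [Z1 Z2] Hz. apply HFab; [split; lra| |exact Hz]. apply neq_of_im. lra.
    - intros z [Z1 Z2] Hz. apply HFab; [split; lra|exact Hz|]. apply neq_of_im. lra. }
  assert (HF' : forall z, inrect x1 x2 y1 y2 z -> z <> q -> z <> p -> holo F z) by auto.
  destruct (Rtotal_order (Re p) (Re q)) as [H|[H|H]].
  - apply (Sx p q); assumption.
  - destruct (Rtotal_order (Im p) (Im q)) as [H'|[H'|H']].
    + apply (Sy p q); assumption.
    + exfalso. apply Hpq, C_ext; assumption.
    + apply (Sy q p); assumption.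
  - apply (Sx q p); assumption.
Qed.

Lemma sq_plus_sq_pos (a e : R) : 0 < e -> 0 < a ^ 2 + e ^ 2.
Proof. intros He. apply Rplus_le_lt_0_compat; [apply pow2_ge_0|apply pow_lt, He]. Qed.

Lemma RInt_odd_kernel (c e : R) : 0 < e ->
  RInt (fun t => (t - c) / ((t - c) ^ 2 + e ^ 2)) (c - e) (c + e) = 0.
Proof.
  intros He. apply is_RInt_unique.
  assert (P : forall t, 0 < (t - c) ^ 2 + e ^ 2) by (intros t; apply sq_plus_sq_pos, He).
  replace 0 with (minus (ln ((c + e - c) ^ 2 + e ^ 2) / 2) (ln ((c - e - c) ^ 2 + e ^ 2) / 2)).
  - apply (@is_RInt_derive R_CompleteNormedModule (fun t => ln ((t - c) ^ 2 + e ^ 2) / 2)).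
    + intros t _. specialize (P t). auto_derive; [lra|]. field. lra.
    + intros t _. apply continuity_pt_filterlim. specialize (P t). reg. lra.
  - unfold minus, plus, opp; simpl. replace (c - e - c) with (- e) by ring.
    replace (c + e - c) with e by ring. replace (- e * (- e * 1)) with (e * (e * 1)) by ring. ring.
Qed.

Lemma RInt_even_kernel (c e : R) : 0 < e ->
  RInt (fun t => e / ((t - c) ^ 2 + e ^ 2)) (c - e) (c + e) = PI / 2.
Proof.
  intros He. apply is_RInt_unique.
  assert (P : forall t, 0 < (t - c) ^ 2 + e ^ 2) by (intros t; apply sq_plus_sq_pos, He).
  replace (PI / 2) with (minus (atan ((c + e - c) / e)) (atan ((c - e - c) / e))).
  - apply (@is_RInt_derive R_CompleteNormedModule (fun t => atan ((t - c) / e))).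
    + intros t _. specialize (P t). auto_derive; [lra|]. field. split; [lra|nra].
    + intros t _. apply continuity_pt_filterlim. specialize (P t). reg. lra.
  - unfold minus, plus, opp; simpl. replace ((c - e - c) / e) with (- (1)) by (field; lra).
    replace ((c + e - c) / e) with 1 by (field; lra). rewrite atan_opp, atan_1. field.
Qed.

Lemma RInt_opp_val (f : R -> R) (a b v : R) : ex_RInt f a b -> RInt f a b = v ->
  RInt (fun t => - f t) a b = - v.
Proof.
  intros H <-. apply is_RInt_unique.
  apply (@is_RInt_opp R_CompleteNormedModule). apply (@RInt_correct R_CompleteNormedModule), H.
Qed.

(** On each side the integrand splits into an odd logarithmic kernel, with integral 0, and an even
    arctangent kernel, with integral [PI / 2] up to sign; the four sides add up to the full turn. *)
Lemma rect_inv_square (z : C) (e : R) : 0 < e ->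
  rect (fun w => / (w - z))%C (Re z - e) (Re z + e) (Im z - e) (Im z + e) = (2 * PI * Ci)%C.
Proof.
  intros He. destruct z as [p q]. unfold Re, Im. simpl.
  assert (P : forall t c, 0 < (t - c) ^ 2 + e ^ 2) by (intros t c; apply sq_plus_sq_pos, He).
  assert (I1 : forall c, ex_RInt (fun t => (t - c) / ((t - c) ^ 2 + e ^ 2)) (c - e) (c + e)).
  { intros c. apply @ex_RInt_continuous. intros t _. apply continuity_pt_filterlim.
    specialize (P t c). reg. lra. }
  assert (I2 : forall c, ex_RInt (fun t => e / ((t - c) ^ 2 + e ^ 2)) (c - e) (c + e)).
  { intros c. apply @ex_RInt_continuous. intros t _. apply continuity_pt_filterlim.
    specialize (P t c). reg. lra. }
  assert (O1 : forall c, RInt (fun t => - ((t - c) / ((t - c) ^ 2 + e ^ 2))) (c - e) (c + e) = - 0).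
  { intros c. apply RInt_opp_val; [apply I1|apply RInt_odd_kernel, He]. }
  assert (O2 : forall c, RInt (fun t => - (e / ((t - c) ^ 2 + e ^ 2))) (c - e) (c + e) = - (PI / 2)).
  { intros c. apply RInt_opp_val; [apply I2|apply RInt_even_kernel, He]. }
  unfold rect.
  assert (B1 : CI (fun x => / ((x, (q - e)%R) - (p, q)))%C (p - e) (p + e) = (0, PI / 2)).
  { unfold CI. rewrite <- (RInt_odd_kernel p e He), <- (RInt_even_kernel p e He).
    f_equal; apply RInt_ext; intros t _; unfold Re, Im, Cinv; simpl; specialize (P t p);
      simpl in P; field; nra. }
  assert (B2 : CI (fun y => / (((p + e)%R, y) - (p, q)))%C (q - e) (q + e) = (PI / 2, - 0)).
  { unfold CI. rewrite <- (O1 q), <- (RInt_even_kernel q e He).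
    f_equal; apply RInt_ext; intros t _; unfold Re, Im, Cinv; simpl; specialize (P t q);
      simpl in P; field; nra. }
  assert (B3 : CI (fun x => / ((x, (q + e)%R) - (p, q)))%C (p - e) (p + e) = (0, - (PI / 2))).
  { unfold CI. rewrite <- (RInt_odd_kernel p e He), <- (O2 p).
    f_equal; apply RInt_ext; intros t _; unfold Re, Im, Cinv; simpl; specialize (P t p);
      simpl in P; field; nra. }
  assert (B4 : CI (fun y => / (((p - e)%R, y) - (p, q)))%C (q - e) (q + e) = (- (PI / 2), - 0)).
  { unfold CI. rewrite <- (O1 q), <- (O2 q).
    f_equal; apply RInt_ext; intros t _; unfold Re, Im, Cinv; simpl; specialize (P t q);
      simpl in P; field; nra. }
  rewrite B1, B2, B3, B4.
  apply C_ext; unfold Re, Im, Cplus, Cminus, Copp, Cmult, Ci, RtoC; simpl; field.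
Qed.

Lemma holo_inv_shift (z w : C) : w <> z -> holo (fun u => / (u - z))%C w.
Proof.
  intros H. apply (holo_inv (fun u => u - z)%C).
  - apply holo_minus; [apply holo_id|apply holo_const].
  - apply Cminus_eq_contra, H.
Qed.

Lemma rect_inv (x1 x2 y1 y2 : R) (z : C) : inside x1 x2 y1 y2 z ->
  rect (fun w => / (w - z))%C x1 x2 y1 y2 = (2 * PI * Ci)%C.
Proof.
  intros Hz. destruct (inside_margin _ _ _ _ _ Hz) as [e [He Hm]].
  destruct (Hm e) as [A1 [A2 [A3 A4]]]; [lra|].
  rewrite (rect_shrink _ x1 x2 y1 y2 z e); try assumption.
  - apply rect_inv_square, He.
  - intros w _ Hw. apply holo_inv_shift, Hw.
Qed.

Lemma bddnear_of_holo (F : C -> C) (p : C) : holo F p -> bddnear F p.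
Proof.
  intros H. destruct (holo_ccont F p H 1 Rlt_0_1) as [d [Hd K]].
  exists (Cmod (F p) + 1), d. split; [exact Hd|]. intros w _ Hw. specialize (K w Hw).
  replace (F w) with (F w - F p + F p)%C by ring. eapply Rle_trans. apply Cmod_triangle. lra.
Qed.

Lemma bddnear_quotient (F : C -> C) (z : C) : holo F z -> bddnear (fun w => (F w - F z) / (w - z))%C z.
Proof.
  intros [l D]. destruct (cder_local_bound F z l D) as [d [Hd K]].
  exists (Cmod l + 1), d. split; [exact Hd|]. intros w Hw Hwd. specialize (K w Hwd).
  assert (P := Cmod_neq0 _ (Cminus_eq_contra _ _ Hw)).
  rewrite Cmod_div by (apply Cminus_eq_contra, Hw).
  apply Rmult_le_reg_r with (Cmod (w - z)%C); [exact P|].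
  unfold Rdiv. rewrite Rmult_assoc, Rinv_l by lra. lra.
Qed.

Lemma bddnear_mult (F G : C -> C) (p : C) : bddnear F p -> bddnear G p ->
  bddnear (fun w => F w * G w)%C p.
Proof.
  intros [M [d [Hd HM]]] [N [d' [Hd' HN]]].
  exists (M * N), (Rmin d d'). split. apply Rmin_pos; assumption.
  intros w Hw Hwd. rewrite Cmod_mult. apply Rmult_le_compat; try apply Cmod_ge_0.
  apply HM; [exact Hw|]. eapply Rlt_le_trans; [exact Hwd|apply Rmin_l].
  apply HN; [exact Hw|]. eapply Rlt_le_trans; [exact Hwd|apply Rmin_r].
Qed.

Lemma bddnear_plus (F G : C -> C) (p : C) : bddnear F p -> bddnear G p ->
  bddnear (fun w => F w + G w)%C p.
Proof.
  intros [M [d [Hd HM]]] [N [d' [Hd' HN]]].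
  exists (M + N), (Rmin d d'). split. apply Rmin_pos; assumption.
  intros w Hw Hwd. eapply Rle_trans. apply Cmod_triangle. apply Rplus_le_compat.
  apply HM; [exact Hw|]. eapply Rlt_le_trans; [exact Hwd|apply Rmin_l].
  apply HN; [exact Hw|]. eapply Rlt_le_trans; [exact Hwd|apply Rmin_r].
Qed.

(** The difference quotient [psi] has two bounded singularities, at [z] and at [p]. Allowing an
    arbitrary value at [p] is what Riemann's removability theorem needs. *)
Lemma Cauchy_formula_punctured (F : C -> C) (x1 x2 y1 y2 : R) (p z : C) : z <> p ->
  inside x1 x2 y1 y2 p -> inside x1 x2 y1 y2 z ->
  (forall w, inrect x1 x2 y1 y2 w -> w <> p -> holo F w) -> bddnear F p ->
  rect (fun w => F w * / (w - z))%C x1 x2 y1 y2 = (2 * PI * Ci * F z)%C.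
Proof.
  intros Hzp Hp Hz HF HB.
  assert (Hx : x1 <= x2) by (unfold inside in Hz; lra).
  assert (Hy : y1 <= y2) by (unfold inside in Hz; lra).
  assert (HI : inrect x1 x2 y1 y2 z) by (unfold inside, inrect in *; lra).
  set (psi := fun w => ((F w - F z) / (w - z))%C).
  assert (Hpsi : forall w, inrect x1 x2 y1 y2 w -> w <> p -> w <> z -> holo psi w).
  { intros w Hw Hwp Hwz. apply holo_div.
    - apply holo_minus; [apply HF; assumption|apply holo_const].
    - apply holo_minus; [apply holo_id|apply holo_const].
    - apply Cminus_eq_contra, Hwz. }
  assert (Hinv : forall w, bdry x1 x2 y1 y2 w -> ccont (fun u => F z * / (u - z))%C w).
  { intros w Hw. apply holo_ccont, (holo_mult (fun _ => F z)); [apply holo_const|].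
    apply holo_inv_shift, (bdry_inside_neq _ _ _ _ _ _ Hw Hz). }
  transitivity (rect (fun w => psi w + F z * / (w - z))%C x1 x2 y1 y2).
  - apply rect_ext; try assumption. intros w Hw. unfold psi.
    assert (w <> z) by apply (bdry_inside_neq _ _ _ _ _ _ Hw Hz).
    field. apply Cminus_eq_contra. assumption.
  - rewrite rect_plus; try assumption.
    + rewrite (Goursat_two_punctures psi x1 x2 y1 y2 p z); try assumption.
      * rewrite (rect_scal (F z) (fun w => / (w - z))%C); try assumption.
        { rewrite rect_inv by exact Hz. ring. }
        intros w Hw. apply holo_ccont, holo_inv_shift, (bdry_inside_neq _ _ _ _ _ _ Hw Hz).
      * intros E. apply Hzp. symmetry. exact E.
      * unfold psi, Cdiv. apply (bddnear_mult (fun w => F w - F z)%C (fun w => / (w - z))%C).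
        { unfold Cminus. apply bddnear_plus; [exact HB|]. apply bddnear_of_holo, holo_const. }
        apply bddnear_of_holo, holo_inv_shift. intros E. apply Hzp. symmetry. exact E.
      * apply bddnear_quotient. apply HF; assumption.
    + intros w Hw. apply holo_ccont, Hpsi. apply Hw.
      apply (bdry_inside_neq _ _ _ _ _ _ Hw Hp). apply (bdry_inside_neq _ _ _ _ _ _ Hw Hz).
Qed.

Lemma Cauchy_formula (F : C -> C) (x1 x2 y1 y2 : R) (z : C) : inside x1 x2 y1 y2 z ->
  (forall w, inrect x1 x2 y1 y2 w -> holo F w) ->
  rect (fun w => F w * / (w - z))%C x1 x2 y1 y2 = (2 * PI * Ci * F z)%C.
Proof.
  (* A fictitious puncture, halfway to the right side and hence different from [z], reduces the
     claim to the punctured formula. *)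
  intros Hz HF. set (p := (((Re z + x2) / 2)%R, Im z) : C).
  assert (Hp : inside x1 x2 y1 y2 p) by (unfold inside, p, Re, Im in *; simpl; lra).
  apply (Cauchy_formula_punctured F x1 x2 y1 y2 p z); try assumption.
  - apply neq_of_re. unfold inside in Hz. unfold p, Re in *. simpl. lra.
  - intros w Hw _. apply HF, Hw.
  - apply bddnear_of_holo, HF. unfold inside, inrect in *. lra.
Qed.

Lemma Cmod_two_pi_i : Cmod (2 * PI * Ci)%C = 2 * PI.
Proof.
  rewrite !Cmod_mult, Cmod_Ci, !Cmod_R, !Rabs_pos_eq; generalize PI_RGT_0; lra.
Qed.

(** Differentiation under the integral sign, justified by a second-order remainder of the kernel
    that is uniform on the contour. *)
Lemma kernel_cder (phi : C -> C) (x1 x2 y1 y2 M : R) (k : C -> C -> C) (k' : C -> C) (z : C) (B d : R) :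
  x1 <= x2 -> y1 <= y2 -> 0 < d ->
  (forall w, bdry x1 x2 y1 y2 w -> ccont phi w) ->
  (forall w, bdry x1 x2 y1 y2 w -> Cmod (phi w) <= M) ->
  (forall u w, Cmod (u - z)%C < d -> bdry x1 x2 y1 y2 w -> ccont (k u) w) ->
  (forall w, bdry x1 x2 y1 y2 w -> ccont k' w) ->
  (forall u w, Cmod (u - z)%C < d -> bdry x1 x2 y1 y2 w ->
     Cmod (k u w - k z w - (u - z) * k' w)%C <= B * Cmod (u - z)%C ^ 2) ->
  cder (fun u => rect (fun w => phi w * k u w)%C x1 x2 y1 y2) z
       (rect (fun w => phi w * k' w)%C x1 x2 y1 y2).
Proof.
  intros Hx Hy Hd Hphi HM Hk Hk' HB eps Heps.
  set (M' := Rabs M + 1). assert (HM' : 0 < M') by (unfold M'; generalize (Rabs_pos M); lra).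
  set (B' := Rabs B + 1). assert (HB' : 0 < B') by (unfold B'; generalize (Rabs_pos B); lra).
  set (S := (x2 - x1) + (y2 - y1) + 1). assert (HS : 0 < S) by (unfold S; lra).
  set (Q := 4 * (M' * B') * S).
  assert (HQ : 0 < Q) by (unfold Q; repeat apply Rmult_lt_0_compat; lra).
  exists (Rmin d (eps / Q)). split. apply Rmin_pos; [exact Hd|apply Rdiv_lt_0_compat; lra].
  intros u Hu.
  assert (U1 := Rlt_le_trans _ _ _ Hu (Rmin_l _ _)).
  assert (U2 := Rlt_le_trans _ _ _ Hu (Rmin_r _ _)).
  assert (Z0 : Cmod (z - z)%C < d) by (rewrite Cmod_diag; exact Hd).
  assert (E : (rect (fun w => phi w * k u w)%C x1 x2 y1 y2 - rect (fun w => phi w * k z w)%C x1 x2 y1 y2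
     - rect (fun w => phi w * k' w)%C x1 x2 y1 y2 * (u - z))%C
     = rect (fun w => phi w * k u w + ((- (1)) * (phi w * k z w) + (- (u - z)) * (phi w * k' w)))%C x1 x2 y1 y2).
  { rewrite (rect_plus (fun w => phi w * k u w)%C
      (fun w => (- (1)) * (phi w * k z w) + (- (u - z)) * (phi w * k' w))%C); try assumption.
    - rewrite (rect_plus (fun w => (- (1)) * (phi w * k z w))%C (fun w => (- (u - z)) * (phi w * k' w))%C); try assumption.
      + rewrite (rect_scal (- (1)) (fun w => phi w * k z w)%C); try assumption.
        rewrite (rect_scal (- (u - z)) (fun w => phi w * k' w)%C); try assumption.
        * ring.
        * intros w Hw. apply ccont_mult; auto.
        * intros w Hw. apply ccont_mult; auto.
      + intros w Hw. apply (ccont_mult (fun _ => (- (1))%C)). apply holo_ccont, holo_const. apply ccont_mult; auto.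
      + intros w Hw. apply (ccont_mult (fun _ => (- (u - z))%C)). apply holo_ccont, holo_const. apply ccont_mult; auto.
    - intros w Hw. apply ccont_mult; auto.
    - intros w Hw. apply ccont_plus.
      apply (ccont_mult (fun _ => (- (1))%C)). apply holo_ccont, holo_const. apply ccont_mult; auto.
      apply (ccont_mult (fun _ => (- (u - z))%C)). apply holo_ccont, holo_const. apply ccont_mult; auto. }
  rewrite E. set (D := Cmod (u - z)%C) in *. assert (HD : 0 <= D) by apply Cmod_ge_0.
  eapply Rle_trans. apply (rect_bound _ _ _ _ _ (M' * (B' * D ^ 2))); try assumption.
  - intros w Hw. apply ccont_plus. apply ccont_mult; auto. apply ccont_plus.
    apply (ccont_mult (fun _ => (- (1))%C)). apply holo_ccont, holo_const. apply ccont_mult; auto.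
    apply (ccont_mult (fun _ => (- (u - z))%C)). apply holo_ccont, holo_const. apply ccont_mult; auto.
  - intros w Hw.
    replace (phi w * k u w + (- (1) * (phi w * k z w) + - (u - z) * (phi w * k' w)))%C
      with (phi w * (k u w - k z w - (u - z) * k' w))%C by ring.
    rewrite Cmod_mult. apply Rmult_le_compat; try apply Cmod_ge_0.
    + eapply Rle_trans. apply HM, Hw. unfold M'. generalize (Rle_abs M). lra.
    + eapply Rle_trans. apply HB; assumption. apply Rmult_le_compat_r. apply pow_le, HD.
      unfold B'. generalize (Rle_abs B). lra.
  - apply Rle_trans with (Q * D * D).
    + unfold Q. replace (4 * (M' * (B' * D ^ 2)) * (x2 - x1 + (y2 - y1)))
        with (4 * (M' * B') * (D * D) * (x2 - x1 + (y2 - y1))) by ring.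
      replace (4 * (M' * B') * S * D * D) with (4 * (M' * B') * (D * D) * S) by ring.
      apply Rmult_le_compat_l. assert (0 <= D * D) by nra. assert (0 < M' * B') by nra. nra.
      unfold S. lra.
    + apply Rmult_le_compat_r. exact HD.
      apply Rmult_lt_compat_l with (r := Q) in U2; [|exact HQ].
      replace (Q * (eps / Q)) with eps in U2 by (field; lra). lra.
Qed.

Lemma Cmod_far (a h : C) (rho : R) : rho <= Cmod a -> Cmod h < rho / 2 -> rho / 2 < Cmod (a - h)%C.
Proof. intros Ha Hh. assert (T := Cmod_triangle_rev a h). lra. Qed.

(** The first kernel gives the analyticity of Cauchy integrals, the squared one the analyticity of
    their derivatives. *)
Lemma Cauchy_type_cder (phi : C -> C) (x1 x2 y1 y2 M rho : R) (z : C) :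
  x1 <= x2 -> y1 <= y2 -> 0 < rho ->
  (forall w, bdry x1 x2 y1 y2 w -> ccont phi w) ->
  (forall w, bdry x1 x2 y1 y2 w -> Cmod (phi w) <= M) ->
  (forall w, bdry x1 x2 y1 y2 w -> rho <= Cmod (w - z)%C) ->
  cder (fun u => rect (fun w => phi w * / (w - u))%C x1 x2 y1 y2) z
       (rect (fun w => phi w * / ((w - z) * (w - z)))%C x1 x2 y1 y2) /\
  holo (fun u => rect (fun w => phi w * / ((w - u) * (w - u)))%C x1 x2 y1 y2) z.
Proof.
  intros Hx Hy Hr Hphi HM Hrho.
  assert (Hne : forall u w, Cmod (u - z)%C < rho / 2 -> bdry x1 x2 y1 y2 w ->
     rho / 2 < Cmod (w - u)%C /\ (w - u)%C <> RtoC 0).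
  { intros u w Hu Hw. assert (K : rho / 2 < Cmod (w - u)%C).
    { replace (w - u)%C with ((w - z) - (u - z))%C by ring. apply Cmod_far; [apply Hrho, Hw|exact Hu]. }
    split; [exact K|]. apply Cmod_gt_0. lra. }
  assert (Z0 : Cmod (z - z)%C < rho / 2) by (rewrite Cmod_diag; lra).
  assert (Hh : forall u w, Cmod (u - z)%C < rho / 2 -> bdry x1 x2 y1 y2 w -> holo (fun w => / (w - u))%C w).
  { intros u w Hu Hw. apply holo_inv_shift. intros E. apply (proj2 (Hne u w Hu Hw)). rewrite E. ring. }
  split.
  - apply (kernel_cder phi x1 x2 y1 y2 M (fun u w => / (w - u))%C (fun w => / ((w - z) * (w - z)))%C z
      (/ (rho / 2 * (rho * rho))) (rho / 2)); try assumption; try lra.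
    + intros u w Hu Hw. apply holo_ccont, Hh; assumption.
    + intros w Hw. apply holo_ccont. apply (holo_ext (fun w => / (w - z) * / (w - z))%C).
      (* [holo_ext] asks for equality at every [v]; at [v = z] both sides are 0, the default value
         of the inverse of 0. *)
      * intros v. destruct (Ceq_dec (v - z) 0) as [E|E].
        { rewrite E. unfold Cinv, Cmult, RtoC; simpl. f_equal; unfold Rdiv; ring. }
        field. exact E.
      * apply holo_mult; apply Hh; assumption.
    + intros u w Hu Hw.
      destruct (Hne u w Hu Hw) as [N1 N2]. destruct (Hne z w Z0 Hw) as [N3 N4].
      assert (N5 := Hrho w Hw).
      replace (/ (w - u) - / (w - z) - (u - z) * / ((w - z) * (w - z)))%C
        with ((u - z) * (u - z) * / ((w - u) * ((w - z) * (w - z))))%C by (field; auto).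
      rewrite Cmod_mult, Cmod_inv, !Cmod_mult by (repeat apply Cmult_neq_0; assumption).
      rewrite Rmult_comm. replace (Cmod (u - z)%C ^ 2) with (Cmod (u - z)%C * Cmod (u - z)%C) by ring.
      apply Rmult_le_compat_r. apply Rmult_le_pos; apply Cmod_ge_0.
      apply Rinv_le_contravar. repeat apply Rmult_lt_0_compat; lra.
      apply Rmult_le_compat; try lra. apply Rmult_le_pos; lra. apply Rmult_le_compat; lra.
  (* The remainder has numerator [3 * (w - z) - 2 * (u - z)], of modulus at most [4 * Cmod (w - z)],
     over the cube of [w - z] and the square of [w - u]. The distances are at least [rho] and
     [rho / 2], which gives 16. *)
  - eexists. apply (kernel_cder phi x1 x2 y1 y2 M (fun u w => / ((w - u) * (w - u)))%C
      (fun w => 2 * / (w - z) ^ 3)%C z (16 / (rho ^ 4)) (rho / 2)); try assumption; try lra.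
    + intros u w Hu Hw. apply holo_ccont. apply (holo_inv (fun v => (v - u) * (v - u))%C).
      * apply holo_mult; apply holo_minus; try apply holo_id; apply holo_const.
      * apply Cmult_neq_0; apply (Hne u w Hu Hw).
    + intros w Hw. apply holo_ccont. apply (holo_mult (fun _ => RtoC 2)). apply holo_const.
      apply (holo_inv (fun v => (v - z) ^ 3)%C).
      * apply (holo_pow (fun v => v - z)%C). apply holo_minus; [apply holo_id|apply holo_const].
      * apply Cpow_nz. apply (Hne z w Z0 Hw).
    + intros u w Hu Hw.
      destruct (Hne u w Hu Hw) as [N1 N2]. destruct (Hne z w Z0 Hw) as [N3 N4].
      assert (N5 := Hrho w Hw).
      replace (/ ((w - u) * (w - u)) - / ((w - z) * (w - z)) - (u - z) * (2 * / (w - z) ^ 3))%C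
        with ((u - z) * (u - z) * ((3 * (w - z) - 2 * (u - z)) * / ((w - z) ^ 3 * ((w - u) * (w - u)))))%C
        by (field; auto).
      rewrite !Cmod_mult, Cmod_inv, !Cmod_mult, Cmod_pow
        by (apply Cmult_neq_0; [apply Cpow_nz, N4|apply Cmult_neq_0; exact N2]).
      rewrite (Rmult_comm (16 / rho ^ 4)).
      replace (Cmod (u - z)%C ^ 2) with (Cmod (u - z)%C * Cmod (u - z)%C) by ring.
      apply Rmult_le_compat_l. apply Rmult_le_pos; apply Cmod_ge_0.
      set (a := Cmod (w - z)%C) in *. set (b := Cmod (w - u)%C) in *.
      assert (T : Cmod (3 * (w - z) - 2 * (u - z))%C <= 4 * a).
      { eapply Rle_trans. apply Cmod_triangle_minus. rewrite !Cmod_mult, !Cmod_R, !Rabs_pos_eq by lra.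
        fold a. lra. }
      assert (P3 : 0 < a ^ 3 * (b * b)) by (repeat apply Rmult_lt_0_compat; try apply pow_lt; lra).
      apply Rle_trans with (4 * a * / (a ^ 3 * (b * b))).
      { apply Rmult_le_compat_r. left. apply Rinv_0_lt_compat, P3. exact T. }
      replace (4 * a * / (a ^ 3 * (b * b))) with (4 * / ((a * a) * (b * b))) by (field; lra).
      replace (16 / rho ^ 4) with (4 * / ((rho * rho) * (rho / 2 * (rho / 2)))) by (field; lra).
      apply Rmult_le_compat_l; [lra|]. apply Rinv_le_contravar.
      repeat apply Rmult_lt_0_compat; lra.
      apply Rmult_le_compat; try (apply Rmult_le_pos; lra); apply Rmult_le_compat; lra.
Qed.

(** * Squares, removable singularities, the maximum principle and uniform limits *)

(** Squares in the sup norm stand in for discs, because the contours are rectangles; [r] is half the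
    side. *)
Definition sq (c : C) (r : R) : C -> Prop := inrect (Re c - r) (Re c + r) (Im c - r) (Im c + r).
Definition sqb (c : C) (r : R) : C -> Prop := bdry (Re c - r) (Re c + r) (Im c - r) (Im c + r).
Definition sqi (c : C) (r : R) : C -> Prop := inside (Re c - r) (Re c + r) (Im c - r) (Im c + r).

Lemma re_minus (a b : C) : Re (a - b)%C = Re a - Re b.
Proof. reflexivity. Qed.

Lemma im_minus (a b : C) : Im (a - b)%C = Im a - Im b.
Proof. reflexivity. Qed.

Lemma re_le_of_Cmod (a b : C) : Rabs (Re a - Re b) <= Cmod (a - b)%C.
Proof. rewrite <- re_minus. apply re_le_Cmod. Qed.

Lemma im_le_of_Cmod (a b : C) : Rabs (Im a - Im b) <= Cmod (a - b)%C.
Proof. rewrite <- im_minus. apply im_le_Cmod. Qed.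

Lemma Cmod_le_of_box (a b : C) (r s : R) : - r <= Re a - Re b <= r -> - s <= Im a - Im b <= s ->
  Cmod (a - b)%C <= r + s.
Proof.
  intros H1 H2. eapply Rle_trans. apply Cmod_le_re_im. rewrite re_minus, im_minus.
  apply Rplus_le_compat; apply Rabs_le; lra.
Qed.

Lemma sq_Cmod (c : C) (r : R) (z : C) : sq c r z -> Cmod (z - c)%C <= 2 * r.
Proof. intros [H1 H2]. replace (2 * r) with (r + r) by ring. apply Cmod_le_of_box; lra. Qed.

Lemma Cmod_sq (c : C) (r : R) (z : C) : Cmod (z - c)%C <= r -> sq c r z.
Proof.
  intros H. assert (H1 := re_le_of_Cmod z c). assert (H2 := im_le_of_Cmod z c).
  apply Rabs_le_between in H1. apply Rabs_le_between in H2. split; lra.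
Qed.

Lemma Cmod_sqi (c : C) (r : R) (z : C) : Cmod (z - c)%C < r -> sqi c r z.
Proof.
  intros H. assert (H1 := re_le_of_Cmod z c). assert (H2 := im_le_of_Cmod z c).
  apply Rabs_le_between in H1. apply Rabs_le_between in H2. split; lra.
Qed.

Lemma sqb_sq (c : C) (r : R) (z : C) : sqb c r z -> sq c r z.
Proof. intros H. apply H. Qed.

Lemma sqi_sq (c : C) (r : R) (z : C) : sqi c r z -> sq c r z.
Proof. intros [H1 H2]. split; lra. Qed.

Lemma sq_cases (c : C) (r : R) (z : C) : sq c r z -> sqb c r z \/ sqi c r z.
Proof.
  intros [H1 H2]. destruct (classic (sqi c r z)) as [H|H]; [right; exact H|left].
  split; [split; assumption|]. apply NNPP. intros N. apply H. split; split; apply Rnot_le_lt; intros K;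
  apply N; [left|right; left|right; right; left|right; right; right]; lra.
Qed.

Lemma sqb_dist (c : C) (r s : R) (w z : C) : sqb c r w -> sq c s z -> r - s <= Cmod (w - z)%C.
Proof.
  intros [H0 H] [H1 H2].
  assert (K1 := re_le_of_Cmod w z). assert (K2 := im_le_of_Cmod w z).
  apply Rabs_le_between in K1. apply Rabs_le_between in K2.
  destruct H as [H|[H|[H|H]]]; lra.
Qed.

Lemma sq_center (c : C) (r : R) : 0 <= r -> sq c r c.
Proof. intros H. split; lra. Qed.

Lemma sq_le (c : C) (r s : R) (z : C) : r <= s -> sq c r z -> sq c s z.
Proof. intros H [H1 H2]. split; lra. Qed.

Lemma sq_trans (c p : C) (r s : R) (z : C) : sq c r p -> sq p s z -> sq c (r + s) z.
Proof. intros [H1 H2] [H3 H4]. split; lra. Qed.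

Lemma sq_wide (c : C) (r : R) : 0 < r -> Re c - r <= Re c + r /\ Im c - r <= Im c + r.
Proof. lra. Qed.

(** The value at [p] is that of the Cauchy integral, which is analytic across [p] and agrees with
    [F] off [p] by the punctured formula. *)
Theorem Riemann_removable (F : C -> C) (p : C) (d : R) : 0 < d ->
  (forall z, z <> p -> Cmod (z - p)%C < d -> holo F z) -> bddnear F p ->
  exists c, holo (fun z => if Ceq_dec z p then c else F z) p.
Proof.
  intros Hd HF HB. destruct HB as [M [d' [Hd' HM]]].
  set (e := Rmin d d' / 4). assert (He : 0 < e) by (unfold e; assert (0 < Rmin d d') by (apply Rmin_pos; assumption); lra).
  assert (He1 : 2 * e < d) by (unfold e; assert (Rmin d d' <= d) by apply Rmin_l; lra).
  assert (He2 : 2 * e < d') by (unfold e; assert (Rmin d d' <= d') by apply Rmin_r; lra).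
  destruct (sq_wide p e He) as [Wx Wy].
  assert (Hb : forall w, sqb p e w -> w <> p).
  { intros w Hw. apply (bdry_inside_neq _ _ _ _ _ _ Hw). split; lra. }
  set (K := fun u => rect (fun w => F w * / (w - u))%C (Re p - e) (Re p + e) (Im p - e) (Im p + e)).
  destruct (Cauchy_type_cder F (Re p - e) (Re p + e) (Im p - e) (Im p + e) M e p) as [D _]; try lra.
  - intros w Hw. apply holo_ccont, HF. apply Hb, Hw. assert (S := sq_Cmod p e w (sqb_sq _ _ _ Hw)). lra.
  - intros w Hw. apply HM. apply Hb, Hw. assert (S := sq_Cmod p e w (sqb_sq _ _ _ Hw)). lra.
  - intros w Hw. assert (S := sqb_dist p e 0 w p Hw (sq_center p 0 (Rle_refl 0))). lra.
  - fold K in D. exists (/ (2 * PI * Ci) * K p)%C.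
    apply (holo_ext_near (fun z => / (2 * PI * Ci) * K z)%C).
    + exists e. split; [exact He|]. intros w Hw. destruct (Ceq_dec w p) as [->|N]; [reflexivity|].
      unfold K. rewrite (Cauchy_formula_punctured F _ _ _ _ p w); try assumption.
      * field. split; [apply Ci_nz|]. intros E. apply RtoC_inj in E. generalize PI_RGT_0; lra.
      * split; lra.
      * apply Cmod_sqi, Hw.
      * intros z Hz Hzp. apply HF; [exact Hzp|]. assert (S := sq_Cmod p e z Hz). lra.
      * exists M, d'. split; assumption.
    + apply holo_mult; [apply holo_const|]. eexists. exact D.
Qed.

Lemma pow_lt_const_contra (x M B : R) : 0 <= M -> M < x -> ~ (forall n, (1 <= n)%nat -> x ^ n <= B * M ^ n).
Proof.
  intros HM Hx H.
  destruct (pow_lt_1_zero (M / x)) with (y := / (Rabs B + 1)) as [n Hn].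
  - assert (0 <= M / x) by (apply Rdiv_le_0_compat; lra).
    rewrite Rabs_pos_eq by assumption. apply Rmult_lt_reg_r with x; [lra|].
    unfold Rdiv. rewrite Rmult_assoc, Rinv_l by lra. lra.
  - apply Rinv_0_lt_compat. generalize (Rabs_pos B). lra.
  - assert (HB := Rabs_pos B). assert (LB := Rle_abs B).
    specialize (Hn (S n) (le_S _ _ (Nat.le_refl n))). specialize (H (S n) ltac:(lia)).
    assert (Px : 0 < x ^ S n) by (apply pow_lt; lra).
    assert (PM : 0 <= M ^ S n) by (apply pow_le; lra).
    assert (E : (M / x) ^ S n = M ^ S n / x ^ S n).
    { unfold Rdiv. rewrite Rpow_mult_distr, pow_inv. reflexivity. }
    rewrite E, Rabs_pos_eq in Hn by (apply Rdiv_le_0_compat; assumption).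
    apply Rmult_lt_compat_r with (r := x ^ S n) in Hn; [|exact Px].
    unfold Rdiv in Hn. rewrite Rmult_assoc, Rinv_l, Rmult_1_r in Hn by lra.
    apply Rmult_lt_compat_l with (r := Rabs B + 1) in Hn; [|lra].
    rewrite <- Rmult_assoc, Rinv_r, Rmult_1_l in Hn by lra. nra.
Qed.

(* Cauchy's bound for [F ^ n] loses a factor that does not depend on [n], and
   disappears in the [n]-th root. *)
Theorem maximum_principle (F : C -> C) (c : C) (r M : R) (z : C) : 0 < r ->
  (forall w, sq c r w -> holo F w) -> (forall w, sqb c r w -> Cmod (F w) <= M) ->
  sq c r z -> Cmod (F z) <= M.
Proof.
  intros Hr HF HM Hz. destruct (sq_cases c r z Hz) as [Hb|Hi]; [apply HM, Hb|].
  destruct (sq_wide c r Hr) as [Wx Wy].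
  apply Rnot_lt_le. intros HN.
  destruct (inside_margin _ _ _ _ _ Hi) as [e [He Hme]].
  destruct (Hme e) as [m1 [m2 [m3 m4]]]; [lra|].
  assert (HM0 : 0 <= M).
  { eapply Rle_trans. apply (Cmod_ge_0 (F (Re c + r, Im c))). apply HM.
    unfold sqb, bdry, inrect, Re, Im. simpl. lra. }
  assert (Hd : forall w, sqb c r w -> e <= Cmod (w - z)%C).
  { intros w Hw. assert (K1 := re_le_of_Cmod w z). assert (K2 := im_le_of_Cmod w z).
    apply Rabs_le_between in K1. apply Rabs_le_between in K2.
    destruct Hw as [_ [H|[H|[H|H]]]]; lra. }
  apply (pow_lt_const_contra (Cmod (F z)) M (4 * / e * (4 * r) / (2 * PI)) HM0 HN).
  intros n _.
  assert (E : (2 * PI * Ci * F z ^ n)%C = rect (fun w => F w ^ n * / (w - z))%C (Re c - r) (Re c + r) (Im c - r) (Im c + r)).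
  { symmetry. apply (Cauchy_formula (fun w => F w ^ n)%C); [exact Hi|].
    intros w Hw. apply holo_pow, HF, Hw. }
  assert (B : Cmod (2 * PI * Ci * F z ^ n)%C <= 4 * (M ^ n * / e) * ((Re c + r - (Re c - r)) + (Im c + r - (Im c - r)))).
  { rewrite E. apply rect_bound; try assumption.
    - intros w Hw. apply holo_ccont, holo_mult. apply holo_pow, HF, sqb_sq, Hw.
      apply holo_inv_shift. apply (bdry_inside_neq _ _ _ _ _ _ Hw Hi).
    - intros w Hw. assert (N : (w - z)%C <> RtoC 0).
      { apply Cminus_eq_contra, (bdry_inside_neq _ _ _ _ _ _ Hw Hi). }
      rewrite Cmod_mult, Cmod_pow, Cmod_inv by exact N. apply Rmult_le_compat.
      + apply pow_le, Cmod_ge_0.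
      + left. apply Rinv_0_lt_compat, Cmod_neq0, N.
      + apply pow_incr. split. apply Cmod_ge_0. apply HM, Hw.
      + apply Rinv_le_contravar; [exact He|]. apply Hd, Hw. }
  rewrite Cmod_mult, Cmod_two_pi_i, Cmod_pow in B.
  assert (P := PI_RGT_0).
  apply Rmult_le_reg_l with (2 * PI); [lra|].
  eapply Rle_trans. apply B. right. field. lra.
Qed.

(** Converse of Cauchy's formula: a continuous function reproduced by it is a Cauchy-type integral.
    Continuity and the formula both pass to uniform limits, so this serves as the entry to
    Weierstrass's theorem. *)
Lemma holo_of_Cauchy (F : C -> C) (z : C) (d : R) : 0 < d ->
  (forall w, Cmod (w - z)%C < d -> ccont F w) ->
  (forall e w, 0 < e -> 2 * e < d -> sqi z e w ->
     rect (fun u => F u * / (u - w))%C (Re z - e) (Re z + e) (Im z - e) (Im z + e) = (2 * PI * Ci * F w)%C) ->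
  holo F z.
Proof.
  intros Hd HC HK.
  destruct (HC z) with (eps := 1) as [d' [Hd' HB]]; [rewrite Cmod_diag; exact Hd|lra|].
  set (e := Rmin d d' / 4). assert (He : 0 < e) by (unfold e; assert (0 < Rmin d d') by (apply Rmin_pos; assumption); lra).
  assert (He1 : 2 * e < d) by (unfold e; assert (Rmin d d' <= d) by apply Rmin_l; lra).
  assert (He2 : 2 * e < d') by (unfold e; assert (Rmin d d' <= d') by apply Rmin_r; lra).
  set (K := fun u => rect (fun w => F w * / (w - u))%C (Re z - e) (Re z + e) (Im z - e) (Im z + e)).
  destruct (Cauchy_type_cder F (Re z - e) (Re z + e) (Im z - e) (Im z + e) (Cmod (F z) + 1) e z) as [D _]; try lra.
  - intros w Hw. apply HC. assert (S := sq_Cmod z e w (sqb_sq _ _ _ Hw)). lra.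
  - intros w Hw. assert (S := sq_Cmod z e w (sqb_sq _ _ _ Hw)).
    specialize (HB w ltac:(lra)). replace (F w) with (F w - F z + F z)%C by ring.
    eapply Rle_trans. apply Cmod_triangle. lra.
  - intros w Hw. assert (S := sqb_dist z e 0 w z Hw (sq_center z 0 (Rle_refl 0))). lra.
  - fold K in D. apply (holo_ext_near (fun w => / (2 * PI * Ci) * K w)%C).
    + exists e. split; [exact He|]. intros w Hw. unfold K.
      rewrite HK; [|lra|lra|apply Cmod_sqi, Hw].
      field. split; [apply Ci_nz|]. intros E. apply RtoC_inj in E. generalize PI_RGT_0; lra.
    + apply holo_mult; [apply holo_const|]. eexists. exact D.
Qed.

Theorem holo_uniform_limit (Fn : nat -> C -> C) (F : C -> C) (z : C) (d : R) : 0 < d ->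
  (forall n w, Cmod (w - z)%C < d -> holo (Fn n) w) ->
  (forall eps, 0 < eps -> exists n, forall w, Cmod (w - z)%C < d -> Cmod (Fn n w - F w)%C <= eps) ->
  holo F z.
Proof.
  intros Hd HFn HU.
  assert (HC : forall w, Cmod (w - z)%C < d -> ccont F w).
  { intros w Hw eps Heps. destruct (HU (eps / 4)) as [n Hn]; [lra|].
    destruct (holo_ccont _ _ (HFn n w Hw) (eps / 4)) as [d' [Hd' K]]; [lra|].
    exists (Rmin d' (d - Cmod (w - z)%C)). split. apply Rmin_pos; lra.
    intros u Hu.
    assert (U1 := Rlt_le_trans _ _ _ Hu (Rmin_l _ _)).
    assert (U2 := Rlt_le_trans _ _ _ Hu (Rmin_r _ _)).
    assert (U3 : Cmod (u - z)%C < d).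
    { replace (u - z)%C with ((u - w) + (w - z))%C by ring.
      eapply Rle_lt_trans. apply Cmod_triangle. lra. }
    replace (F u - F w)%C with ((Fn n u - Fn n w) - (Fn n u - F u) + (Fn n w - F w))%C by ring.
    eapply Rle_lt_trans. apply Cmod_triangle.
    eapply Rle_lt_trans. apply Rplus_le_compat_r, Cmod_triangle_minus.
    specialize (K u U1). assert (N1 := Hn u U3). assert (N2 := Hn w Hw). lra. }
  apply (holo_of_Cauchy F z d Hd HC).
  intros e w He Hed Hw. destruct (sq_wide z e He) as [Wx Wy].
  destruct (inside_margin _ _ _ _ _ Hw) as [m [Hm Hmm]].
  destruct (Hmm m) as [m1 [m2 [m3 m4]]]; [lra|].
  assert (Hdist : forall u, sqb z e u -> m <= Cmod (u - w)%C).
  { intros u Hu. assert (K1 := re_le_of_Cmod u w). assert (K2 := im_le_of_Cmod u w).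
    apply Rabs_le_between in K1. apply Rabs_le_between in K2.
    destruct Hu as [_ [H|[H|[H|H]]]]; lra. }
  assert (Hin : forall u, sq z e u -> Cmod (u - z)%C < d) by (intros u Hu; assert (S := sq_Cmod z e u Hu); lra).
  assert (Hinv : forall u, sqb z e u -> ccont (fun v => / (v - w))%C u).
  { intros u Hu. apply holo_ccont, holo_inv_shift, (bdry_inside_neq _ _ _ _ _ _ Hu Hw). }
  set (I := rect (fun u => F u * / (u - w))%C (Re z - e) (Re z + e) (Im z - e) (Im z + e)).
  cut (Cmod (I - 2 * PI * Ci * F w)%C = 0).
  { intros H. apply Cmod_eq_0 in H. apply Ceq_minus, H. }
  apply Rle_antisym; [|apply Cmod_ge_0]. apply le_epsilon. intros eps Heps. rewrite Rplus_0_l.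
  assert (P := PI_RGT_0).
  (* For a unit error, [16 * e / m] bounds the contour integral and [2 * PI] the value term. *)
  set (Q := 16 * e / m + 2 * PI).
  assert (HQ : 0 < Q) by (unfold Q; assert (0 < 16 * e / m) by (apply Rdiv_lt_0_compat; lra); lra).
  destruct (HU (eps / Q)) as [n Hn]; [apply Rdiv_lt_0_compat; lra|].
  assert (E : (I - 2 * PI * Ci * F w)%C =
    (rect (fun u => (F u - Fn n u) * / (u - w))%C (Re z - e) (Re z + e) (Im z - e) (Im z + e)
      + 2 * PI * Ci * (Fn n w - F w))%C).
  { assert (CF := Cauchy_formula (Fn n) _ _ _ _ w Hw (fun u Hu => HFn n u (Hin u Hu))).
    assert (L : I = (rect (fun u => (F u - Fn n u) * / (u - w))%C (Re z - e) (Re z + e) (Im z - e) (Im z + e)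
      + rect (fun u => Fn n u * / (u - w))%C (Re z - e) (Re z + e) (Im z - e) (Im z + e))%C).
    { rewrite <- rect_plus; try assumption.
      - unfold I. apply rect_ext; try assumption. intros u _. ring.
      - intros u Hu. apply ccont_mult; [|apply Hinv, Hu].
        unfold Cminus. apply ccont_plus. apply HC, Hin, sqb_sq, Hu.
        apply holo_ccont, holo_opp, HFn, Hin, sqb_sq, Hu.
      - intros u Hu. apply ccont_mult; [|apply Hinv, Hu]. apply holo_ccont, HFn, Hin, sqb_sq, Hu. }
    rewrite L, CF. ring. }
  rewrite E. eapply Rle_trans. apply Cmod_triangle.
  assert (B1 : Cmod (rect (fun u => (F u - Fn n u) * / (u - w))%C (Re z - e) (Re z + e) (Im z - e) (Im z + e))
     <= 4 * (eps / Q * / m) * ((Re z + e - (Re z - e)) + (Im z + e - (Im z - e)))).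
  { apply rect_bound; try assumption.
    - intros u Hu. apply ccont_mult; [|apply Hinv, Hu].
      unfold Cminus. apply ccont_plus. apply HC, Hin, sqb_sq, Hu.
      apply holo_ccont, holo_opp, HFn, Hin, sqb_sq, Hu.
    - intros u Hu. assert (N : (u - w)%C <> RtoC 0).
      { apply Cminus_eq_contra, (bdry_inside_neq _ _ _ _ _ _ Hu Hw). }
      rewrite Cmod_mult, Cmod_inv by exact N. apply Rmult_le_compat.
      + apply Cmod_ge_0.
      + left. apply Rinv_0_lt_compat, Cmod_neq0, N.
      + rewrite Cmod_minus_sym. apply Hn, Hin, sqb_sq, Hu.
      + apply Rinv_le_contravar; [exact Hm|]. apply Hdist, Hu. }
  assert (B2 : Cmod (2 * PI * Ci * (Fn n w - F w))%C <= 2 * PI * (eps / Q)).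
  { rewrite Cmod_mult, Cmod_two_pi_i. apply Rmult_le_compat_l; [lra|]. apply Hn, Hin, sqi_sq, Hw. }
  eapply Rle_trans. apply Rplus_le_compat; [apply B1|apply B2].
  apply Rle_trans with (Q * (eps / Q)).
  - right. unfold Q at 3. field. split; lra.
  - right. field. lra.
Qed.

Lemma cder_unique (F : C -> C) (z l m : C) : cder F z l -> cder F z m -> l = m.
Proof.
  intros D1 D2. apply NNPP. intros N.
  assert (P := Cmod_neq0 _ (Cminus_eq_contra _ _ N)). set (k := Cmod (l - m)%C) in *.
  destruct (D1 (k / 4)) as [d1 [Hd1 H1]]; [lra|]. destruct (D2 (k / 4)) as [d2 [Hd2 H2]]; [lra|].
  set (h := Rmin d1 d2 / 2). assert (Hh : 0 < h) by (unfold h; assert (0 < Rmin d1 d2) by (apply Rmin_pos; assumption); lra).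
  assert (Hh1 : h < d1) by (unfold h in *; assert (Rmin d1 d2 <= d1) by apply Rmin_l; lra).
  assert (Hh2 : h < d2) by (unfold h in *; assert (Rmin d1 d2 <= d2) by apply Rmin_r; lra).
  assert (E : Cmod ((z + h) - z)%C = h).
  { replace ((z + h) - z)%C with (RtoC h) by ring. rewrite Cmod_R. apply Rabs_pos_eq. lra. }
  specialize (H1 (z + h)%C). specialize (H2 (z + h)%C). rewrite E in H1, H2.
  specialize (H1 Hh1). specialize (H2 Hh2).
  assert (T : Cmod ((l - m) * ((z + h) - z))%C <= k / 4 * h + k / 4 * h).
  { replace ((l - m) * ((z + h) - z))%C
      with ((F (z + h) - F z - m * ((z + h) - z)) - (F (z + h) - F z - l * ((z + h) - z)))%C by ring.
    eapply Rle_trans. apply Cmod_triangle_minus. lra. }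
  rewrite Cmod_mult, E in T. fold k in T. nra.
Qed.

(** The derivative is a Cauchy-type integral with squared kernel; uniqueness of derivatives
    identifies the two. It makes the logarithmic derivative analytic later. *)
Lemma holo_derivative (F F' : C -> C) (q : C) (d : R) : 0 < d ->
  (forall z, Cmod (z - q)%C < d -> cder F z (F' z)) -> holo F' q.
Proof.
  intros Hd HF.
  assert (HH : forall z, Cmod (z - q)%C < d -> holo F z) by (intros z Hz; eexists; apply HF, Hz).
  destruct (holo_ccont F q (HH q ltac:(rewrite Cmod_diag; exact Hd)) 1 Rlt_0_1) as [d' [Hd' HB]].
  set (e := Rmin d d' / 4). assert (He : 0 < e) by (unfold e; assert (0 < Rmin d d') by (apply Rmin_pos; assumption); lra).
  assert (He1 : 2 * e < d) by (unfold e; assert (Rmin d d' <= d) by apply Rmin_l; lra).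
  assert (He2 : 2 * e < d') by (unfold e; assert (Rmin d d' <= d') by apply Rmin_r; lra).
  assert (Hin : forall u, sq q e u -> Cmod (u - q)%C < d) by (intros u Hu; assert (S := sq_Cmod q e u Hu); lra).
  assert (KK : forall z, sq q (e / 2) z ->
    cder (fun u => rect (fun w => F w * / (w - u))%C (Re q - e) (Re q + e) (Im q - e) (Im q + e)) z
       (rect (fun w => F w * / ((w - z) * (w - z)))%C (Re q - e) (Re q + e) (Im q - e) (Im q + e)) /\
    holo (fun u => rect (fun w => F w * / ((w - u) * (w - u)))%C (Re q - e) (Re q + e) (Im q - e) (Im q + e)) z).
  { intros z Hz. apply (Cauchy_type_cder F _ _ _ _ (Cmod (F q) + 1) (e / 2) z); try lra.
    - intros w Hw. apply holo_ccont, HH, Hin, sqb_sq, Hw.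
    - intros w Hw. assert (S := sq_Cmod q e w (sqb_sq _ _ _ Hw)).
      specialize (HB w ltac:(lra)). replace (F w) with (F w - F q + F q)%C by ring.
      eapply Rle_trans. apply Cmod_triangle. lra.
    - intros w Hw. assert (S := sqb_dist q e (e / 2) w z Hw Hz). lra. }
  apply (holo_ext_near (fun z => / (2 * PI * Ci) *
    rect (fun w => F w * / ((w - z) * (w - z)))%C (Re q - e) (Re q + e) (Im q - e) (Im q + e))%C).
  - exists (e / 2). split; [lra|]. intros z Hz.
    assert (Hzs : sq q (e / 2) z) by (apply Cmod_sq; lra).
    apply (cder_unique F z); [|apply HF; lra].
    apply (cder_ext_near (fun u => / (2 * PI * Ci) *
      rect (fun w => F w * / (w - u))%C (Re q - e) (Re q + e) (Im q - e) (Im q + e))%C).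
    + exists (e / 2). split; [lra|]. intros u Hu.
      rewrite (Cauchy_formula F _ _ _ _ u).
      * field. split; [apply Ci_nz|]. intros E. apply RtoC_inj in E. generalize PI_RGT_0; lra.
      * apply Cmod_sqi. replace (u - q)%C with ((u - z) + (z - q))%C by ring.
        eapply Rle_lt_trans. apply Cmod_triangle. lra.
      * intros w Hw. apply HH, Hin, Hw.
    + destruct (KK z Hzs) as [D _].
      assert (Q := cder_mult (fun _ => / (2 * PI * Ci))%C _ z _ _ (cder_const _ z) D). cbv beta in Q.
      match type of Q with cder _ _ ?l => match goal with |- cder _ _ ?m => replace m with l by ring end end.
      exact Q.
  - apply holo_mult; [apply holo_const|]. apply (KK q). apply sq_center. lra.
Qed.

(** * Exponentials and logarithms *)

Definition Cexp (z : C) : C := (exp (Re z) * cos (Im z), exp (Re z) * sin (Im z)).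

Lemma Cexp_0 : Cexp 0 = RtoC 1.
Proof. unfold Cexp, RtoC, Re, Im; simpl. rewrite exp_0, cos_0, sin_0. f_equal; ring. Qed.

Lemma Cexp_plus (z w : C) : Cexp (z + w) = (Cexp z * Cexp w)%C.
Proof.
  unfold Cexp, Cmult, Re, Im; simpl. rewrite exp_plus, cos_plus, sin_plus. f_equal; ring.
Qed.

Lemma Cmod_Cexp (z : C) : Cmod (Cexp z) = exp (Re z).
Proof.
  unfold Cmod, Cexp; simpl.
  replace (exp (Re z) * cos (Im z) * (exp (Re z) * cos (Im z) * 1) +
    exp (Re z) * sin (Im z) * (exp (Re z) * sin (Im z) * 1))
    with ((exp (Re z))² * ((sin (Im z))² + (cos (Im z))²)) by (unfold Rsqr; ring).
  rewrite sin2_cos2, Rmult_1_r. apply sqrt_Rsqr. left. apply exp_pos.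
Qed.

Lemma derivable_pt_lim_bound (f : R -> R) (x l : R) : derivable_pt_lim f x l -> forall eps, 0 < eps ->
  exists d, 0 < d /\ forall h, Rabs h < d -> Rabs (f (x + h) - f x - l * h) <= eps * Rabs h.
Proof.
  intros D eps Heps. destruct (D eps Heps) as [d H]. exists d. split. apply cond_pos.
  intros h Hh. destruct (Req_dec h 0) as [->|N].
  - rewrite Rplus_0_r, Rmult_0_r. replace (f x - f x - 0) with 0 by ring. rewrite Rabs_R0. lra.
  - specialize (H h N Hh).
    replace (f (x + h) - f x - l * h) with (((f (x + h) - f x) / h - l) * h) by (field; exact N).
    rewrite Rabs_mult. apply Rmult_le_compat_r. apply Rabs_pos. lra.
Qed.

Lemma cder_Cexp_0 : cder Cexp 0 1.
Proof.
  (* Real and imaginary parts cost [3 * k] and [5 * k] times [D], which explains the 8; [k <= 1 / 8]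
     tames the quadratic terms. *)
  intros eps Heps. set (k := Rmin 1 eps / 8).
  assert (Hk : 0 < k) by (unfold k; assert (0 < Rmin 1 eps) by (apply Rmin_pos; lra); lra).
  assert (Hk1 : k <= 1 / 8) by (unfold k; assert (Rmin 1 eps <= 1) by apply Rmin_l; lra).
  assert (Hk2 : k <= eps / 8) by (unfold k; assert (Rmin 1 eps <= eps) by apply Rmin_r; lra).
  destruct (derivable_pt_lim_bound exp 0 (exp 0) (derivable_pt_lim_exp 0) k Hk) as [d1 [Hd1 H1]].
  destruct (derivable_pt_lim_bound cos 0 (- sin 0) (derivable_pt_lim_cos 0) k Hk) as [d2 [Hd2 H2]].
  destruct (derivable_pt_lim_bound sin 0 (cos 0) (derivable_pt_lim_sin 0) k Hk) as [d3 [Hd3 H3]].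
  exists (Rmin (Rmin d1 k) (Rmin d2 d3)). split. repeat apply Rmin_pos; assumption.
  intros w Hw. replace (w - 0)%C with w in * by ring. destruct w as [x y].
  assert (Hx := re_le_Cmod (x, y)). assert (Hy := im_le_Cmod (x, y)).
  set (D := Cmod (x, y)) in *. unfold Re, Im in Hx, Hy; simpl in Hx, Hy.
  assert (HD : D < d1 /\ D < k /\ D < d2 /\ D < d3).
  { revert Hw. unfold Rmin. repeat destruct Rle_dec; intros; lra. }
  destruct HD as [D1 [D2 [D3 D4]]].
  specialize (H1 x ltac:(lra)). specialize (H2 y ltac:(lra)). specialize (H3 y ltac:(lra)).
  rewrite exp_0, Rplus_0_l in H1. rewrite cos_0, sin_0, Rplus_0_l in H2. rewrite sin_0, cos_0, Rplus_0_l in H3.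
  rewrite Cexp_0, (Cmult_1_l (x, y)).
  set (a := exp x - 1 - 1 * x) in *. set (b := cos y - 1 - - 0 * y) in *. set (c := sin y - 0 - 1 * y) in *.
  eapply Rle_trans. apply Cmod_le_re_im.
  replace (Re (Cexp (x, y) - 1 - (x, y))%C) with (a + b + (a + x) * b)
    by (unfold a, b, Cexp, Cminus, Cplus, Copp, Re, Im, RtoC; simpl; ring).
  replace (Im (Cexp (x, y) - 1 - (x, y))%C) with (c + (a + x) * (c + y))
    by (unfold a, c, Cexp, Cminus, Cplus, Copp, Re, Im, RtoC; simpl; ring).
  assert (HD0 : 0 <= D) by apply Cmod_ge_0.
  assert (Ax : Rabs (a + x) <= 2 * D).
  { eapply Rle_trans. apply Rabs_triang. nra. }
  assert (Ax' : Rabs (a + x) <= 2 * k) by lra.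
  assert (Cy : Rabs (c + y) <= 2 * D).
  { eapply Rle_trans. apply Rabs_triang. nra. }
  assert (K1 : Rabs (a + b + (a + x) * b) <= k * D + k * D + k * D).
  { eapply Rle_trans. apply Rabs_triang. apply Rplus_le_compat.
    - eapply Rle_trans. apply Rabs_triang. apply Rplus_le_compat; nra.
    - rewrite Rabs_mult. assert (0 <= Rabs b) by apply Rabs_pos. assert (Rabs b <= k * D) by nra.
      assert (0 <= Rabs (a + x)) by apply Rabs_pos. nra. }
  assert (K2 : Rabs (c + (a + x) * (c + y)) <= k * D + 2 * k * (2 * D)).
  { eapply Rle_trans. apply Rabs_triang. apply Rplus_le_compat; [nra|].
    rewrite Rabs_mult. apply Rmult_le_compat; try apply Rabs_pos; assumption. }
  nra.
Qed.

Lemma cder_Cexp (z : C) : cder Cexp z (Cexp z).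
Proof.
  assert (D : cder (fun w => Cexp z * Cexp (w - z))%C z (Cexp z)).
  { assert (D1 : cder (fun w => w - z)%C z 1).
    { assert (Q := cder_plus (fun w => w) (fun _ => (- z)%C) z _ _ (cder_id z) (cder_const _ z)).
      replace (RtoC 1) with (1 + 0)%C by ring. exact Q. }
    assert (D2 : cder Cexp (z - z)%C 1) by (replace (z - z)%C with (RtoC 0) by ring; apply cder_Cexp_0).
    assert (Q := cder_mult (fun _ => Cexp z) (fun w => Cexp (w - z)%C) z _ _ (cder_const _ z)
      (cder_comp (fun w => w - z)%C Cexp z _ _ D1 D2)). cbv beta in Q.
    match type of Q with cder _ _ ?l => replace l with (Cexp z) in Q by ring end. exact Q. }
  apply (cder_ext_near (fun w => Cexp z * Cexp (w - z))%C); [|exact D].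
  apply near_eq_refl. intros w. rewrite <- Cexp_plus. f_equal. ring.
Qed.

Lemma holo_Cexp (z : C) : holo Cexp z.
Proof. eexists. apply cder_Cexp. Qed.


(** * Primitives and logarithms *)

Lemma CI_swap (f : R -> C) (a b : R) : cint f a b -> CI f b a = (- CI f a b)%C.
Proof.
  intros [H1 H2]. unfold CI, Copp; simpl. f_equal; symmetry;
    apply (@opp_RInt_swap R_CompleteNormedModule); assumption.
Qed.

Lemma CI_const (c : C) (a b : R) : CI (fun _ => c) a b = (c * (b - a))%C.
Proof.
  unfold CI. rewrite !(@RInt_const R_CompleteNormedModule).
  apply C_ext; unfold Re, Im, Cmult, Cminus, Cplus, Copp, RtoC, scal; simpl; unfold mult; simpl; ring.
Qed.

Lemma CI_near_const (f : R -> C) (c : C) (a b eps : R) : cint f (Rmin a b) (Rmax a b) ->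
  (forall t, Rmin a b <= t <= Rmax a b -> Cmod (f t - c)%C <= eps) ->
  Cmod (CI f a b - c * (b - a))%C <= 2 * eps * Rabs (b - a).
Proof.
  assert (Key : forall a b, a <= b -> cint f a b -> (forall t, a <= t <= b -> Cmod (f t - c)%C <= eps) ->
    Cmod (CI f a b - c * (b - a))%C <= 2 * eps * Rabs (b - a)).
  { intros a' b' Hab I H.
    assert (Ic : cint (fun _ : R => (- c)%C) a' b').
    { split; apply @ex_RInt_const. }
    replace (CI f a' b' - c * (b' - a'))%C with (CI (fun t => f t + - c)%C a' b').
    - rewrite Rabs_pos_eq by lra. apply CI_bound; [exact Hab|apply cint_plus; assumption|exact H].
    - rewrite CI_plus by assumption. rewrite CI_const. ring. }
  intros I H. destruct (Rle_or_lt a b) as [Hab|Hab].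
  - rewrite Rmin_left, Rmax_right in * by lra. apply Key; assumption.
  - rewrite Rmin_right, Rmax_left in * by lra.
    rewrite (CI_swap f b a I).
    replace (- CI f b a - c * (b - a))%C with (- (CI f b a - c * (a - b)))%C by ring.
    rewrite Cmod_opp. replace (Rabs (b - a)) with (Rabs (a - b)) by apply Rabs_minus_sym.
    apply Key; [lra|assumption..].
Qed.

(** The primitive integrates along the bottom side and then upwards. Goursat's theorem turns its
    horizontal increments into integrals at the actual height, so increments in both directions only
    see [phi] near the point. *)
Lemma primitive_exists (phi : C -> C) (x1 x2 y1 y2 : R) :
  (forall z, inrect x1 x2 y1 y2 z -> holo phi z) ->
  exists P : C -> C, forall z, inside x1 x2 y1 y2 z -> cder P z (phi z).
Proof.
  intros Hphi.
  assert (HC : forall x y, x1 <= x <= x2 -> y1 <= y <= y2 -> ccont phi (x, y)).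
  { intros x y Hx Hy. apply holo_ccont, Hphi. split; assumption. }
  set (P := fun z => (CI (fun x => phi (x, y1)) x1 (Re z) + Ci * CI (fun y => phi (Re z, y)) y1 (Im z))%C).
  assert (IH : forall y a b, y1 <= y <= y2 -> x1 <= a -> a <= b -> b <= x2 -> cint (fun x => phi (x, y)) a b).
  { intros y a b Hy Ha Hab Hb. apply cint_horiz; [exact Hab|]. intros x Hx. apply HC; lra. }
  assert (IV : forall x a b, x1 <= x <= x2 -> y1 <= a -> a <= b -> b <= y2 -> cint (fun y => phi (x, y)) a b).
  { intros x a b Hx Ha Hab Hb. apply cint_vert; [exact Hab|]. intros y Hy. apply HC; lra. }
  assert (StepH : forall x x' y, x1 <= x <= x2 -> x1 <= x' <= x2 -> y1 <= y <= y2 ->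
    (P (x', y) - P (x, y))%C = CI (fun t => phi (t, y)) x x').
  { assert (K : forall x x' y, x1 <= x -> x <= x' -> x' <= x2 -> y1 <= y <= y2 ->
      (P (x', y) - P (x, y))%C = CI (fun t => phi (t, y)) x x').
    { intros x x' y H1 H2 H3 Hy.
      assert (G : rect phi x x' y1 y = RtoC 0).
      { apply Goursat; try lra. intros z [Z1 Z2]. apply Hphi. split; lra. }
      unfold P, Re, Im; simpl.
      rewrite (CI_Chasles (fun t => phi (t, y1)) x1 x x') by (apply IH; lra).
      unfold rect in G.
      replace (CI (fun t => phi (t, y)) x x') with (CI (fun t => phi (t, y)) x x' + 0)%C by ring.
      rewrite <- G. ring. }
    intros x x' y Hx Hx' Hy. destruct (Rle_or_lt x x') as [L|L].
    - apply K; lra.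
    - rewrite (CI_swap _ x' x) by (apply IH; lra). rewrite <- K by lra. ring. }
  assert (StepV : forall x y y', x1 <= x <= x2 -> y1 <= y <= y2 -> y1 <= y' <= y2 ->
    (P (x, y') - P (x, y))%C = (Ci * CI (fun t => phi (x, t)) y y')%C).
  { assert (K : forall x y y', x1 <= x <= x2 -> y1 <= y -> y <= y' -> y' <= y2 ->
      (P (x, y') - P (x, y))%C = (Ci * CI (fun t => phi (x, t)) y y')%C).
    { intros x y y' Hx H1 H2 H3. unfold P, Re, Im; simpl.
      rewrite (CI_Chasles (fun t => phi (x, t)) y1 y y') by (apply IV; lra). ring. }
    intros x y y' Hx Hy Hy'. destruct (Rle_or_lt y y') as [L|L].
    - apply K; lra.
    - rewrite (CI_swap _ y' y) by (apply IV; lra).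
      replace (Ci * - CI (fun t => phi (x, t)) y' y)%C with (- (Ci * CI (fun t => phi (x, t)) y' y))%C by ring.
      rewrite <- K by lra. ring. }
  exists P. intros [x y] Hz eps Heps.
  destruct (inside_margin _ _ _ _ _ Hz) as [m [Hm Hmm]].
  destruct (Hmm m) as [m1 [m2 [m3 m4]]]; [lra|]. unfold Re, Im in m1, m2, m3, m4; simpl in m1, m2, m3, m4.
  destruct (HC x y ltac:(lra) ltac:(lra) (eps / 4)) as [d [Hd K]]; [lra|].
  exists (Rmin m (d / 2)). split. apply Rmin_pos; lra.
  intros [x' y'] Hw.
  assert (W1 := Rlt_le_trans _ _ _ Hw (Rmin_l _ _)).
  assert (W2 := Rlt_le_trans _ _ _ Hw (Rmin_r _ _)).
  assert (Ax := re_le_of_Cmod (x', y') (x, y)). assert (Ay := im_le_of_Cmod (x', y') (x, y)).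
  set (D := Cmod ((x', y') - (x, y))%C) in *.
  unfold Re, Im in Ax, Ay; simpl in Ax, Ay.
  assert (Bx := Ax). assert (By := Ay). apply Rabs_le_between in Bx. apply Rabs_le_between in By.
  assert (Nx : forall t, Rmin x x' <= t <= Rmax x x' -> x1 <= t <= x2 /\ Rabs (t - x) <= Rabs (x' - x)).
  { intros t. unfold Rmin, Rmax. repeat destruct Rle_dec; intros Ht; (split; [lra|]);
    unfold Rabs; repeat destruct Rcase_abs; lra. }
  assert (Ny : forall t, Rmin y y' <= t <= Rmax y y' -> y1 <= t <= y2 /\ Rabs (t - y) <= Rabs (y' - y)).
  { intros t. unfold Rmin, Rmax. repeat destruct Rle_dec; intros Ht; (split; [lra|]);
    unfold Rabs; repeat destruct Rcase_abs; lra. }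
  assert (E : (P (x', y') - P (x, y) - phi (x, y) * ((x', y') - (x, y)))%C =
    ((CI (fun t => phi (t, y)) x x' - phi (x, y) * (x' - x)) +
     Ci * (CI (fun t => phi (x', t)) y y' - phi (x, y) * (y' - y)))%C).
  { assert (E1 := StepH x x' y ltac:(lra) ltac:(lra) ltac:(lra)).
    assert (E2 := StepV x' y y' ltac:(lra) ltac:(lra) ltac:(lra)).
    replace (P (x', y') - P (x, y))%C with ((P (x', y) - P (x, y)) + (P (x', y') - P (x', y)))%C by ring.
    rewrite E1, E2.
    replace ((x', y') - (x, y))%C with ((x' - x) + Ci * (y' - y))%C
      by (apply C_ext; unfold Re, Im, Cmult, Cminus, Cplus, Copp, RtoC, Ci; simpl; ring).
    ring. }
  rewrite E. eapply Rle_trans. apply Cmod_triangle. rewrite Cmod_mult, Cmod_Ci.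
  assert (B1 : Cmod (CI (fun t => phi (t, y)) x x' - phi (x, y) * (x' - x))%C <= 2 * (eps / 4) * Rabs (x' - x)).
  { apply CI_near_const.
    - apply IH; try lra; unfold Rmin, Rmax; destruct Rle_dec; lra.
    - intros t Ht. destruct (Nx t Ht) as [T1 T2]. left. apply K. rewrite Cmod_horiz. lra. }
  assert (B2 : Cmod (CI (fun t => phi (x', t)) y y' - phi (x, y) * (y' - y))%C <= 2 * (eps / 4) * Rabs (y' - y)).
  { apply CI_near_const.
    - apply IV; try lra; unfold Rmin, Rmax; destruct Rle_dec; lra.
    - intros t Ht. destruct (Ny t Ht) as [T1 T2]. left. apply K.
      eapply Rle_lt_trans. apply (Cmod_le_of_box _ _ (Rabs (x' - x)) (Rabs (y' - y)));
        unfold Re, Im; simpl; apply Rabs_le_between; lra. lra. }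
  nra.
Qed.

(** [pr] stands for [Re] or [Im]. Along a segment the complex derivative becomes a real one, to
    which the constancy criterion for real functions applies. *)
Lemma cder_real_part (F : C -> C) (z v l : C) (t : R) (pr : C -> R) :
  (forall a b, pr (a - b)%C = pr a - pr b) -> (forall a, Rabs (pr a) <= Cmod a) ->
  (forall (s : R) a, pr (s * a)%C = s * pr a) ->
  cder F (z + t * v)%C l -> is_derive (fun s : R => pr (F (z + s * v)%C)) t (pr (l * v)%C).
Proof.
  intros Hm Hb Hs D. apply is_derive_Reals. intros eps Heps.
  set (V := Cmod v + 1). assert (HV : 0 < V) by (unfold V; generalize (Cmod_ge_0 v); lra).
  destruct (D (eps / (2 * V))) as [d [Hd H]]; [apply Rdiv_lt_0_compat; lra|].
  assert (Hdv : 0 < d / V) by (apply Rdiv_lt_0_compat; lra).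
  exists (mkposreal _ Hdv). intros h Hh0 Hh. simpl in Hh.
  assert (E : (z + RtoC (t + h)%R * v - (z + t * v))%C = (RtoC h * v)%C) by (rewrite RtoC_plus; ring).
  specialize (H (z + RtoC (t + h)%R * v)%C). rewrite E in H.
  rewrite Cmod_mult, Cmod_R in H.
  assert (Hvh : Rabs h * Cmod v <= Rabs h * V) by (apply Rmult_le_compat_l; [apply Rabs_pos|unfold V; lra]).
  assert (Hlt : Rabs h * V < d).
  { apply Rmult_lt_compat_r with (r := V) in Hh; [|exact HV].
    replace (d / V * V) with d in Hh by (field; lra). exact Hh. }
  specialize (H ltac:(lra)).
  replace ((pr (F (z + RtoC (t + h)%R * v)%C) - pr (F (z + t * v)%C)) / h - pr (l * v)%C)
    with (pr (F (z + RtoC (t + h)%R * v) - F (z + t * v) - l * (h * v))%C / h).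
  - unfold Rdiv. rewrite Rabs_mult, Rabs_inv.
    assert (Ph : 0 < Rabs h) by (apply Rabs_pos_lt, Hh0).
    apply Rmult_lt_reg_r with (Rabs h); [exact Ph|]. rewrite Rmult_assoc, Rinv_l, Rmult_1_r by lra.
    eapply Rle_lt_trans. apply Hb. eapply Rle_lt_trans. apply H.
    apply Rle_lt_trans with (eps / (2 * V) * (Rabs h * V)).
    + apply Rmult_le_compat_l; [|exact Hvh]. left. apply Rdiv_lt_0_compat; lra.
    + replace (eps / (2 * V) * (Rabs h * V)) with (eps * Rabs h / 2) by (field; lra). nra.
  - rewrite !Hm. replace (l * (h * v))%C with (h * (l * v))%C by ring. rewrite Hs. field. exact Hh0.
Qed.

Lemma zero_derivative_const (F : C -> C) (x1 x2 y1 y2 : R) (z w : C) :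
  (forall u, inside x1 x2 y1 y2 u -> cder F u 0) ->
  inside x1 x2 y1 y2 z -> inside x1 x2 y1 y2 w -> F z = F w.
Proof.
  intros HF Hz Hw.
  assert (Seg : forall t, 0 <= t <= 1 -> inside x1 x2 y1 y2 (z + t * (w - z))%C).
  { intros t Ht. destruct Hz as [Z1 Z2]. destruct Hw as [W1 W2].
    unfold inside. rewrite re_plus, im_plus, re_scal_l, im_scal_l, re_minus, im_minus.
    assert (forall p q a b, a < p < b -> a < q < b -> a < p + t * (q - p) < b).
    { intros p q a b Hp Hq. destruct (Req_dec t 0) as [->|N]; [lra|].
      assert (0 < t * (q - a)) by (apply Rmult_lt_0_compat; lra).
      assert (0 < t * (b - q)) by (apply Rmult_lt_0_compat; lra).
      assert (0 <= (1 - t) * (p - a)) by (apply Rmult_le_pos; lra).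
      assert (0 <= (1 - t) * (b - p)) by (apply Rmult_le_pos; lra). lra. }
    split; auto. }
  assert (E0 : (z + 0 * (w - z))%C = z) by ring. assert (E1 : (z + 1 * (w - z))%C = w) by ring.
  apply C_ext.
  - cut (Re (F (z + 0 * (w - z))%C) = Re (F (z + 1 * (w - z))%C)); [rewrite E0, E1; auto|].
    apply (eq_is_derive (fun s : R => Re (F (z + s * (w - z))%C)) 0 1); [|lra].
    intros t Ht.
    assert (Q := cder_real_part F z (w - z) 0 t Re (fun a b => eq_refl) re_le_Cmod re_scal_l (HF _ (Seg t Ht))).
    replace (Re (0 * (w - z))%C) with 0 in Q by (rewrite Cmult_0_l; reflexivity). exact Q.
  - cut (Im (F (z + 0 * (w - z))%C) = Im (F (z + 1 * (w - z))%C)); [rewrite E0, E1; auto|].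
    apply (eq_is_derive (fun s : R => Im (F (z + s * (w - z))%C)) 0 1); [|lra].
    intros t Ht.
    assert (Q := cder_real_part F z (w - z) 0 t Im (fun a b => eq_refl) im_le_Cmod im_scal_l (HF _ (Seg t Ht))).
    replace (Im (0 * (w - z))%C) with 0 in Q by (rewrite Cmult_0_l; reflexivity). exact Q.
Qed.

(** The logarithm is a primitive of [G' / G] vanishing at [z1]; then [G] divided by its exponential
    has derivative 0. The smaller radius [r'] leaves room around each point for the analyticity of
    [G']. *)
Lemma logarithm_exists (G : C -> C) (c z1 : C) (r r' : R) : r' < r ->
  (forall z, sq c r z -> holo G z /\ G z <> RtoC 0) -> sqi c r' z1 ->
  exists g : C -> C, g z1 = RtoC 0 /\
    forall z, sqi c r' z -> holo g z /\ G z = (G z1 * Cexp (g z))%C.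
Proof.
  intros Hr HG Hz1.
  set (G' := fun z => epsilon (inhabits (RtoC 0)) (fun l => cder G z l)).
  assert (HG' : forall z, sq c r z -> cder G z (G' z)).
  { intros z Hz. unfold G'. apply epsilon_spec. exact (proj1 (HG z Hz)). }
  set (phi := fun z => (G' z / G z)%C).
  assert (Hphi : forall z, sq c r' z -> holo phi z).
  { intros z Hz. assert (Hz' : sq c r z) by (apply (sq_le c r'); [lra|exact Hz]).
    apply holo_div; [|apply HG, Hz'|apply HG, Hz'].
    apply (holo_derivative G G' z (r - r')); [lra|]. intros w Hw. apply HG'.
    replace r with (r' + (r - r')) by ring. apply (sq_trans c z); [exact Hz|]. apply Cmod_sq. lra. }
  destruct (primitive_exists phi _ _ _ _ Hphi) as [P HP].
  fold (sqi c r') in HP.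
  exists (fun z => P z - P z1)%C. split; [ring|]. intros z Hz.
  assert (HD : forall u, sqi c r' u -> cder (fun z => P z - P z1)%C u (phi u)).
  { intros u Hu. assert (Q := cder_plus P (fun _ => - P z1)%C u _ _ (HP u Hu) (cder_const _ u)).
    replace (phi u) with (phi u + 0)%C by ring. exact Q. }
  split; [eexists; apply HD, Hz|].
  set (Q := fun u => (Cexp (- (P u - P z1)) * G u)%C).
  assert (EQ : Q z = Q z1).
  { apply (zero_derivative_const Q (Re c - r') (Re c + r') (Im c - r') (Im c + r')); [|exact Hz|exact Hz1].
    intros u Hu. assert (Hu' : sq c r u) by (apply (sq_le c r'); [lra|apply sqi_sq, Hu]).
    assert (D0 : cder (fun z => - (P z - P z1))%C u (- phi u)%C).
    { assert (T := cder_mult (fun _ => (- (1))%C) (fun z => P z - P z1)%C u _ _ (cder_const _ u) (HD u Hu)).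
      cbv beta in T.
      replace (- phi u)%C with (0 * (P u - P z1) + - (1) * phi u)%C by ring.
      apply (cder_ext_near (fun w => - (1) * (P w - P z1))%C); [|exact T].
      apply near_eq_refl. intros w. ring. }
    assert (D1 := cder_comp _ Cexp u _ _ D0 (cder_Cexp _)). cbv beta in D1.
    assert (D2 := cder_mult _ G u _ _ D1 (HG' u Hu')). cbv beta in D2.
    match type of D2 with cder _ _ ?l => replace (RtoC 0) with l end; [exact D2|].
    unfold phi. field. apply HG, Hu'. }
  assert (E1 : Q z1 = G z1).
  { unfold Q. replace (- (P z1 - P z1))%C with (RtoC 0) by ring. rewrite Cexp_0. ring. }
  rewrite <- E1, <- EQ. unfold Q.
  replace (Cexp (- (P z - P z1)) * G z * Cexp (P z - P z1))%C
    with ((Cexp (- (P z - P z1)) * Cexp (P z - P z1)) * G z)%C by ring.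
  rewrite <- Cexp_plus. replace (- (P z - P z1) + (P z - P z1))%C with (RtoC 0) by ring.
  rewrite Cexp_0. ring.
Qed.

(** * Zeros of bounded analytic functions *)

Lemma sqi_margin (c : C) (r : R) (a : C) : sqi c r a ->
  exists e, 0 < e /\ forall z, Cmod (z - a)%C < e -> sqi c r z.
Proof.
  intros [H1 H2].
  exists (Rmin (Rmin (Re a - (Re c - r)) (Re c + r - Re a)) (Rmin (Im a - (Im c - r)) (Im c + r - Im a))).
  split. repeat apply Rmin_pos; lra.
  intros z Hz. assert (K1 := re_le_of_Cmod z a). assert (K2 := im_le_of_Cmod z a).
  apply Rabs_le_between in K1. apply Rabs_le_between in K2.
  revert Hz. unfold Rmin. repeat destruct Rle_dec; intros; split; lra.
Qed.

(** Off [a] the quotient is formed literally, and at [a] Riemann's theorem supplies the value. Hence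
    the identity holds on the whole plane and only analyticity is tied to the square, so
    factorizations chain without side conditions. *)
Lemma divide_zero (F : C -> C) (c : C) (r : R) (a : C) : sqi c r a ->
  (forall z, sq c r z -> holo F z) -> F a = RtoC 0 ->
  exists G, (forall z, sq c r z -> holo G z) /\ forall z, F z = ((z - a) * G z)%C.
Proof.
  intros Ha HF H0. destruct (sqi_margin c r a Ha) as [e [He Hme]].
  destruct (Riemann_removable (fun z => (F z - F a) / (z - a))%C a e He) as [l Hl].
  - intros z Hz Hze. apply holo_div.
    + apply holo_minus; [apply HF, sqi_sq, Hme, Hze|apply holo_const].
    + apply holo_minus; [apply holo_id|apply holo_const].
    + apply Cminus_eq_contra, Hz.
  - apply bddnear_quotient, HF, sqi_sq, Ha.
  - exists (fun z => if Ceq_dec z a then l else ((F z - F a) / (z - a))%C). split.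
    + intros z Hz. destruct (Ceq_dec z a) as [->|N]; [exact Hl|].
      apply (holo_ext_near (fun z => (F z - F a) / (z - a))%C).
      * exists (Cmod (z - a)%C). split; [apply Cmod_neq0, Cminus_eq_contra, N|].
        intros w Hw. destruct (Ceq_dec w a) as [->|N']; [|reflexivity].
        rewrite Cmod_minus_sym in Hw. lra.
      * apply holo_div.
        { apply holo_minus; [apply HF, Hz|apply holo_const]. }
        { apply holo_minus; [apply holo_id|apply holo_const]. }
        apply Cminus_eq_contra, N.
    + intros z. destruct (Ceq_dec z a) as [->|N].
      * rewrite H0. ring.
      * rewrite H0. field. apply Cminus_eq_contra, N.
Qed.

(** On the boundary the divisor is at least [r - s]; the maximum principle carries the bound
    inside. *)
Lemma zero_quotient_bound (F G : C -> C) (c : C) (r s M : R) (a : C) : 0 < s < r -> sq c s a ->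
  (forall z, sq c r z -> holo G z) -> (forall z, F z = ((z - a) * G z)%C) ->
  (forall z, sqb c r z -> Cmod (F z) <= M) ->
  forall z, sq c r z -> Cmod (G z) <= M / (r - s).
Proof.
  intros Hs Ha HG HE HM z Hz.
  apply (maximum_principle G c r); try assumption; [lra|].
  intros w Hw. assert (D := sqb_dist c r s w a Hw Ha).
  assert (K := HM w Hw). rewrite HE, Cmod_mult in K.
  apply Rmult_le_reg_l with (r - s); [lra|].
  replace ((r - s) * (M / (r - s))) with M by (field; lra).
  eapply Rle_trans; [|exact K]. apply Rmult_le_compat_r. apply Cmod_ge_0. exact D.
Qed.

(* Borel-Caratheodory estimate for the logarithm of [G / G z1]. *)
Lemma zero_free_lower_bound (G : C -> C) (p : C) (s M m : R) (z1 z : C) : 0 < s -> 0 < m ->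
  (forall w, sq p s w -> holo G w /\ G w <> RtoC 0) ->
  (forall w, sq p s w -> Cmod (G w) <= M) ->
  sq p (s / 20) z1 -> m <= Cmod (G z1) -> sq p (s / 20) z -> m * m / (2 * M) <= Cmod (G z).
Proof.
  intros Hs Hm HG HM Hz1 Hm1 Hz.
  assert (Hsub : forall a b w, a <= b -> sq p a w -> sq p b w) by (intros; eapply sq_le; eassumption).
  destruct (logarithm_exists G p z1 s (95 / 100 * s)) as [h [h0 Hh]]; [lra|exact HG| |].
  { destruct Hz1. split; lra. }
  assert (K1 : Cmod (G z1) <= M) by (apply HM, (Hsub (s / 20)); [lra|exact Hz1]).
  assert (P1 : 0 < Cmod (G z1)) by lra. assert (PM : 0 < M) by lra.
  (* As [Cmod (G z1) <= M], the factor 2 makes [L] positive and the bound [Re (h w) < L] strict. *)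
  set (L := ln (2 * M / Cmod (G z1))).
  assert (Pq : 0 < 2 * M / Cmod (G z1)) by (apply Rdiv_lt_0_compat; lra).
  assert (EL : exp L = 2 * M / Cmod (G z1)) by (apply exp_ln, Pq).
  assert (HL : 0 < L).
  { apply exp_lt_inv. rewrite EL, exp_0. apply Rmult_lt_reg_r with (Cmod (G z1)); [exact P1|].
    unfold Rdiv. rewrite Rmult_assoc, Rinv_l by lra. lra. }
  assert (HRe : forall w, sqi p (95 / 100 * s) w -> Re (h w) < L).
  { intros w Hw. destruct (Hh w Hw) as [_ E]. apply exp_lt_inv. rewrite EL, <- Cmod_Cexp.
    assert (K : Cmod (G w) <= M) by (apply HM, (Hsub (95 / 100 * s)); [lra|apply sqi_sq, Hw]).
    rewrite E, Cmod_mult in K.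
    apply Rmult_lt_reg_l with (Cmod (G z1)); [exact P1|].
    replace (Cmod (G z1) * (2 * M / Cmod (G z1))) with (2 * M) by (field; lra). lra. }
  assert (Hin : forall w, sq p (9 / 10 * s) w -> sqi p (95 / 100 * s) w).
  { intros w [W1 W2]. split; lra. }
  assert (HN : forall w, sq p (9 / 10 * s) w -> (2 * L - h w)%C <> RtoC 0).
  { intros w Hw E. specialize (HRe w (Hin w Hw)).
    assert (E' : Re (2 * L - h w)%C = 0) by (rewrite E; reflexivity).
    rewrite re_minus, re_scal_l, re_RtoC in E'. lra. }
  (* This maps the half plane of real parts below [L] into the unit disc and 0 to 0, so that
     Schwarz's lemma applies at [z1]. *)
  set (phi := fun w => (h w / (2 * L - h w))%C).
  destruct (divide_zero phi p (9 / 10 * s) z1) as [phi1 [D1 E1]].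
  { destruct Hz1. split; lra. }
  { intros w Hw. apply holo_div; [apply Hh, Hin, Hw| |apply HN, Hw].
    apply holo_minus; [apply holo_const|apply Hh, Hin, Hw]. }
  { unfold phi. rewrite h0. unfold Cdiv. ring. }
  assert (Hphi : forall w, sq p (9 / 10 * s) w -> Cmod (phi w) <= 1).
  { intros w Hw. unfold phi. rewrite Cmod_div by (apply HN, Hw).
    assert (PP := Cmod_neq0 _ (HN w Hw)).
    apply Rmult_le_reg_r with (Cmod (2 * L - h w)%C); [exact PP|].
    unfold Rdiv. rewrite Rmult_assoc, Rinv_l, Rmult_1_l, Rmult_1_r by lra.
    apply Rsqr_incr_0; try apply Cmod_ge_0. unfold Rsqr.
    specialize (HRe w (Hin w Hw)).
    assert (Q1 := Cmod2_alt (h w)). assert (Q2 := Cmod2_alt (2 * L - h w)%C).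
    rewrite re_minus, im_minus, re_scal_l, im_scal_l, re_RtoC, im_RtoC in Q2. simpl in Q1, Q2. nra. }
  assert (B1 : Cmod (phi1 z) <= 1 / (9 / 10 * s - s / 20)).
  { apply (zero_quotient_bound phi phi1 p (9 / 10 * s) (s / 20) 1 z1); try assumption; try lra.
    - intros w Hw. apply Hphi, sqb_sq, Hw.
    - apply (Hsub (s / 20)); [lra|exact Hz]. }
  assert (Bz : Cmod (z - z1)%C <= s / 5).
  { destruct Hz, Hz1. replace (s / 5) with (s / 10 + s / 10) by field. apply Cmod_le_of_box; lra. }
  (* Schwarz: the points are at most [s / 5] apart and the square leaves room [17 / 20 * s], whence
     4/17. The bound 1/4 gives [3 * Cmod (h z) <= 2 * L]. *)
  assert (B2 : Cmod (phi z) <= 1 / 4).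
  { rewrite E1, Cmod_mult.
    apply Rle_trans with (s / 5 * (1 / (9 / 10 * s - s / 20))).
    - apply Rmult_le_compat; try apply Cmod_ge_0; assumption.
    - replace (s / 5 * (1 / (9 / 10 * s - s / 20))) with (4 / 17) by (field; lra). lra. }
  assert (Hz9 : sq p (9 / 10 * s) z) by (apply (Hsub (s / 20)); [lra|exact Hz]).
  assert (B3 : Cmod (h z) <= L).
  { unfold phi in B2. rewrite Cmod_div in B2 by (apply HN, Hz9).
    assert (PP := Cmod_neq0 _ (HN z Hz9)).
    apply Rmult_le_compat_r with (r := Cmod (2 * L - h z)%C) in B2; [|lra].
    unfold Rdiv in B2. rewrite Rmult_assoc, Rinv_l, Rmult_1_r in B2 by lra.
    assert (T := Cmod_triangle_minus (2 * L) (h z)).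
    rewrite Cmod_mult, !Cmod_R, !Rabs_pos_eq in T by lra. lra. }
  destruct (Hh z (Hin z Hz9)) as [_ E]. rewrite E, Cmod_mult, Cmod_Cexp.
  assert (B4 := re_le_Cmod (h z)). apply Rabs_le_between in B4.
  assert (B5 : exp (- L) <= exp (Re (h z))) by (apply Rnot_lt_le; intros K; apply exp_lt_inv in K; lra).
  rewrite exp_Ropp, EL in B5.
  apply Rle_trans with (Cmod (G z1) * / (2 * M / Cmod (G z1))).
  - replace (Cmod (G z1) * / (2 * M / Cmod (G z1))) with (Cmod (G z1) * Cmod (G z1) / (2 * M)) by (field; lra).
    apply Rmult_le_compat_r. left. apply Rinv_0_lt_compat. lra. nra.
  - apply Rmult_le_compat_l; lra.
Qed.

(** A list carries multiplicity by repetition, so zeros are divided out one at a time and orders of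
    vanishing need no definition. *)
Fixpoint W (A : list C) (z : C) : C :=
  match A with nil => RtoC 1 | a :: A' => ((z - a) * W A' z)%C end.

Fixpoint prodl (Phi : C -> C) (A : list C) : C :=
  match A with nil => RtoC 1 | a :: A' => (Phi a * prodl Phi A')%C end.

Lemma holo_W (A : list C) (z : C) : holo (W A) z.
Proof.
  induction A as [|a A IH]; simpl; [apply holo_const|].
  apply (holo_mult (fun z => z - a)%C (W A)); [|exact IH].
  apply holo_minus; [apply holo_id|apply holo_const].
Qed.

Lemma W_app (A B : list C) (z : C) : W (A ++ B) z = (W A z * W B z)%C.
Proof. induction A as [|a A IH]; simpl; [ring|]. rewrite IH. ring. Qed.

Lemma prodl_app (Phi : C -> C) (A B : list C) : prodl Phi (A ++ B) = (prodl Phi A * prodl Phi B)%C.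
Proof. induction A as [|a A IH]; simpl; [ring|]. rewrite IH. ring. Qed.

Lemma W_eq_0 (A : list C) (z : C) : W A z = RtoC 0 -> In z A.
Proof.
  induction A as [|a A IH]; simpl; intros H.
  - exfalso. apply C1_nz, H.
  - destruct (Ceq_dec z a) as [->|N]; [left; reflexivity|right]. apply IH.
    apply NNPP. intros K. apply (Cmult_neq_0 (z - a) (W A z)); try assumption.
    apply Cminus_eq_contra, N.
Qed.

Lemma W_root (A : list C) (z : C) : In z A -> W A z = RtoC 0.
Proof.
  induction A as [|a A IH]; simpl; [tauto|]. intros [->|H]; [ring|]. rewrite IH by exact H. ring.
Qed.

Lemma prodl_1 (Phi : C -> C) (A : list C) : (forall a, In a A -> Phi a = RtoC 1) -> prodl Phi A = RtoC 1.
Proof.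
  induction A as [|a A IH]; simpl; intros H; [reflexivity|].
  rewrite H by (left; reflexivity). rewrite IH by (intros b Hb; apply H; right; exact Hb). ring.
Qed.

Lemma ccont_eq_limit (F G : C -> C) (a : C) : ccont F a -> ccont G a ->
  (forall z, z <> a -> F z = G z) -> F a = G a.
Proof.
  intros CF CG H. apply NNPP. intros N.
  assert (P := Cmod_neq0 _ (Cminus_eq_contra _ _ N)). set (k := Cmod (F a - G a)%C) in *.
  destruct (CF (k / 4)) as [d1 [Hd1 H1]]; [lra|]. destruct (CG (k / 4)) as [d2 [Hd2 H2]]; [lra|].
  set (h := Rmin d1 d2 / 2). assert (Hh : 0 < h) by (unfold h; assert (0 < Rmin d1 d2) by (apply Rmin_pos; assumption); lra).
  assert (Hh1 : h < d1) by (unfold h in *; assert (Rmin d1 d2 <= d1) by apply Rmin_l; lra).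
  assert (Hh2 : h < d2) by (unfold h in *; assert (Rmin d1 d2 <= d2) by apply Rmin_r; lra).
  assert (E : Cmod ((a + h) - a)%C = h).
  { replace ((a + h) - a)%C with (RtoC h) by ring. rewrite Cmod_R. apply Rabs_pos_eq. lra. }
  assert (Na : (a + h)%C <> a).
  { intros K. rewrite K in E. rewrite Cmod_diag in E. lra. }
  specialize (H1 (a + h)%C). specialize (H2 (a + h)%C). rewrite E in H1, H2.
  specialize (H1 Hh1). specialize (H2 Hh2). rewrite (H _ Na) in H1.
  assert (T : k <= k / 4 + k / 4).
  { unfold k at 1. replace (F a - G a)%C with ((G (a + h) - G a) - (G (a + h) - F a))%C by ring.
    eapply Rle_trans. apply Cmod_triangle_minus. lra. }
  lra.
Qed.

(** Within [X] the roots are those of the common function, with multiplicity, since [G] and [H] have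
    no zeros there; roots outside [X] contribute the factor 1. So a product over a zero list does
    not depend on how the list was found. *)
Lemma factorization_unique (Phi : C -> C) (X : C -> Prop) (A : list C) :
  forall (B : list C) (G H : C -> C),
  (forall z, ~ X z -> Phi z = RtoC 1) ->
  (forall z, X z -> ccont G z /\ G z <> RtoC 0) -> (forall z, X z -> ccont H z /\ H z <> RtoC 0) ->
  (forall z, (W A z * G z)%C = (W B z * H z)%C) -> prodl Phi A = prodl Phi B.
Proof.
  induction A as [|a A IH]; intros B G H HPhi HG HH HE.
  - simpl. symmetry. apply prodl_1. intros b Hb. apply HPhi. intros Xb.
    specialize (HE b). rewrite (W_root B b Hb) in HE. simpl in HE.
    destruct (HG b Xb) as [_ N]. apply N. replace (G b) with (1 * G b)%C by ring. rewrite HE. ring.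
  - destruct (classic (X a)) as [Xa|Xa].
    + assert (Ia : In a B).
      { apply W_eq_0. apply NNPP. intros N. destruct (HH a Xa) as [_ NH].
        apply (Cmult_neq_0 _ _ N NH). rewrite <- HE. simpl. ring. }
      destruct (in_split a B Ia) as [B1 [B2 ->]].
      assert (HE2 : forall z, ((z - a) * (W A z * G z))%C = ((z - a) * (W (B1 ++ B2) z * H z))%C).
      { intros z. specialize (HE z). rewrite W_app in *. simpl in HE.
        transitivity ((z - a) * W A z * G z)%C; [ring|]. rewrite HE. ring. }
      rewrite prodl_app. simpl.
      rewrite (IH (B1 ++ B2) G H HPhi HG HH).
      { rewrite prodl_app. ring. }
      assert (NE : forall z, z <> a -> (W A z * G z)%C = (W (B1 ++ B2) z * H z)%C).
      { intros z Hz. assert (N := Cminus_eq_contra _ _ Hz).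
        transitivity (/ (z - a) * ((z - a) * (W A z * G z)))%C; [field; exact N|].
        rewrite HE2. field. exact N. }
      (* At [a] itself the cancelled identity follows by continuity. *)
      intros z. destruct (Ceq_dec z a) as [->|N]; [|apply NE, N].
      apply (ccont_eq_limit (fun z => W A z * G z)%C (fun z => W (B1 ++ B2) z * H z)%C a).
      * apply ccont_mult. apply holo_ccont, holo_W. apply HG, Xa.
      * apply ccont_mult. apply holo_ccont, holo_W. apply HH, Xa.
      * exact NE.
    (* A root outside [X] is moved into [G], which stays free of zeros on [X]. *)
    + simpl. rewrite (HPhi a Xa), (IH B (fun z => (z - a) * G z)%C H HPhi).
      * ring.
      * intros z Xz. destruct (HG z Xz) as [C1 N1]. split.
        { apply (ccont_mult (fun z => z - a)%C G); [|exact C1].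
          apply holo_ccont, holo_minus; [apply holo_id|apply holo_const]. }
        apply Cmult_neq_0; [|exact N1]. apply Cminus_eq_contra. intros E. apply Xa. rewrite <- E. exact Xz.
      * exact HH.
      * intros z. rewrite <- HE. simpl. ring.
Qed.

(** * Uniform bounds for zeros *)

(** A quantitative way of not being close to 0, in place of compactness: the constants derived from
    it depend on [r], [M] and [m] only. The radius [16 * r] leaves room [12 * r] when a zero within
    [4 * r] is divided out. *)
Definition nondegenerate (r M : R) (m : R -> R) (c : C) (F : C -> C) : Prop :=
  (forall z, sq c (16 * r) z -> holo F z /\ Cmod (F z) <= M) /\
  (forall p s, sq c (4 * r) p -> 0 < s <= r -> exists z, sq p s z /\ m s <= Cmod (F z)).

Lemma nondegenerate_divide (r M : R) (m : R -> R) (c : C) (F G : C -> C) (a : C) : 0 < r ->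
  nondegenerate r M m c F -> sq c (4 * r) a -> (forall z, F z = ((z - a) * G z)%C) ->
  (forall z, sq c (16 * r) z -> holo G z) ->
  nondegenerate r (M / (12 * r)) (fun s => m s / (18 * r)) c G.
Proof.
  intros Hr [HF HN] Ha HE HG. split.
  - intros z Hz. split; [apply HG, Hz|].
    replace (12 * r) with (16 * r - 4 * r) by ring.
    apply (zero_quotient_bound F G c (16 * r) (4 * r) M a); try assumption; [lra|].
    intros w Hw. apply HF, sqb_sq, Hw.
  - intros p s Hp Hs. destruct (HN p s Hp Hs) as [z [Hz Hm]]. exists z. split; [exact Hz|].
    rewrite HE, Cmod_mult in Hm.
    (* [z] lies within [5 * r] of [c] and [a] within [4 * r], so each coordinate differs by at most
       [9 * r]. *)
    assert (D : Cmod (z - a)%C <= 18 * r).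
    { destruct Hz, Hp, Ha. replace (18 * r) with (9 * r + 9 * r) by ring. apply Cmod_le_of_box; lra. }
    apply Rmult_le_reg_l with (18 * r); [lra|].
    replace (18 * r * (m s / (18 * r))) with (m s) by (field; lra).
    eapply Rle_trans; [exact Hm|]. apply Rmult_le_compat_r; [apply Cmod_ge_0|exact D].
Qed.

Lemma nondegenerate_ext (r M : R) (m : R -> R) (c : C) (F G : C -> C) :
  (forall z, F z = G z) -> nondegenerate r M m c F -> nondegenerate r M m c G.
Proof.
  intros E [HF HN]. split.
  - intros z Hz. rewrite <- E. split; [apply (holo_ext F); [exact E|]|]; apply HF, Hz.
  - intros p s Hp Hs. destruct (HN p s Hp Hs) as [z [Hz Hm]]. exists z. rewrite <- E. auto.
Qed.

Lemma nondegenerate_divide_list (r : R) (c : C) (A : list C) : 0 < r ->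
  forall (M : R) (m : R -> R) (F G : C -> C),
  nondegenerate r M m c F -> (forall a, In a A -> sq c (4 * r) a) ->
  (forall z, F z = (W A z * G z)%C) -> (forall z, sq c (16 * r) z -> holo G z) ->
  nondegenerate r (M / (12 * r) ^ length A) (fun s => m s / (18 * r) ^ length A) c G.
Proof.
  intros Hr. induction A as [|a A IH]; intros M m F G HF HA HE HG; simpl.
  - assert (K : nondegenerate r M m c G).
    { apply (nondegenerate_ext r M m c F); [|exact HF]. intros z. rewrite HE. simpl. ring. }
    destruct K as [K1 K2]. split.
    + intros z Hz. replace (M / 1) with M by field. apply K1, Hz.
    + intros p s Hp Hs. replace (m s / 1) with (m s) by field. apply K2; assumption.
  - assert (K : nondegenerate r (M / (12 * r)) (fun s => m s / (18 * r)) c (fun z => W A z * G z)%C).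
    { apply (nondegenerate_divide r M m c F _ a); try assumption.
      - apply HA. left. reflexivity.
      - intros z. rewrite HE. simpl. ring.
      - intros z Hz. apply holo_mult; [apply holo_W|apply HG, Hz]. }
    specialize (IH _ _ _ G K (fun b Hb => HA b (or_intror Hb)) (fun z => eq_refl) HG).
    destruct IH as [I1 I2].
    assert (P1 : 0 < (12 * r) ^ length A) by (apply pow_lt; lra).
    assert (P2 : 0 < (18 * r) ^ length A) by (apply pow_lt; lra).
    split.
    + intros z Hz. replace (M / (12 * r * (12 * r) ^ length A)) with (M / (12 * r) / (12 * r) ^ length A)
        by (field; split; lra). apply I1, Hz.
    + intros p s Hp Hs. replace (m s / (18 * r * (18 * r) ^ length A)) with (m s / (18 * r) / (18 * r) ^ length A)
        by (field; split; lra). apply I2; assumption.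
Qed.

(** Non-degeneracy at scale [s / 20] supplies the point [z1] from which [zero_free_lower_bound]
    starts. *)
Lemma zero_free_uniform_bound (r M : R) (m : R -> R) (c : C) (F : C -> C) (p : C) (s : R) :
  0 < s <= r -> 0 < m (s / 20) -> nondegenerate r M m c F -> sq c (4 * r) p ->
  (forall z, sq p s z -> F z <> RtoC 0) ->
  m (s / 20) * m (s / 20) / (2 * M) <= Cmod (F p).
Proof.
  intros Hs Hm [HF HN] Hp H0.
  destruct (HN p (s / 20) Hp ltac:(lra)) as [z1 [Hz1 Hm1]].
  assert (Hin : forall z, sq p s z -> sq c (16 * r) z).
  { intros z Hz. apply (sq_le c (4 * r + s)); [lra|]. apply (sq_trans c p); assumption. }
  apply (zero_free_lower_bound F p s M (m (s / 20)) z1 p); try assumption; try lra.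
  - intros w Hw. split; [apply HF, Hin, Hw|apply H0, Hw].
  - intros w Hw. apply HF, Hin, Hw.
  - apply sq_center. lra.
Qed.

Lemma finite_pos_min (f : nat -> R) (N : nat) : (forall k, 0 < f k) ->
  exists l, 0 < l /\ forall k, (k <= N)%nat -> l <= f k.
Proof.
  intros H. induction N as [|N [l [Hl K]]].
  - exists (f 0%nat). split; [apply H|]. intros k Hk. replace k with 0%nat by lia. lra.
  - exists (Rmin l (f (S N))). split; [apply Rmin_pos; [exact Hl|apply H]|].
    intros k Hk. destruct (Nat.eq_dec k (S N)) as [->|N']; [apply Rmin_r|].
    eapply Rle_trans; [apply Rmin_l|]. apply K. lia.
Qed.

(** A substitute for Jensen's formula: dividing out a zero lowers the bound on the boundary by the
    factor [13 * r], while at [z1] the linear factor is at most [8 * r]. Each zero therefore costs a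
    factor 8/13. *)
Lemma zero_count (r M : R) (m : R -> R) (c : C) (F G : C -> C) (A : list C) : 0 < r ->
  nondegenerate r M m c F -> (forall a, In a A -> sq c (3 * r) a) ->
  (forall z, F z = (W A z * G z)%C) -> (forall z, sq c (16 * r) z -> holo G z) ->
  m r <= M * (8 / 13) ^ length A.
Proof.
  intros Hr [HF HN] HA HE HG.
  destruct (HN c r) as [z1 [Hz1 Hm]]; [apply sq_center; lra|lra|].
  eapply Rle_trans; [exact Hm|]. clear Hm HN.
  assert (HF' : forall z, sqb c (16 * r) z -> Cmod (F z) <= M) by (intros z Hz; apply HF, sqb_sq, Hz).
  clear HF. revert M F HE HF'. induction A as [|a A IH]; intros M F HE HF'.
  - simpl. rewrite Rmult_1_r. apply (maximum_principle F c (16 * r)); [lra| |exact HF'|].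
    + intros w Hw. apply (holo_ext G); [|apply HG, Hw]. intros u. rewrite HE. simpl. ring.
    + apply (sq_le c r); [lra|exact Hz1].
  - rewrite HE. simpl. rewrite <- Cmult_assoc, Cmod_mult.
    assert (D : Cmod (z1 - a)%C <= 8 * r).
    { destruct Hz1. destruct (HA a (or_introl eq_refl)).
      replace (8 * r) with (4 * r + 4 * r) by ring. apply Cmod_le_of_box; lra. }
    assert (K : Cmod (W A z1 * G z1)%C <= M / (13 * r) * (8 / 13) ^ length A).
    { apply (IH (fun b Hb => HA b (or_intror Hb)) (M / (13 * r)) (fun z => W A z * G z)%C); [reflexivity|].
      intros w Hw. replace (13 * r) with (16 * r - 3 * r) by ring.
      apply (zero_quotient_bound F (fun z => W A z * G z)%C c (16 * r) (3 * r) M a); try assumption.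
      - lra.
      - apply HA. left. reflexivity.
      - intros u Hu. apply holo_mult; [apply holo_W|apply HG, Hu].
      - intros u. rewrite HE. simpl. ring.
      - apply sqb_sq, Hw. }
    apply Rle_trans with (8 * r * (M / (13 * r) * (8 / 13) ^ length A)).
    + apply Rmult_le_compat; try apply Cmod_ge_0; assumption.
    + right. field. lra.
Qed.

(** Zeros are divided out until none is left within [3 * r]; [zero_count] allows at most [N] of
    them. The lower bound uses a zero-free square of radius [r / 2] around each point, hence the
    smaller radius [5 / 2 * r]. *)
Theorem zero_list (r M : R) (m : R -> R) : 0 < r -> 0 < M -> (forall s, 0 < s -> 0 < m s) ->
  exists (N : nat) (l : R), 0 < l /\ forall c F, nondegenerate r M m c F ->
    exists A G, (length A <= N)%nat /\ (forall a, In a A -> sq c (3 * r) a) /\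
      (forall z, F z = (W A z * G z)%C) /\ (forall z, sq c (16 * r) z -> holo G z) /\
      (forall z, sq c (3 * r) z -> G z <> RtoC 0) /\
      (forall z, sq c (5 / 2 * r) z -> l <= Cmod (G z)).
Proof.
  intros Hr HM Hm.
  destruct (pow_lt_1_zero (8 / 13)) with (y := m r / M) as [N HN].
  { rewrite Rabs_pos_eq; lra. }
  { apply Rdiv_lt_0_compat; [apply Hm|]; lra. }
  destruct (finite_pos_min (fun k => m (r / 2 / 20) / (18 * r) ^ k * (m (r / 2 / 20) / (18 * r) ^ k) /
     (2 * (M / (12 * r) ^ k))) N) as [l [Hl HlN]].
  { intros k. assert (0 < m (r / 2 / 20)) by (apply Hm; lra).
    assert (0 < (12 * r) ^ k) by (apply pow_lt; lra). assert (0 < (18 * r) ^ k) by (apply pow_lt; lra).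
    assert (0 < m (r / 2 / 20) / (18 * r) ^ k) by (apply Rdiv_lt_0_compat; lra).
    assert (0 < M / (12 * r) ^ k) by (apply Rdiv_lt_0_compat; lra).
    apply Rdiv_lt_0_compat; [apply Rmult_lt_0_compat|]; lra. }
  exists N, l. split; [exact Hl|]. intros c F HF.
  (* After [n] rounds either no zero is left or [n] zeros have been removed; [n = S N] excludes the
     second. *)
  assert (Step : forall n, exists A G, (forall a, In a A -> sq c (3 * r) a) /\
      (forall z, F z = (W A z * G z)%C) /\ (forall z, sq c (16 * r) z -> holo G z) /\
      ((forall z, sq c (3 * r) z -> G z <> RtoC 0) \/ length A = n)).
  { induction n as [|n [A [G [H1 [H2 [H3 [H4|H4]]]]]]].
    - exists nil, F. split; [|split; [|split]].
      + intros a [].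
      + intros z. simpl. ring.
      + intros z Hz. apply HF, Hz.
      + right. reflexivity.
    - exists A, G. auto.
    - destruct (classic (forall z, sq c (3 * r) z -> G z <> RtoC 0)) as [K|K].
      + exists A, G. auto.
      + apply not_all_ex_not in K. destruct K as [a K]. apply imply_to_and in K. destruct K as [Ha K].
        apply NNPP in K.
        destruct (divide_zero G c (16 * r) a) as [G' [D E]]; try assumption.
        { destruct Ha. split; lra. }
        exists (a :: A), G'. split; [|split; [|split]].
        * intros b [<-|Hb]; [exact Ha|apply H1, Hb].
        * intros z. rewrite H2, E. simpl. ring.
        * exact D.
        * right. simpl. rewrite H4. reflexivity. }
  destruct (Step (S N)) as [A [G [H1 [H2 [H3 H4]]]]].
  assert (HA : (length A <= N)%nat).
  { apply Nat.nlt_ge. intros L.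
    assert (Z := zero_count r M m c F G A Hr HF H1 H2 H3).
    specialize (HN (length A) ltac:(lia)). rewrite Rabs_pos_eq in HN by (apply pow_le; lra).
    apply Rmult_lt_compat_l with (r := M) in HN; [|exact HM].
    replace (M * (m r / M)) with (m r) in HN by (field; lra). lra. }
  destruct H4 as [H4|H4]; [|lia].
  exists A, G. split; [exact HA|split; [exact H1|split; [exact H2|split; [exact H3|split; [exact H4|]]]]].
  intros z Hz.
  assert (ND := nondegenerate_divide_list r c A Hr M m F G HF
    (fun a Ha => sq_le c (3 * r) (4 * r) a ltac:(lra) (H1 a Ha)) H2 H3).
  eapply Rle_trans; [apply (HlN (length A) HA)|].
  refine (zero_free_uniform_bound r (M / (12 * r) ^ length A) _ c G z (r / 2) _ _ ND _ _).
  - lra.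
  - apply Rdiv_lt_0_compat; [apply Hm; lra|apply pow_lt; lra].
  - apply (sq_le c (5 / 2 * r)); [lra|exact Hz].
  - intros w Hw. apply H4. replace (3 * r) with (5 / 2 * r + r / 2) by field. apply (sq_trans c z); assumption.
Qed.

(** Hurwitz's theorem with constants. At a zero [a] of [F] the value of [F'] lies below its
    zero-free lower bound, so [F'] has a zero [a'] nearby. The quotients by [z - a] and [z - a'] are
    again close, and the induction continues with them. *)
Theorem zero_matching (k : nat) (r : R) : 0 < r -> forall (M : R) (m : R -> R) (s : R), 0 < M ->
  (forall t, 0 < t -> 0 < m t) -> 0 < s ->
  exists eps, 0 < eps /\ forall c A F F' G, length A = k -> (forall a, In a A -> sq c (3 * r) a) ->
    (forall z, F z = (W A z * G z)%C) -> (forall z, sq c (16 * r) z -> holo G z) ->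
    nondegenerate r M m c F' -> (forall z, sq c (16 * r) z -> Cmod (F z - F' z)%C <= eps) ->
    exists A' G', (forall z, F' z = (W A' z * G' z)%C) /\ (forall z, sq c (16 * r) z -> holo G' z) /\
      (forall z, sq c (16 * r) z -> Cmod (G z - G' z)%C <= s) /\
      Forall2 (fun a a' => Cmod (a - a')%C <= s) A A'.
Proof.
  intros Hr. induction k as [|k IH]; intros M m s HM Hm Hs.
  - exists s. split; [exact Hs|]. intros c A F F' G HA _ HE HG HF' Hd.
    destruct A; [|discriminate]. exists nil, F'. split; [|split; [|split]].
    + intros z. simpl. ring.
    + intros z Hz. apply HF', Hz.
    + intros z Hz. replace (G z) with (F z) by (rewrite HE; simpl; ring). apply Hd, Hz.
    + constructor.
  - destruct (IH (M / (12 * r)) (fun t => m t / (18 * r)) s) as [e1 [He1 K]]; try assumption.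
    { apply Rdiv_lt_0_compat; lra. }
    { intros t Ht. apply Rdiv_lt_0_compat; [apply Hm, Ht|lra]. }
    (* The last entry absorbs the term [F' w * (a - a')] in the comparison of the quotients, where
       both divisors are at least [12 * r]. *)
    set (s1 := Rmin (Rmin (s / 2) r) (e1 * (144 * r * r) / (4 * M))).
    assert (Hs1 : 0 < s1).
    { repeat apply Rmin_pos; try lra. apply Rdiv_lt_0_compat; [|lra]. repeat apply Rmult_lt_0_compat; lra. }
    assert (S1 : s1 <= s / 2) by (eapply Rle_trans; [apply Rmin_l|apply Rmin_l]).
    assert (S2 : s1 <= r) by (eapply Rle_trans; [apply Rmin_l|apply Rmin_r]).
    assert (S3 : s1 <= e1 * (144 * r * r) / (4 * M)) by apply Rmin_r.
    assert (Pm : 0 < m (s1 / 20)) by (apply Hm; lra).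
    set (l := m (s1 / 20) * m (s1 / 20) / (2 * M)).
    assert (Hl : 0 < l) by (apply Rdiv_lt_0_compat; nra).
    (* [l / 2] forces the zero [a']; [6 * r * e1] makes the remaining term of the comparison at most
       [e1 / 2]. *)
    exists (Rmin (l / 2) (6 * r * e1)). split.
    { apply Rmin_pos; [lra|]. repeat apply Rmult_lt_0_compat; lra. }
    intros c A F F' G HA HAin HE HG HF' Hd. destruct A as [|a A]; [discriminate|].
    injection HA as HA.
    assert (Ha : sq c (3 * r) a) by (apply HAin; left; reflexivity).
    assert (Ha16 : sq c (16 * r) a) by (apply (sq_le c (3 * r)); [lra|exact Ha]).
    assert (Fa : F a = RtoC 0) by (rewrite HE; simpl; ring).
    assert (Ez : exists a', sq a s1 a' /\ F' a' = RtoC 0).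
    { apply NNPP. intros N.
      assert (L : l <= Cmod (F' a)).
      { apply (zero_free_uniform_bound r M m c F' a s1); try assumption; try lra.
        - apply (sq_le c (3 * r)); [lra|exact Ha].
        - intros z Hz E. apply N. exists z. split; assumption. }
      specialize (Hd a Ha16). rewrite Fa in Hd.
      replace (0 - F' a)%C with (- F' a)%C in Hd by ring. rewrite Cmod_opp in Hd.
      assert (Rmin (l / 2) (6 * r * e1) <= l / 2) by apply Rmin_l. lra. }
    destruct Ez as [a' [Ha' Fa']].
    assert (Ha4 : sq c (4 * r) a').
    { apply (sq_le c (3 * r + s1)); [lra|]. apply (sq_trans c a); assumption. }
    destruct (divide_zero F' c (16 * r) a') as [F1' [D1 E1]]; try assumption.
    { destruct Ha4. split; lra. }
    { intros z Hz. apply HF', Hz. }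
    assert (D1' : forall z, sq c (16 * r) z -> holo (fun z => W A z * G z)%C z).
    { intros z Hz. apply holo_mult; [apply holo_W|apply HG, Hz]. }
    destruct (K c A (fun z => W A z * G z)%C F1' G HA) as [A' [G' [Q1 [Q2 [Q3 Q4]]]]].
    + intros b Hb. apply HAin. right. exact Hb.
    + reflexivity.
    + exact HG.
    + apply (nondegenerate_divide r M m c F' F1' a'); assumption.
    + intros z Hz.
      apply (maximum_principle (fun z => W A z * G z - F1' z)%C c (16 * r)); [lra| | |exact Hz].
      { intros w Hw. apply holo_minus; [apply D1', Hw|apply D1, Hw]. }
      intros w Hw.
      assert (DA := sqb_dist c (16 * r) (3 * r) w a Hw Ha).
      assert (DA' := sqb_dist c (16 * r) (4 * r) w a' Hw Ha4).
      assert (N : (w - a)%C <> RtoC 0) by (apply Cmod_gt_0; lra).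
      assert (N' : (w - a')%C <> RtoC 0) by (apply Cmod_gt_0; lra).
      assert (EF : F w = ((w - a) * (W A w * G w))%C) by (rewrite HE; simpl; ring).
      assert (E : (W A w * G w - F1' w)%C = ((F w - F' w) / (w - a) + F' w * (a - a') / ((w - a) * (w - a')))%C).
      { rewrite EF, (E1 w). field. auto. }
      rewrite E. eapply Rle_trans. apply Cmod_triangle.
      rewrite !Cmod_div, !Cmod_mult by (try apply Cmult_neq_0; assumption).
      specialize (Hd w (sqb_sq _ _ _ Hw)).
      assert (Hdd : Cmod (F w - F' w)%C <= 6 * r * e1) by (eapply Rle_trans; [exact Hd|apply Rmin_r]).
      assert (BF : Cmod (F' w) <= M) by (apply HF', sqb_sq, Hw).
      assert (Da : Cmod (a - a')%C <= 2 * s1) by (rewrite Cmod_minus_sym; apply sq_Cmod, Ha').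
      assert (T1 : Cmod (F w - F' w)%C / Cmod (w - a)%C <= e1 / 2).
      { apply Rle_trans with (6 * r * e1 * / (12 * r)).
        - apply Rmult_le_compat; try assumption. apply Cmod_ge_0.
          left; apply Rinv_0_lt_compat; lra. apply Rinv_le_contravar; lra.
        - right. field. lra. }
      assert (T2 : Cmod (F' w) * Cmod (a - a')%C / (Cmod (w - a)%C * Cmod (w - a')%C) <= e1 / 2).
      { apply Rle_trans with (M * (2 * (e1 * (144 * r * r) / (4 * M))) * / (12 * r * (12 * r))).
        - apply Rmult_le_compat.
          + apply Rmult_le_pos; apply Cmod_ge_0.
          + left. apply Rinv_0_lt_compat. apply Rmult_lt_0_compat; lra.
          + apply Rmult_le_compat; try apply Cmod_ge_0; [exact BF|lra].
          + apply Rinv_le_contravar. apply Rmult_lt_0_compat; lra. apply Rmult_le_compat; lra.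
        - right. field. lra. }
      lra.
    + exists (a' :: A'), G'. split; [|split; [|split]].
      * intros z. rewrite E1, Q1. simpl. ring.
      * exact Q2.
      * exact Q3.
      * constructor; [|exact Q4]. rewrite Cmod_minus_sym.
        eapply Rle_trans; [apply sq_Cmod, Ha'|lra].
Qed.

(** Schwarz's lemma iterated. Dividing [F - F p] by [z - p] lowers the bound on the large square by
    the factor [4 * r], and multiplying back costs at most [3 * r]: a net gain of 3/4 per step. The
    price is a constant [A] that grows with [K]. *)
Theorem quantitative_uniqueness (K : nat) : exists A, 0 < A /\ forall (F : C -> C) (p : C) (r M mu : R), 0 < r ->
  (forall z, sq p (8 * r) z -> holo F z /\ Cmod (F z) <= M) -> (forall z, sq p r z -> Cmod (F z) <= mu) ->
  forall z, sq p (3 / 2 * r) z -> Cmod (F z) <= A * mu + M * (3 / 4) ^ K.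
Proof.
  induction K as [|K [A [HA IH]]].
  - exists 1. split; [lra|]. intros F p r M mu Hr HF Hmu z Hz.
    assert (0 <= mu) by (eapply Rle_trans; [apply (Cmod_ge_0 (F p))|apply Hmu, sq_center; lra]).
    destruct (HF z) as [_ B]; [apply (sq_le p (3 / 2 * r)); [lra|exact Hz]|]. simpl. lra.
  - exists (1 + 6 * A). split; [lra|]. intros F p r M mu Hr HF Hmu z Hz.
    assert (Pp : Cmod (F p) <= mu) by (apply Hmu, sq_center; lra).
    assert (PM : Cmod (F p) <= M) by (apply HF, sq_center; lra).
    destruct (divide_zero (fun z => F z - F p)%C p (8 * r) p) as [G [D E]].
    { split; lra. }
    { intros w Hw. apply holo_minus; [apply HF, Hw|apply holo_const]. }
    { ring. }
    assert (EG : forall s w, 0 < s -> sqb p s w -> s <= Cmod (w - p)%C).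
    { intros s w Hs Hw. assert (T := sqb_dist p s 0 w p Hw (sq_center p 0 (Rle_refl 0))). lra. }
    assert (BG : forall s B, 0 < s <= 8 * r -> (forall w, sqb p s w -> Cmod (F w) <= B) -> Cmod (F p) <= B ->
      forall w, sq p s w -> Cmod (G w) <= 2 * B / s).
    { intros s B Hs HB HBp w Hw.
      apply (maximum_principle G p s); [lra| | |exact Hw].
      { intros u Hu. apply D, (sq_le p s); [lra|exact Hu]. }
      intros u Hu. specialize (EG s u ltac:(lra) Hu). specialize (HB u Hu).
      assert (T : Cmod (u - p)%C * Cmod (G u) <= 2 * B).
      { rewrite <- Cmod_mult, <- E. eapply Rle_trans. apply Cmod_triangle_minus. lra. }
      apply Rmult_le_reg_l with s; [lra|]. replace (s * (2 * B / s)) with (2 * B) by (field; lra).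
      eapply Rle_trans; [|exact T]. apply Rmult_le_compat_r; [apply Cmod_ge_0|exact EG]. }
    assert (B1 := IH G p r (2 * M / (8 * r)) (2 * mu / r) Hr).
    assert (B2 : Cmod (G z) <= A * (2 * mu / r) + 2 * M / (8 * r) * (3 / 4) ^ K).
    { apply B1; [| |exact Hz].
      - intros w Hw. split; [apply D, Hw|]. apply (BG (8 * r)); try assumption; [lra|].
        intros u Hu. apply HF, sqb_sq, Hu.
      - apply (BG r); try assumption; [lra|]. intros u Hu. apply Hmu, sqb_sq, Hu. }
    replace (F z) with (F p + (F z - F p))%C by ring. rewrite E.
    eapply Rle_trans. apply Cmod_triangle. rewrite Cmod_mult.
    assert (Dz : Cmod (z - p)%C <= 3 * r).
    { eapply Rle_trans. apply sq_Cmod, Hz. lra. }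
    assert (B3 : Cmod (z - p)%C * Cmod (G z) <= 3 * r * (A * (2 * mu / r) + 2 * M / (8 * r) * (3 / 4) ^ K)).
    { apply Rmult_le_compat; try apply Cmod_ge_0; assumption. }
    replace (3 * r * (A * (2 * mu / r) + 2 * M / (8 * r) * (3 / 4) ^ K))
      with (6 * A * mu + M * (3 / 4 * (3 / 4) ^ K)) in B3 by (field; lra).
    simpl. lra.
Qed.

(** * Spherically almost periodic functions *)

(** Height on the sphere measured from infinity: 0 exactly at [Cinf], 1 at the origin. A positive
    lower bound for [tS (f z)] means that [f] is bounded there. *)
Definition tS (u : Cbar) : R :=
  match u with Cfin w => / (1 + Cmod w ^ 2) | Cinf => 0 end.

Definition wS (u : Cbar) : C :=
  match u with Cfin w => (w * / (1 + Cmod w ^ 2)%R)%C | Cinf => RtoC 0 end.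

(* [1 / u], with the junk value [0] at [u = 0]. *)
Definition invS (u : Cbar) : C :=
  match u with Cfin w => (/ w)%C | Cinf => RtoC 0 end.

(* The point [(wS, tS)] of [C * R] runs through a sphere of diameter 1. *)
Definition sclose (e : R) (u v : Cbar) : Prop :=
  Rabs (tS u - tS v) <= e /\ Cmod (wS u - wS v)%C <= e.

Lemma sclose_sym (e : R) (u v : Cbar) : sclose e u v -> sclose e v u.
Proof.
  intros [H1 H2]. split; [rewrite Rabs_minus_sym|rewrite Cmod_minus_sym]; assumption.
Qed.

Lemma sclose_trans (e e' : R) (u v w : Cbar) : sclose e u v -> sclose e' v w -> sclose (e + e') u w.
Proof.
  intros [H1 H2] [H3 H4]. split.
  - replace (tS u - tS w) with ((tS u - tS v) + (tS v - tS w)) by ring.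
    eapply Rle_trans. apply Rabs_triang. lra.
  - replace (wS u - wS w)%C with ((wS u - wS v) + (wS v - wS w))%C by ring.
    eapply Rle_trans. apply Cmod_triangle. lra.
Qed.

Lemma sclose_le (e e' : R) (u v : Cbar) : e <= e' -> sclose e u v -> sclose e' u v.
Proof. intros H [H1 H2]. split; lra. Qed.

Lemma sclose_refl (e : R) (u : Cbar) : 0 <= e -> sclose e u u.
Proof.
  intros H. split; [rewrite Rminus_diag, Rabs_R0|rewrite Cmod_diag]; exact H.
Qed.

Lemma one_plus_sq_pos (x : R) : 0 < 1 + x ^ 2.
Proof. generalize (pow2_ge_0 x). lra. Qed.

Lemma sqrt_one_plus_mult (x y : R) : 0 <= x -> 0 <= y ->
  x + y <= sqrt (1 + x ^ 2) * sqrt (1 + y ^ 2) /\ 1 + x * y <= sqrt (1 + x ^ 2) * sqrt (1 + y ^ 2).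
Proof.
  intros Hx Hy. assert (Px := one_plus_sq_pos x). assert (Py := one_plus_sq_pos y).
  rewrite <- sqrt_mult by lra.
  split; apply Rsqr_incr_0_var; try apply sqrt_pos; rewrite Rsqr_sqrt by nra; unfold Rsqr.
  - assert (0 <= (1 - x * y) * (1 - x * y)) by apply Rle_0_sqr. nra.
  - assert (0 <= (x - y) * (x - y)) by apply Rle_0_sqr. nra.
Qed.

Lemma asin_ge (x : R) : 0 <= x <= 1 -> x <= asin x.
Proof.
  intros Hx. destruct (Req_dec x 0) as [->|N]; [rewrite asin_0; lra|].
  assert (P : 0 < asin x).
  { apply Rnot_le_lt. intros K. assert (B := asin_bound x). assert (Q := PI_RGT_0).
    assert (S := sin_ge_0 (- asin x) ltac:(lra) ltac:(lra)).
    rewrite sin_neg, sin_asin in S by lra. lra. }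
  assert (S := sin_lt_x (asin x) P). rewrite sin_asin in S by lra. lra.
Qed.

(** On the sphere of diameter 1 the distance of two points is half their chord on the unit sphere,
    so the chord dominates every difference of coordinates. *)
Lemma chord_sclose (u v : Cbar) : 0 <= chord u v <= 2 /\ sclose (chord u v) u v.
Proof.
  assert (Key : forall z, 2 / sqrt (1 + Cmod z ^ 2) = 2 * (/ sqrt (1 + Cmod z ^ 2)) /\
    0 < / sqrt (1 + Cmod z ^ 2) <= 1 /\
    / (1 + Cmod z ^ 2) = / sqrt (1 + Cmod z ^ 2) * / sqrt (1 + Cmod z ^ 2) /\
    Cmod z * / sqrt (1 + Cmod z ^ 2) <= 1).
  { intros z. assert (P := one_plus_sq_pos (Cmod z)). assert (Q := Cmod_ge_0 z).
    set (s := sqrt (1 + Cmod z ^ 2)).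
    assert (Ps : 0 < s) by (apply sqrt_lt_R0, P).
    assert (Es : s * s = 1 + Cmod z ^ 2) by (apply sqrt_sqrt; lra).
    assert (S1 : 1 <= s).
    { rewrite <- sqrt_1. apply sqrt_le_1_alt. generalize (pow2_ge_0 (Cmod z)). lra. }
    split; [reflexivity|split; [|split]].
    - split. apply Rinv_0_lt_compat, Ps. rewrite <- Rinv_1. apply Rinv_le_contravar; lra.
    - rewrite <- Es. field. lra.
    - apply Rmult_le_reg_r with s; [exact Ps|]. rewrite Rmult_assoc, Rinv_l by lra. nra. }
  assert (KW : forall z, Cmod (wS (Cfin z)) = Cmod z * / sqrt (1 + Cmod z ^ 2) * / sqrt (1 + Cmod z ^ 2)).
  { intros z. unfold wS. assert (P := one_plus_sq_pos (Cmod z)). destruct (Key z) as [_ [_ [E _]]].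
    rewrite Cmod_mult, <- RtoC_inv, Cmod_R, Rabs_pos_eq by (try (left; apply Rinv_0_lt_compat); lra).
    rewrite E. ring. }
  destruct u as [z|], v as [w|].
  - unfold chord.
    assert (Pz := Cmod_ge_0 z). assert (Pw := Cmod_ge_0 w).
    destruct (sqrt_one_plus_mult (Cmod z) (Cmod w) Pz Pw) as [B1 B2].
    assert (Qz := one_plus_sq_pos (Cmod z)). assert (Qw := one_plus_sq_pos (Cmod w)).
    assert (Sz : 0 < sqrt (1 + Cmod z ^ 2)) by (apply sqrt_lt_R0, Qz).
    assert (Sw : 0 < sqrt (1 + Cmod w ^ 2)) by (apply sqrt_lt_R0, Qw).
    set (S := sqrt (1 + Cmod z ^ 2) * sqrt (1 + Cmod w ^ 2)) in *.
    assert (PS : 0 < S) by (apply Rmult_lt_0_compat; assumption).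
    assert (ES : S * S = (1 + Cmod z ^ 2) * (1 + Cmod w ^ 2)).
    { unfold S. rewrite <- sqrt_mult by lra. apply sqrt_sqrt. nra. }
    set (D := Cmod (z - w)%C). assert (PD : 0 <= D) by apply Cmod_ge_0.
    assert (DT : D <= Cmod z + Cmod w) by apply Cmod_triangle_minus.
    assert (DR : Rabs (Cmod w - Cmod z) <= D).
    { unfold D. apply Rabs_le. assert (T1 := Cmod_triangle_rev z w). assert (T2 := Cmod_triangle_rev w z).
      rewrite (Cmod_minus_sym w z) in T2. lra. }
    assert (Bd : D * S <= 2 * D / S * (S * S)).
    { replace (2 * D / S * (S * S)) with (2 * (D * S)) by (field; lra). nra. }
    assert (Ch0 : 0 <= 2 * D / S) by (apply Rdiv_le_0_compat; lra).
    split; [split; [exact Ch0|]|split].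
    + apply Rmult_le_reg_r with S; [exact PS|]. unfold Rdiv. rewrite Rmult_assoc, Rinv_l by lra. lra.
    + unfold tS.
      replace (/ (1 + Cmod z ^ 2) - / (1 + Cmod w ^ 2))
        with ((Cmod w - Cmod z) * (Cmod z + Cmod w) / (S * S)).
      * unfold Rdiv at 1. rewrite Rabs_mult, Rabs_mult, Rabs_inv.
        rewrite (Rabs_pos_eq (S * S)) by nra. rewrite (Rabs_pos_eq (Cmod z + Cmod w)) by lra.
        apply Rmult_le_reg_r with (S * S); [nra|]. rewrite Rmult_assoc, Rinv_l, Rmult_1_r by nra.
        eapply Rle_trans; [|exact Bd]. apply Rmult_le_compat; try apply Rabs_pos; lra.
      * rewrite ES. field. lra.
    + unfold wS.
      assert (Ez : RtoC (Cmod z ^ 2)%R = (z * Cconj z)%C) by apply Cmod2_conj.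
      assert (Ew : RtoC (Cmod w ^ 2)%R = (w * Cconj w)%C) by apply Cmod2_conj.
      (* Over the common denominator the numerator has modulus at most [D * (1 + Cmod z * Cmod w)],
         which the product of the square roots dominates. *)
      assert (E : (z * / (1 + Cmod z ^ 2)%R - w * / (1 + Cmod w ^ 2)%R)%C =
        (((z - w) + z * w * (Cconj w - Cconj z)) * / (S * S)%R)%C).
      { rewrite ES. rewrite RtoC_mult.
        assert (Nz : RtoC (1 + Cmod z ^ 2)%R <> RtoC 0) by (intros K; apply RtoC_inj in K; lra).
        assert (Nw : RtoC (1 + Cmod w ^ 2)%R <> RtoC 0) by (intros K; apply RtoC_inj in K; lra).
        transitivity ((z * (1 + Cmod w ^ 2)%R - w * (1 + Cmod z ^ 2)%R) * / ((1 + Cmod z ^ 2)%R * (1 + Cmod w ^ 2)%R))%C.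
        - field. auto.
        - f_equal. rewrite !RtoC_plus, Ez, Ew. ring. }
      rewrite E, Cmod_mult.
      replace (/ RtoC (S * S)%R)%C with (RtoC (/ (S * S))) by (apply RtoC_inv; nra).
      rewrite Cmod_R, Rabs_pos_eq by (left; apply Rinv_0_lt_compat; nra).
      apply Rmult_le_reg_r with (S * S); [nra|]. rewrite Rmult_assoc, Rinv_l, Rmult_1_r by nra.
      eapply Rle_trans; [|exact Bd]. eapply Rle_trans. apply Cmod_triangle.
      rewrite !Cmod_mult, <- Cminus_conj, Cmod_conj, (Cmod_minus_sym w z). fold D. nra.
  - unfold chord. destruct (Key z) as [E1 [E2 [E3 E4]]].
    rewrite E1. set (k := / sqrt (1 + Cmod z ^ 2)) in *.
    split; [lra|split].
    + unfold tS. rewrite E3, Rminus_0_r, Rabs_pos_eq by nra. nra.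
    + replace (wS (Cfin z) - wS Cinf)%C with (wS (Cfin z)) by (change (wS Cinf) with (RtoC 0); ring). rewrite KW. fold k. nra.
  - unfold chord. destruct (Key w) as [E1 [E2 [E3 E4]]].
    rewrite E1. set (k := / sqrt (1 + Cmod w ^ 2)) in *.
    split; [lra|split].
    + unfold tS. rewrite E3, Rabs_minus_sym, Rminus_0_r, Rabs_pos_eq by nra. nra.
    + rewrite Cmod_minus_sym.
      replace (wS (Cfin w) - wS Cinf)%C with (wS (Cfin w)) by (change (wS Cinf) with (RtoC 0); ring). rewrite KW. fold k. nra.
  - unfold chord. split; [lra|]. apply sclose_refl. lra.
Qed.

(** An arc is at least as long as its chord. Nothing else about the metric [rho] enters the
    proof. *)
Lemma rho_sclose (u v : Cbar) (e : R) : rho u v < e -> sclose e u v.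
Proof.
  intros H. destruct (chord_sclose u v) as [B K]. apply (sclose_le (chord u v)); [|exact K].
  assert (A := asin_ge (chord u v / 2) ltac:(lra)). unfold rho in H. lra.
Qed.

Lemma tS_range (u : Cbar) : 0 <= tS u <= 1.
Proof.
  destruct u as [w|]; simpl; [|lra]. assert (P := one_plus_sq_pos (Cmod w)). simpl in P. split.
  - left. apply Rinv_0_lt_compat. exact P.
  - rewrite <- Rinv_1. apply Rinv_le_contravar; [lra|]. generalize (pow2_ge_0 (Cmod w)). simpl. lra.
Qed.

Lemma Cmod_wS_sq (u : Cbar) : Cmod (wS u) ^ 2 = tS u * (1 - tS u).
Proof.
  destruct u as [w|].
  - unfold wS, tS. assert (P := one_plus_sq_pos (Cmod w)).
    rewrite Cmod_mult, <- RtoC_inv, Cmod_R, Rabs_pos_eq by (try (left; apply Rinv_0_lt_compat); lra).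
    field. lra.
  - simpl. rewrite Cmod_0. ring.
Qed.

Lemma Cmod_wS_le (u : Cbar) : Cmod (wS u) <= 1.
Proof.
  assert (E := Cmod_wS_sq u). assert (T := tS_range u). assert (P := Cmod_ge_0 (wS u)). nra.
Qed.

Lemma tS_lt_1 (u : Cbar) : tS u < 1 -> u <> Cfin 0.
Proof. intros H ->. simpl in H. rewrite Cmod_0 in H. lra. Qed.

(** The formula makes [1 / u] a Lipschitz function of the sphere coordinates away from [u = 0],
    infinity included. *)
Lemma invS_sphere (u : Cbar) : tS u < 1 -> invS u = (Cconj (wS u) * / (1 - tS u)%R)%C.
Proof.
  intros H. destruct u as [w|].
  - unfold invS, wS, tS in *. assert (P := one_plus_sq_pos (Cmod w)).
    assert (N : w <> RtoC 0).
    { intros ->. rewrite Cmod_0 in H. lra. }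
    assert (Pw := Cmod_neq0 w N).
    replace (1 - / (1 + Cmod w ^ 2)) with (Cmod w ^ 2 * / (1 + Cmod w ^ 2)) by (field; lra).
    rewrite RtoC_mult, (RtoC_inv (1 + Cmod w ^ 2)) by lra.
    rewrite Cmult_conj, Cinv_conj.
    2:{ intros K. apply RtoC_inj in K. lra. }
    assert (Ew : RtoC (Cmod w ^ 2)%R = (w * Cconj w)%C) by apply Cmod2_conj. rewrite Ew.
    assert (ER : Cconj (RtoC (1 + Cmod w ^ 2)%R) = RtoC (1 + Cmod w ^ 2)%R).
    { unfold Cconj, RtoC; simpl. f_equal; ring. }
    rewrite ER.
    assert (Nc : Cconj w <> RtoC 0) by (apply Cmod_gt_0; rewrite Cmod_conj; exact Pw).
    assert (Nr : RtoC (1 + Cmod w ^ 2)%R <> RtoC 0) by (intros K; apply RtoC_inj in K; lra).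
    field. auto.
  - simpl. unfold Cconj, RtoC, Cmult, Cinv; simpl. f_equal; ring.
Qed.

Lemma Cmod_invS_sq (u : Cbar) : tS u < 1 -> Cmod (invS u) ^ 2 = tS u / (1 - tS u).
Proof.
  intros H. rewrite invS_sphere by exact H. rewrite Cmod_mult, Cmod_conj.
  rewrite <- RtoC_inv, Cmod_R, Rabs_pos_eq by (try (left; apply Rinv_0_lt_compat); lra).
  rewrite Rpow_mult_distr, Cmod_wS_sq. field. lra.
Qed.

Lemma invS_le_2 (u : Cbar) : tS u < 3 / 4 -> Cmod (invS u) <= 2.
Proof.
  intros H. assert (E := Cmod_invS_sq u ltac:(lra)). assert (P := Cmod_ge_0 (invS u)).
  assert (T := tS_range u).
  assert (K : tS u / (1 - tS u) <= 4).
  { apply Rmult_le_reg_r with (1 - tS u); [lra|]. unfold Rdiv. rewrite Rmult_assoc, Rinv_l by lra. lra. }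
  nra.
Qed.

Lemma invS_ge (u : Cbar) : tS u < 3 / 4 -> tS u / 2 <= Cmod (invS u).
Proof.
  intros H. assert (E := Cmod_invS_sq u ltac:(lra)). assert (P := Cmod_ge_0 (invS u)).
  assert (T := tS_range u). assert (B := invS_le_2 u H).
  assert (K : tS u <= tS u / (1 - tS u)).
  { apply Rmult_le_reg_r with (1 - tS u); [lra|]. unfold Rdiv. rewrite Rmult_assoc, Rinv_l by lra. nra. }
  nra.
Qed.

Lemma tS_ge_of_invS (u : Cbar) (mu : R) : 0 <= mu -> tS u < 1 -> mu <= Cmod (invS u) ->
  mu ^ 2 / (1 + mu ^ 2) <= tS u.
Proof.
  intros Hmu H B. assert (E := Cmod_invS_sq u H). assert (T := tS_range u).
  assert (Q := one_plus_sq_pos mu).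
  assert (K : mu ^ 2 <= tS u / (1 - tS u)) by (rewrite <- E; apply pow_incr; lra).
  apply Rmult_le_reg_r with (1 + mu ^ 2); [exact Q|]. unfold Rdiv. rewrite Rmult_assoc, Rinv_l by lra.
  apply Rmult_le_compat_r with (r := 1 - tS u) in K; [|lra].
  unfold Rdiv in K. rewrite Rmult_assoc, Rinv_l in K by lra. lra.
Qed.

(** With [1 - tS] at least 1/10 the two terms have the coefficients 10 and 100. *)
Lemma sclose_invS (e : R) (u v : Cbar) : tS u <= 9 / 10 -> tS v <= 9 / 10 -> sclose e u v ->
  Cmod (invS u - invS v)%C <= 110 * e.
Proof.
  intros Hu Hv [H1 H2]. rewrite !invS_sphere by lra.
  assert (Nu : RtoC (1 - tS u)%R <> RtoC 0) by (intros K; apply RtoC_inj in K; lra).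
  assert (Nv : RtoC (1 - tS v)%R <> RtoC 0) by (intros K; apply RtoC_inj in K; lra).
  replace (Cconj (wS u) * / (1 - tS u)%R - Cconj (wS v) * / (1 - tS v)%R)%C
    with (Cconj (wS u - wS v) * / (1 - tS u)%R + Cconj (wS v) * (tS u - tS v)%R * / ((1 - tS u)%R * (1 - tS v)%R))%C.
  - eapply Rle_trans. apply Cmod_triangle.
    rewrite !Cmod_mult, !Cmod_conj, !Cmod_inv, !Cmod_mult, !Cmod_R by (try apply Cmult_neq_0; assumption).
    rewrite (Rabs_pos_eq (1 - tS u)), (Rabs_pos_eq (1 - tS v)) by lra.
    assert (I1 : / (1 - tS u) <= 10).
    { replace 10 with (/ (1 / 10)) by field. apply Rinv_le_contravar; lra. }
    assert (I2 : / ((1 - tS u) * (1 - tS v)) <= 100).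
    { replace 100 with (/ (1 / 100)) by field. apply Rinv_le_contravar; nra. }
    assert (J1 : 0 < / (1 - tS u)) by (apply Rinv_0_lt_compat; lra).
    assert (J2 : 0 < / ((1 - tS u) * (1 - tS v))) by (apply Rinv_0_lt_compat; nra).
    assert (Pe : 0 <= e) by (eapply Rle_trans; [apply Rabs_pos|exact H1]).
    assert (Q1 : Cmod (wS u - wS v)%C * / (1 - tS u) <= e * 10).
    { apply Rmult_le_compat; try lra. apply Cmod_ge_0. }
    assert (Q2 : Cmod (wS v) * Rabs (tS u - tS v) * / ((1 - tS u) * (1 - tS v)) <= 1 * e * 100).
    { apply Rmult_le_compat; try lra. apply Rmult_le_pos; [apply Cmod_ge_0|apply Rabs_pos].
      apply Rmult_le_compat; try lra; [apply Cmod_ge_0|apply Rabs_pos|apply Cmod_wS_le]. }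
    lra.
  - rewrite Cminus_conj. rewrite (RtoC_minus (tS u)).
    replace (RtoC (tS u)) with (1 - (1 - tS u)%R)%C by (rewrite RtoC_minus; ring).
    replace (RtoC (tS v)) with (1 - (1 - tS v)%R)%C at 1 by (rewrite RtoC_minus; ring).
    field. auto.
Qed.

Lemma affine_sphere (u : Cbar) : 0 < tS u -> affine_part u = (wS u * / tS u)%C /\ u = Cfin (affine_part u).
Proof.
  intros H. destruct u as [w|]; simpl in H; [|lra]. split; [|reflexivity].
  simpl affine_part. unfold wS, tS. assert (P := one_plus_sq_pos (Cmod w)).
  assert (N : RtoC (1 + Cmod w ^ 2)%R <> RtoC 0) by (intros K; apply RtoC_inj in K; lra).
  rewrite RtoC_inv by lra. field. exact N.
Qed.

Lemma sclose_affine (e m : R) (u v : Cbar) : 0 < m -> m <= tS u -> m <= tS v -> sclose e u v ->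
  Cmod (affine_part u - affine_part v)%C <= (/ m + / (m * m)) * e.
Proof.
  intros Hm Hu Hv [H1 H2].
  rewrite (proj1 (affine_sphere u ltac:(lra))), (proj1 (affine_sphere v ltac:(lra))).
  assert (Nu : RtoC (tS u) <> RtoC 0) by (intros K; apply RtoC_inj in K; lra).
  assert (Nv : RtoC (tS v) <> RtoC 0) by (intros K; apply RtoC_inj in K; lra).
  replace (wS u * / tS u - wS v * / tS v)%C
    with ((wS u - wS v) * / tS u + wS v * (tS v - tS u)%R * / (tS u * tS v))%C
    by (rewrite RtoC_minus; field; auto).
  eapply Rle_trans. apply Cmod_triangle.
  rewrite !Cmod_mult, !Cmod_inv, !Cmod_mult, !Cmod_R by (try apply Cmult_neq_0; assumption).
  rewrite (Rabs_pos_eq (tS u)), (Rabs_pos_eq (tS v)) by lra. rewrite Rabs_minus_sym.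
  assert (I1 : / tS u <= / m) by (apply Rinv_le_contravar; lra).
  assert (I2 : / (tS u * tS v) <= / (m * m)) by (apply Rinv_le_contravar; nra).
  assert (J1 : 0 < / tS u) by (apply Rinv_0_lt_compat; lra).
  assert (J2 : 0 < / (tS u * tS v)) by (apply Rinv_0_lt_compat; nra).
  assert (Pe : 0 <= e) by (eapply Rle_trans; [apply Rabs_pos|exact H1]).
  assert (Q1 : Cmod (wS u - wS v)%C * / tS u <= e * / m).
  { apply Rmult_le_compat; try lra. apply Cmod_ge_0. }
  assert (Q2 : Cmod (wS v) * Rabs (tS u - tS v) * / (tS u * tS v) <= 1 * e * / (m * m)).
  { apply Rmult_le_compat; try lra. apply Rmult_le_pos; [apply Cmod_ge_0|apply Rabs_pos].
    apply Rmult_le_compat; try lra; [apply Cmod_ge_0|apply Rabs_pos|apply Cmod_wS_le]. }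
  lra.
Qed.

Lemma Cmod_affine_le (u : Cbar) (m : R) : 0 < m -> m <= tS u -> Cmod (affine_part u) <= / m.
Proof.
  intros Hm Hu. rewrite (proj1 (affine_sphere u ltac:(lra))).
  rewrite Cmod_mult, <- RtoC_inv, Cmod_R, Rabs_pos_eq by (try (left; apply Rinv_0_lt_compat); lra).
  assert (I1 : / tS u <= / m) by (apply Rinv_le_contravar; lra).
  assert (J1 : 0 < / tS u) by (apply Rinv_0_lt_compat; lra).
  assert (B := Cmod_wS_le u). assert (P := Cmod_ge_0 (wS u)). nra.
Qed.

(** * Meromorphic functions as continuous maps to the sphere *)

(** Neighbourhoods in [C] come from the product structure, with square balls; discs and squares are
    exchanged at the cost of a factor 2. *)
Lemma locally'_C (z0 : C) (P : C -> Prop) : locally' z0 P <->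
  exists d, 0 < d /\ forall w, w <> z0 -> Cmod (w - z0)%C < d -> P w.
Proof.
  split.
  - intros [e H]. exists e. split; [apply cond_pos|]. intros w Hw Hd. apply H; [|exact Hw].
    split.
    + change (Rabs (Re w - Re z0) < e). eapply Rle_lt_trans; [apply re_le_of_Cmod|exact Hd].
    + change (Rabs (Im w - Im z0) < e). eapply Rle_lt_trans; [apply im_le_of_Cmod|exact Hd].
  - intros [d [Hd H]]. exists (mkposreal (d / 2) ltac:(lra)). intros w [B1 B2] Hw.
    apply H; [exact Hw|].
    change (Rabs (Re w - Re z0) < d / 2) in B1. change (Rabs (Im w - Im z0) < d / 2) in B2.
    eapply Rle_lt_trans; [apply Cmod_le_re_im|]. rewrite re_minus, im_minus. lra.
Qed.

Definition scont (f : C -> Cbar) (z0 : C) : Prop :=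
  forall e, 0 < e -> exists d, 0 < d /\ forall w, Cmod (w - z0)%C < d -> sclose e (f w) (f z0).

Lemma strip_open (a b : Rbar) (z0 : C) : strip a b z0 ->
  exists d, 0 < d /\ forall w, Rabs (Im w - Im z0) < d -> strip a b w.
Proof.
  intros [H1 H2].
  assert (L : exists d, 0 < d /\ forall y, Im z0 - d < y -> Rbar_lt a y).
  { destruct a as [a| |]; simpl in H1.
    - exists (Im z0 - a). split; [lra|]. intros y Hy. simpl. lra.
    - destruct H1.
    - exists 1. split; [lra|]. intros y _. exact I. }
  assert (U : exists d, 0 < d /\ forall y, y < Im z0 + d -> Rbar_lt y b).
  { destruct b as [b| |]; simpl in H2.
    - exists (b - Im z0). split; [lra|]. intros y Hy. simpl. lra.
    - exists 1. split; [lra|]. intros y _. exact I.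
    - destruct H2. }
  destruct L as [d1 [Hd1 L]]. destruct U as [d2 [Hd2 U]].
  exists (Rmin d1 d2). split; [apply Rmin_pos; assumption|]. intros w Hw.
  assert (K1 := Rmin_l d1 d2). assert (K2 := Rmin_r d1 d2).
  apply Rabs_lt_between in Hw. split; [apply L|apply U]; lra.
Qed.

Lemma inner_strip_in (alpha beta : R) (a b : Rbar) (z : C) : inner_strip alpha beta a b ->
  alpha <= Im z <= beta -> strip a b z.
Proof.
  intros [H1 [_ H3]] Hz. split.
  - apply Rbar_lt_le_trans with alpha; [exact H1|]. simpl. lra.
  - apply Rbar_le_lt_trans with beta; [|exact H3]. simpl. lra.
Qed.

Lemma inner_strip_widen (alpha beta : R) (a b : Rbar) : inner_strip alpha beta a b ->
  exists e, 0 < e /\ forall e', 0 <= e' <= e -> inner_strip (alpha - e') (beta + e') a b.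
Proof.
  intros [H1 [H2 H3]].
  destruct (strip_open a b (0, alpha)) as [d1 [Hd1 K1]].
  { split; [exact H1|]. apply Rbar_lt_trans with beta; [simpl; exact H2|exact H3]. }
  destruct (strip_open a b (0, beta)) as [d2 [Hd2 K2]].
  { split; [|exact H3]. apply Rbar_lt_trans with alpha; [exact H1|simpl; exact H2]. }
  exists (Rmin d1 d2 / 2). assert (P : 0 < Rmin d1 d2) by (apply Rmin_pos; assumption).
  assert (L1 := Rmin_l d1 d2). assert (L2 := Rmin_r d1 d2).
  split; [lra|]. intros e' He'. split; [|split; [lra|]].
  - apply (K1 (0, alpha - e')). unfold Im; simpl. rewrite Rabs_minus_sym, Rabs_pos_eq; lra.
  - apply (K2 (0, beta + e')). unfold Im; simpl. rewrite Rabs_pos_eq; lra.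
Qed.

Lemma meromorphic_finite (a b : Rbar) (f : C -> Cbar) (z0 : C) : meromorphic_on (strip a b) f ->
  strip a b z0 -> f z0 <> Cinf -> holo (fun z => affine_part (f z)) z0 /\
  exists d, 0 < d /\ forall w, Cmod (w - z0)%C < d -> f w <> Cinf.
Proof.
  intros Hf Hz N. destruct (Hf z0 Hz) as [H1 H2]. split.
  - destruct (f z0); [apply C_differentiable_holo, H2|]. exfalso. apply N. reflexivity.
  - apply locally'_C in H1. destruct H1 as [d [Hd H]]. exists d. split; [exact Hd|].
    intros w Hw. destruct (Ceq_dec w z0) as [->|K]; [exact N|]. apply (H w K Hw).
Qed.

Lemma meromorphic_pole (a b : Rbar) (f : C -> Cbar) (z0 : C) : meromorphic_on (strip a b) f ->
  strip a b z0 -> f z0 = Cinf -> forall M, exists d, 0 < d /\ forall w, w <> z0 -> Cmod (w - z0)%C < d ->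
    f w <> Cinf /\ holo (fun z => affine_part (f z)) w /\ M < Cmod (affine_part (f w)).
Proof.
  intros Hf Hz E M. destruct (Hf z0 Hz) as [H1 H2]. rewrite E in H2.
  specialize (H2 (fun x => M < x)). unfold filtermap in H2.
  assert (H3 : locally' z0 (fun z => M < Cmod (affine_part (f z)))).
  { apply H2. exists M. auto. }
  apply locally'_C in H1. apply locally'_C in H3.
  destruct H1 as [d1 [Hd1 K1]]. destruct H3 as [d2 [Hd2 K2]].
  exists (Rmin d1 d2). split; [apply Rmin_pos; assumption|]. intros w Hw Hd.
  assert (W1 := Rlt_le_trans _ _ _ Hd (Rmin_l _ _)).
  assert (W2 := Rlt_le_trans _ _ _ Hd (Rmin_r _ _)).
  destruct (K1 w Hw W1) as [Q1 Q2]. split; [exact Q1|split].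
  - apply C_differentiable_holo, Q2.
  - apply K2; assumption.
Qed.

Lemma finite_affine (u : Cbar) : u <> Cinf -> u = Cfin (affine_part u).
Proof. destruct u; [reflexivity|]. intros N. exfalso. apply N. reflexivity. Qed.

Lemma Cfin_sclose_continuous (F : C -> C) (z0 : C) : ccont F z0 -> scont (fun z => Cfin (F z)) z0.
Proof.
  intros HF e He. destruct (HF (e / 2)) as [d [Hd K]]; [lra|].
  exists d. split; [exact Hd|]. intros w Hw. specialize (K w Hw).
  destruct (chord_sclose (Cfin (F w)) (Cfin (F z0))) as [_ Q].
  apply (sclose_le _ e) in Q; [exact Q|].
  unfold chord. assert (P1 := one_plus_sq_pos (Cmod (F w))). assert (P2 := one_plus_sq_pos (Cmod (F z0))).
  destruct (sqrt_one_plus_mult (Cmod (F w)) (Cmod (F z0)) (Cmod_ge_0 _) (Cmod_ge_0 _)) as [_ B].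
  set (S := sqrt (1 + Cmod (F w) ^ 2) * sqrt (1 + Cmod (F z0) ^ 2)) in *.
  assert (PP : 0 <= Cmod (F w) * Cmod (F z0)) by (apply Rmult_le_pos; apply Cmod_ge_0).
  apply Rmult_le_reg_r with S; [lra|]. unfold Rdiv. rewrite Rmult_assoc, Rinv_l by lra. nra.
Qed.

Lemma meromorphic_scont (a b : Rbar) (f : C -> Cbar) (z0 : C) : meromorphic_on (strip a b) f ->
  strip a b z0 -> scont f z0.
Proof.
  intros Hf Hz. destruct (classic (f z0 = Cinf)) as [E|N].
  - intros e He. destruct (meromorphic_pole a b f z0 Hf Hz E (2 / e)) as [d [Hd K]].
    exists d. split; [exact Hd|]. intros w Hw. destruct (Ceq_dec w z0) as [->|Nw].
    { apply sclose_refl. lra. }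
    destruct (K w Nw Hw) as [K1 [_ K3]]. rewrite E, (finite_affine _ K1).
    destruct (chord_sclose (Cfin (affine_part (f w))) Cinf) as [_ Q].
    apply (sclose_le _ e) in Q; [exact Q|]. unfold chord.
    set (x := Cmod (affine_part (f w))) in *.
    assert (P := one_plus_sq_pos x). assert (Pe : 0 < 2 / e) by (apply Rdiv_lt_0_compat; lra).
    assert (S1 : x <= sqrt (1 + x ^ 2)).
    { apply Rsqr_incr_0_var; [|apply sqrt_pos]. rewrite Rsqr_sqrt by lra. unfold Rsqr. simpl. lra. }
    apply Rmult_le_reg_r with (sqrt (1 + x ^ 2)); [lra|]. unfold Rdiv at 1. rewrite Rmult_assoc, Rinv_l by lra.
    apply Rle_trans with (e * (2 / e)); [right; field; lra|]. apply Rmult_le_compat_l; lra.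
  - destruct (meromorphic_finite a b f z0 Hf Hz N) as [H1 [d [Hd K]]].
    intros e He.
    destruct (Cfin_sclose_continuous (fun z => affine_part (f z)) z0 (holo_ccont _ _ H1) e He) as [d' [Hd' K']].
    exists (Rmin d d'). split; [apply Rmin_pos; assumption|]. intros w Hw.
    assert (W1 := Rlt_le_trans _ _ _ Hw (Rmin_l _ _)).
    assert (W2 := Rlt_le_trans _ _ _ Hw (Rmin_r _ _)).
    rewrite (finite_affine _ (K w W1)), (finite_affine _ N). apply K', W2.
Qed.

(** At a pole [1 / f] is bounded, so Riemann's theorem applies, and the extending value is the limit
    0, which is [invS Cinf]. *)
Lemma meromorphic_inv_holo (a b : Rbar) (f : C -> Cbar) (z0 : C) : meromorphic_on (strip a b) f ->
  strip a b z0 -> tS (f z0) < 1 -> holo (fun z => invS (f z)) z0.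
Proof.
  intros Hf Hz T. destruct (classic (f z0 = Cinf)) as [E|N].
  - destruct (meromorphic_pole a b f z0 Hf Hz E 1) as [d [Hd K]].
    assert (EI : forall w, w <> z0 -> Cmod (w - z0)%C < d -> invS (f w) = (/ affine_part (f w))%C).
    { intros w Hw Hwd. destruct (K w Hw Hwd) as [K1 _]. rewrite (finite_affine _ K1) at 1. reflexivity. }
    destruct (Riemann_removable (fun z => invS (f z)) z0 d Hd) as [c Hc].
    + intros z Nz Hzd. destruct (K z Nz Hzd) as [K1 [K2 K3]].
      apply (holo_ext_near (fun z => / affine_part (f z))%C).
      * exists (Rmin (Cmod (z - z0)%C) (d - Cmod (z - z0)%C)). split.
        { apply Rmin_pos; [apply Cmod_neq0, Cminus_eq_contra, Nz|lra]. }
        intros w Hw.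
        assert (W1 := Rlt_le_trans _ _ _ Hw (Rmin_l _ _)).
        assert (W2 := Rlt_le_trans _ _ _ Hw (Rmin_r _ _)).
        symmetry. apply EI.
        { intros ->. rewrite Cmod_minus_sym in W1. lra. }
        replace (w - z0)%C with ((w - z) + (z - z0))%C by ring.
        eapply Rle_lt_trans. apply Cmod_triangle. lra.
      * apply holo_inv; [exact K2|]. apply Cmod_gt_0. lra.
    + exists 1, d. split; [exact Hd|]. intros w Nw Hw. rewrite EI by assumption.
      destruct (K w Nw Hw) as [_ [_ K3]]. rewrite Cmod_inv by (apply Cmod_gt_0; lra).
      rewrite <- Rinv_1. apply Rinv_le_contravar; lra.
    + assert (c0 : c = RtoC 0).
      { apply Cmod_eq_0. apply Rle_antisym; [|apply Cmod_ge_0]. apply le_epsilon. intros e He.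
        rewrite Rplus_0_l.
        destruct (holo_ccont _ _ Hc (e / 2)) as [d1 [Hd1 Q1]]; [lra|].
        destruct (meromorphic_pole a b f z0 Hf Hz E (2 / e)) as [d2 [Hd2 Q2]].
        set (h := Rmin (Rmin d1 d2) d / 2).
        assert (Hh : 0 < h) by (unfold h; assert (0 < Rmin (Rmin d1 d2) d) by (repeat apply Rmin_pos; assumption); lra).
        assert (Hh1 : h < d1 /\ h < d2 /\ h < d).
        { unfold h in *. revert Hh. unfold Rmin. repeat destruct Rle_dec; intros; lra. }
        assert (Eh : Cmod ((z0 + h) - z0)%C = h).
        { replace ((z0 + h) - z0)%C with (RtoC h) by ring. rewrite Cmod_R. apply Rabs_pos_eq. lra. }
        assert (Nh : (z0 + h)%C <> z0).
        { intros K0. rewrite K0, Cmod_diag in Eh. lra. }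
        specialize (Q1 (z0 + h)%C ltac:(lra)). cbv beta in Q1.
        destruct (Ceq_dec (z0 + h)%C z0) as [K0|_]; [exfalso; apply Nh, K0|].
        destruct (Ceq_dec z0 z0) as [_|K0]; [|exfalso; apply K0; reflexivity].
        rewrite EI in Q1 by (try assumption; lra).
        destruct (Q2 (z0 + h)%C Nh ltac:(lra)) as [_ [_ Q3]].
        assert (Pe : 0 < 2 / e) by (apply Rdiv_lt_0_compat; lra).
        assert (B : Cmod (/ affine_part (f (z0 + h)%C))%C <= e / 2).
        { rewrite Cmod_inv by (apply Cmod_gt_0; lra).
          replace (e / 2) with (/ (2 / e)) by (field; lra). apply Rinv_le_contravar; lra. }
        assert (Tr := Cmod_triangle_rev c (/ affine_part (f (z0 + h)%C))%C).
        rewrite Cmod_minus_sym in Tr. lra. }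
      apply (holo_ext (fun z => if Ceq_dec z z0 then c else invS (f z))); [|exact Hc].
      intros w. destruct (Ceq_dec w z0) as [->|Nw]; [|reflexivity]. rewrite c0, E. reflexivity.
  - destruct (meromorphic_finite a b f z0 Hf Hz N) as [H1 [d [Hd K]]].
    apply (holo_ext_near (fun z => / affine_part (f z))%C).
    + exists d. split; [exact Hd|]. intros w Hw. rewrite (finite_affine _ (K w Hw)) at 2. reflexivity.
    + apply holo_inv; [exact H1|]. intros E0. apply (tS_lt_1 _ T).
      rewrite (finite_affine _ N), E0. reflexivity.
Qed.

(** * Uniformity drawn from almost periodicity *)

Definition ap_set (f : C -> Cbar) (alpha beta e : R) (tau : R) : Prop :=
  forall z, alpha <= Im z <= beta -> sclose e (f (z + tau)%C) (f z).

Lemma ap_sclose (a b : Rbar) (f : C -> Cbar) (alpha beta e : R) : meromorphic_almost_periodic a b f ->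
  inner_strip alpha beta a b -> 0 < e -> exists L, 0 < L /\
    forall t, exists tau, t <= tau <= t + L /\ ap_set f alpha beta e tau.
Proof.
  intros [_ Hf] Hs He. destruct (inner_strip_widen _ _ _ _ Hs) as [d [Hd K]].
  destruct (Hf (alpha - d) (beta + d) (K d ltac:(lra)) e He) as [L [HL H]].
  exists L. split; [exact HL|]. intros t. destruct (H t) as [tau [Ht Q]].
  exists tau. split; [exact Ht|]. intros z Hz. apply rho_sclose, Q. split; simpl; lra.
Qed.

(** An almost period carries both points into one fixed rectangle, where Heine's theorem applies.
    The rectangle runs from -1 to [L + 1] to accommodate [w], which is within 1 of [z]. *)
Lemma uniformly_continuous_of_ap (u : C -> R) (alpha beta : R) : alpha <= beta ->
  (forall z, alpha <= Im z <= beta -> forall e, 0 < e -> exists d, 0 < d /\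
     forall w, Cmod (w - z)%C < d -> Rabs (u w - u z) < e) ->
  (forall e, 0 < e -> exists L, 0 < L /\ forall t, exists tau, t <= tau <= t + L /\
     forall z, alpha <= Im z <= beta -> Rabs (u (z + tau)%C - u z) <= e) ->
  forall e, 0 < e -> exists d, 0 < d /\ forall z w, alpha <= Im z <= beta -> alpha <= Im w <= beta ->
    Cmod (w - z)%C < d -> Rabs (u w - u z) <= e.
Proof.
  intros Hab HC HA e He.
  destruct (HA (e / 3)) as [L [HL K]]; [lra|].
  destruct (uniform_continuity_2d (fun x y => u (x, y)) (-1) (L + 1) alpha beta) with (eps := mkposreal (e / 3) ltac:(lra))
    as [d Hd].
  { intros x y Hx Hy eps. destruct (HC (x, y) Hy eps (cond_pos eps)) as [d [Hd Q]].
    exists (mkposreal (d / 2) ltac:(lra)). intros x' y' H1 H2. simpl in H1, H2. apply Q.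
    eapply Rle_lt_trans; [apply Cmod_le_re_im|]. rewrite re_minus, im_minus. unfold Re, Im; simpl. lra. }
  exists (Rmin d 1). split; [apply Rmin_pos; [apply cond_pos|lra]|].
  intros z w Hz Hw Hzw.
  assert (W1 := Rlt_le_trans _ _ _ Hzw (Rmin_l _ _)).
  assert (W2 := Rlt_le_trans _ _ _ Hzw (Rmin_r _ _)).
  assert (Ar := re_le_of_Cmod w z). assert (Ai := im_le_of_Cmod w z).
  assert (Br : - 1 < Re w - Re z < 1) by (apply Rabs_lt_between; lra).
  destruct (K (- Re z)) as [tau [Ht Q]].
  assert (E : forall v : C, ((Re v + tau)%R, Im v) = (v + tau)%C).
  { intros [x y]. unfold Cplus, RtoC, Re, Im; simpl. f_equal. ring. }
  assert (Hd' : Rabs (u (w + tau)%C - u (z + tau)%C) < e / 3).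
  { rewrite <- !E. apply Hd; try lra.
    - replace (Re w + tau - (Re z + tau)) with (Re w - Re z) by ring. lra. }
  assert (Q1 := Q z Hz). assert (Q2 := Q w Hw).
  apply Rabs_lt_between in Hd'. apply Rabs_le_between in Q1. apply Rabs_le_between in Q2.
  apply Rabs_le. lra.
Qed.

Lemma spherical_uniform (a b : Rbar) (f : C -> Cbar) (alpha beta e : R) :
  meromorphic_almost_periodic a b f -> inner_strip alpha beta a b -> 0 < e ->
  exists d, 0 < d /\ forall z w, alpha <= Im z <= beta -> alpha <= Im w <= beta ->
    Cmod (w - z)%C < d -> sclose e (f w) (f z).
Proof.
  intros Hf Hs He.
  assert (Hab : alpha <= beta) by (destruct Hs as [_ [H _]]; lra).
  assert (Gen : forall u : Cbar -> R, (forall e p q, sclose e p q -> Rabs (u p - u q) <= e) ->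
    forall e, 0 < e -> exists d, 0 < d /\ forall z w, alpha <= Im z <= beta -> alpha <= Im w <= beta ->
    Cmod (w - z)%C < d -> Rabs (u (f w) - u (f z)) <= e).
  { intros u Hu. apply (uniformly_continuous_of_ap (fun z => u (f z))); [exact Hab| |].
    - intros z Hz e' He'.
      destruct (meromorphic_scont a b f z (proj1 Hf) (inner_strip_in _ _ _ _ z Hs Hz) (e' / 2)) as [d [Hd K]]; [lra|].
      exists d. split; [exact Hd|]. intros w Hw. apply Rle_lt_trans with (e' / 2); [apply Hu, K, Hw|lra].
    - intros e' He'. destruct (ap_sclose a b f alpha beta e' Hf Hs He') as [L [HL K]].
      exists L. split; [exact HL|]. intros t. destruct (K t) as [tau [Ht Q]]. exists tau. split; [exact Ht|].
      intros z Hz. apply Hu, Q, Hz. }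
  destruct (Gen tS) with (e := e) as [d1 [Hd1 K1]]; [intros e' p q [H _]; exact H|exact He|].
  destruct (Gen (fun p => Re (wS p))) with (e := e / 2) as [d2 [Hd2 K2]];
    [intros e' p q [_ H]; eapply Rle_trans; [apply re_le_of_Cmod|exact H]|lra|].
  destruct (Gen (fun p => Im (wS p))) with (e := e / 2) as [d3 [Hd3 K3]];
    [intros e' p q [_ H]; eapply Rle_trans; [apply im_le_of_Cmod|exact H]|lra|].
  exists (Rmin d1 (Rmin d2 d3)). split; [repeat apply Rmin_pos; assumption|].
  intros z w Hz Hw Hzw.
  assert (W : Cmod (w - z)%C < d1 /\ Cmod (w - z)%C < d2 /\ Cmod (w - z)%C < d3).
  { revert Hzw. unfold Rmin. repeat destruct Rle_dec; intros; lra. }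
  destruct W as [W1 [W2 W3]]. split; [apply K1; assumption|].
  eapply Rle_trans; [apply Cmod_le_re_im|]. rewrite re_minus, im_minus.
  specialize (K2 z w Hz Hw W2). specialize (K3 z w Hz Hw W3). cbv beta in K2, K3. lra.
Qed.

(** One member is fixed in each of finitely many inhabited classes; the largest modulus is [B]. *)
Lemma bounded_representatives (E : R -> Prop) (P : Z -> R -> Prop) (q : nat) :
  exists B, 0 <= B /\ forall i, (0 <= i < Z.of_nat q)%Z -> (exists tau, E tau /\ P i tau) ->
    exists tau, E tau /\ P i tau /\ Rabs tau <= B.
Proof.
  induction q as [|q [B [HB IH]]].
  - exists 0. split; [lra|]. intros i Hi. lia.
  - destruct (classic (exists tau, E tau /\ P (Z.of_nat q) tau)) as [[t [H1 H2]]|N].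
    + exists (Rmax B (Rabs t)). split; [eapply Rle_trans; [exact HB|apply Rmax_l]|].
      intros i Hi Hex. destruct (Z.eq_dec i (Z.of_nat q)) as [->|Ni].
      * exists t. split; [exact H1|split; [exact H2|apply Rmax_r]].
      * destruct (IH i ltac:(lia) Hex) as [s [S1 [S2 S3]]].
        exists s. split; [exact S1|split; [exact S2|]]. eapply Rle_trans; [exact S3|apply Rmax_l].
    + exists B. split; [exact HB|]. intros i Hi Hex.
      destruct (Z.eq_dec i (Z.of_nat q)) as [->|Ni]; [exfalso; apply N, Hex|].
      apply IH; [lia|exact Hex].
Qed.

(* Almost periods falling into the same class of [R / Z] up to a small error
   differ by nearly an integer, and the classes are finite in number. *)
Theorem integer_almost_periods (a b : Rbar) (f : C -> Cbar) (alpha beta e : R) :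
  meromorphic_almost_periodic a b f -> inner_strip alpha beta a b -> 0 < e ->
  exists L, 0 < L /\ forall t, exists m : Z, t <= IZR m <= t + L /\ ap_set f alpha beta e (IZR m).
Proof.
  intros Hf Hs He.
  destruct (ap_sclose a b f alpha beta (e / 3) Hf Hs ltac:(lra)) as [L0 [HL0 K]].
  destruct (spherical_uniform a b f alpha beta (e / 3) Hf Hs ltac:(lra)) as [d [Hd HU]].
  destruct (INR_unbounded (1 / d)) as [q Hq].
  assert (Pd : 0 < 1 / d) by (apply Rdiv_lt_0_compat; lra).
  assert (Pq : 0 < INR q) by lra.
  assert (Nq : (0 < q)%nat) by (apply INR_lt; simpl; exact Pq).
  rewrite INR_IZR_INZ in *. set (Q := Z.of_nat q) in *. assert (HQ : (0 < Q)%Z) by lia.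
  (* [tau] is classified by the arc of length [1 / Q], less than [d], that contains its fractional
     part. *)
  set (P := fun i tau => exists j : Z, IZR j <= IZR Q * tau < IZR j + 1 /\ (j mod Q = i)%Z).
  assert (HP : forall tau, exists i, (0 <= i < Q)%Z /\ P i tau).
  { intros tau. set (j := (up (IZR Q * tau) - 1)%Z).
    destruct (archimed (IZR Q * tau)) as [A1 A2].
    exists (j mod Q)%Z. split; [apply Z.mod_pos_bound, HQ|]. exists j. split; [|reflexivity].
    unfold j. rewrite minus_IZR. lra. }
  destruct (bounded_representatives (ap_set f alpha beta (e / 3)) P q) as [B [HB HR]].
  exists (L0 + 2 * B + 2). split; [lra|]. intros t.
  (* Subtracting [s] and rounding moves [tau] by at most [B + 1]; this start keeps the resulting
     integer above [t]. *)
  destruct (K (t + B + 1)) as [tau [Ht Htau]].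
  destruct (HP tau) as [i [Hi Pi]].
  destruct (HR i Hi) as [s [Hs1 [Ps Bs]]]; [exists tau; split; assumption|].
  destruct Pi as [j [Hj Mj]]. destruct Ps as [k [Hk Mk]].
  assert (En : exists n, (j - k = Q * n)%Z).
  { exists (j / Q - k / Q)%Z. assert (D1 := Z.div_mod j Q ltac:(lia)). assert (D2 := Z.div_mod k Q ltac:(lia)).
    rewrite Mj in D1. rewrite Mk in D2. nia. }
  destruct En as [n En]. apply (f_equal IZR) in En. rewrite minus_IZR, mult_IZR in En.
  assert (Hn : - 1 < IZR Q * (tau - s - IZR n) < 1) by lra.
  assert (Hdq : 1 < d * IZR Q).
  { apply Rmult_lt_compat_l with (r := d) in Hq; [|exact Hd].
    replace (d * (1 / d)) with 1 in Hq by (field; lra). exact Hq. }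
  assert (Hn' : - d < tau - s - IZR n < d).
  { split; apply Rmult_lt_reg_l with (IZR Q); try exact Pq; lra. }
  assert (HQ1 : 1 <= IZR Q) by (apply IZR_le; lia).
  assert (Hn1 : - 1 < tau - s - IZR n < 1) by (split; nra).
  apply Rabs_le_between in Bs.
  exists n. split; [lra|].
  intros z Hz.
  assert (I : forall r : R, Im (z + r)%C = Im z) by (intros r; rewrite im_plus, im_RtoC; ring).
  replace e with (e / 3 + (e / 3 + e / 3)) by field.
  (* From the integer to [tau - s] by uniform continuity, from there to [z - s] by the almost period
     [tau], and to [z] by the almost period [s]. *)
  apply sclose_trans with (f (z + (tau - s)%R)%C).
  - apply HU; try (rewrite I; exact Hz).
    replace (z + IZR n - (z + (tau - s)%R))%C with (RtoC (IZR n - (tau - s))) by (rewrite RtoC_minus; ring).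
    rewrite Cmod_R. apply Rabs_lt_between. lra.
  - apply sclose_trans with (f (z + (- s)%R)%C).
    + replace (z + (tau - s)%R)%C with ((z + (- s)%R) + tau)%C by (rewrite RtoC_minus, RtoC_opp; ring).
      apply Htau. rewrite I. exact Hz.
    + apply sclose_sym. replace (f z) with (f ((z + (- s)%R) + s)%C) by (f_equal; rewrite RtoC_opp; ring).
      apply Hs1. rewrite I. exact Hz.
Qed.

Lemma INR_step (x s : R) : 0 <= x -> 0 < s -> exists K, x <= INR K * s.
Proof.
  intros Hx Hs. destruct (INR_unbounded (x / s)) as [K HK]. exists K.
  apply Rmult_lt_compat_r with (r := s) in HK; [|exact Hs].
  unfold Rdiv in HK. rewrite Rmult_assoc, Rinv_l in HK by lra. lra.
Qed.

(** On a small enough square the height varies by at most 1/5, less than the gap between 1/2 and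
    3/4: either [f] stays bounded there or it stays away from 0. *)
Lemma small_cells (a b : Rbar) (f : C -> Cbar) (alpha beta : R) :
  meromorphic_almost_periodic a b f -> inner_strip alpha beta a b ->
  exists r0, 0 < r0 /\ forall r c, 0 < r <= r0 -> alpha <= Im c <= beta ->
    (forall z, sq c (16 * r) z -> strip a b z) /\
    ((forall z, sq c (16 * r) z -> 1 / 2 < tS (f z)) \/
     (forall z, sq c (16 * r) z -> tS (f z) < 3 / 4 /\ holo (fun z => invS (f z)) z /\ Cmod (invS (f z)) <= 2)).
Proof.
  intros Hf Hs. destruct (inner_strip_widen _ _ _ _ Hs) as [e [He Hw]].
  specialize (Hw e ltac:(lra)).
  destruct (spherical_uniform a b f _ _ (1 / 5) Hf Hw ltac:(lra)) as [d [Hd HU]].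
  set (r0 := Rmin e d / 80).
  assert (Hr0 : 0 < r0) by (unfold r0; assert (0 < Rmin e d) by (apply Rmin_pos; assumption); lra).
  assert (R1 : 80 * r0 <= e) by (unfold r0; assert (Rmin e d <= e) by apply Rmin_l; lra).
  assert (R2 : 80 * r0 <= d) by (unfold r0; assert (Rmin e d <= d) by apply Rmin_r; lra).
  exists r0. split; [exact Hr0|]. intros r c Hr Hc.
  assert (Hin : forall z, sq c (16 * r) z -> alpha - e <= Im z <= beta + e) by (intros z [_ Hz]; lra).
  assert (Hst : forall z, sq c (16 * r) z -> strip a b z).
  { intros z Hz. apply (inner_strip_in _ _ _ _ z Hw), Hin, Hz. }
  split; [exact Hst|].
  destruct (classic (forall z, sq c (16 * r) z -> tS (f z) < 3 / 4)) as [T|N].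
  - right. intros z Hz. specialize (T z Hz). split; [exact T|split].
    + apply (meromorphic_inv_holo a b f z (proj1 Hf) (Hst z Hz)). lra.
    + apply invS_le_2, T.
  - left. apply not_all_ex_not in N. destruct N as [z0 N]. apply imply_to_and in N. destruct N as [Hz0 N].
    intros z Hz.
    assert (D : Cmod (z - z0)%C < d).
    { eapply Rle_lt_trans. apply (Cmod_le_of_box z z0 (32 * r) (32 * r)); destruct Hz, Hz0; lra. lra. }
    destruct (HU z0 z (Hin z0 Hz0) (Hin z Hz) D) as [K _]. apply Rabs_le_between in K. lra.
Qed.

Lemma finite_point (a b : Rbar) (f : C -> Cbar) (y : R) : meromorphic_on (strip a b) f ->
  Rbar_lt a y -> Rbar_lt y b -> exists z0, Im z0 = y /\ f z0 <> Cinf.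
Proof.
  intros Hf H1 H2. destruct (classic (f (0, y) = Cinf)) as [E|N].
  - destruct (meromorphic_pole a b f (0, y) Hf (conj H1 H2) E 1) as [d [Hd K]].
    exists (d / 2, y). split; [reflexivity|]. apply K.
    + apply neq_of_re. unfold Re; simpl. lra.
    + rewrite Cmod_horiz, Rminus_0_r, Rabs_pos_eq; lra.
  - exists (0, y). split; [reflexivity|exact N].
Qed.

Lemma tS_pos (u : Cbar) : u <> Cinf -> 0 < tS u.
Proof.
  intros N. rewrite (finite_affine u N). unfold tS. apply Rinv_0_lt_compat, one_plus_sq_pos.
Qed.

(* Almost periodicity brings a point where [f] is not large to within a bounded
   distance of [q]; from there, quantitative uniqueness moves along a bounded
   number of overlapping squares. *)
Theorem nowhere_uniformly_infinite (a b : Rbar) (f : C -> Cbar) (alpha beta r : R) :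
  meromorphic_almost_periodic a b f -> inner_strip alpha beta a b -> 0 < r ->
  exists m, 0 < m /\ forall q, alpha <= Im q <= beta -> exists z, sq q r z /\ m <= tS (f z).
Proof.
  intros Hf Hs Hr.
  assert (Hab : alpha < beta) by (destruct Hs as [_ [H _]]; exact H).
  destruct (small_cells a b f alpha beta Hf Hs) as [r0 [Hr0 HC]].
  set (r1 := Rmin r r0). assert (Hr1 : 0 < r1) by (apply Rmin_pos; assumption).
  assert (R1 : r1 <= r) by apply Rmin_l. assert (R2 : r1 <= r0) by apply Rmin_r.
  destruct (finite_point a b f alpha (proj1 Hf)) as [z0 [Iz0 Fz0]].
  { apply Hs. } { apply Rbar_lt_trans with beta; [simpl; exact Hab|apply Hs]. }
  assert (T0 := tS_pos _ Fz0). set (t0 := tS (f z0)) in *.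
  destruct (ap_sclose a b f alpha beta (t0 / 2) Hf Hs ltac:(lra)) as [L [HL HA]].
  (* One step of the chain, by contraposition: if [1 / f] were tiny on the square [r1],
     [quantitative_uniqueness] would make it small on the square [3 / 2 * r1]. *)
  assert (Prop1 : forall m, 0 < m -> exists m', 0 < m' /\ forall q, alpha <= Im q <= beta ->
    (exists z1, sq q (3 / 2 * r1) z1 /\ m <= tS (f z1)) -> exists z, sq q r1 z /\ m' <= tS (f z)).
  { intros m Hm.
    destruct (pow_lt_1_zero (3 / 4)) with (y := m / 16) as [K HK]; [rewrite Rabs_pos_eq; lra|lra|].
    specialize (HK K (Nat.le_refl K)). rewrite Rabs_pos_eq in HK by (apply pow_le; lra).
    destruct (quantitative_uniqueness K) as [A [HA1 HQ]].
    (* With this choice [A * mu] and [2 * (3 / 4) ^ K] are at most [m / 8] each, which contradicts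
       the lower bound [tS / 2] for [1 / f] at [z1]. *)
    set (mu := m / (8 * A)). assert (Hmu : 0 < mu) by (apply Rdiv_lt_0_compat; lra).
    assert (Emu : A * mu = m / 8) by (unfold mu; field; lra).
    assert (Qmu := one_plus_sq_pos mu).
    set (m' := Rmin (1 / 2) (mu ^ 2 / (1 + mu ^ 2))).
    assert (Hm' : 0 < m').
    { apply Rmin_pos; [lra|]. apply Rdiv_lt_0_compat; [|exact Qmu]. apply pow_lt, Hmu. }
    assert (M1 : m' <= 1 / 2) by apply Rmin_l.
    assert (M2 : m' <= mu ^ 2 / (1 + mu ^ 2)) by apply Rmin_r.
    exists m'. split; [exact Hm'|]. intros q Hq [z1 [Hz1 Tz1]].
    destruct (HC r1 q (conj Hr1 R2) Hq) as [_ [HB|HB]].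
    - exists q. split; [apply sq_center; lra|]. assert (Q := HB q (sq_center q (16 * r1) ltac:(lra))). lra.
    - apply NNPP. intros N.
      assert (B : forall z, sq q r1 z -> Cmod (invS (f z)) <= mu).
      { intros z Hz. apply Rnot_lt_le. intros G. apply N. exists z. split; [exact Hz|].
        destruct (HB z) as [T _]; [apply (sq_le q r1); [lra|exact Hz]|].
        eapply Rle_trans; [exact M2|]. apply tS_ge_of_invS; lra. }
      assert (Z := HQ (fun z => invS (f z)) q r1 2 mu Hr1).
      assert (Z1 : Cmod (invS (f z1)) <= A * mu + 2 * (3 / 4) ^ K).
      { apply Z; [|exact B|exact Hz1]. intros z Hz. destruct (HB z) as [_ H]; [|exact H].
        apply (sq_le q (8 * r1)); [lra|exact Hz]. }
      destruct (HB z1) as [T _]; [apply (sq_le q (3 / 2 * r1)); [lra|exact Hz1]|].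
      assert (G := invS_ge _ T). lra. }
  assert (Chain : forall k, exists m, 0 < m /\ forall q p, alpha <= Im q <= beta -> alpha <= Im p <= beta ->
    t0 / 2 <= tS (f p) -> Rabs (Re p - Re q) <= INR k * (r1 / 2) -> Rabs (Im p - Im q) <= INR k * (r1 / 2) ->
    exists z, sq q r1 z /\ m <= tS (f z)).
  { induction k as [|k [m [Hm IH]]].
    - exists (t0 / 2). split; [lra|]. intros q p Hq Hp Tp H1 H2. exists p. split; [|exact Tp].
      simpl in H1, H2. rewrite Rmult_0_l in H1, H2. apply Rabs_le_between in H1. apply Rabs_le_between in H2.
      split; lra.
    - destruct (Prop1 m Hm) as [m' [Hm' P1]]. exists m'. split; [exact Hm'|].
      intros q p Hq Hp Tp H1 H2. apply P1; [exact Hq|].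
      assert (Pk : 0 < INR (S k)) by (apply lt_0_INR; lia). assert (Ek := S_INR k). assert (Nk := pos_INR k).
      set (l := / INR (S k)). assert (Hl : 0 < l) by (apply Rinv_0_lt_compat, Pk).
      assert (El : l * INR (S k) = 1) by (apply Rinv_l; lra).
      assert (Hl1 : l <= 1) by nra.
      (* The first of [S k] equal steps from [q] to [p], at most [r1 / 2] in each coordinate; hence
         the square [r1] about [q'] lies in the square [3 / 2 * r1] about [q]. *)
      set (q' := ((Re q + l * (Re p - Re q))%R, (Im q + l * (Im p - Im q))%R) : C).
      assert (Sc : forall x, Rabs x <= INR (S k) * (r1 / 2) -> - (r1 / 2) <= l * x <= r1 / 2 /\
        Rabs (x - l * x) <= INR k * (r1 / 2)).
      { intros x Hx. split.
        - apply Rabs_le_between. rewrite Rabs_mult, (Rabs_pos_eq l) by lra.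
          apply Rle_trans with (l * (INR (S k) * (r1 / 2))); [apply Rmult_le_compat_l; lra|].
          rewrite <- Rmult_assoc, El. lra.
        - replace (x - l * x) with ((1 - l) * x) by ring. rewrite Rabs_mult, (Rabs_pos_eq (1 - l)) by lra.
          apply Rle_trans with ((1 - l) * (INR (S k) * (r1 / 2))); [apply Rmult_le_compat_l; lra|].
          replace ((1 - l) * (INR (S k) * (r1 / 2))) with ((INR (S k) - l * INR (S k)) * (r1 / 2)) by ring.
          rewrite El, Ek. right. ring. }
      destruct (Sc _ H1) as [A1 A2]. destruct (Sc _ H2) as [A3 A4].
      destruct (IH q' p) as [z [Hz Tz]].
      + change (alpha <= Im q + l * (Im p - Im q) <= beta).
        assert (0 <= (1 - l) * (Im q - alpha)) by (apply Rmult_le_pos; lra).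
        assert (0 <= l * (Im p - alpha)) by (apply Rmult_le_pos; lra).
        assert (0 <= (1 - l) * (beta - Im q)) by (apply Rmult_le_pos; lra).
        assert (0 <= l * (beta - Im p)) by (apply Rmult_le_pos; lra). lra.
      + exact Hp.
      + exact Tp.
      + change (Re q') with (Re q + l * (Re p - Re q)). replace (Re p - (Re q + l * (Re p - Re q))) with ((Re p - Re q) - l * (Re p - Re q)) by ring. exact A2.
      + change (Im q') with (Im q + l * (Im p - Im q)). replace (Im p - (Im q + l * (Im p - Im q))) with ((Im p - Im q) - l * (Im p - Im q)) by ring. exact A4.
      + exists z. split; [|exact Tz]. destruct Hz as [Z1 Z2].
        change (Re q') with (Re q + l * (Re p - Re q)) in Z1.
        change (Im q') with (Im q + l * (Im p - Im q)) in Z2. split; lra. }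
  destruct (INR_step (L + (beta - alpha)) (r1 / 2)) as [K HK]; [lra|lra|].
  destruct (Chain K) as [m [Hm HCh]].
  exists m. split; [exact Hm|]. intros q Hq.
  destruct (HA (Re q - Re z0)) as [tau [Ht Htau]].
  destruct (HCh q (z0 + tau)%C Hq) as [z [Hz Tz]].
  - rewrite im_plus, im_RtoC, Iz0. lra.
  - destruct (Htau z0) as [T _]; [rewrite Iz0; lra|]. apply Rabs_le_between in T. fold t0 in T. lra.
  - rewrite re_plus, re_RtoC. apply Rabs_le. lra.
  - rewrite im_plus, im_RtoC, Iz0. apply Rabs_le. lra.
  - exists z. split; [apply (sq_le q r1); assumption|exact Tz].
Qed.

(** Choosing [m] by [epsilon] makes it a single function of the scale, common to all cells and all
    [r]. The widened strip accommodates the centres [p] around [c], and the half comes from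
    [invS_ge]. *)
Lemma cells (a b : Rbar) (f : C -> Cbar) (alpha beta : R) :
  meromorphic_almost_periodic a b f -> inner_strip alpha beta a b ->
  exists r0 m, 0 < r0 /\ (forall s, 0 < s -> 0 < m s) /\ forall r c, 0 < r <= r0 -> alpha <= Im c <= beta ->
    (forall z, sq c (16 * r) z -> strip a b z) /\
    ((forall z, sq c (16 * r) z -> 1 / 2 < tS (f z)) \/
     ((forall z, sq c (16 * r) z -> tS (f z) < 3 / 4) /\ nondegenerate r 2 m c (fun z => invS (f z)))).
Proof.
  intros Hf Hs. destruct (inner_strip_widen _ _ _ _ Hs) as [e [He Hw]].
  specialize (Hw e ltac:(lra)).
  destruct (small_cells a b f alpha beta Hf Hs) as [r0 [Hr0 HC]].
  set (m := fun s => epsilon (inhabits 0) (fun m => 0 < m /\ forall q, alpha - e <= Im q <= beta + e ->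
    exists z, sq q s z /\ m <= tS (f z))).
  assert (Hm : forall s, 0 < s -> 0 < m s /\ forall q, alpha - e <= Im q <= beta + e ->
    exists z, sq q s z /\ m s <= tS (f z)).
  { intros s Hs'. unfold m. apply epsilon_spec.
    apply (nowhere_uniformly_infinite a b f (alpha - e) (beta + e) s Hf Hw Hs'). }
  exists (Rmin r0 (e / 4)), (fun s => m s / 2). split; [apply Rmin_pos; lra|split].
  { intros s Hs'. destruct (Hm s Hs'). lra. }
  intros r c Hr Hc.
  assert (R1 : r <= r0) by (eapply Rle_trans; [apply Hr|apply Rmin_l]).
  assert (R2 : r <= e / 4) by (eapply Rle_trans; [apply Hr|apply Rmin_r]).
  destruct (HC r c ltac:(lra) Hc) as [H1 [H2|H2]]; (split; [exact H1|]); [left; exact H2|right].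
  split; [intros z Hz; apply H2, Hz|]. split; [intros z Hz; apply H2, Hz|].
  intros p s Hp Hs'. destruct (Hm s ltac:(lra)) as [Ms K].
  destruct (K p) as [z [Hz Tz]]; [destruct Hp; lra|].
  exists z. split; [exact Hz|].
  destruct (H2 z) as [T _].
  { apply (sq_le c (4 * r + s)); [lra|]. apply (sq_trans c p); assumption. }
  assert (G := invS_ge _ T). lra.
Qed.

(** For each point one of the two outer quarters of the interval stays a quarter of the length away
    from it; the remaining points are treated inside that quarter. *)
Lemma avoid_points (L : list R) : forall u v, u < v ->
  exists s, u <= s <= v /\ forall x, In x L -> (v - u) / 4 ^ length L <= Rabs (s - x).
Proof.
  induction L as [|x L IH]; intros u v Huv.
  - exists u. split; [lra|]. intros x [].
  - assert (P : 0 < 4 ^ length L) by (apply pow_lt; lra).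
    assert (Hp : 1 <= 4 ^ length L) by (apply pow_R1_Rle; lra).
    assert (Q : (v - u) / 4 ^ length (x :: L) <= (v - u) / 4).
    { simpl. unfold Rdiv. rewrite Rinv_mult. rewrite <- (Rmult_1_r ((v - u) * / 4)).
      rewrite <- Rmult_assoc. apply Rmult_le_compat_l; [lra|].
      rewrite <- Rinv_1. apply Rinv_le_contravar; lra. }
    assert (Step : forall u', u <= u' <= u + (v - u) * (3 / 4) ->
      (forall s, u' <= s <= u' + (v - u) / 4 -> (v - u) / 4 <= Rabs (s - x)) ->
      exists s, u <= s <= v /\ forall y, In y (x :: L) -> (v - u) / 4 ^ length (x :: L) <= Rabs (s - y)).
    { intros u' Hu' Hx. destruct (IH u' (u' + (v - u) / 4)) as [s [Hs K]]; [lra|].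
      exists s. split; [lra|]. intros y [<-|Hy].
      - eapply Rle_trans; [exact Q|]. apply Hx, Hs.
      - eapply Rle_trans; [|apply K, Hy]. simpl. right. field. lra. }
    destruct (Rle_or_lt x ((u + v) / 2)) as [Hx|Hx].
    + apply (Step (u + (v - u) * (3 / 4))); [lra|]. intros s Hs. rewrite Rabs_pos_eq; lra.
    + apply (Step u); [lra|]. intros s Hs. rewrite Rabs_minus_sym, Rabs_pos_eq; lra.
Qed.

Lemma W_lower (A : list C) (z : C) (d : R) : 0 <= d -> (forall a, In a A -> d <= Cmod (z - a)%C) ->
  d ^ length A <= Cmod (W A z).
Proof.
  intros Hd. induction A as [|a A IH]; intros H; simpl.
  - rewrite Cmod_1. lra.
  - rewrite Cmod_mult. apply Rmult_le_compat; [exact Hd|apply pow_le, Hd| |].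
    + apply H. left. reflexivity.
    + apply IH. intros b Hb. apply H. right. exact Hb.
Qed.

Lemma pow_le_le1 (x : R) (n N : nat) : 0 <= x <= 1 -> (n <= N)%nat -> x ^ N <= x ^ n.
Proof.
  intros Hx H. induction H as [|N H IH]; [lra|]. simpl. assert (0 <= x ^ N) by (apply pow_le; lra). nra.
Qed.

(** A square contour can be close to a zero of [1 / f] only if its radius is close to a coordinate
    distance of that zero from [c]. These are at most [2 * N] values; a radius that avoids them
    bounds [W] below, and [zero_list] bounds the other factor. *)
Theorem good_contour (a b : Rbar) (f : C -> Cbar) (alpha beta : R) :
  meromorphic_almost_periodic a b f -> inner_strip alpha beta a b ->
  exists r m, 0 < r /\ 0 < m /\ forall c, alpha <= Im c <= beta ->
    (forall z, sq c r z -> strip a b z) /\ exists s, 0 < s <= r /\ forall z, sqb c s z -> m <= tS (f z).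
Proof.
  intros Hf Hs. destruct (cells a b f alpha beta Hf Hs) as [r [m [Hr [Hm HC]]]].
  destruct (zero_list r 2 m Hr ltac:(lra) Hm) as [N [l [Hl HZ]]].
  set (d := Rmin 1 ((r - r / 2) / 4 ^ (2 * N))).
  assert (P4 : 0 < 4 ^ (2 * N)) by (apply pow_lt; lra).
  assert (Hd : 0 < d) by (apply Rmin_pos; [lra|apply Rdiv_lt_0_compat; lra]).
  assert (D1 : d <= 1) by apply Rmin_l.
  assert (D2 : d <= (r - r / 2) / 4 ^ (2 * N)) by apply Rmin_r.
  assert (PdN : 0 < d ^ N) by (apply pow_lt, Hd).
  set (mu := d ^ N * l). assert (Hmu : 0 < mu) by (apply Rmult_lt_0_compat; assumption).
  assert (Q := one_plus_sq_pos mu).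
  assert (Hmm : 0 < mu ^ 2 / (1 + mu ^ 2)) by (apply Rdiv_lt_0_compat; [apply pow_lt|]; assumption).
  exists r, (Rmin (1 / 2) (mu ^ 2 / (1 + mu ^ 2))).
  split; [exact Hr|split; [apply Rmin_pos; lra|]].
  intros c Hc. destruct (HC r c ltac:(lra) Hc) as [H1 H2].
  split. { intros z Hz. apply H1, (sq_le c r); [lra|exact Hz]. }
  destruct H2 as [H2|[H2 H3]].
  - exists r. split; [lra|]. intros z Hz. eapply Rle_trans; [apply Rmin_l|]. left. apply H2.
    apply (sq_le c r); [lra|apply sqb_sq, Hz].
  - destruct (HZ c _ H3) as [A [G [LA [InA [EF [_ [_ LG]]]]]]].
    set (L := map (fun x => Rabs (Re x - Re c)) A ++ map (fun x => Rabs (Im x - Im c)) A).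
    destruct (avoid_points L (r / 2) r) as [s [Hs' HL]]; [lra|].
    assert (LL : (length L <= 2 * N)%nat) by (unfold L; rewrite length_app, !length_map; lia).
    assert (HL' : forall x, In x L -> d <= Rabs (s - x)).
    { intros x Hx. eapply Rle_trans; [exact D2|]. eapply Rle_trans; [|apply HL, Hx].
      unfold Rdiv. apply Rmult_le_compat_l; [lra|]. apply Rinv_le_contravar; [apply pow_lt; lra|].
      apply Rle_pow; [lra|exact LL]. }
    exists s. split; [lra|]. intros z Hz.
    assert (Hz16 : sq c (16 * r) z) by (apply (sq_le c s); [lra|apply sqb_sq, Hz]).
    assert (Dist : forall x, In x A -> d <= Cmod (z - x)%C).
    { intros x Hx.
      assert (I1 : d <= Rabs (s - Rabs (Re x - Re c))).
      { apply HL'. unfold L. apply in_or_app. left. apply (in_map (fun x => Rabs (Re x - Re c))), Hx. }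
      assert (I2 : d <= Rabs (s - Rabs (Im x - Im c))).
      { apply HL'. unfold L. apply in_or_app. right. apply (in_map (fun x => Rabs (Im x - Im c))), Hx. }
      assert (K1 := re_le_of_Cmod z x). assert (K2 := im_le_of_Cmod z x).
      destruct Hz as [_ Hz].
      destruct Hz as [Hz|[Hz|[Hz|Hz]]]; rewrite Hz in *;
        revert K1 K2 I1 I2; unfold Rabs; repeat destruct Rcase_abs; intros; lra. }
    assert (LF : mu <= Cmod (invS (f z))).
    { rewrite EF, Cmod_mult. unfold mu. apply Rmult_le_compat; try lra.
      - eapply Rle_trans; [apply (pow_le_le1 d (length A) N); [lra|exact LA]|]. apply W_lower; [lra|exact Dist].
      - apply LG. apply (sq_le c s); [lra|apply sqb_sq, Hz]. }
    eapply Rle_trans; [apply Rmin_r|]. apply tS_ge_of_invS; [lra| |exact LF].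
    specialize (H2 z Hz16). lra.
Qed.

(** * Products over the integers *)

Fixpoint PP (p : Z -> C) (lo : Z) (L : nat) : C :=
  match L with O => RtoC 1 | S k => (p lo * PP p (lo + 1) k)%C end.

Fixpoint SS (e : Z -> R) (lo : Z) (L : nat) : R :=
  match L with O => 0 | S k => e lo + SS e (lo + 1) k end.

Lemma PP_app (p : Z -> C) (L1 L2 : nat) : forall lo,
  PP p lo (L1 + L2) = (PP p lo L1 * PP p (lo + Z.of_nat L1) L2)%C.
Proof.
  induction L1 as [|L1 IH]; intros lo.
  - simpl. rewrite Z.add_0_r. ring.
  - simpl Nat.add. cbn [PP]. rewrite IH. replace (lo + Z.of_nat (S L1))%Z with (lo + 1 + Z.of_nat L1)%Z by lia. ring.
Qed.

Lemma SS_nonneg (e : Z -> R) (L : nat) : (forall n, 0 <= e n) -> forall lo, 0 <= SS e lo L.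
Proof.
  intros H. induction L as [|L IH]; intros lo; simpl; [lra|]. specialize (H lo). specialize (IH (lo + 1)%Z). lra.
Qed.

Lemma SS_scal (c : R) (e : Z -> R) (L : nat) : forall lo, SS (fun n => c * e n) lo L = c * SS e lo L.
Proof. induction L as [|L IH]; intros lo; simpl; [ring|]. rewrite IH. ring. Qed.

Lemma Cmod_near_1 (p : C) (e : R) : Cmod (p - 1)%C <= e -> Cmod p <= exp e.
Proof.
  intros H. eapply Rle_trans; [|apply exp_ineq1_le].
  replace p with (1 + (p - 1))%C by ring. eapply Rle_trans; [apply Cmod_triangle|]. rewrite Cmod_1. lra.
Qed.

Lemma PP_bound (p : Z -> C) (e : Z -> R) (L : nat) : forall lo,
  (forall n, Cmod (p n - 1)%C <= e n) -> Cmod (PP p lo L) <= exp (SS e lo L).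
Proof.
  induction L as [|L IH]; intros lo H; simpl.
  - rewrite Cmod_1, exp_0. lra.
  - rewrite Cmod_mult, exp_plus. apply Rmult_le_compat; try apply Cmod_ge_0.
    + apply Cmod_near_1, H.
    + apply IH, H.
Qed.

Lemma PP_bound_factor (p : Z -> C) (e : Z -> R) (L : nat) (n : Z) : forall lo,
  (forall k, Cmod (p k - 1)%C <= e k) -> (lo <= n < lo + Z.of_nat L)%Z ->
  Cmod (PP p lo L) <= Cmod (p n) * exp (SS e lo L).
Proof.
  induction L as [|L IH]; intros lo H Hn; [lia|]. simpl. rewrite Cmod_mult, exp_plus.
  assert (He : forall k, 0 <= e k) by (intros k; eapply Rle_trans; [apply Cmod_ge_0|apply H]).
  destruct (Z.eq_dec lo n) as [->|N].
  - apply Rmult_le_compat_l; [apply Cmod_ge_0|]. eapply Rle_trans; [apply (PP_bound p e), H|].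
    rewrite <- (Rmult_1_l (exp (SS e (n + 1) L))) at 1. apply Rmult_le_compat_r; [left; apply exp_pos|].
    rewrite <- exp_0. specialize (He n). destruct (Req_dec 0 (e n)) as [<-|N']; [lra|]. left. apply exp_increasing. lra.
  - replace (Cmod (p n) * (exp (e lo) * exp (SS e (lo + 1) L)))
      with (exp (e lo) * (Cmod (p n) * exp (SS e (lo + 1) L))) by ring.
    apply Rmult_le_compat; try apply Cmod_ge_0.
    + apply Cmod_near_1, H.
    + apply IH; [exact H|lia].
Qed.

(** Factors are exchanged one at a time, the others staying below the exponential of their summed
    errors. *)
Lemma PP_diff (p q : Z -> C) (e : Z -> R) (L : nat) : forall lo,
  (forall n, Cmod (p n - 1)%C <= e n) -> (forall n, Cmod (q n - 1)%C <= e n) ->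
  Cmod (PP p lo L - PP q lo L)%C <= exp (SS e lo L) * SS (fun n => Cmod (p n - q n)%C) lo L.
Proof.
  induction L as [|L IH]; intros lo Hp Hq; simpl.
  - rewrite Cmod_diag. lra.
  - replace (p lo * PP p (lo + 1) L - q lo * PP q (lo + 1) L)%C
      with (p lo * (PP p (lo + 1) L - PP q (lo + 1) L) + (p lo - q lo) * PP q (lo + 1) L)%C by ring.
    eapply Rle_trans; [apply Cmod_triangle|]. rewrite !Cmod_mult, exp_plus, Rmult_plus_distr_l, Rplus_comm.
    assert (He : forall k, 0 <= e k) by (intros k; eapply Rle_trans; [apply Cmod_ge_0|apply Hp]).
    assert (E1 : 1 <= exp (e lo)).
    { eapply Rle_trans; [|apply exp_ineq1_le]. specialize (He lo). lra. }
    assert (B := PP_bound q e L (lo + 1) Hq).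
    apply Rplus_le_compat.
    + rewrite Rmult_comm. apply Rmult_le_compat_r; [apply Cmod_ge_0|].
      eapply Rle_trans; [exact B|]. rewrite <- (Rmult_1_l (exp (SS e (lo + 1) L))) at 1.
      apply Rmult_le_compat_r; [left; apply exp_pos|exact E1].
    + replace (exp (e lo) * exp (SS e (lo + 1) L) * SS (fun n => Cmod (p n - q n)%C) (lo + 1) L)
        with (exp (e lo) * (exp (SS e (lo + 1) L) * SS (fun n => Cmod (p n - q n)%C) (lo + 1) L)) by ring.
      apply Rmult_le_compat; try apply Cmod_ge_0; [apply Cmod_near_1, Hp|apply IH; assumption].
Qed.

Lemma PP_one (lo : Z) (L : nat) : PP (fun _ => RtoC 1) lo L = RtoC 1.
Proof. revert lo. induction L as [|L IH]; intros lo; simpl; [reflexivity|]. rewrite IH. ring. Qed.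

Lemma SS_le (e e' : Z -> R) (L : nat) : (forall n, e n <= e' n) -> forall lo, SS e lo L <= SS e' lo L.
Proof.
  intros H. induction L as [|L IH]; intros lo; simpl; [lra|]. specialize (H lo). specialize (IH (lo + 1)%Z). lra.
Qed.

Lemma PP_near_1 (p : Z -> C) (e : Z -> R) (L : nat) (lo : Z) :
  (forall n, Cmod (p n - 1)%C <= e n) -> Cmod (PP p lo L - 1)%C <= exp (SS e lo L) * SS e lo L.
Proof.
  intros H. assert (He : forall k, 0 <= e k) by (intros k; eapply Rle_trans; [apply Cmod_ge_0|apply H]).
  rewrite <- (PP_one lo L) at 1. eapply Rle_trans.
  - apply (PP_diff p (fun _ => RtoC 1) e L lo H). intros n. rewrite Cmod_diag. apply He.
  - apply Rmult_le_compat_l; [left; apply exp_pos|]. apply SS_le, H.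
Qed.

Lemma PP_shift (p : Z -> C) (M : Z) (L : nat) : forall lo, PP (fun n => p (n + M)%Z) lo L = PP p (lo + M) L.
Proof.
  induction L as [|L IH]; intros lo; simpl; [reflexivity|]. rewrite IH.
  replace (lo + 1 + M)%Z with (lo + M + 1)%Z by lia. reflexivity.
Qed.

Lemma holo_PP (h : Z -> C -> C) (L : nat) (z : C) : (forall n, holo (h n) z) ->
  forall lo, holo (fun w => PP (fun n => h n w) lo L) z.
Proof.
  intros H. induction L as [|L IH]; intros lo; simpl; [apply holo_const|].
  apply (holo_mult (h lo) (fun w => PP (fun n => h n w) (lo + 1) L)); [apply H|apply IH].
Qed.

Definition decay (x : R) : R := / (1 + x ^ 2).

Lemma decay_pos (x : R) : 0 < decay x.
Proof. apply Rinv_0_lt_compat, one_plus_sq_pos. Qed.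

Lemma decay_le_1 (x : R) : decay x <= 1.
Proof.
  unfold decay. rewrite <- Rinv_1. apply Rinv_le_contravar; [lra|]. generalize (pow2_ge_0 x). lra.
Qed.

(** 33 comes from [1 + y ^ 2 <= 1 + 2 * x ^ 2 + 2 * 16]. A shift by 4 covers the horizontal
    displacements inside a cell. *)
Lemma decay_shift (x y : R) : Rabs (x - y) <= 4 -> decay x <= 33 * decay y.
Proof.
  intros H. apply Rabs_le_between in H. unfold decay.
  assert (P1 := one_plus_sq_pos x). assert (P2 := one_plus_sq_pos y).
  apply Rmult_le_reg_r with ((1 + x ^ 2) * (1 + y ^ 2)); [nra|].
  replace (/ (1 + x ^ 2) * ((1 + x ^ 2) * (1 + y ^ 2))) with (1 + y ^ 2) by (field; lra).
  replace (33 * / (1 + y ^ 2) * ((1 + x ^ 2) * (1 + y ^ 2))) with (33 * (1 + x ^ 2)) by (field; lra).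
  assert (K1 : 0 <= (x + (x - y)) ^ 2) by apply pow2_ge_0.
  assert (K2 : 0 <= (4 - (x - y)) * (4 + (x - y))) by (apply Rmult_le_pos; lra).
  assert (K3 := pow2_ge_0 x). lra.
Qed.

(* The increments of [atan] dominate the terms, which makes the sum telescope. *)
Lemma SS_decay (s x : R) (L : nat) : 0 < s <= 1 -> forall lo,
  SS (fun n => decay (x - IZR n * s)) lo L <= 3 / s * (atan (IZR (lo + Z.of_nat L) * s - x) - atan (IZR lo * s - x)).
Proof.
  intros Hs. induction L as [|L IH]; intros lo.
  - cbn [SS]. rewrite Z.add_0_r. right. ring.
  - cbn [SS]. specialize (IH (lo + 1)%Z).
    replace (lo + Z.of_nat (S L))%Z with (lo + 1 + Z.of_nat L)%Z by lia.
    set (y := IZR lo * s - x) in *.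
    assert (Ey : IZR (lo + 1) * s - x = y + s) by (rewrite plus_IZR; unfold y; ring).
    rewrite Ey in IH.
    assert (K : decay (x - IZR lo * s) <= 3 / s * (atan (y + s) - atan y)).
    { destruct (MVT_gen atan y (y + s) (fun t => / (1 + t ^ 2))) as [c [Hc E]].
      - intros t _. apply is_derive_Reals. apply derivable_pt_lim_atan.
      - intros t _. apply derivable_continuous_pt. exists (/ (1 + t ^ 2)). apply derivable_pt_lim_atan.
      - rewrite E. replace (y + s - y) with s by ring. rewrite Rmin_left, Rmax_right in Hc by lra.
        replace (x - IZR lo * s) with (- y) by (unfold y; ring). unfold decay.
        replace ((- y) ^ 2) with (y ^ 2) by ring.
        replace (3 / s * (/ (1 + c ^ 2) * s)) with (3 * / (1 + c ^ 2)) by (field; split; [generalize (pow2_ge_0 c)|]; lra).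
        assert (P1 := one_plus_sq_pos c). assert (P2 := one_plus_sq_pos y).
        apply Rmult_le_reg_r with ((1 + c ^ 2) * (1 + y ^ 2)); [nra|].
        replace (/ (1 + y ^ 2) * ((1 + c ^ 2) * (1 + y ^ 2))) with (1 + c ^ 2) by (field; lra).
        replace (3 * / (1 + c ^ 2) * ((1 + c ^ 2) * (1 + y ^ 2))) with (3 * (1 + y ^ 2)) by (field; lra).
        assert (K1 : 0 <= (y - (c - y)) ^ 2) by apply pow2_ge_0.
        assert (K2 : 0 <= (1 - (c - y)) * (1 + (c - y))) by (apply Rmult_le_pos; lra).
        assert (K3 := pow2_ge_0 y). lra. }
    lra.
Qed.

Lemma SS_decay_total (s x : R) (L : nat) (lo : Z) : 0 < s <= 1 ->
  SS (fun n => decay (x - IZR n * s)) lo L <= 3 / s * PI.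
Proof.
  intros Hs. eapply Rle_trans; [apply SS_decay, Hs|].
  apply Rmult_le_compat_l; [left; apply Rdiv_lt_0_compat; lra|].
  assert (B1 := atan_bound (IZR (lo + Z.of_nat L) * s - x)). assert (B2 := atan_bound (IZR lo * s - x)). lra.
Qed.

Lemma SS_decay_tail (s X eps : R) : 0 < s <= 1 -> 0 < eps -> exists N : nat, forall x lo L, Rabs x <= X ->
  (Z.of_nat N <= lo)%Z \/ (lo + Z.of_nat L <= - Z.of_nat N)%Z ->
  SS (fun n => decay (x - IZR n * s)) lo L <= eps.
Proof.
  intros Hs He. set (e := Rmin (eps * s / 3) 1). assert (P := PI_RGT_0). assert (P3 := PI2_3_2).
  assert (He0 : 0 < e) by (apply Rmin_pos; [apply Rdiv_lt_0_compat; [apply Rmult_lt_0_compat|]|]; lra).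
  assert (He1 : e <= 1) by apply Rmin_r. assert (He2 : e <= eps * s / 3) by apply Rmin_l.
  (* Beyond [t] the arctangent is within [e] of its limit, which bounds the telescoped tail. *)
  set (t := tan (PI / 2 - e)).
  assert (Et : atan t = PI / 2 - e) by (apply atan_tan; lra).
  destruct (INR_step (Rmax 0 (t + X + 1)) s) as [N HN]; [apply Rmax_l|lra|].
  assert (HN' : t + X + 1 <= INR N * s) by (eapply Rle_trans; [apply Rmax_r|exact HN]).
  rewrite INR_IZR_INZ in HN'.
  exists N. intros x lo L Hx HL. apply Rabs_le_between in Hx.
  eapply Rle_trans; [apply SS_decay, Hs|].
  apply Rle_trans with (3 / s * e).
  - apply Rmult_le_compat_l; [left; apply Rdiv_lt_0_compat; lra|].
    assert (B1 := atan_bound (IZR (lo + Z.of_nat L) * s - x)). assert (B2 := atan_bound (IZR lo * s - x)).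
    destruct HL as [HL|HL].
    + assert (K : t < IZR lo * s - x).
      { apply IZR_le in HL. assert (IZR (Z.of_nat N) * s <= IZR lo * s) by (apply Rmult_le_compat_r; lra). lra. }
      apply atan_increasing in K. lra.
    + assert (K : IZR (lo + Z.of_nat L) * s - x < - t).
      { apply IZR_le in HL. rewrite opp_IZR in HL.
        assert (IZR (lo + Z.of_nat L) * s <= - IZR (Z.of_nat N) * s) by (apply Rmult_le_compat_r; lra). lra. }
      apply atan_increasing in K. rewrite atan_opp in K. lra.
  - apply Rle_trans with (3 / s * (eps * s / 3)); [|right; field; lra].
    apply Rmult_le_compat_l; [left; apply Rdiv_lt_0_compat; lra|exact He2].
Qed.

Lemma complex_Cauchy_limit (u : nat -> C) : (forall eps, 0 < eps -> exists N, forall n, (N <= n)%nat ->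
  Cmod (u n - u N)%C <= eps) -> exists l, forall eps, 0 < eps -> exists N, forall n, (N <= n)%nat -> Cmod (u n - l)%C <= eps.
Proof.
  intros H.
  assert (K : forall pr : C -> R, (forall a b, Rabs (pr a - pr b) <= Cmod (a - b)%C) ->
    exists x, forall eps, 0 < eps -> exists N, forall n, (N <= n)%nat -> Rabs (pr (u n) - x) <= eps).
  { intros pr Hpr. destruct (Rcomplete.R_complete (fun n => pr (u n))) as [x Hx].
    - intros eps Heps. destruct (H (eps / 4)) as [N HN]; [lra|]. exists N. intros n m Hn Hm.
      unfold Rdist. eapply Rle_lt_trans; [apply Hpr|].
      replace (u n - u m)%C with ((u n - u N) - (u m - u N))%C by ring.
      eapply Rle_lt_trans; [apply Cmod_triangle_minus|].
      assert (A1 := HN n Hn). assert (A2 := HN m Hm). lra.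
    - exists x. intros eps Heps. destruct (Hx eps Heps) as [N HN]. exists N. intros n Hn. left. apply HN, Hn. }
  destruct (K Re re_le_of_Cmod) as [x Hx]. destruct (K Im im_le_of_Cmod) as [y Hy].
  exists (x, y). intros eps Heps.
  destruct (Hx (eps / 2)) as [N1 H1]; [lra|]. destruct (Hy (eps / 2)) as [N2 H2]; [lra|].
  exists (Nat.max N1 N2). intros n Hn. eapply Rle_trans; [apply Cmod_le_re_im|]. rewrite re_minus, im_minus.
  assert (A1 := H1 n ltac:(lia)). assert (A2 := H2 n ltac:(lia)). unfold Re at 2, Im at 2; simpl. lra.
Qed.

(** The two ends of the window go to infinity independently, so the limit is unchanged when the
    indices are shifted. *)
Definition product_limit (p : Z -> C) (l : C) : Prop :=
  forall eps, 0 < eps -> exists K : Z, forall lo L, (lo <= - K)%Z -> (K <= lo + Z.of_nat L)%Z ->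
    Cmod (PP p lo L - l)%C <= eps.

(** A large window differs from a central one by two outer blocks, which the tail of [decay] brings
    close to 1, uniformly for [z] in a bounded set. This gives the Cauchy property and a locally
    uniform limit. *)
Theorem integer_product (s : R) (h : Z -> C -> C) : 0 < s <= 1 ->
  (forall n z, holo (h n) z) ->
  (forall V, exists B, 0 <= B /\ forall n z, Rabs (Im z) <= V -> Cmod (h n z - 1)%C <= B * decay (Re z - IZR n * s)) ->
  exists H : C -> C, (forall z, holo H z) /\ forall z, product_limit (fun n => h n z) (H z).
Proof.
  intros Hs Hh HB.
  assert (Main : forall X V eps, 0 < eps -> exists N : nat, forall z, Rabs (Re z) <= X -> Rabs (Im z) <= V ->
    forall lo L, (lo <= - Z.of_nat N)%Z -> (Z.of_nat N <= lo + Z.of_nat L)%Z ->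
    Cmod (PP (fun n => h n z) lo L - PP (fun n => h n z) (- Z.of_nat N) (2 * N))%C <= eps).
  { intros X V eps Heps. destruct (HB V) as [B [HB0 HBV]].
    set (D := exp (B * (3 / s * PI))). assert (HD : 0 < D) by apply exp_pos.
    destruct (SS_decay_tail s X (eps / (2 * D * D * D * (B + 1))) Hs) as [N HN].
    { apply Rdiv_lt_0_compat; [exact Heps|]. repeat apply Rmult_lt_0_compat; lra. }
    exists N. intros z HX HV lo L Hlo HL.
    set (p := fun n => h n z). set (e := fun n => B * decay (Re z - IZR n * s)).
    assert (He : forall n, Cmod (p n - 1)%C <= e n) by (intros n; apply HBV, HV).
    assert (ES : forall lo L, exp (SS e lo L) <= D).
    { intros lo' L'. unfold e. rewrite SS_scal. apply Rnot_lt_le. intros K. apply exp_lt_inv in K.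
      assert (T := SS_decay_total s (Re z) L' lo' Hs). nra. }
    set (L1 := Z.to_nat (- Z.of_nat N - lo)). set (L3 := Z.to_nat (lo + Z.of_nat L - Z.of_nat N)).
    assert (EL : L = (L1 + (2 * N + L3))%nat) by (unfold L1, L3; lia).
    rewrite EL, PP_app, PP_app.
    replace (lo + Z.of_nat L1)%Z with (- Z.of_nat N)%Z by (unfold L1; lia).
    replace (- Z.of_nat N + Z.of_nat (2 * N))%Z with (Z.of_nat N) by lia.
    set (P1 := PP p lo L1). set (P2 := PP p (- Z.of_nat N) (2 * N)). set (P3 := PP p (Z.of_nat N) L3).
    assert (T1 : SS e lo L1 <= eps / (2 * D * D * D)).
    { unfold e. rewrite SS_scal. apply Rle_trans with (B * (eps / (2 * D * D * D * (B + 1)))).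
      - apply Rmult_le_compat_l; [exact HB0|]. apply HN; [exact HX|]. right. unfold L1. lia.
      - apply Rle_trans with ((B + 1) * (eps / (2 * D * D * D * (B + 1)))); [|right; field; lra].
        apply Rmult_le_compat_r; [|lra]. left. apply Rdiv_lt_0_compat; [exact Heps|]. repeat apply Rmult_lt_0_compat; lra. }
    assert (T3 : SS e (Z.of_nat N) L3 <= eps / (2 * D * D * D)).
    { unfold e. rewrite SS_scal. apply Rle_trans with (B * (eps / (2 * D * D * D * (B + 1)))).
      - apply Rmult_le_compat_l; [exact HB0|]. apply HN; [exact HX|]. left. lia.
      - apply Rle_trans with ((B + 1) * (eps / (2 * D * D * D * (B + 1)))); [|right; field; lra].
        apply Rmult_le_compat_r; [|lra]. left. apply Rdiv_lt_0_compat; [exact Heps|]. repeat apply Rmult_lt_0_compat; lra. }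
    assert (Se : forall lo L, 0 <= SS e lo L).
    { intros. apply SS_nonneg. intros n. eapply Rle_trans; [apply Cmod_ge_0|apply He]. }
    assert (N1 : Cmod (P1 - 1)%C <= D * (eps / (2 * D * D * D))).
    { eapply Rle_trans; [apply PP_near_1, He|]. apply Rmult_le_compat; auto. left. apply exp_pos. }
    assert (N3 : Cmod (P3 - 1)%C <= D * (eps / (2 * D * D * D))).
    { eapply Rle_trans; [apply PP_near_1, He|]. apply Rmult_le_compat; auto. left. apply exp_pos. }
    assert (B2 : Cmod P2 <= D) by (eapply Rle_trans; [apply PP_bound, He|apply ES]).
    assert (B3 : Cmod P3 <= D) by (eapply Rle_trans; [apply PP_bound, He|apply ES]).
    assert (D1 : 1 <= D).
    { unfold D. rewrite <- exp_0. apply Rnot_lt_le. intros K. apply exp_lt_inv in K.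
      assert (0 < 3 / s * PI) by (apply Rmult_lt_0_compat; [apply Rdiv_lt_0_compat; lra|apply PI_RGT_0]). nra. }
    replace (P1 * (P2 * P3) - P2)%C with (P2 * ((P1 - 1) * P3 + (P3 - 1)))%C by ring.
    rewrite Cmod_mult. set (k := D * (eps / (2 * D * D * D))) in *.
    assert (Ek : k * (2 * D * D) = eps) by (unfold k; field; lra).
    assert (Pk : 0 <= k) by (eapply Rle_trans; [apply Cmod_ge_0|exact N1]).
    assert (Bs : Cmod ((P1 - 1) * P3 + (P3 - 1))%C <= k * D + k * D).
    { eapply Rle_trans; [apply Cmod_triangle|]. rewrite Cmod_mult. apply Rplus_le_compat.
      - apply Rmult_le_compat; try apply Cmod_ge_0; assumption.
      - eapply Rle_trans; [exact N3|]. nra. }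
    apply Rle_trans with (D * (k * D + k * D)); [|right; rewrite <- Ek; ring].
    apply Rmult_le_compat; try apply Cmod_ge_0; assumption. }
  assert (Lim : forall z, exists l, product_limit (fun n => h n z) l).
  { intros z. destruct (complex_Cauchy_limit (fun N => PP (fun n => h n z) (- Z.of_nat N) (2 * N))) as [l Hl].
    - intros eps Heps. destruct (Main (Rabs (Re z)) (Rabs (Im z)) eps Heps) as [N HN].
      exists N. intros n Hn. apply HN; try lra; lia.
    - exists l. intros eps Heps.
      destruct (Main (Rabs (Re z)) (Rabs (Im z)) (eps / 4)) as [N HN]; [lra|].
      destruct (Hl (eps / 4)) as [N' HN']; [lra|].
      set (M := Nat.max N N').
      exists (Z.of_nat N). intros lo L H1 H2.
      assert (A1 := HN z ltac:(lra) ltac:(lra) lo L H1 H2).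
      assert (A2 := HN z ltac:(lra) ltac:(lra) (- Z.of_nat M)%Z (2 * M)%nat ltac:(lia) ltac:(lia)).
      assert (A3 := HN' M ltac:(lia)). cbv beta in A3.
      match goal with |- Cmod (?a - l)%C <= _ => match type of A1 with Cmod (_ - ?b)%C <= _ =>
        match type of A2 with Cmod (?c - _)%C <= _ =>
        replace (a - l)%C with ((a - b) - (c - b) + (c - l))%C by ring end end end.
      eapply Rle_trans; [apply Cmod_triangle|]. eapply Rle_trans; [apply Rplus_le_compat_r, Cmod_triangle_minus|]. lra. }
  exists (fun z => epsilon (inhabits (RtoC 0)) (fun l => product_limit (fun n => h n z) l)).
  set (H := fun z => epsilon (inhabits (RtoC 0)) (fun l => product_limit (fun n => h n z) l)).
  assert (HL : forall z, product_limit (fun n => h n z) (H z)) by (intros z; apply epsilon_spec, Lim).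
  split; [|exact HL]. intros z. fold H.
  apply (holo_uniform_limit (fun k => fun w => PP (fun n => h n w) (- Z.of_nat k) (2 * k)) H z 1); [lra| |].
  - intros k w _. apply holo_PP. intros n. apply Hh.
  - intros eps Heps. destruct (Main (Rabs (Re z) + 1) (Rabs (Im z) + 1) (eps / 2)) as [N HN]; [lra|].
    exists N. intros w Hw.
    assert (Rw : Rabs (Re w) <= Rabs (Re z) + 1).
    { replace (Re w) with (Re z + (Re w - Re z)) by ring. eapply Rle_trans; [apply Rabs_triang|].
      assert (T := re_le_of_Cmod w z). lra. }
    assert (Iw : Rabs (Im w) <= Rabs (Im z) + 1).
    { replace (Im w) with (Im z + (Im w - Im z)) by ring. eapply Rle_trans; [apply Rabs_triang|].
      assert (T := im_le_of_Cmod w z). lra. }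
    destruct (HL w (eps / 2)) as [K HK]; [lra|].
    set (M := Nat.max N (Z.to_nat K)).
    assert (A1 := HN w Rw Iw (- Z.of_nat M)%Z (2 * M)%nat ltac:(lia) ltac:(lia)).
    assert (A2 := HK (- Z.of_nat M)%Z (2 * M)%nat ltac:(lia) ltac:(lia)).
    match goal with |- Cmod (?a - _)%C <= _ => match type of A2 with Cmod (?b - _)%C <= _ =>
      replace (a - H w)%C with ((b - H w) - (b - a))%C by ring end end.
    eapply Rle_trans; [apply Cmod_triangle_minus|]. lra.
Qed.

(** * Products killing the poles of a row *)

Definition kern (kappa mu : R) (w : C) : C := Cexp ((- kappa)%R * (w * w) - Ci * (mu * w))%C.

Lemma kern_0 (kappa mu : R) : kern kappa mu 0 = RtoC 1.
Proof. unfold kern. rewrite <- Cexp_0. f_equal. ring. Qed.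

Lemma holo_kern (kappa mu : R) (w : C) : holo (kern kappa mu) w.
Proof.
  apply (holo_comp (fun w => (- kappa)%R * (w * w) - Ci * (mu * w))%C Cexp); [|apply holo_Cexp].
  apply holo_minus.
  - apply (holo_mult (fun _ => RtoC (- kappa))); [apply holo_const|]. apply holo_mult; apply holo_id.
  - apply (holo_mult (fun _ => Ci)); [apply holo_const|].
    apply (holo_mult (fun _ => RtoC mu)); [apply holo_const|apply holo_id].
Qed.

(** The two ways of making a kernel small are visible here: a large [kappa] where the horizontal
    distance exceeds the vertical one, and a large [mu] of the right sign where the vertical
    distance is bounded below. *)
Lemma Cmod_kern (kappa mu : R) (w : C) :
  Cmod (kern kappa mu w) = exp (- kappa * (Re w ^ 2 - Im w ^ 2) + mu * Im w).
Proof.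
  unfold kern. rewrite Cmod_Cexp. f_equal. destruct w as [u v].
  unfold Re, Im, Cminus, Cplus, Copp, Cmult, Ci, RtoC; simpl. ring.
Qed.

Lemma exp_le_compat (x y : R) : x <= y -> exp x <= exp y.
Proof. intros H. apply Rnot_lt_le. intros K. apply exp_lt_inv in K. lra. Qed.

Lemma exp_neg_sq_le_decay (x : R) : exp (- x ^ 2) <= decay x.
Proof.
  rewrite exp_Ropp. apply Rinv_le_contravar; [apply one_plus_sq_pos|apply exp_ineq1_le].
Qed.

Lemma kern_bound (kappa mu V : R) (w : C) : 1 <= kappa -> Rabs (Im w) <= V ->
  Cmod (kern kappa mu w) <= exp (kappa * V ^ 2 + Rabs mu * V) * decay (Re w).
Proof.
  intros Hk HV. rewrite Cmod_kern.
  assert (V2 : Im w ^ 2 <= V ^ 2) by (rewrite <- (pow2_abs (Im w)); apply pow_incr; split; [apply Rabs_pos|exact HV]).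
  assert (MV : mu * Im w <= Rabs mu * V).
  { eapply Rle_trans; [apply Rle_abs|]. rewrite Rabs_mult. apply Rmult_le_compat_l; [apply Rabs_pos|exact HV]. }
  apply Rle_trans with (exp (kappa * V ^ 2 + Rabs mu * V) * exp (- Re w ^ 2)).
  - rewrite <- exp_plus. apply exp_le_compat. assert (U2 := pow2_ge_0 (Re w)). nra.
  - apply Rmult_le_compat_l; [left; apply exp_pos|apply exp_neg_sq_le_decay].
Qed.

(** Schwarz's lemma for [F - F w], whose bound [2 * M] is divided by the radius. *)
Lemma Lipschitz_of_bound (F : C -> C) (w w' : C) (R0 M : R) : 0 < R0 ->
  (forall u, sq w R0 u -> holo F u /\ Cmod (F u) <= M) -> sq w R0 w' ->
  Cmod (F w' - F w)%C <= 2 * M / R0 * Cmod (w' - w)%C.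
Proof.
  intros HR HF Hw'.
  destruct (divide_zero (fun u => F u - F w)%C w R0 w) as [G [D E]].
  - split; lra.
  - intros u Hu. apply holo_minus; [apply HF, Hu|apply holo_const].
  - ring.
  - rewrite E, Cmod_mult, Rmult_comm. apply Rmult_le_compat_r; [apply Cmod_ge_0|].
    apply (maximum_principle G w R0); try assumption.
    intros u Hu. assert (T := sqb_dist w R0 0 u w Hu (sq_center w 0 (Rle_refl 0))).
    assert (K : Cmod (u - w)%C * Cmod (G u) <= 2 * M).
    { rewrite <- Cmod_mult, <- E. eapply Rle_trans; [apply Cmod_triangle_minus|].
      assert (A1 := proj2 (HF u (sqb_sq _ _ _ Hu))). assert (A2 := proj2 (HF w (sq_center w R0 (Rlt_le _ _ HR)))). lra. }
    apply Rmult_le_reg_l with R0; [exact HR|]. replace (R0 * (2 * M / R0)) with (2 * M) by (field; lra).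
    eapply Rle_trans; [|exact K]. apply Rmult_le_compat_r; [apply Cmod_ge_0|lra].
Qed.

(** Equal to 1 up to radius [r], to 0 from radius [2 * r] on, and linear in the sup norm distance
    between. Zero lists reach to [3 * r], so a zero that crosses their border is invisible to the
    product. *)
Definition cutoff (c : C) (r : R) (a : C) : R :=
  Rmax 0 (Rmin 1 (2 - Rmax (Rabs (Re a - Re c)) (Rabs (Im a - Im c)) / r)).

Lemma cutoff_range (c : C) (r : R) (a : C) : 0 <= cutoff c r a <= 1.
Proof.
  unfold cutoff. split; [apply Rmax_l|]. apply Rmax_lub; [lra|apply Rmin_l].
Qed.

Lemma cutoff_in (c : C) (r : R) (a : C) : 0 < r -> sq c r a -> cutoff c r a = 1.
Proof.
  intros Hr [H1 H2]. unfold cutoff.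
  assert (K : Rmax (Rabs (Re a - Re c)) (Rabs (Im a - Im c)) / r <= 1).
  { apply Rmult_le_reg_r with r; [exact Hr|]. unfold Rdiv. rewrite Rmult_assoc, Rinv_l by lra.
    rewrite Rmult_1_r, Rmult_1_l. apply Rmax_lub; apply Rabs_le; lra. }
  rewrite Rmin_left by lra. apply Rmax_right. lra.
Qed.

Lemma cutoff_out (c : C) (r : R) (a : C) : 0 < r -> ~ sq c (2 * r) a -> cutoff c r a = 0.
Proof.
  intros Hr N. unfold cutoff. apply Rmax_left. eapply Rle_trans; [apply Rmin_r|].
  assert (K : 2 <= Rmax (Rabs (Re a - Re c)) (Rabs (Im a - Im c)) / r).
  { apply Rnot_lt_le. intros G. apply N. apply Rmult_lt_compat_r with (r := r) in G; [|exact Hr].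
    unfold Rdiv in G. rewrite Rmult_assoc, Rinv_l, Rmult_1_r in G by lra.
    assert (G1 := Rle_lt_trans _ _ _ (Rmax_l _ _) G). assert (G2 := Rle_lt_trans _ _ _ (Rmax_r _ _) G).
    apply Rabs_lt_between in G1. apply Rabs_lt_between in G2. split; lra. }
  lra.
Qed.

Lemma Rabs_Rmax_diff (a b c d e : R) : Rabs (a - c) <= e -> Rabs (b - d) <= e -> Rabs (Rmax a b - Rmax c d) <= e.
Proof.
  intros H1 H2. apply Rabs_le_between in H1. apply Rabs_le_between in H2.
  apply Rabs_le. unfold Rmax. repeat destruct Rle_dec; lra.
Qed.

Lemma Rabs_Rmin_diff (a b c d e : R) : Rabs (a - c) <= e -> Rabs (b - d) <= e -> Rabs (Rmin a b - Rmin c d) <= e.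
Proof.
  intros H1 H2. apply Rabs_le_between in H1. apply Rabs_le_between in H2.
  apply Rabs_le. unfold Rmin. repeat destruct Rle_dec; lra.
Qed.

Lemma cutoff_Lipschitz (c : C) (r : R) (a a' : C) : 0 < r ->
  Rabs (cutoff c r a - cutoff c r a') <= Cmod (a - a')%C / r.
Proof.
  intros Hr. set (e := Cmod (a - a')%C). assert (He : 0 <= e) by apply Cmod_ge_0.
  assert (Her : 0 <= e / r) by (apply Rdiv_le_0_compat; lra).
  unfold cutoff. apply Rabs_Rmax_diff; [rewrite Rminus_diag, Rabs_R0; exact Her|].
  apply Rabs_Rmin_diff; [rewrite Rminus_diag, Rabs_R0; exact Her|].
  set (m := Rmax (Rabs (Re a - Re c)) (Rabs (Im a - Im c))).
  set (m' := Rmax (Rabs (Re a' - Re c)) (Rabs (Im a' - Im c))).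
  replace (2 - m / r - (2 - m' / r)) with ((m' - m) * / r) by (field; lra).
  rewrite Rabs_mult, (Rabs_pos_eq (/ r)) by (left; apply Rinv_0_lt_compat, Hr).
  apply Rmult_le_compat_r; [left; apply Rinv_0_lt_compat, Hr|].
  rewrite Rabs_minus_sym. apply Rabs_Rmax_diff.
  - eapply Rle_trans; [apply Rabs_triang_inv2|].
    replace (Re a - Re c - (Re a' - Re c)) with (Re a - Re a') by ring. apply re_le_of_Cmod.
  - eapply Rle_trans; [apply Rabs_triang_inv2|].
    replace (Im a - Im c - (Im a' - Im c)) with (Im a - Im a') by ring. apply im_le_of_Cmod.
Qed.

Definition theta (kappa mu : R) (c : C) (r : R) (z a : C) : C :=
  (1 - cutoff c r a * kern kappa mu (z - a))%C.

Lemma holo_theta (kappa mu : R) (c : C) (r : R) (a z : C) : holo (fun z => theta kappa mu c r z a) z.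
Proof.
  unfold theta. apply holo_minus; [apply holo_const|].
  apply (holo_mult (fun _ => RtoC (cutoff c r a))); [apply holo_const|].
  apply (holo_comp (fun z => z - a)%C (kern kappa mu)); [|apply holo_kern].
  apply holo_minus; [apply holo_id|apply holo_const].
Qed.

Lemma holo_prodl (Phi : C -> C -> C) (A : list C) (z : C) : (forall a, holo (fun z => Phi z a) z) ->
  holo (fun z => prodl (Phi z) A) z.
Proof.
  intros H. induction A as [|a A IH]; simpl; [apply holo_const|].
  apply (holo_mult (fun z => Phi z a) (fun z => prodl (Phi z) A)); [apply H|exact IH].
Qed.

Lemma pow_1_plus_mono (E : R) (k N : nat) : 0 <= E -> (k <= N)%nat -> (1 + E) ^ k <= (1 + E) ^ N.
Proof. intros HE H. apply Rle_pow; [lra|exact H]. Qed.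

Lemma Cmod_prodl_le (Phi : C -> C) (E : R) (A : list C) : 0 <= E ->
  (forall a, In a A -> Cmod (Phi a) <= 1 + E) -> Cmod (prodl Phi A) <= (1 + E) ^ length A.
Proof.
  intros HE. induction A as [|a A IH]; intros H; simpl.
  - rewrite Cmod_1. lra.
  - rewrite Cmod_mult. apply Rmult_le_compat; try apply Cmod_ge_0.
    + apply H. left. reflexivity.
    + apply IH. intros b Hb. apply H. right. exact Hb.
Qed.

Lemma prodl_diff (Phi : C -> C) (E eta : R) (A A' : list C) : 0 <= E -> 0 <= eta ->
  Forall2 (fun a a' => Cmod (Phi a) <= 1 + E /\ Cmod (Phi a') <= 1 + E /\ Cmod (Phi a - Phi a')%C <= eta) A A' ->
  Cmod (prodl Phi A - prodl Phi A')%C <= eta * (INR (length A) * (1 + E) ^ length A).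
Proof.
  intros HE Heta H. induction H as [|a a' A A' [H1 [H2 H3]] HF IH].
  - simpl. rewrite Cmod_diag. lra.
  - cbn [prodl length pow]. rewrite S_INR.
    replace (Phi a * prodl Phi A - Phi a' * prodl Phi A')%C
      with ((Phi a - Phi a') * prodl Phi A + Phi a' * (prodl Phi A - prodl Phi A'))%C by ring.
    eapply Rle_trans; [apply Cmod_triangle|]. rewrite !Cmod_mult.
    assert (B : Cmod (prodl Phi A) <= (1 + E) ^ length A).
    { apply Cmod_prodl_le; [exact HE|]. intros b Hb. clear IH H1 H2 H3.
      induction HF as [|x x' l l' [K1 _] HF' IHF]; [destruct Hb|]. destruct Hb as [<-|Hb]; [exact K1|apply IHF, Hb]. }
    assert (P := pow_le (1 + E) (length A) ltac:(lra)). set (w := (1 + E) ^ length A) in *.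
    assert (T1 : Cmod (Phi a - Phi a')%C * Cmod (prodl Phi A) <= eta * w).
    { apply Rmult_le_compat; try apply Cmod_ge_0; assumption. }
    assert (T2 : Cmod (Phi a') * Cmod (prodl Phi A - prodl Phi A')%C <= (1 + E) * (eta * (INR (length A) * w))).
    { apply Rmult_le_compat; try apply Cmod_ge_0; assumption. }
    assert (0 <= INR (length A)) by apply pos_INR. assert (0 <= eta * w) by (apply Rmult_le_pos; assumption).
    assert (0 <= eta * w * E) by (apply Rmult_le_pos; assumption).
    apply Rle_trans with (eta * w + (1 + E) * (eta * (INR (length A) * w))); [lra|]. 
    replace (eta * ((INR (length A) + 1) * ((1 + E) * w)))
      with (eta * w + (1 + E) * (eta * (INR (length A) * w)) + eta * w * E) by ring. lra.
Qed.

Lemma prodl_near_1 (Phi : C -> C) (e E : R) (N : nat) (A : list C) : 0 <= e <= E -> (length A <= N)%nat ->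
  (forall a, In a A -> Cmod (Phi a - 1)%C <= e) -> Cmod (prodl Phi A - 1)%C <= e * (INR N * (1 + E) ^ N).
Proof.
  intros He HN H.
  apply Rle_trans with (e * (INR (length A) * (1 + E) ^ length A)).
  - clear HN N. induction A as [|a A IH].
    + simpl. rewrite Cmod_diag. lra.
    + cbn [prodl length pow]. rewrite S_INR.
      replace (Phi a * prodl Phi A - 1)%C with ((Phi a - 1) * prodl Phi A + (prodl Phi A - 1))%C by ring.
      eapply Rle_trans; [apply Cmod_triangle|]. rewrite Cmod_mult.
      assert (B : Cmod (prodl Phi A) <= (1 + E) ^ length A).
      { apply Cmod_prodl_le; [lra|]. intros b Hb. replace (Phi b) with (1 + (Phi b - 1))%C by ring.
        eapply Rle_trans; [apply Cmod_triangle|]. rewrite Cmod_1. specialize (H b (or_intror Hb)). lra. }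
      assert (I := IH (fun b Hb => H b (or_intror Hb))).
      assert (P := pow_le (1 + E) (length A) ltac:(lra)). set (w := (1 + E) ^ length A) in *.
      assert (T1 : Cmod (Phi a - 1)%C * Cmod (prodl Phi A) <= e * w).
      { apply Rmult_le_compat; try apply Cmod_ge_0; [apply H; left; reflexivity|exact B]. }
      assert (0 <= INR (length A)) by apply pos_INR. assert (0 <= e * w) by (apply Rmult_le_pos; lra).
      assert (0 <= e * w * E) by (apply Rmult_le_pos; lra).
      assert (0 <= e * w * E * INR (length A)) by (apply Rmult_le_pos; lra).
      replace (e * ((INR (length A) + 1) * ((1 + E) * w)))
        with (e * w + e * w * E + e * (INR (length A) * w) + e * w * E * INR (length A)) by ring. lra.
  - apply Rmult_le_compat_l; [lra|]. apply Rmult_le_compat; [apply pos_INR|apply pow_le; lra|apply le_INR, HN|].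
    apply pow_1_plus_mono; [lra|exact HN].
Qed.

Definition kbound (kappa mu V : R) : R := exp (kappa * V ^ 2 + Rabs mu * V).

Lemma kbound_pos (kappa mu V : R) : 0 < kbound kappa mu V.
Proof. apply exp_pos. Qed.

Lemma theta_near_1 (kappa mu : R) (c : C) (r : R) (z a : C) (e : R) :
  Cmod (kern kappa mu (z - a)) <= e -> Cmod (theta kappa mu c r z a - 1)%C <= e.
Proof.
  intros H. unfold theta.
  replace (1 - cutoff c r a * kern kappa mu (z - a) - 1)%C with (- (cutoff c r a * kern kappa mu (z - a)))%C by ring.
  rewrite Cmod_opp, Cmod_mult, Cmod_R. assert (K := cutoff_range c r a). rewrite Rabs_pos_eq by lra.
  assert (P := Cmod_ge_0 (kern kappa mu (z - a))). nra.
Qed.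

(** 1089 is [33 ^ 2]: the decay is shifted once from [u] to [z - a] and once from [a] to the centre.
    The square of radius 1 about [z - a] prepares a Lipschitz estimate. *)
Lemma kern_cell_bound (kappa mu V Y : R) (c : C) (r : R) (z a : C) : 1 <= kappa -> 0 < r <= 1 ->
  Rabs (Im c) <= Y -> Rabs (Im z) <= V -> sq c (4 * r) a -> forall u, sq (z - a) 1 u ->
  Cmod (kern kappa mu u) <= 1089 * kbound kappa mu (V + Y + 5) * decay (Re z - Re c).
Proof.
  intros Hk Hr HY HV [A1 A2] u [U1 U2]. rewrite re_minus in U1. rewrite im_minus in U2.
  apply Rabs_le_between in HY. apply Rabs_le_between in HV.
  eapply Rle_trans; [apply (kern_bound kappa mu (V + Y + 5)); [exact Hk|apply Rabs_le; lra]|].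
  fold (kbound kappa mu (V + Y + 5)). assert (P := kbound_pos kappa mu (V + Y + 5)).
  set (k := kbound kappa mu (V + Y + 5)) in *.
  assert (D1 := decay_shift (Re u) (Re z - Re a) ltac:(apply Rabs_le; lra)).
  assert (D2 := decay_shift (Re z - Re a) (Re z - Re c) ltac:(apply Rabs_le; lra)).
  nra.
Qed.

(** The pole enters through the kernel, which costs [2 * M * s], and through the cutoff, which costs
    [s / r * M]. As [r <= 1], both together are at most [3 * (s / r) * M], and 3267 is
    [3 * 1089]. *)
Lemma theta_diff (kappa mu V Y : R) (c : C) (r s : R) (z a a' : C) : 1 <= kappa -> 0 < r <= 1 -> s <= r ->
  Rabs (Im c) <= Y -> Rabs (Im z) <= V -> sq c (3 * r) a -> Cmod (a - a')%C <= s ->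
  Cmod (theta kappa mu c r z a - theta kappa mu c r z a')%C <=
    s * (3267 / r * kbound kappa mu (V + Y + 5)) * decay (Re z - Re c).
Proof.
  intros Hk Hr Hs HY HV Ha Haa.
  assert (Ha4 : sq c (4 * r) a) by (apply (sq_le c (3 * r)); [lra|exact Ha]).
  assert (KB := kern_cell_bound kappa mu V Y c r z a Hk Hr HY HV Ha4).
  set (M := 1089 * kbound kappa mu (V + Y + 5) * decay (Re z - Re c)) in *.
  assert (PM : 0 < M) by (unfold M; assert (Q1 := kbound_pos kappa mu (V + Y + 5)); assert (Q2 := decay_pos (Re z - Re c)); nra).
  assert (L : Cmod (kern kappa mu (z - a') - kern kappa mu (z - a))%C <= 2 * M / 1 * Cmod ((z - a') - (z - a))%C).
  { apply Lipschitz_of_bound; [lra| |].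
    - intros u Hu. split; [apply holo_kern|apply KB, Hu].
    - apply Cmod_sq. replace ((z - a') - (z - a))%C with (a - a')%C by ring. lra. }
  replace ((z - a') - (z - a))%C with (a - a')%C in L by ring.
  assert (K0 : Cmod (kern kappa mu (z - a)) <= M) by (apply KB, sq_center; lra).
  assert (CL := cutoff_Lipschitz c r a a' ltac:(lra)).
  assert (CR := cutoff_range c r a').
  unfold theta.
  replace (1 - cutoff c r a * kern kappa mu (z - a) - (1 - cutoff c r a' * kern kappa mu (z - a')))%C
    with (cutoff c r a' * (kern kappa mu (z - a') - kern kappa mu (z - a)) - (cutoff c r a - cutoff c r a')%R * kern kappa mu (z - a))%C
    by (rewrite RtoC_minus; ring).
  eapply Rle_trans; [apply Cmod_triangle_minus|]. rewrite !Cmod_mult, !Cmod_R.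
  rewrite (Rabs_pos_eq (cutoff c r a')) by lra.
  assert (P1 := Cmod_ge_0 (a - a')%C).
  assert (S0 : 0 <= s) by lra.
  assert (Is : s / 1 <= s / r).
  { unfold Rdiv. apply Rmult_le_compat_l; [exact S0|]. apply Rinv_le_contravar; lra. }
  assert (Ir : Cmod (a - a')%C / r <= s / r).
  { unfold Rdiv. apply Rmult_le_compat_r; [left; apply Rinv_0_lt_compat; lra|exact Haa]. }
  assert (T1 : cutoff c r a' * Cmod (kern kappa mu (z - a') - kern kappa mu (z - a))%C <= 1 * (2 * M * s)).
  { apply Rmult_le_compat; try apply Cmod_ge_0; try lra. eapply Rle_trans; [exact L|].
    replace (2 * M / 1) with (2 * M) by field. apply Rmult_le_compat_l; lra. }
  assert (T2 : Rabs (cutoff c r a - cutoff c r a') * Cmod (kern kappa mu (z - a)) <= s / r * M).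
  { apply Rmult_le_compat; [apply Rabs_pos|apply Cmod_ge_0|lra|exact K0]. }
  replace (s * (3267 / r * kbound kappa mu (V + Y + 5)) * decay (Re z - Re c)) with (3 * (s / r) * M)
    by (unfold M; field; lra).
  assert (s * M <= s / r * M) by (apply Rmult_le_compat_r; lra). lra.
Qed.

(** Any list with these properties will do, so that [epsilon] may pick one for each cell separately.
    Non-degeneracy is recorded because two cells are compared by [zero_matching]; the bound [l]
    holds beyond [2 * r], where the cutoff ends. *)
Definition cell_spec (f : C -> Cbar) (r : R) (m : R -> R) (N : nat) (l : R) (c : C) (A : list C) : Prop :=
  (length A <= N)%nat /\ (forall a, In a A -> sq c (3 * r) a /\ f a = Cinf) /\
  (((forall z, sq c (16 * r) z -> 1 / 2 < tS (f z)) /\ A = nil) \/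
   ((forall z, sq c (16 * r) z -> tS (f z) < 3 / 4) /\ nondegenerate r 2 m c (fun z => invS (f z)) /\
    exists G, (forall z, invS (f z) = (W A z * G z)%C) /\ (forall z, sq c (16 * r) z -> holo G z) /\
      (forall z, sq c (3 * r) z -> G z <> RtoC 0) /\ (forall z, sq c (5 / 2 * r) z -> l <= Cmod (G z)))).

Lemma invS_zero (u : Cbar) : tS u < 1 -> invS u = RtoC 0 -> u = Cinf.
Proof.
  intros T E. destruct u as [w|]; [|reflexivity]. exfalso.
  assert (Q := Cmod_invS_sq _ T). rewrite E, Cmod_0 in Q.
  assert (P := tS_pos (Cfin w) ltac:(discriminate)).
  assert (0 < tS (Cfin w) / (1 - tS (Cfin w))) by (apply Rdiv_lt_0_compat; lra). lra.
Qed.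

Lemma cell_spec_exists (a b : Rbar) (f : C -> Cbar) (alpha beta : R) :
  meromorphic_almost_periodic a b f -> inner_strip alpha beta a b ->
  exists r0 m, 0 < r0 /\ (forall s, 0 < s -> 0 < m s) /\ forall r, 0 < r <= r0 ->
    exists N l, 0 < l /\ forall c, alpha <= Im c <= beta ->
      (forall z, sq c (16 * r) z -> strip a b z) /\ exists A, cell_spec f r m N l c A.
Proof.
  intros Hf Hs. destruct (cells a b f alpha beta Hf Hs) as [r0 [m [Hr0 [Hm HC]]]].
  exists r0, m. split; [exact Hr0|split; [exact Hm|]]. intros r Hr.
  destruct (zero_list r 2 m ltac:(lra) ltac:(lra) Hm) as [N [l [Hl HZ]]].
  exists N, l. split; [exact Hl|]. intros c Hc. destruct (HC r c Hr Hc) as [H1 H2].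
  split; [exact H1|]. destruct H2 as [H2|[H2 H3]].
  - exists nil. split; [simpl; lia|split; [intros x []|left; auto]].
  - destruct (HZ c _ H3) as [A [G [LA [InA [EF [HG [NG LG]]]]]]].
    exists A. split; [exact LA|split].
    + intros x Hx. split; [apply InA, Hx|]. apply invS_zero.
      * specialize (H2 x (sq_le c (3 * r) (16 * r) x ltac:(lra) (InA x Hx))). lra.
      * rewrite EF, (W_root A x Hx). ring.
    + right. split; [exact H2|split; [exact H3|]]. exists G. auto.
Qed.

Lemma sq_shift (c z : C) (r tau : R) : sq (c + tau)%C r (z + tau)%C <-> sq c r z.
Proof.
  unfold sq, inrect. rewrite !re_plus, !im_plus, re_RtoC, im_RtoC. split; intros [H1 H2]; split; lra.
Qed.

Lemma holo_shift (F : C -> C) (z : C) (tau : R) : holo F (z + tau)%C -> holo (fun z => F (z + tau)%C) z.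
Proof.
  intros H. apply (holo_comp (fun z => z + tau)%C F); [|exact H].
  apply holo_plus; [apply holo_id|apply holo_const].
Qed.

Lemma nondegenerate_shift (r M : R) (m : R -> R) (c : C) (F : C -> C) (tau : R) :
  nondegenerate r M m (c + tau)%C F -> nondegenerate r M m c (fun z => F (z + tau)%C).
Proof.
  intros [H1 H2]. split.
  - intros z Hz. apply sq_shift with (tau := tau) in Hz. destruct (H1 _ Hz) as [D B].
    split; [apply holo_shift, D|exact B].
  - intros p s Hp Hs. apply sq_shift with (tau := tau) in Hp. destruct (H2 _ s Hp Hs) as [z [Hz B]].
    exists (z - tau)%C. replace (z - tau + tau)%C with z by ring. split; [|exact B].
    apply (sq_shift p (z - tau) s tau). replace (z - tau + tau)%C with z by ring. exact Hz.
Qed.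

Lemma W_shift (A : list C) (tau z : C) : W A (z + tau)%C = W (map (fun a => a - tau)%C A) z.
Proof. induction A as [|a A IH]; simpl; [reflexivity|]. rewrite IH. ring. Qed.

Lemma theta_shift (kappa mu : R) (c : C) (r : R) (z a : C) (tau : R) :
  theta kappa mu (c + tau)%C r (z + tau)%C a = theta kappa mu c r z (a - tau)%C.
Proof.
  unfold theta, cutoff. rewrite !re_plus, !im_plus, !re_minus, !im_minus, re_RtoC, im_RtoC.
  replace (Re a - (Re c + tau)) with (Re a - tau - Re c) by ring.
  replace (Im a - (Im c + 0)) with (Im a - 0 - Im c) by ring.
  replace (z + tau - a)%C with (z - (a - tau))%C by ring. reflexivity.
Qed.

Lemma prodl_map (Phi Psi : C -> C) (g : C -> C) (A : list C) : (forall a, Phi a = Psi (g a)) ->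
  prodl Phi A = prodl Psi (map g A).
Proof. intros H. induction A as [|a A IH]; simpl; [reflexivity|]. rewrite IH, H. reflexivity. Qed.

Lemma theta_outside (kappa mu : R) (c : C) (r : R) (z a : C) : 0 < r -> ~ sq c (2 * r) a ->
  theta kappa mu c r z a = RtoC 1.
Proof. intros Hr H. unfold theta. rewrite (cutoff_out c r a Hr H). ring. Qed.

Lemma Forall2_In_l (P : C -> C -> Prop) (A A' : list C) : Forall2 P A A' ->
  Forall2 (fun a a' => In a A /\ P a a') A A'.
Proof.
  intros H. induction H as [|a a' A A' H HF IH]; constructor.
  - split; [left; reflexivity|exact H].
  - revert IH. apply Forall2_impl. intros x x' [K1 K2]. split; [right; exact K1|exact K2].
Qed.

(** The list chosen for the shifted cell bears no relation to the original one. [zero_matching]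
    produces a third list [B], close to [A], for the shifted function; unique factorization on the
    support of the cutoff shows that [B] and [A'], shifted back, give the same product. *)
Lemma cell_continuity (f : C -> Cbar) (r : R) (m : R -> R) (N : nat) (l kappa mu V Y eps : R) :
  0 < r <= 1 -> (forall s, 0 < s -> 0 < m s) -> 0 < l -> 1 <= kappa -> 0 < eps ->
  exists delta, 0 < delta /\ forall c A A' (tau : R), Rabs (Im c) <= Y ->
    cell_spec f r m N l c A -> cell_spec f r m N l (c + tau)%C A' ->
    (forall z, sq c (16 * r) z -> sclose delta (f (z + tau)%C) (f z)) ->
    forall z, Rabs (Im z) <= V ->
      Cmod (prodl (theta kappa mu (c + tau)%C r (z + tau)%C) A' - prodl (theta kappa mu c r z) A)%C
        <= eps * decay (Re z - Re c).
Proof.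
  intros Hr Hm Hl Hk He.
  set (k := kbound kappa mu (V + Y + 5)). assert (Pk : 0 < k) by apply kbound_pos.
  set (E := 1089 * k). assert (HE : 0 < E) by (unfold E; lra).
  set (Q := 3267 / r * k * (INR N * (1 + E) ^ N) + 1).
  assert (HQ : 1 <= Q).
  { unfold Q. assert (0 <= 3267 / r * k * (INR N * (1 + E) ^ N)); [|lra].
    apply Rmult_le_pos; [apply Rmult_le_pos; [apply Rdiv_le_0_compat|]; lra|].
    apply Rmult_le_pos; [apply pos_INR|apply pow_le; lra]. }
  (* [l / 2] keeps the matched cofactor away from 0 on the support of the cutoff, [r] keeps the
     matched zeros within [4 * r], and [eps / Q] is the final accuracy. *)
  set (s := Rmin (l / 2) (Rmin r (eps / Q))).
  assert (Hs : 0 < s) by (repeat apply Rmin_pos; try lra; apply Rdiv_lt_0_compat; lra).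
  assert (S1 : s <= l / 2) by apply Rmin_l.
  assert (S2 : s <= r) by (eapply Rle_trans; [apply Rmin_r|apply Rmin_l]).
  assert (S3 : s <= eps / Q) by (eapply Rle_trans; [apply Rmin_r|apply Rmin_r]).
  (* The threshold of [zero_matching] depends on the number of zeros; at most [N] occur, so a
     minimum over lengths serves all cells. *)
  set (em := fun j : nat => epsilon (inhabits 0) (fun e => 0 < e /\
    forall c A F F' G, length A = j -> (forall a, In a A -> sq c (3 * r) a) ->
    (forall z, F z = (W A z * G z)%C) -> (forall z, sq c (16 * r) z -> holo G z) ->
    nondegenerate r 2 m c F' -> (forall z, sq c (16 * r) z -> Cmod (F z - F' z)%C <= e) ->
    exists A' G', (forall z, F' z = (W A' z * G' z)%C) /\ (forall z, sq c (16 * r) z -> holo G' z) /\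
      (forall z, sq c (16 * r) z -> Cmod (G z - G' z)%C <= s) /\
      Forall2 (fun a a' => Cmod (a - a')%C <= s) A A')).
  assert (Hem : forall j, _ /\ _) by (intros j; exact (epsilon_spec (inhabits 0) _
    (zero_matching j r ltac:(lra) 2 m s ltac:(lra) Hm Hs))).
  fold em in Hem.
  destruct (finite_pos_min em N) as [e0 [He0 Hmin]]; [intros j; apply (proj1 (Hem j))|].
  (* A pole has height 0 and cells of the first kind have heights above 1/2, so 1/8 keeps a listed
     pole from meeting such a cell; 110 is the constant of [sclose_invS]. *)
  exists (Rmin (1 / 8) (e0 / 110)). split; [apply Rmin_pos; lra|].
  intros c A A' tau HY [LA [InA SA]] [LA' [InA' SA']] Hcl z HV.
  assert (D1 : Rmin (1 / 8) (e0 / 110) <= 1 / 8) by apply Rmin_l.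
  assert (D2 : Rmin (1 / 8) (e0 / 110) <= e0 / 110) by apply Rmin_r.
  set (delta := Rmin (1 / 8) (e0 / 110)) in *.
  assert (HT : forall w, sq c (16 * r) w -> Rabs (tS (f (w + tau)%C) - tS (f w)) <= 1 / 8).
  { intros w Hw. destruct (Hcl w Hw) as [K _]. lra. }
  assert (Sub : forall w, sq c (3 * r) w -> sq c (16 * r) w) by (intros w; apply sq_le; lra).
  assert (Trivial : A = nil -> A' = nil ->
    Cmod (prodl (theta kappa mu (c + tau)%C r (z + tau)%C) A' - prodl (theta kappa mu c r z) A)%C <= eps * decay (Re z - Re c)).
  { intros -> ->. simpl. rewrite Cmod_diag. assert (P := decay_pos (Re z - Re c)). nra. }
  destruct SA as [[TA EA]|[TA [NA [G [EG [HG [NG LG]]]]]]].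
  - apply Trivial; [exact EA|]. destruct A' as [|a' A']; [reflexivity|]. exfalso.
    destruct (InA' a' (or_introl eq_refl)) as [Q1 Q2].
    assert (Q3 : sq c (3 * r) (a' - tau)%C).
    { apply (sq_shift c (a' - tau) (3 * r) tau). replace (a' - tau + tau)%C with a' by ring. exact Q1. }
    assert (Q4 := HT _ (Sub _ Q3)). assert (Q5 := TA _ (Sub _ Q3)).
    replace (a' - tau + tau)%C with a' in Q4 by ring. rewrite Q2 in Q4. simpl in Q4.
    apply Rabs_le_between in Q4. lra.
  - destruct SA' as [[TA' EA']|[TA' [NA' [G' [EG' [HG' [NG' _]]]]]]].
    + apply Trivial; [|exact EA']. destruct A as [|a A]; [reflexivity|]. exfalso.
      destruct (InA a (or_introl eq_refl)) as [Q1 Q2].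
      assert (Q4 := HT _ (Sub _ Q1)).
      assert (Q5 := TA' (a + tau)%C (proj2 (sq_shift c a (16 * r) tau) (Sub _ Q1))).
      rewrite Q2 in Q4. simpl in Q4. apply Rabs_le_between in Q4. lra.
    + destruct (proj2 (Hem (length A)) c A (fun z => invS (f z)) (fun z => invS (f (z + tau)%C)) G)
        as [B [G2 [EB [HG2 [DG FB]]]]]; try reflexivity; try assumption.
      { intros x Hx. apply InA, Hx. }
      { apply (nondegenerate_shift r 2 m c (fun z => invS (f z)) tau). exact NA'. }
      { intros w Hw. rewrite Cmod_minus_sym. apply Rle_trans with (110 * delta).
        - apply sclose_invS; [| |apply Hcl, Hw].
          + assert (K := TA' _ (proj2 (sq_shift c w (16 * r) tau) Hw)). lra.
          + assert (K := TA w Hw). lra.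
        - apply Rle_trans with e0; [lra|exact (Hmin (length A) LA)]. }
      assert (EqP : prodl (theta kappa mu (c + tau)%C r (z + tau)%C) A' = prodl (theta kappa mu c r z) B).
      { rewrite (prodl_map _ (theta kappa mu c r z) (fun a => a - tau)%C) by (intros x; apply theta_shift).
        apply (factorization_unique (theta kappa mu c r z) (sq c (2 * r)) _ B (fun z => G' (z + tau)%C) G2).
        - intros w Hw. apply theta_outside; [lra|exact Hw].
        - intros w Hw. assert (Hw' := proj2 (sq_shift c w (2 * r) tau) Hw). split.
          + apply holo_ccont, holo_shift, HG'. apply (sq_le _ (2 * r)); [lra|exact Hw'].
          + apply NG'. apply (sq_le _ (2 * r)); [lra|exact Hw'].
        - intros w Hw. split.
          + apply holo_ccont, HG2. apply (sq_le _ (2 * r)); [lra|exact Hw].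
          + intros K. assert (B1 := LG w (sq_le c (2 * r) (5 / 2 * r) w ltac:(lra) Hw)).
            assert (B2 := DG w (sq_le c (2 * r) (16 * r) w ltac:(lra) Hw)). rewrite K in B2.
            replace (G w - 0)%C with (G w) in B2 by ring. lra.
        - intros w. rewrite <- W_shift, <- EG'. apply EB. }
      rewrite EqP, Cmod_minus_sym.
      assert (Pd := decay_pos (Re z - Re c)). assert (Pd1 := decay_le_1 (Re z - Re c)).
      eapply Rle_trans.
      * apply (prodl_diff (theta kappa mu c r z) E (s * (3267 / r * k) * decay (Re z - Re c))); [lra| |].
        { apply Rmult_le_pos; [|lra]. apply Rmult_le_pos; [lra|]. apply Rmult_le_pos; [apply Rdiv_le_0_compat|]; lra. }
        apply Forall2_In_l in FB. revert FB. apply Forall2_impl. intros x x' [Hx Hxx].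
        destruct (InA x Hx) as [Sx _].
        assert (Bd : forall y, sq c (4 * r) y -> Cmod (theta kappa mu c r z y) <= 1 + E).
        { intros y Hy. replace (theta kappa mu c r z y) with (1 + (theta kappa mu c r z y - 1))%C by ring.
          eapply Rle_trans; [apply Cmod_triangle|]. rewrite Cmod_1. apply Rplus_le_compat_l.
          apply theta_near_1. eapply Rle_trans.
          - apply (kern_cell_bound kappa mu V Y c r z y Hk Hr HY HV Hy). apply sq_center. lra.
          - fold k. fold E. nra. }
        split; [|split].
        { apply Bd. apply (sq_le c (3 * r)); [lra|exact Sx]. }
        { apply Bd. apply (sq_le c (3 * r + r)); [lra|]. apply (sq_trans c x); [exact Sx|].
          apply Cmod_sq. rewrite Cmod_minus_sym. lra. }
        { apply (theta_diff kappa mu V Y c r s z x x' Hk Hr S2 HY HV Sx Hxx). }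
      * replace (s * (3267 / r * k) * decay (Re z - Re c) * (INR (length A) * (1 + E) ^ length A))
          with (s * (3267 / r * k * (INR (length A) * (1 + E) ^ length A)) * decay (Re z - Re c)) by ring.
        apply Rmult_le_compat_r; [lra|].
        apply Rle_trans with (s * Q).
        { apply Rmult_le_compat_l; [lra|]. unfold Q.
          assert (3267 / r * k * (INR (length A) * (1 + E) ^ length A) <= 3267 / r * k * (INR N * (1 + E) ^ N)); [|lra].
          apply Rmult_le_compat_l; [apply Rmult_le_pos; [apply Rdiv_le_0_compat|]; lra|].
          apply Rmult_le_compat; [apply pos_INR|apply pow_le; lra|apply le_INR, LA|apply pow_1_plus_mono; [lra|exact LA]]. }
        apply Rle_trans with (eps / Q * Q); [apply Rmult_le_compat_r; lra|right; field; lra].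
Qed.

(** Boundedness of [f] times [H] near [p] is what Riemann's theorem asks for; the order of the pole
    never has to be compared with the multiplicity of a zero. *)
Definition kills (f : C -> Cbar) (H : C -> C) (p : C) : Prop :=
  exists M d, 0 < d /\ forall w, w <> p -> Cmod (w - p)%C < d -> Cmod (affine_part (f w)) * Cmod (H w) <= M.

Definition bounded_on (a b : Rbar) (H : C -> C) : Prop :=
  forall alpha beta, inner_strip alpha beta a b ->
  exists M, forall z, alpha <= Im z <= beta -> Cmod (H z) <= M.

(* Only integral almost periods are used: they permute the cells of a row. *)
Definition controlled (a b : Rbar) (f : C -> Cbar) (H : C -> C) : Prop :=
  forall alpha beta, inner_strip alpha beta a b -> forall eps, 0 < eps ->
  exists alpha' beta' delta, inner_strip alpha' beta' a b /\ 0 < delta /\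
    forall k : Z, ap_set f alpha' beta' delta (IZR k) ->
    forall z, alpha <= Im z <= beta -> Cmod (H (z + IZR k)%C - H z)%C <= eps.

(** A factor with [a = p] vanishes at [p], where kernel and cutoff are 1, and so is O(w - a). For
    [a] different from [p], [w - a] stays away from 0 and a bounded factor suffices. *)
Lemma prodl_theta_le_W (kappa mu : R) (c : C) (r : R) (p : C) (A : list C) : cutoff c r p = 1 ->
  exists M d, 0 <= M /\ 0 < d /\ forall w, w <> p -> Cmod (w - p)%C < d ->
    Cmod (prodl (theta kappa mu c r w) A) <= M * Cmod (W A w).
Proof.
  intros Hp. induction A as [|a A [M [d [HM [Hd IH]]]]].
  - exists 1, 1. split; [lra|split; [lra|]]. intros w _ _. simpl. rewrite Cmod_1. lra.
  - assert (One : exists M1 d1, 0 <= M1 /\ 0 < d1 /\ forall w, w <> p -> Cmod (w - p)%C < d1 ->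
      Cmod (theta kappa mu c r w a) <= M1 * Cmod (w - a)%C).
    { destruct (Ceq_dec a p) as [->|N].
      - destruct (holo_theta kappa mu c r p p) as [l D].
        destruct (cder_local_bound _ _ _ D) as [d1 [Hd1 K]]. cbv beta in K.
        exists (Cmod l + 1), d1. split; [generalize (Cmod_ge_0 l); lra|split; [exact Hd1|]].
        intros w _ Hw. specialize (K w Hw).
        assert (E0 : theta kappa mu c r p p = RtoC 0).
        { unfold theta. replace (p - p)%C with (RtoC 0) by ring. rewrite kern_0, Hp. ring. }
        rewrite E0 in K. replace (theta kappa mu c r w p - 0)%C with (theta kappa mu c r w p) in K by ring. exact K.
      - assert (P := Cmod_neq0 _ (Cminus_eq_contra _ _ N)). set (q := Cmod (a - p)%C) in *.
        destruct (bddnear_of_holo _ _ (holo_theta kappa mu c r a p)) as [M1 [d1 [Hd1 K]]].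
        exists (Rabs M1 * (2 / q)), (Rmin d1 (q / 2)). split.
        { apply Rmult_le_pos; [apply Rabs_pos|left; apply Rdiv_lt_0_compat; lra]. }
        split; [apply Rmin_pos; lra|]. intros w Hw Hwd.
        assert (W1 := Rlt_le_trans _ _ _ Hwd (Rmin_l _ _)).
        assert (W2 := Rlt_le_trans _ _ _ Hwd (Rmin_r _ _)).
        assert (Far : q / 2 <= Cmod (w - a)%C).
        { assert (T := Cmod_triangle_rev (a - p) (w - p)). fold q in T.
          replace (a - p - (w - p))%C with (a - w)%C in T by ring. rewrite (Cmod_minus_sym a w) in T. lra. }
        eapply Rle_trans; [apply (K w Hw W1)|]. eapply Rle_trans; [apply Rle_abs|].
        rewrite Rmult_assoc. rewrite <- (Rmult_1_r (Rabs M1)) at 1. apply Rmult_le_compat_l; [apply Rabs_pos|].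
        apply Rle_trans with (2 / q * (q / 2)); [right; field; lra|].
        apply Rmult_le_compat_l; [left; apply Rdiv_lt_0_compat; lra|exact Far]. }
    destruct One as [M1 [d1 [HM1 [Hd1 K]]]].
    exists (M1 * M), (Rmin d d1). split; [apply Rmult_le_pos; assumption|split; [apply Rmin_pos; assumption|]].
    intros w Hw Hwd.
    assert (W1 := Rlt_le_trans _ _ _ Hwd (Rmin_l _ _)).
    assert (W2 := Rlt_le_trans _ _ _ Hwd (Rmin_r _ _)).
    simpl. rewrite !Cmod_mult.
    replace (M1 * M * (Cmod (w - a)%C * Cmod (W A w))) with ((M1 * Cmod (w - a)%C) * (M * Cmod (W A w))) by ring.
    apply Rmult_le_compat; try apply Cmod_ge_0; [apply K; assumption|apply IH; assumption].
Qed.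

Lemma ccont_nonzero_near (G : C -> C) (p : C) : ccont G p -> G p <> RtoC 0 ->
  exists d, 0 < d /\ forall w, Cmod (w - p)%C < d -> Cmod (G p) / 2 <= Cmod (G w).
Proof.
  intros CG N. assert (P := Cmod_neq0 _ N). destruct (CG (Cmod (G p) / 2)) as [d [Hd K]]; [lra|].
  exists d. split; [exact Hd|]. intros w Hw. specialize (K w Hw).
  assert (T := Cmod_triangle_rev (G p) (G w)). rewrite Cmod_minus_sym in T. lra.
Qed.

Lemma affine_inv_le_1 (u : Cbar) : u <> Cinf -> Cmod (affine_part u) * Cmod (invS u) <= 1.
Proof.
  intros N. rewrite (finite_affine u N). simpl. set (w := affine_part u).
  destruct (Ceq_dec w 0) as [->|Nw].
  - rewrite Cmod_0. lra.
  - rewrite <- Cmod_mult, Cinv_r by exact Nw. rewrite Cmod_1. lra.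
Qed.

(** Near [p] the product is bounded by a multiple of [W A], while [1 / f] is [W A] times a factor
    that stays away from 0. *)
Lemma cell_kills (a b : Rbar) (f : C -> Cbar) (r : R) (m : R -> R) (N : nat) (l kappa mu : R) (c : C) (A : list C) (p : C) :
  meromorphic_on (strip a b) f -> 0 < r -> strip a b p -> cell_spec f r m N l c A -> sq c r p -> f p = Cinf ->
  kills f (fun z => prodl (theta kappa mu c r z) A) p.
Proof.
  intros Hf Hr Hst [_ [_ SA]] Hp Fp.
  assert (Hp16 : sq c (16 * r) p) by (apply (sq_le c r); [lra|exact Hp]).
  destruct SA as [[TA _]|[TA [_ [G [EG [HG [NG _]]]]]]].
  - exfalso. specialize (TA p Hp16). rewrite Fp in TA. simpl in TA. lra.
  - destruct (prodl_theta_le_W kappa mu c r p A (cutoff_in c r p Hr Hp)) as [M [d1 [HM [Hd1 K1]]]].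
    assert (Hp3 : sq c (3 * r) p) by (apply (sq_le c r); [lra|exact Hp]).
    destruct (ccont_nonzero_near G p (holo_ccont _ _ (HG p Hp16)) (NG p Hp3)) as [d2 [Hd2 K2]].
    destruct (meromorphic_pole a b f p Hf Hst Fp 1) as [d3 [Hd3 K3]].
    assert (PG := Cmod_neq0 _ (NG p Hp3)). set (g := Cmod (G p)) in *.
    exists (M * (2 / g)), (Rmin d1 (Rmin d2 d3)). split; [repeat apply Rmin_pos; assumption|].
    intros w Hw Hwd.
    assert (Wd : Cmod (w - p)%C < d1 /\ Cmod (w - p)%C < d2 /\ Cmod (w - p)%C < d3).
    { revert Hwd. unfold Rmin. repeat destruct Rle_dec; intros; lra. }
    destruct Wd as [W1 [W2 W3]].
    specialize (K1 w Hw W1). specialize (K2 w W2). destruct (K3 w Hw W3) as [Nw _].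
    assert (AI := affine_inv_le_1 _ Nw). rewrite EG, Cmod_mult in AI.
    set (x := Cmod (affine_part (f w))) in *. set (y := Cmod (W A w)) in *. set (v := Cmod (G w)) in *.
    assert (Px : 0 <= x) by apply Cmod_ge_0. assert (Py : 0 <= y) by apply Cmod_ge_0.
    apply Rle_trans with (x * (M * y)); [apply Rmult_le_compat_l; assumption|].
    replace (x * (M * y)) with (M * (x * y)) by ring. apply Rmult_le_compat_l; [exact HM|].
    apply Rmult_le_reg_r with (g / 2); [lra|]. replace (2 / g * (g / 2)) with 1 by (field; lra).
    assert (0 <= x * y) by (apply Rmult_le_pos; assumption). nra.
Qed.

Lemma product_limit_close (p q : Z -> C) (l l' : C) (M : R) : product_limit p l -> product_limit q l' ->
  (forall lo L, Cmod (PP p lo L - PP q lo L)%C <= M) -> Cmod (l - l')%C <= M.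
Proof.
  intros Hp Hq H. apply le_epsilon. intros e He.
  destruct (Hp (e / 2)) as [K1 A1]; [lra|]. destruct (Hq (e / 2)) as [K2 A2]; [lra|].
  set (K := Z.to_nat (Z.max K1 K2)).
  assert (B1 := A1 (- Z.of_nat K)%Z (2 * K)%nat ltac:(lia) ltac:(lia)).
  assert (B2 := A2 (- Z.of_nat K)%Z (2 * K)%nat ltac:(lia) ltac:(lia)).
  specialize (H (- Z.of_nat K)%Z (2 * K)%nat).
  set (P := PP p (- Z.of_nat K) (2 * K)) in *. set (Q := PP q (- Z.of_nat K) (2 * K)) in *.
  replace (l - l')%C with ((P - Q) - (P - l) + (Q - l'))%C by ring.
  eapply Rle_trans; [apply Cmod_triangle|]. eapply Rle_trans; [apply Rplus_le_compat_r, Cmod_triangle_minus|]. lra.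
Qed.

Lemma product_limit_one : product_limit (fun _ => RtoC 1) 1.
Proof. intros e He. exists 0%Z. intros lo L _ _. rewrite PP_one, Cmod_diag. lra. Qed.

Lemma product_limit_shift (p : Z -> C) (l : C) (M : Z) : product_limit p l ->
  product_limit (fun n => p (n + M)%Z) l.
Proof.
  intros H e He. destruct (H e He) as [K HK]. exists (K + Z.abs M)%Z. intros lo L H1 H2.
  rewrite PP_shift. apply HK; lia.
Qed.

Lemma product_limit_bound (p : Z -> C) (l : C) (M : R) (n : Z) : product_limit p l ->
  (forall lo L, (lo <= n < lo + Z.of_nat L)%Z -> Cmod (PP p lo L) <= M) -> Cmod l <= M.
Proof.
  intros H HM. apply le_epsilon. intros e He. destruct (H e He) as [K HK].
  set (k := Z.to_nat (Z.abs K + Z.abs n + 1)).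
  assert (B := HK (- Z.of_nat k)%Z (2 * k)%nat ltac:(lia) ltac:(lia)).
  specialize (HM (- Z.of_nat k)%Z (2 * k)%nat ltac:(lia)).
  set (P := PP p (- Z.of_nat k) (2 * k)) in *.
  replace l with (P - (P - l))%C by ring. eapply Rle_trans; [apply Cmod_triangle_minus|]. lra.
Qed.

(** [C0] is fixed before [y0], [kappa] and [mu]. This order allows a kernel to be chosen afterwards
    that brings the product as close to 1 as desired at prescribed points. *)
Theorem row_product (a b : Rbar) (f : C -> Cbar) (alpha beta : R) :
  meromorphic_almost_periodic a b f -> inner_strip alpha beta a b ->
  exists r0, 0 < r0 /\ forall r, 0 < r <= r0 -> exists C0, 0 < C0 /\
    forall y0 kappa mu, alpha <= y0 <= beta -> 1 <= kappa -> exists H : C -> C,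
      (forall z, holo H z) /\ bounded_on a b H /\ controlled a b f H /\
      (forall p, f p = Cinf -> Rabs (Im p - y0) <= r -> kills f H p) /\
      (forall z e, 0 <= e <= 1 ->
        (forall p, f p = Cinf -> Rabs (Im p - y0) <= 3 * r ->
           Cmod (kern kappa mu (z - p)) <= e * decay (Re z - Re p)) -> Cmod (H z - 1)%C <= C0 * e).
Proof.
  intros Hf Hs. destruct (cell_spec_exists a b f alpha beta Hf Hs) as [r0 [m [Hr0 [Hm HC]]]].
  exists (Rmin r0 1). split; [apply Rmin_pos; lra|]. intros r Hr.
  assert (R1 : r <= r0) by (eapply Rle_trans; [apply Hr|apply Rmin_l]).
  assert (R2 : r <= 1) by (eapply Rle_trans; [apply Hr|apply Rmin_r]).
  destruct (HC r ltac:(lra)) as [N [l [Hl HA]]].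
  (* The spacing [s] is the reciprocal of an integer: a shift by the integer [k] takes cell [n] to
     cell [n + k * K0]. Since [s <= r], the squares of radius [r] cover the row. *)
  destruct (INR_unbounded (1 / r)) as [K0 HK0].
  assert (Pr : 0 < 1 / r) by (apply Rdiv_lt_0_compat; lra).
  assert (PK : 0 < INR K0) by lra.
  set (s := / INR K0). assert (Ps : 0 < s) by (apply Rinv_0_lt_compat, PK).
  assert (Es : INR K0 * s = 1) by (apply Rinv_r; lra).
  assert (Hsr : s <= r).
  { unfold s. replace r with (/ (1 / r)) by (field; lra). apply Rinv_le_contravar; lra. }
  assert (Hs1 : 0 < s <= 1) by lra.
  set (D := 3 / s * PI). assert (HD : 0 < D) by (apply Rmult_lt_0_compat; [apply Rdiv_lt_0_compat; lra|apply PI_RGT_0]).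
  set (S0 := 33 * (INR N * (1 + 33) ^ N) * D).
  assert (PS0 : 0 <= S0).
  { unfold S0. apply Rmult_le_pos; [|lra]. apply Rmult_le_pos; [lra|]. apply Rmult_le_pos; [apply pos_INR|apply pow_le; lra]. }
  exists (exp S0 * S0 + 1). split.
  { assert (0 <= exp S0 * S0) by (apply Rmult_le_pos; [left; apply exp_pos|exact PS0]). lra. }
  intros y0 kappa mu Hy Hk.
  set (c := fun n : Z => ((IZR n * s)%R, y0) : C).
  assert (Ic : forall n, alpha <= Im (c n) <= beta) by (intros n; exact Hy).
  set (A := fun n => epsilon (inhabits (@nil C)) (cell_spec f r m N l (c n))).
  assert (SA : forall n, cell_spec f r m N l (c n) (A n)).
  { intros n. unfold A. apply epsilon_spec. apply (HA (c n) (Ic n)). }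
  set (h := fun n z => prodl (theta kappa mu (c n) r z) (A n)).
  assert (Hh : forall n z, holo (h n) z) by (intros n z; apply holo_prodl; intros x; apply holo_theta).
  set (BV := fun V => 1089 * kbound kappa mu (V + Rabs y0 + 5) * (INR N * (1 + 1089 * kbound kappa mu (V + Rabs y0 + 5)) ^ N)).
  assert (HBV0 : forall V, 0 <= BV V).
  { intros V. unfold BV. assert (P := kbound_pos kappa mu (V + Rabs y0 + 5)).
    apply Rmult_le_pos; [lra|]. apply Rmult_le_pos; [apply pos_INR|apply pow_le; lra]. }
  assert (HBV : forall V n z, Rabs (Im z) <= V -> Cmod (h n z - 1)%C <= BV V * decay (Re z - IZR n * s)).
  { intros V n z HV. destruct (SA n) as [LA [InA _]].
    set (E := 1089 * kbound kappa mu (V + Rabs y0 + 5)).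
    assert (PE : 0 < E) by (unfold E; assert (P := kbound_pos kappa mu (V + Rabs y0 + 5)); lra).
    assert (Pd := decay_pos (Re z - IZR n * s)). assert (Pd1 := decay_le_1 (Re z - IZR n * s)).
    unfold BV. fold E.
    replace (E * (INR N * (1 + E) ^ N) * decay (Re z - IZR n * s))
      with (E * decay (Re z - IZR n * s) * (INR N * (1 + E) ^ N)) by ring.
    apply prodl_near_1; [split; nra|exact LA|].
    intros x Hx. apply theta_near_1.
    change (IZR n * s) with (Re (c n)).
    apply (kern_cell_bound kappa mu V (Rabs y0) (c n) r z x Hk ltac:(lra)); [unfold c, Im; simpl; lra|exact HV| |].
    - apply (sq_le (c n) (3 * r)); [lra|apply InA, Hx].
    - apply sq_center. lra. }
  destruct (integer_product s h Hs1 Hh) as [H [HolH HL]].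
  { intros V. exists (BV V). split; [apply HBV0|]. intros n z HV. apply HBV, HV. }
  assert (SSD : forall B x lo L, 0 <= B -> SS (fun n => B * decay (x - IZR n * s)) lo L <= B * D).
  { intros B x lo L HB. rewrite SS_scal. apply Rmult_le_compat_l; [exact HB|]. apply SS_decay_total, Hs1. }
  assert (Vab : forall al be z, al <= Im z <= be -> Rabs (Im z) <= Rmax (Rabs al) (Rabs be)).
  { intros al be z Hz. unfold Rmax, Rabs. repeat destruct Rle_dec; repeat destruct Rcase_abs; lra. }
  exists H. split; [exact HolH|split; [|split; [|split]]].
  - intros al be _. set (V := Rmax (Rabs al) (Rabs be)). exists (exp (BV V * D)). intros z Hz.
    apply (product_limit_bound (fun n => h n z) (H z) _ 0%Z (HL z)). intros lo L _.
    eapply Rle_trans; [apply PP_bound; intros n; apply HBV, (Vab al be z Hz)|].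
    apply exp_le_compat. apply SSD, HBV0.
  - intros al be _ eps Heps. set (V := Rmax (Rabs al) (Rabs be)).
    set (e1 := eps / (exp (BV V * D) * D)).
    assert (PE := exp_pos (BV V * D)).
    assert (He1 : 0 < e1) by (apply Rdiv_lt_0_compat; [exact Heps|apply Rmult_lt_0_compat; assumption]).
    destruct (cell_continuity f r m N l kappa mu V (Rabs y0) e1) as [delta [Hdelta KC]]; try assumption; try lra.
    (* These heights are those of the squares of radius [16 * r] on which [cell_continuity] compares
       [f] with its shift. *)
    exists (y0 - 16 * r), (y0 + 16 * r), delta. split; [|split; [exact Hdelta|]].
    { destruct (HA (c 0%Z) (Ic 0%Z)) as [St _].
      assert (T1 : strip a b (0, y0 - 16 * r)).
      { apply St. unfold c, sq, inrect, Re, Im; simpl. lra. }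
      assert (T2 : strip a b (0, y0 + 16 * r)).
      { apply St. unfold c, sq, inrect, Re, Im; simpl. lra. }
      split; [apply T1|split; [lra|apply T2]]. }
    intros k Hap z Hz.
    set (M := (k * Z.of_nat K0)%Z).
    assert (EM : IZR M * s = IZR k).
    { unfold M. rewrite mult_IZR, <- INR_IZR_INZ, Rmult_assoc, Es. ring. }
    assert (Ecn : forall n, c (n + M)%Z = (c n + IZR k)%C).
    { intros n. unfold c. apply C_ext; unfold Re, Im, Cplus, RtoC; simpl; [|ring].
      rewrite plus_IZR, Rmult_plus_distr_r, EM. ring. }
    assert (Iz : Im (z + IZR k)%C = Im z) by (rewrite im_plus, im_RtoC; ring).
    (* Reindexing by [M] pairs each factor at the shifted point with its original. *)
    apply (product_limit_close (fun n => h (n + M)%Z (z + IZR k)%C) (fun n => h n z)).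
    + apply (product_limit_shift (fun n => h n (z + IZR k)%C)), HL.
    + apply HL.
    + intros lo L.
      assert (Hp : forall n, Cmod (h (n + M)%Z (z + IZR k)%C - 1)%C <= BV V * decay (Re z - IZR n * s)).
      { intros n. eapply Rle_trans; [apply (HBV V); rewrite Iz; apply (Vab al be z Hz)|].
        rewrite re_plus, re_RtoC, plus_IZR.
        replace (Re z + IZR k - (IZR n + IZR M) * s) with (Re z - IZR n * s) by (rewrite <- EM; ring). lra. }
      assert (Hq : forall n, Cmod (h n z - 1)%C <= BV V * decay (Re z - IZR n * s)).
      { intros n. apply HBV, (Vab al be z Hz). }
      eapply Rle_trans; [apply (PP_diff _ _ _ L lo Hp Hq)|].
      apply Rle_trans with (exp (BV V * D) * (e1 * D)).
      * apply Rmult_le_compat.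
        { left. apply exp_pos. }
        { apply SS_nonneg. intros n. apply Cmod_ge_0. }
        { apply exp_le_compat, SSD, HBV0. }
        eapply Rle_trans; [|apply (SSD e1 (Re z) lo L); lra].
        apply SS_le. intros n. unfold h. rewrite Ecn.
        change (IZR n * s) with (Re (c n)).
        apply KC.
        { unfold c, Im; simpl. lra. }
        { apply SA. }
        { rewrite <- Ecn. apply SA. }
        { intros w [_ Hw]. apply Hap. unfold c in Hw. unfold Im at 1 3 in Hw. simpl in Hw. exact Hw. }
        apply (Vab al be z Hz).
      * right. unfold e1. field. split; lra.
  - intros p Fp Hp.
    (* [up q - 1] is the integer part of [q], so [p] lies in the inner square of cell [n]. *)
    set (q := Re p / s). set (n := (up q - 1)%Z).
    destruct (archimed q) as [A1 A2].
    assert (Hn : IZR n * s <= Re p <= IZR n * s + s).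
    { assert (Ep : Re p = q * s) by (unfold q; field; lra). rewrite Ep. unfold n. rewrite minus_IZR.
      clearbody q. split; nra. }
    apply Rabs_le_between in Hp.
    assert (Hpc : sq (c n) r p).
    { unfold c. split; [change (Re (IZR n * s, y0)) with (IZR n * s)|change (Im (IZR n * s, y0)) with y0]; lra. }
    assert (Hst : strip a b p).
    { apply (proj1 (HA (c n) (Ic n))). apply (sq_le (c n) r); [lra|exact Hpc]. }
    destruct (cell_kills a b f r m N l kappa mu (c n) (A n) p (proj1 Hf) ltac:(lra) Hst (SA n) Hpc Fp) as [M [d [Hd K]]].
    set (V := Rabs (Im p) + 1).
    exists (M * exp (BV V * D)), (Rmin d 1). split; [apply Rmin_pos; lra|]. intros w Hw Hwd.
    assert (W1 := Rlt_le_trans _ _ _ Hwd (Rmin_l _ _)).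
    assert (W2 := Rlt_le_trans _ _ _ Hwd (Rmin_r _ _)).
    assert (HV : Rabs (Im w) <= V).
    { replace (Im w) with (Im p + (Im w - Im p)) by ring. eapply Rle_trans; [apply Rabs_triang|].
      assert (T := im_le_of_Cmod w p). unfold V. lra. }
    (* All factors but the [n]-th go into the exponential, which leaves the one that kills [p]. *)
    assert (HH : Cmod (H w) <= Cmod (h n w) * exp (BV V * D)).
    { apply (product_limit_bound (fun n => h n w) (H w) _ n (HL w)). intros lo L HLo.
      eapply Rle_trans; [apply (PP_bound_factor _ (fun n => BV V * decay (Re w - IZR n * s)) L n); [intros j; apply HBV, HV|exact HLo]|].
      apply Rmult_le_compat_l; [apply Cmod_ge_0|]. apply exp_le_compat, SSD, HBV0. }
    specialize (K w Hw W1). cbv beta in K. fold (h n w) in K.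
    apply Rle_trans with (Cmod (affine_part (f w)) * (Cmod (h n w) * exp (BV V * D))).
    + apply Rmult_le_compat_l; [apply Cmod_ge_0|exact HH].
    + rewrite <- Rmult_assoc. apply Rmult_le_compat_r; [left; apply exp_pos|exact K].
  - intros z e He Hker.
    assert (Bh : forall n, Cmod (h n z - 1)%C <= e * (33 * (INR N * (1 + 33) ^ N)) * decay (Re z - IZR n * s)).
    { intros n. destruct (SA n) as [LA [InA _]].
      assert (Pd := decay_pos (Re z - IZR n * s)). assert (Pd1 := decay_le_1 (Re z - IZR n * s)).
      replace (e * (33 * (INR N * (1 + 33) ^ N)) * decay (Re z - IZR n * s))
        with (33 * e * decay (Re z - IZR n * s) * (INR N * (1 + 33) ^ N)) by ring.
      apply prodl_near_1; [split; nra|exact LA|].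
      intros x Hx. destruct (InA x Hx) as [Sx Fx]. apply theta_near_1.
      destruct Sx as [X1 X2]. change (Re (c n)) with (IZR n * s) in X1. change (Im (c n)) with y0 in X2.
      eapply Rle_trans; [apply Hker; [exact Fx|apply Rabs_le; lra]|].
      assert (Ds := decay_shift (Re z - Re x) (Re z - IZR n * s) ltac:(apply Rabs_le; lra)). nra. }
    set (B := e * (33 * (INR N * (1 + 33) ^ N))) in *.
    assert (PN : 0 <= INR N * (1 + 33) ^ N) by (apply Rmult_le_pos; [apply pos_INR|apply pow_le; lra]).
    assert (HB : 0 <= B) by (unfold B; apply Rmult_le_pos; lra).
    assert (BD : B * D = e * S0) by (unfold B, S0; ring).
    apply (product_limit_close (fun n => h n z) (fun _ => RtoC 1) _ _ _ (HL z) product_limit_one).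
    intros lo L. rewrite PP_one. eapply Rle_trans; [apply PP_near_1, Bh|].
    assert (T := SSD B (Re z) lo L HB). rewrite BD in T.
    apply Rle_trans with (exp S0 * (e * S0)).
    + apply Rmult_le_compat; [left; apply exp_pos| | |exact T].
      * apply SS_nonneg. intros n. apply Rmult_le_pos; [exact HB|left; apply decay_pos].
      * apply exp_le_compat. eapply Rle_trans; [exact T|]. nra.
    + replace (exp S0 * (e * S0)) with ((exp S0 * S0) * e) by ring. nra.
Qed.

(** * Exhaustion of the strip *)

(** Boundedness on inner strips is carried along because control of a product relies on it. *)
Definition ap_factor (a b : Rbar) (f : C -> Cbar) (H : C -> C) : Prop :=
  (forall z, strip a b z -> holo H z) /\ bounded_on a b H /\ controlled a b f H.

Lemma ap_set_mono (f : C -> Cbar) (al be al' be' d d' : R) (tau : R) : al <= al' -> be' <= be -> d <= d' ->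
  ap_set f al be d tau -> ap_set f al' be' d' tau.
Proof. intros H1 H2 H3 H z Hz. apply (sclose_le d); [exact H3|]. apply H. lra. Qed.

Lemma inner_strip_union (a b : Rbar) (al be al' be' : R) : inner_strip al be a b -> inner_strip al' be' a b ->
  inner_strip (Rmin al al') (Rmax be be') a b.
Proof.
  intros [H1 [H2 H3]] [H4 [H5 H6]]. split; [|split].
  - unfold Rmin. destruct Rle_dec; assumption.
  - eapply Rle_lt_trans; [apply Rmin_l|]. eapply Rlt_le_trans; [exact H2|apply Rmax_l].
  - unfold Rmax. destruct Rle_dec; assumption.
Qed.

Lemma ap_factor_one (a b : Rbar) (f : C -> Cbar) : ap_factor a b f (fun _ => RtoC 1).
Proof.
  split; [|split].
  - intros z _. apply holo_const.
  - intros al be _. exists 1. intros z _. rewrite Cmod_1. lra.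
  - intros al be Hs eps Heps. exists al, be, 1. split; [exact Hs|split; [lra|]].
    intros k _ z _. rewrite Cmod_diag. lra.
Qed.

Lemma ap_factor_mult (a b : Rbar) (f : C -> Cbar) (H H' : C -> C) : ap_factor a b f H -> ap_factor a b f H' ->
  ap_factor a b f (fun z => H z * H' z)%C.
Proof.
  intros [A1 [A2 A3]] [B1 [B2 B3]]. split; [|split].
  - intros z Hz. apply holo_mult; [apply A1|apply B1]; exact Hz.
  - intros al be Hs. destruct (A2 al be Hs) as [M HM]. destruct (B2 al be Hs) as [M' HM'].
    exists (M * M'). intros z Hz. rewrite Cmod_mult. apply Rmult_le_compat; try apply Cmod_ge_0; auto.
  - intros al be Hs eps Heps. destruct (A2 al be Hs) as [M HM]. destruct (B2 al be Hs) as [M' HM'].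
    set (S := Rabs M + Rabs M' + 1). assert (PM := Rabs_pos M). assert (PM' := Rabs_pos M').
    assert (PS : 0 < S) by (unfold S; lra).
    assert (Pe : 0 < eps / S) by (apply Rdiv_lt_0_compat; lra).
    destruct (A3 al be Hs (eps / S / 2)) as [a1 [b1 [d1 [S1 [Hd1 K1]]]]]; [lra|].
    destruct (B3 al be Hs (eps / S / 2)) as [a2 [b2 [d2 [S2 [Hd2 K2]]]]]; [lra|].
    exists (Rmin a1 a2), (Rmax b1 b2), (Rmin d1 d2).
    split; [apply inner_strip_union; assumption|split; [apply Rmin_pos; assumption|]].
    intros k Hap z Hz.
    assert (Q1 : Cmod (H (z + IZR k)%C - H z)%C <= eps / S / 2).
    { apply K1; [|exact Hz]. revert Hap. apply ap_set_mono; [apply Rmin_l|apply Rmax_l|apply Rmin_l]. }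
    assert (Q2 : Cmod (H' (z + IZR k)%C - H' z)%C <= eps / S / 2).
    { apply K2; [|exact Hz]. revert Hap. apply ap_set_mono; [apply Rmin_r|apply Rmax_r|apply Rmin_r]. }
    assert (Iz : al <= Im (z + IZR k)%C <= be) by (rewrite im_plus, im_RtoC; lra).
    replace (H (z + IZR k)%C * H' (z + IZR k)%C - H z * H' z)%C
      with ((H (z + IZR k)%C - H z) * H' (z + IZR k)%C + H z * (H' (z + IZR k)%C - H' z))%C by ring.
    eapply Rle_trans; [apply Cmod_triangle|]. rewrite !Cmod_mult.
    assert (T1 : Cmod (H (z + IZR k)%C - H z)%C * Cmod (H' (z + IZR k)%C) <= eps / S / 2 * S).
    { apply Rmult_le_compat; try apply Cmod_ge_0; [exact Q1|]. specialize (HM' _ Iz).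
      generalize (Rle_abs M'). unfold S. lra. }
    assert (T2 : Cmod (H z) * Cmod (H' (z + IZR k)%C - H' z)%C <= S * (eps / S / 2)).
    { apply Rmult_le_compat; try apply Cmod_ge_0; [|exact Q2]. specialize (HM _ Hz).
      generalize (Rle_abs M). unfold S. lra. }
    replace (eps / S / 2 * S) with (eps / 2) in T1 by (field; lra).
    replace (S * (eps / S / 2)) with (eps / 2) in T2 by (field; lra). lra.
Qed.

Lemma kills_mult (f : C -> Cbar) (H H' : C -> C) (p : C) : kills f H p -> holo H' p ->
  kills f (fun z => H z * H' z)%C p.
Proof.
  intros [M [d [Hd K]]] HH. destruct (bddnear_of_holo H' p HH) as [M' [d' [Hd' K']]].
  exists (M * M'), (Rmin d d'). split; [apply Rmin_pos; assumption|]. intros w Hw Hwd.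
  assert (A1 := K w Hw (Rlt_le_trans _ _ _ Hwd (Rmin_l _ _))).
  assert (A2 := K' w Hw (Rlt_le_trans _ _ _ Hwd (Rmin_r _ _))).
  rewrite Cmod_mult, <- Rmult_assoc. apply Rmult_le_compat; try assumption; try apply Cmod_ge_0.
  apply Rmult_le_pos; apply Cmod_ge_0.
Qed.

Lemma kills_ext (f : C -> Cbar) (H H' : C -> C) (p : C) : (forall z, H z = H' z) -> kills f H p -> kills f H' p.
Proof. intros E [M [d [Hd K]]]. exists M, d. split; [exact Hd|]. intros w Hw Hwd. rewrite <- E. apply K; assumption. Qed.

Lemma mult_near_1 (p q : C) (e : R) : e <= 3 -> Cmod (p - 1)%C <= e / 3 -> Cmod (q - 1)%C <= e / 3 ->
  Cmod (p * q - 1)%C <= e.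
Proof.
  intros He Hp Hq. replace (p * q - 1)%C with ((p - 1) * q + (q - 1))%C by ring.
  assert (Bq : Cmod q <= 2).
  { replace q with ((q - 1) + 1)%C by ring. eapply Rle_trans; [apply Cmod_triangle|]. rewrite Cmod_1. lra. }
  eapply Rle_trans; [apply Cmod_triangle|]. rewrite Cmod_mult.
  assert (T : Cmod (p - 1)%C * Cmod q <= e / 3 * 2) by (apply Rmult_le_compat; try apply Cmod_ge_0; assumption). lra.
Qed.

(* The sign [sg] tells on which side of the band [c, d] the set [Z] lies, where
   a large [mu] makes the kernels small. *)
Lemma band_product (a b : Rbar) (f : C -> Cbar) (c d sg g T e : R) (Z : C -> Prop) :
  meromorphic_almost_periodic a b f -> inner_strip c d a b -> sg = 1 \/ sg = -1 -> 0 < g -> 0 < e <= 1 ->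
  (forall z p, Z z -> c - g <= Im p <= d + g -> sg * (Im z - Im p) <= - g /\ Rabs (Im z - Im p) <= T) ->
  exists H, ap_factor a b f H /\ (forall p, f p = Cinf -> c <= Im p <= d -> kills f H p) /\
    forall z, Z z -> Cmod (H z - 1)%C <= e.
Proof.
  intros Hf Hs Hsg Hg He HZ.
  assert (Hcd : c < d) by (destruct Hs as [_ [K _]]; exact K).
  destruct (row_product a b f c d Hf Hs) as [r0 [Hr0 HR]].
  set (r := Rmin r0 (g / 3)). assert (Hr : 0 < r) by (apply Rmin_pos; lra).
  assert (R1 : r <= r0) by apply Rmin_l. assert (R2 : r <= g / 3) by apply Rmin_r.
  destruct (HR r ltac:(lra)) as [C0 [HC0 HRow]].
  assert (Row : forall y e', c <= y <= d -> 0 < e' -> exists H, ap_factor a b f H /\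
    (forall p, f p = Cinf -> Rabs (Im p - y) <= r -> kills f H p) /\ forall z, Z z -> Cmod (H z - 1)%C <= e').
  { intros y e' Hy He'.
    set (e1 := Rmin 1 (e' / C0)).
    assert (He1 : 0 < e1) by (apply Rmin_pos; [lra|apply Rdiv_lt_0_compat; lra]).
    assert (E1 : e1 <= 1) by apply Rmin_l. assert (E2 : e1 <= e' / C0) by apply Rmin_r.
    (* Chosen so that [exp (T ^ 2 - mu * g) = e1]: [g] is the least vertical distance, and [T ^ 2]
       bounds the growth of the Gaussian for [kappa = 1]. *)
    set (mu := (T ^ 2 - ln e1) / g).
    assert (Emu : mu * g = T ^ 2 - ln e1) by (unfold mu; field; lra).
    assert (Lne : ln e1 <= 0).
    { rewrite <- ln_1. destruct (Req_dec e1 1) as [->|N]; [lra|]. left. apply ln_increasing; lra. }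
    assert (Pmu : 0 <= mu) by (apply Rdiv_le_0_compat; [generalize (pow2_ge_0 T); lra|exact Hg]).
    destruct (HRow y 1 (sg * mu) Hy ltac:(lra)) as [H [H1 [H2 [H3 [H4 H5]]]]].
    exists H. split; [split; [intros z _; apply H1|split; assumption]|split; [exact H4|]].
    intros z Hz. apply Rle_trans with (C0 * e1).
    - apply H5; [lra|]. intros p Fp Hp. apply Rabs_le_between in Hp.
      destruct (HZ z p Hz ltac:(lra)) as [K1 K2]. rewrite Cmod_kern, im_minus, re_minus.
      set (t := Im z - Im p) in *. set (x := Re z - Re p).
      assert (T2 : t ^ 2 <= T ^ 2) by (rewrite <- (pow2_abs t); apply pow_incr; split; [apply Rabs_pos|exact K2]).
      assert (MT : sg * mu * t <= - (mu * g)).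
      { replace (sg * mu * t) with (mu * (sg * t)) by ring. nra. }
      apply Rle_trans with (exp (ln e1) * exp (- x ^ 2)).
      + rewrite <- exp_plus. apply exp_le_compat. lra.
      + rewrite exp_ln by exact He1. apply Rmult_le_compat_l; [lra|apply exp_neg_sq_le_decay].
    - apply Rle_trans with (C0 * (e' / C0)); [apply Rmult_le_compat_l; lra|right; field; lra]. }
  (* Rows at heights [c + n * r] cover the band from below, the centre being moved back to [d] when
     it would leave the band. *)
  assert (Ind : forall n e', 0 < e' <= 1 -> exists H, ap_factor a b f H /\
    (forall p, f p = Cinf -> c <= Im p <= d -> Im p <= c + INR n * r -> kills f H p) /\
    forall z, Z z -> Cmod (H z - 1)%C <= e').
  { induction n as [|n IH]; intros e' He'.
    - destruct (Row c e') as [H [H1 [H2 H3]]]; [lra|lra|]. exists H. split; [exact H1|split; [|exact H3]].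
      intros p Fp Hp Hp'. apply H2; [exact Fp|]. simpl in Hp'. apply Rabs_le. lra.
    - destruct (IH (e' / 3)) as [H [H1 [H2 H3]]]; [lra|].
      assert (Pn : 0 <= INR n * r) by (apply Rmult_le_pos; [apply pos_INR|lra]).
      destruct (Row (Rmin d (c + INR n * r)) (e' / 3)) as [H' [H1' [H2' H3']]].
      { split; [apply Rmin_glb; lra|apply Rmin_l]. }
      { lra. }
      exists (fun z => H z * H' z)%C. split; [apply ap_factor_mult; assumption|split].
      + intros p Fp Hp Hp'. assert (Hst : strip a b p) by (apply (inner_strip_in _ _ _ _ p Hs Hp)).
        destruct (Rle_or_lt (Im p) (c + INR n * r)) as [L|L].
        * apply kills_mult; [apply H2; assumption|apply H1', Hst].
        * apply (kills_ext f (fun z => H' z * H z)%C); [intros z; ring|].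
          apply kills_mult; [|apply H1, Hst]. apply H2'; [exact Fp|]. rewrite S_INR in Hp'.
          rewrite Rmin_right by lra. apply Rabs_le. lra.
      + intros z Hz. apply mult_near_1; [lra|apply H3, Hz|apply H3', Hz]. }
  destruct (INR_step (d - c) r) as [n Hn]; [lra|exact Hr|].
  destruct (Ind n e He) as [H [H1 [H2 H3]]]. exists H. split; [exact H1|split; [|exact H3]].
  intros p Fp Hp. apply H2; [exact Fp|exact Hp|lra].
Qed.

(** A disc about [z0] contains no pole. In a row thin compared with it, every pole is farther than
    [dd] from [z0] horizontally but at most [dd / 2] vertically, so a large [kappa] makes all
    kernels at [z0] small, with [mu = 0]. *)
Lemma base_product (a b : Rbar) (f : C -> Cbar) (z0 : C) : meromorphic_almost_periodic a b f ->
  strip a b z0 -> f z0 <> Cinf -> exists r H, 0 < r /\ inner_strip (Im z0 - r) (Im z0 + r) a b /\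
    ap_factor a b f H /\ (forall p, f p = Cinf -> Im z0 - r <= Im p <= Im z0 + r -> kills f H p) /\
    Cmod (H z0 - 1)%C <= 1 / 4.
Proof.
  intros Hf Hz Fz. destruct (meromorphic_finite a b f z0 (proj1 Hf) Hz Fz) as [_ [d0 [Hd0 K0]]].
  destruct (strip_open a b z0 Hz) as [d1 [Hd1 K1]].
  assert (Inner : forall t, 0 < t < d1 -> inner_strip (Im z0 - t) (Im z0 + t) a b).
  { intros t Ht. split; [|split; [lra|]].
    - apply (K1 (0, Im z0 - t)). unfold Im at 1; simpl. apply Rabs_lt_between. lra.
    - apply (K1 (0, Im z0 + t)). unfold Im at 1; simpl. apply Rabs_lt_between. lra. }
  set (dd := d0 / 4). assert (Hdd : 0 < dd) by (unfold dd; lra).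
  destruct (row_product a b f _ _ Hf (Inner (d1 / 2) ltac:(lra))) as [r0 [Hr0 HR]].
  set (r := Rmin (Rmin r0 (dd / 6)) (d1 / 2)).
  assert (Hr : 0 < r) by (repeat apply Rmin_pos; lra).
  assert (R1 : r <= r0) by (eapply Rle_trans; [apply Rmin_l|apply Rmin_l]).
  assert (R2 : r <= dd / 6) by (eapply Rle_trans; [apply Rmin_l|apply Rmin_r]).
  assert (R3 : r <= d1 / 2) by apply Rmin_r.
  destruct (HR r ltac:(lra)) as [C0 [HC0 HRow]].
  set (e := Rmin 1 (1 / 4 / C0)).
  assert (He : 0 < e) by (apply Rmin_pos; [lra|apply Rdiv_lt_0_compat; lra]).
  assert (E1 : e <= 1) by apply Rmin_l. assert (E2 : e <= 1 / 4 / C0) by apply Rmin_r.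
  assert (Lne : ln e <= 0).
  { rewrite <- ln_1. destruct (Req_dec e 1) as [->|N]; [lra|]. left. apply ln_increasing; lra. }
  (* As [x ^ 2 - t ^ 2 >= 3 / 4 * x ^ 2] and [x ^ 2 >= dd ^ 2], this yields
     [kappa * (x ^ 2 - t ^ 2) >= x ^ 2 - ln e]: the decay and the factor [e] at once. *)
  set (kappa := 4 / 3 * (1 - ln e / dd ^ 2)).
  assert (Pdd : 0 < dd ^ 2) by (apply pow_lt, Hdd).
  assert (Lq : 0 <= - ln e / dd ^ 2) by (apply Rdiv_le_0_compat; lra).
  assert (Hk : 1 <= kappa) by (unfold kappa; unfold Rdiv in *; lra).
  destruct (HRow (Im z0) kappa 0 ltac:(lra) Hk) as [H [H1 [H2 [H3 [H4 H5]]]]].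
  exists r, H. split; [exact Hr|split; [apply Inner; lra|split; [split; [intros z _; apply H1|split; assumption]|split]]].
  - intros p Fp Hp. apply H4; [exact Fp|]. apply Rabs_le. lra.
  - apply Rle_trans with (C0 * e).
    + apply H5; [lra|]. intros p Fp Hp. rewrite Cmod_kern, im_minus, re_minus.
      assert (Hp' := Hp). apply Rabs_le_between in Hp'.
      assert (Far : dd < Rabs (Re z0 - Re p)).
      { apply Rnot_le_lt. intros K. apply Rabs_le_between in K. apply (K0 p); [|exact Fp].
        eapply Rle_lt_trans; [apply (Cmod_le_of_box p z0 dd dd); lra|]. unfold dd. lra. }
      set (x := Re z0 - Re p) in *. set (t := Im z0 - Im p).
      assert (X2 : dd ^ 2 <= x ^ 2) by (rewrite <- (pow2_abs x); apply pow_incr; lra).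
      assert (T2 : t ^ 2 <= dd ^ 2 / 4).
      { assert (- (dd / 2) <= t <= dd / 2) by (unfold t; lra). nra. }
      apply Rle_trans with (exp (ln e) * exp (- x ^ 2)).
      * rewrite <- exp_plus. apply exp_le_compat.
        assert (Q : 3 / 4 * x ^ 2 <= x ^ 2 - t ^ 2) by lra.
        assert (Q2 : kappa * (3 / 4 * x ^ 2) <= kappa * (x ^ 2 - t ^ 2)) by (apply Rmult_le_compat_l; lra).
        assert (Q3 : kappa * (3 / 4 * x ^ 2) = x ^ 2 + - ln e / dd ^ 2 * x ^ 2) by (unfold kappa; field; lra).
        assert (Q4 : - ln e / dd ^ 2 * dd ^ 2 <= - ln e / dd ^ 2 * x ^ 2) by (apply Rmult_le_compat_l; assumption).
        replace (- ln e / dd ^ 2 * dd ^ 2) with (- ln e) in Q4 by (field; lra). lra.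
      * rewrite exp_ln by exact He. apply Rmult_le_compat_l; [lra|apply exp_neg_sq_le_decay].
    + apply Rle_trans with (C0 * (1 / 4 / C0)); [apply Rmult_le_compat_l; lra|right; field; lra].
Qed.

Lemma increasing_exhaustion (y : R) (b : Rbar) : Rbar_lt y b ->
  exists B : nat -> R, B 0%nat = y /\ (forall k, B k < B (S k)) /\ (forall k, Rbar_lt (B k) b) /\
    forall beta : R, Rbar_lt beta b -> exists k, beta < B k.
Proof.
  intros Hy. destruct b as [b| |]; simpl in Hy.
  - exists (fun k => b - (b - y) / INR (S k)).
    assert (P : forall k, 0 < INR (S k)) by (intros k; apply lt_0_INR; lia).
    split; [|split; [|split]].
    + simpl. field.
    + intros k. assert (P1 := P k). assert (P2 := P (S k)).
      assert (/ INR (S (S k)) < / INR (S k)).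
      { apply Rinv_lt_contravar; [apply Rmult_lt_0_compat; assumption|]. apply lt_INR. lia. }
      unfold Rdiv. nra.
    + intros k. assert (P1 := P k). assert (0 < (b - y) / INR (S k)) by (apply Rdiv_lt_0_compat; lra).
      change (b - (b - y) / INR (S k) < b). lra.
    + intros beta Hb. simpl in Hb. destruct (INR_unbounded ((b - y) / (b - beta))) as [k Hk].
      exists k. assert (P1 := P k). assert (Hk' : (b - y) / (b - beta) < INR (S k)) by (rewrite S_INR; lra).
      apply Rmult_lt_compat_r with (r := (b - beta) * / INR (S k)) in Hk'.
      * replace ((b - y) / (b - beta) * ((b - beta) * / INR (S k))) with ((b - y) / INR (S k)) in Hk' by (field; split; lra).
        replace (INR (S k) * ((b - beta) * / INR (S k))) with (b - beta) in Hk' by (field; lra). lra.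
      * apply Rmult_lt_0_compat; [lra|apply Rinv_0_lt_compat, P1].
  - exists (fun k => y + INR k). split; [simpl; ring|split; [|split]].
    + intros k. rewrite S_INR. lra.
    + intros k. exact I.
    + intros beta _. destruct (INR_unbounded (beta - y)) as [k Hk]. exists k. lra.
  - destruct Hy.
Qed.

Lemma decreasing_exhaustion (y : R) (a : Rbar) : Rbar_lt a y ->
  exists A : nat -> R, A 0%nat = y /\ (forall k, A (S k) < A k) /\ (forall k, Rbar_lt a (A k)) /\
    forall alpha : R, Rbar_lt a alpha -> exists k, A k < alpha.
Proof.
  intros Hy. destruct (increasing_exhaustion (- y) (Rbar_opp a)) as [B [B0 [B1 [B2 B3]]]].
  { destruct a; simpl in *; lra || exact I. }
  exists (fun k => - B k). split; [lra|split; [|split]].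
  - intros k. specialize (B1 k). lra.
  - intros k. specialize (B2 k). destruct a; simpl in *; lra || auto.
  - intros alpha Ha. destruct (B3 (- alpha)) as [k Hk].
    + destruct a; simpl in *; lra || auto.
    + exists k. lra.
Qed.

(** * The infinite product over an exhaustion *)

Fixpoint NP (q : nat -> C) (n : nat) : C :=
  match n with O => RtoC 1 | S k => (NP q k * q k)%C end.

(** The errors from [n] on sum to [/ 50 * (/ 2) ^ n], and the exponential of that is at most 3. *)
Lemma NP_tail (q : nat -> C) (j : nat) : (forall k, (j <= k)%nat -> Cmod (q k - 1)%C <= / 100 * (/ 2) ^ k) ->
  forall n, (j <= n)%nat -> (forall n', (n <= n')%nat -> Cmod (NP q n') <= 3 * Cmod (NP q n)) /\
    (forall n', (n <= n')%nat -> Cmod (NP q n' - NP q n)%C <= 3 * Cmod (NP q n) * (/ 50 * (/ 2) ^ n)).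
Proof.
  intros H n Hn.
  assert (P2 : forall k, 0 < (/ 2) ^ k <= 1).
  { intros k. split; [apply pow_lt; lra|]. rewrite <- (pow1 k). apply pow_incr. lra. }
  assert (Growth : forall n', (n <= n')%nat -> Cmod (NP q n') <= Cmod (NP q n) * exp (/ 50 * ((/ 2) ^ n - (/ 2) ^ n'))).
  { intros n' Hn'. induction Hn' as [|k Hk IH].
    - rewrite Rminus_diag, Rmult_0_r, exp_0. lra.
    - cbn [NP]. rewrite Cmod_mult.
      assert (Bq : Cmod (q k) <= exp (/ 100 * (/ 2) ^ k)) by (apply Cmod_near_1, H; lia).
      replace (/ 50 * ((/ 2) ^ n - (/ 2) ^ S k)) with (/ 50 * ((/ 2) ^ n - (/ 2) ^ k) + / 100 * (/ 2) ^ k)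
        by (cbn [pow]; field).
      rewrite exp_plus, <- Rmult_assoc. apply Rmult_le_compat; try apply Cmod_ge_0; assumption. }
  assert (G3 : forall n', (n <= n')%nat -> Cmod (NP q n') <= 3 * Cmod (NP q n)).
  { intros n' Hn'. eapply Rle_trans; [apply Growth, Hn'|]. rewrite Rmult_comm.
    apply Rmult_le_compat_r; [apply Cmod_ge_0|]. eapply Rle_trans; [|apply exp_le_3].
    apply exp_le_compat. assert (A1 := P2 n). assert (A2 := P2 n'). lra. }
  split; [exact G3|].
  set (M := 3 * Cmod (NP q n)) in *.
  assert (HM : 0 <= M) by (unfold M; generalize (Cmod_ge_0 (NP q n)); lra).
  assert (Diff : forall n', (n <= n')%nat -> Cmod (NP q n' - NP q n)%C <= M * (/ 50 * ((/ 2) ^ n - (/ 2) ^ n'))).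
  { intros n' Hn'. induction Hn' as [|k Hk IH].
    - rewrite Cmod_diag, Rminus_diag. lra.
    - cbn [NP]. replace (NP q k * q k - NP q n)%C with (NP q k * (q k - 1) + (NP q k - NP q n))%C by ring.
      eapply Rle_trans; [apply Cmod_triangle|]. rewrite Cmod_mult.
      assert (T : Cmod (NP q k) * Cmod (q k - 1)%C <= M * (/ 100 * (/ 2) ^ k)).
      { apply Rmult_le_compat; try apply Cmod_ge_0; [apply G3, Hk|apply H; lia]. }
      replace (M * (/ 50 * ((/ 2) ^ n - (/ 2) ^ S k))) with (M * (/ 100 * (/ 2) ^ k) + M * (/ 50 * ((/ 2) ^ n - (/ 2) ^ k)))
        by (cbn [pow]; field). lra. }
  intros n' Hn'. eapply Rle_trans; [apply Diff, Hn'|]. apply Rmult_le_compat_l; [exact HM|].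
  assert (A2 := P2 n'). lra.
Qed.

Lemma half_pow_small (eps : R) : 0 < eps -> exists n : nat, forall k, (n <= k)%nat -> (/ 2) ^ k < eps.
Proof.
  intros He. destruct (pow_lt_1_zero (/ 2)) with (y := eps) as [n Hn]; [rewrite Rabs_pos_eq; lra|lra|].
  exists n. intros k Hk. specialize (Hn k Hk). rewrite Rabs_pos_eq in Hn by (apply pow_le; lra). exact Hn.
Qed.

(** Both bounds are relative to the partial product, so the limit is small wherever the partial
    product is. A pole killed by one factor thus stays killed, with no division by a product that
    may vanish. *)
Lemma NP_limit (q : nat -> C) (j : nat) : (forall k, (j <= k)%nat -> Cmod (q k - 1)%C <= / 100 * (/ 2) ^ k) ->
  exists l, forall n, (j <= n)%nat -> Cmod l <= 3 * Cmod (NP q n) /\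
    Cmod (NP q n - l)%C <= 3 * Cmod (NP q n) * (/ 50 * (/ 2) ^ n).
Proof.
  intros H. assert (T := NP_tail q j H).
  destruct (complex_Cauchy_limit (NP q)) as [l Hl].
  - intros eps He. destruct (T j (Nat.le_refl j)) as [B _].
    set (M := 3 * (3 * Cmod (NP q j))). assert (HM : 0 <= M) by (unfold M; generalize (Cmod_ge_0 (NP q j)); lra).
    destruct (half_pow_small (eps / (M + 1))) as [n Hn]; [apply Rdiv_lt_0_compat; lra|].
    exists (Nat.max j n). intros k Hk. destruct (T (Nat.max j n) ltac:(lia)) as [_ D].
    eapply Rle_trans; [apply D, Hk|]. specialize (Hn (Nat.max j n) ltac:(lia)).
    specialize (B (Nat.max j n) ltac:(lia)). set (x := (/ 2) ^ Nat.max j n) in *.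
    assert (Px : 0 < x) by (apply pow_lt; lra).
    apply Rle_trans with (M * x).
    { apply Rmult_le_compat; [generalize (Cmod_ge_0 (NP q (Nat.max j n))); lra|lra|unfold M; lra|lra]. }
    apply Rle_trans with ((M + 1) * (eps / (M + 1))); [|right; field; lra].
    apply Rmult_le_compat; lra.
  - exists l. intros n Hn. destruct (T n Hn) as [B D]. split.
    + apply le_epsilon. intros e He. destruct (Hl e He) as [k Hk].
      specialize (Hk (Nat.max k n) ltac:(lia)). specialize (B (Nat.max k n) ltac:(lia)).
      replace l with (NP q (Nat.max k n) - (NP q (Nat.max k n) - l))%C by ring.
      eapply Rle_trans; [apply Cmod_triangle_minus|]. lra.
    + apply le_epsilon. intros e He. destruct (Hl e He) as [k Hk].
      specialize (Hk (Nat.max k n) ltac:(lia)). specialize (D (Nat.max k n) ltac:(lia)).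
      replace (NP q n - l)%C with ((NP q (Nat.max k n) - l) - (NP q (Nat.max k n) - NP q n))%C by ring.
      eapply Rle_trans; [apply Cmod_triangle_minus|]. lra.
Qed.

Lemma ap_factor_NP (a b : Rbar) (f : C -> Cbar) (Q : nat -> C -> C) (n : nat) :
  (forall k, ap_factor a b f (Q k)) -> ap_factor a b f (fun z => NP (fun k => Q k z) n).
Proof.
  intros H. induction n as [|n IH]; simpl; [apply ap_factor_one|].
  apply (ap_factor_mult a b f (fun z => NP (fun k => Q k z) n) (Q n)); [exact IH|apply H].
Qed.

Lemma kills_NP (a b : Rbar) (f : C -> Cbar) (Q : nat -> C -> C) (k n : nat) (p : C) :
  (forall k, ap_factor a b f (Q k)) -> strip a b p -> (k < n)%nat -> kills f (Q k) p ->
  kills f (fun z => NP (fun k => Q k z) n) p.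
Proof.
  intros H Hp Hk K. induction Hk as [|n Hk IH]; simpl.
  - apply (kills_ext f (fun z => Q k z * NP (fun k => Q k z) k)%C); [intros z; ring|].
    apply kills_mult; [exact K|]. apply (ap_factor_NP a b f Q k H), Hp.
  - apply (kills_mult f (fun z => NP (fun k => Q k z) n) (Q n)); [exact IH|apply H, Hp].
Qed.

(** Factor [k] is within a summable error of 1 on strip [k], so on an inner strip the product
    converges uniformly after finitely many factors. Analyticity, boundedness, control and killing
    then pass from partial products to the limit. *)
Lemma infinite_product (a b : Rbar) (f : C -> Cbar) (A B : nat -> R) (Q : nat -> C -> C) :
  (forall k, A (S k) < A k) -> (forall k, B k < B (S k)) -> (forall k, inner_strip (A (S k)) (B (S k)) a b) ->
  (forall al be, inner_strip al be a b -> exists k, A k < al /\ be < B k) ->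
  (forall k, ap_factor a b f (Q k)) ->
  (forall k z, A k <= Im z <= B k -> Cmod (Q k z - 1)%C <= / 100 * (/ 2) ^ k) ->
  exists h, ap_factor a b f h /\ (forall k p, strip a b p -> kills f (Q k) p -> kills f h p) /\
    forall z, A 0%nat <= Im z <= B 0%nat -> Cmod (h z - 1)%C <= / 10.
Proof.
  intros HA HB HAB Hex HQ Hnear.
  assert (Mono : forall j k, (j <= k)%nat -> A k <= A j /\ B j <= B k).
  { intros j k H. induction H as [|k H IH]; [lra|]. specialize (HA k). specialize (HB k). lra. }
  assert (Hn : forall j z, A j <= Im z <= B j -> forall k, (j <= k)%nat -> Cmod (Q k z - 1)%C <= / 100 * (/ 2) ^ k).
  { intros j z Hz k Hk. apply Hnear. destruct (Mono j k Hk). lra. }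
  set (P := fun n z => NP (fun k => Q k z) n).
  set (h := fun z => epsilon (inhabits (RtoC 0)) (fun l => forall j, A j <= Im z <= B j ->
    forall n, (j <= n)%nat -> Cmod l <= 3 * Cmod (P n z) /\ Cmod (P n z - l)%C <= 3 * Cmod (P n z) * (/ 50 * (/ 2) ^ n))).
  assert (Hh : forall z j, A j <= Im z <= B j ->
    forall n, (j <= n)%nat -> Cmod (h z) <= 3 * Cmod (P n z) /\ Cmod (P n z - h z)%C <= 3 * Cmod (P n z) * (/ 50 * (/ 2) ^ n)).
  { intros z j Hz.
    assert (E : exists l, forall j, A j <= Im z <= B j ->
      forall n, (j <= n)%nat -> Cmod l <= 3 * Cmod (P n z) /\ Cmod (P n z - l)%C <= 3 * Cmod (P n z) * (/ 50 * (/ 2) ^ n)).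
    (* The estimates for the least index [j0] whose strip contains [z] include those for all other
       such indices. *)
    { destruct (classic (exists j0, A j0 <= Im z <= B j0 /\ forall j, A j <= Im z <= B j -> (j0 <= j)%nat)) as [[j0 [H1 H2]]|N].
      - destruct (NP_limit (fun k => Q k z) j0 (Hn j0 z H1)) as [l Hl]. exists l.
        intros j' Hj' n Hn'. apply Hl. specialize (H2 j' Hj'). lia.
      - exfalso. apply N. clear N h.
        assert (Well : forall n, (exists j, (j <= n)%nat /\ A j <= Im z <= B j) ->
          exists j0, A j0 <= Im z <= B j0 /\ forall j, A j <= Im z <= B j -> (j0 <= j)%nat).
        { induction n as [|n IH]; intros [i [Hi Ki]].
          - exists 0%nat. split; [replace 0%nat with i by lia; exact Ki|]. intros; lia.
          - destruct (classic (exists j, (j <= n)%nat /\ A j <= Im z <= B j)) as [E|E]; [apply IH, E|].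
            exists i. split; [exact Ki|]. intros j' Hj'. apply Nat.nlt_ge. intros L. apply E. exists j'. split; [lia|exact Hj']. }
        apply (Well j). exists j. split; [lia|exact Hz]. }
    exact (epsilon_spec (inhabits (RtoC 0)) _ E j Hz). }
  assert (Unif : forall al be, inner_strip al be a b -> forall eps, 0 < eps -> exists j n, (j <= n)%nat /\
    (forall z, al <= Im z <= be -> A j <= Im z <= B j) /\ forall z, al <= Im z <= be -> Cmod (P n z - h z)%C <= eps).
  { intros al be Hs eps Heps. destruct (Hex al be Hs) as [j [Hj1 Hj2]].
    destruct (ap_factor_NP a b f Q j HQ) as [_ [Bd _]]. destruct (Bd al be Hs) as [M HM].
    set (M' := 9 * Rabs M + 1). assert (HM' : 0 < M') by (unfold M'; generalize (Rabs_pos M); lra).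
    destruct (half_pow_small (eps / M')) as [n Hn']; [apply Rdiv_lt_0_compat; lra|].
    assert (HinJ : forall z, al <= Im z <= be -> A j <= Im z <= B j) by (intros z Hz; lra).
    exists j, (Nat.max j n). split; [lia|split; [exact HinJ|]]. intros z Hz.
    destruct (Hh z j (HinJ z Hz) (Nat.max j n) ltac:(lia)) as [_ D].
    destruct (NP_tail (fun k => Q k z) j (Hn j z (HinJ z Hz)) j (Nat.le_refl j)) as [G _].
    specialize (G (Nat.max j n) ltac:(lia)). fold (P (Nat.max j n) z) in G.
    specialize (HM z Hz). cbv beta in HM. specialize (Hn' (Nat.max j n) ltac:(lia)).
    assert (LM := Rle_abs M). set (x := (/ 2) ^ Nat.max j n) in *. assert (Px : 0 < x) by (apply pow_lt; lra).
    eapply Rle_trans; [exact D|]. apply Rle_trans with (M' * x).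
    - apply Rmult_le_compat; [generalize (Cmod_ge_0 (P (Nat.max j n) z)); lra|lra|unfold M'; lra|lra].
    - apply Rle_trans with (M' * (eps / M')); [apply Rmult_le_compat_l; lra|right; field; lra]. }
  exists h. split; [split; [|split]|split].
  - intros z Hz. destruct (strip_open a b z Hz) as [d [Hd K]].
    assert (Hs : inner_strip (Im z - d / 2) (Im z + d / 2) a b).
    { split; [|split; [lra|]].
      - apply (K (0, Im z - d / 2)). unfold Im at 1; simpl. apply Rabs_lt_between. lra.
      - apply (K (0, Im z + d / 2)). unfold Im at 1; simpl. apply Rabs_lt_between. lra. }
    assert (Near : forall w, Cmod (w - z)%C < d / 2 -> Im z - d / 2 <= Im w <= Im z + d / 2).
    { intros w Hw. assert (T := im_le_of_Cmod w z). apply Rabs_le_between in T. lra. }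
    set (N := fun k : nat => epsilon (inhabits 0%nat) (fun n => forall w, Im z - d / 2 <= Im w <= Im z + d / 2 ->
      Cmod (P n w - h w)%C <= (/ 2) ^ k)).
    assert (HN : forall k w, Im z - d / 2 <= Im w <= Im z + d / 2 -> Cmod (P (N k) w - h w)%C <= (/ 2) ^ k).
    { intros k. apply (epsilon_spec (inhabits 0%nat)). destruct (Unif _ _ Hs ((/ 2) ^ k)) as [j [n [_ [_ U]]]];
        [apply pow_lt; lra|]. exists n. exact U. }
    apply (holo_uniform_limit (fun k => P (N k)) h z (d / 2)); [lra| |].
    + intros k w Hw. apply (ap_factor_NP a b f Q (N k) HQ). apply (inner_strip_in _ _ _ _ w Hs), Near, Hw.
    + intros eps Heps. destruct (half_pow_small eps Heps) as [k Hk]. exists k. intros w Hw.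
      specialize (Hk k (Nat.le_refl k)). specialize (HN k w (Near w Hw)). lra.
  - intros al be Hs. destruct (Unif al be Hs 1 Rlt_0_1) as [j [n [Hjn [HinJ _]]]].
    destruct (ap_factor_NP a b f Q n HQ) as [_ [Bd _]]. destruct (Bd al be Hs) as [M HM].
    exists (3 * M). intros z Hz. destruct (Hh z j (HinJ z Hz) n Hjn) as [K _]. specialize (HM z Hz). cbv beta in HM.
    unfold P in K. lra.
  - intros al be Hs eps Heps. destruct (Unif al be Hs (eps / 3)) as [j [n [_ [_ U]]]]; [lra|].
    destruct (ap_factor_NP a b f Q n HQ) as [_ [_ Ct]].
    destruct (Ct al be Hs (eps / 3)) as [a1 [b1 [d1 [S1 [Hd1 K1]]]]]; [lra|].
    exists a1, b1, d1. split; [exact S1|split; [exact Hd1|]]. intros k Hap z Hz.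
    assert (Iz : al <= Im (z + IZR k)%C <= be) by (rewrite im_plus, im_RtoC; lra).
    assert (T1 := U z Hz). assert (T2 := U _ Iz). assert (T3 := K1 k Hap z Hz). cbv beta in T3.
    fold (P n (z + IZR k)%C) in T3. fold (P n z) in T3.
    replace (h (z + IZR k)%C - h z)%C
      with ((P n (z + IZR k)%C - P n z) - (P n (z + IZR k)%C - h (z + IZR k)%C) + (P n z - h z))%C by ring.
    eapply Rle_trans; [apply Cmod_triangle|]. eapply Rle_trans; [apply Rplus_le_compat_r, Cmod_triangle_minus|]. lra.
  - intros k p Hp Kp. destruct (strip_open a b p Hp) as [d [Hd K]].
    assert (Hs : inner_strip (Im p - d / 2) (Im p + d / 2) a b).
    { split; [|split; [lra|]].
      - apply (K (0, Im p - d / 2)). unfold Im at 1; simpl. apply Rabs_lt_between. lra.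
      - apply (K (0, Im p + d / 2)). unfold Im at 1; simpl. apply Rabs_lt_between. lra. }
    destruct (Hex _ _ Hs) as [j [Hj1 Hj2]].
    set (n := Nat.max (S k) j).
    destruct (kills_NP a b f Q k n p HQ Hp ltac:(lia) Kp) as [M [d1 [Hd1 K1]]].
    exists (3 * M), (Rmin d1 (d / 2)). split; [apply Rmin_pos; lra|]. intros w Hw Hwd.
    assert (W1 := Rlt_le_trans _ _ _ Hwd (Rmin_l _ _)).
    assert (W2 := Rlt_le_trans _ _ _ Hwd (Rmin_r _ _)).
    assert (T := im_le_of_Cmod w p). apply Rabs_le_between in T.
    destruct (Hh w j ltac:(lra) n ltac:(lia)) as [Hb _].
    specialize (K1 w Hw W1). cbv beta in K1. fold (P n w) in K1.
    assert (Px := Cmod_ge_0 (affine_part (f w))). nra.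
  (* At [n = 0] the partial product is 1, so the error is at most 3/50. *)
  - intros z Hz. destruct (Hh z 0%nat Hz 0%nat (Nat.le_refl 0)) as [_ D]. unfold P in D. simpl in D.
    rewrite Cmod_1 in D. rewrite Cmod_minus_sym in D. lra.
Qed.

(** The base row kills the poles near height [y] without vanishing at [z0]; bands above and below
    cover the rest. Band [k] is separated from strip [k] by a gap, so its factor can be brought as
    close to 1 on that strip as the infinite product requires. *)
Theorem killing_factor (a b : Rbar) (f : C -> Cbar) : Rbar_lt a b -> meromorphic_almost_periodic a b f ->
  exists h, ap_factor a b f h /\ (forall p, strip a b p -> f p = Cinf -> kills f h p) /\
    exists z, strip a b z /\ h z <> RtoC 0.
Proof.
  intros Hab Hf.
  assert (Ey : exists y : R, Rbar_lt a y /\ Rbar_lt y b).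
  { destruct a as [a| |], b as [b| |]; simpl in Hab; try (exfalso; exact Hab).
    - exists ((a + b) / 2). simpl. lra.
    - exists (a + 1). simpl. split; [lra|exact I].
    - exists (b - 1). simpl. split; [exact I|lra].
    - exists 0. split; exact I. }
  destruct Ey as [y [Hy1 Hy2]].
  destruct (finite_point a b f y (proj1 Hf) Hy1 Hy2) as [z0 [Iz0 Fz0]].
  assert (Hz0 : strip a b z0) by (split; rewrite Iz0; assumption).
  destruct (base_product a b f z0 Hf Hz0 Fz0) as [r [Hbase [Hr [Hir [Gb [Kb Nb]]]]]].
  rewrite Iz0 in Hir, Kb.
  destruct (increasing_exhaustion (y + r) b) as [B1 [B10 [B11 [B12 B13]]]]; [apply Hir|].
  destruct (decreasing_exhaustion (y - r) a) as [A1 [A10 [A11 [A12 A13]]]]; [apply Hir|].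
  set (B := fun k => match k with O => y | S j => B1 j end).
  set (A := fun k => match k with O => y | S j => A1 j end).
  assert (HB : forall k, B k < B (S k)) by (intros [|k]; simpl; [lra|apply B11]).
  assert (HA : forall k, A (S k) < A k) by (intros [|k]; simpl; [lra|apply A11]).
  assert (HAB : forall k, A k <= y <= B k).
  { induction k as [|k IH]; [simpl; lra|]. specialize (HA k). specialize (HB k). lra. }
  assert (HBb : forall k, Rbar_lt (B k) b) by (intros [|k]; simpl; [exact Hy2|apply B12]).
  assert (HAa : forall k, Rbar_lt a (A k)) by (intros [|k]; simpl; [exact Hy1|apply A12]).
  assert (HU : forall k, exists U, ap_factor a b f U /\
    (forall p, f p = Cinf -> B (S k) <= Im p <= B (S (S k)) -> kills f U p) /\
    forall z, A k <= Im z <= B k -> Cmod (U z - 1)%C <= / 100 * (/ 2) ^ k / 3).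
  { intros k. assert (b1 := HB k). assert (b2 := HB (S k)). assert (ab := HAB k).
    assert (Pk : 0 < (/ 2) ^ k <= 1).
    { split; [apply pow_lt; lra|]. rewrite <- (pow1 k). apply pow_incr. lra. }
    (* Half of the gap below the band serves as the separation; the last number bounds all vertical
       distances between strip and band. *)
    apply (band_product a b f (B (S k)) (B (S (S k))) 1 ((B (S k) - B k) / 2) (B (S (S k)) + (B (S k) - B k) - A k)
      _ (fun z => A k <= Im z <= B k)); try assumption; try lra.
    - split; [|split; [lra|apply HBb]]. apply Rbar_lt_le_trans with y; [exact Hy1|]. simpl. apply (HAB (S k)).
    - intros z p Hz Hp. split; [lra|]. apply Rabs_le. lra. }
  assert (HL : forall k, exists L, ap_factor a b f L /\
    (forall p, f p = Cinf -> A (S (S k)) <= Im p <= A (S k) -> kills f L p) /\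
    forall z, A k <= Im z <= B k -> Cmod (L z - 1)%C <= / 100 * (/ 2) ^ k / 3).
  { intros k. assert (a1 := HA k). assert (a2 := HA (S k)). assert (ab := HAB k).
    assert (Pk : 0 < (/ 2) ^ k <= 1).
    { split; [apply pow_lt; lra|]. rewrite <- (pow1 k). apply pow_incr. lra. }
    apply (band_product a b f (A (S (S k))) (A (S k)) (-1) ((A k - A (S k)) / 2) (B k - A (S (S k)) + (A k - A (S k)))
      _ (fun z => A k <= Im z <= B k)); try assumption; try lra.
    - split; [apply HAa|split; [lra|]]. apply Rbar_le_lt_trans with y; [simpl; apply (HAB (S k))|exact Hy2].
    - intros z p Hz Hp. split; [lra|]. apply Rabs_le. lra. }
  set (U := fun k => epsilon (inhabits (fun _ : C => RtoC 0)) (fun U => ap_factor a b f U /\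
    (forall p, f p = Cinf -> B (S k) <= Im p <= B (S (S k)) -> kills f U p) /\
    forall z, A k <= Im z <= B k -> Cmod (U z - 1)%C <= / 100 * (/ 2) ^ k / 3)).
  assert (U1 := fun k => epsilon_spec (inhabits (fun _ : C => RtoC 0)) _ (HU k)).
  set (L := fun k => epsilon (inhabits (fun _ : C => RtoC 0)) (fun L => ap_factor a b f L /\
    (forall p, f p = Cinf -> A (S (S k)) <= Im p <= A (S k) -> kills f L p) /\
    forall z, A k <= Im z <= B k -> Cmod (L z - 1)%C <= / 100 * (/ 2) ^ k / 3)).
  assert (L1 := fun k => epsilon_spec (inhabits (fun _ : C => RtoC 0)) _ (HL k)).
  cbv beta in U1, L1.
  destruct (infinite_product a b f A B (fun k z => U k z * L k z)%C HA HB) as [h [Gh [Kh Nh]]].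
  { intros k. split; [apply HAa|split; [|apply HBb]]. assert (a1 := HA k). assert (ab := HAB k). assert (ab' := HAB (S k)). lra. }
  { intros al be [H1 [_ H3]]. destruct (A13 al H1) as [i Hi]. destruct (B13 be H3) as [j Hj].
    assert (MonB : forall i j, (i <= j)%nat -> B i <= B j).
    { intros i' j' H. induction H as [|j' H IH]; [lra|]. specialize (HB j'). lra. }
    assert (MonA : forall i j, (i <= j)%nat -> A j <= A i).
    { intros i' j' H. induction H as [|j' H IH]; [lra|]. specialize (HA j'). lra. }
    exists (S (Nat.max i j)). split.
    - eapply Rle_lt_trans; [apply (MonA (S i)); lia|exact Hi].
    - eapply Rlt_le_trans; [exact Hj|apply (MonB (S j)); lia]. }
  { intros k. apply ap_factor_mult; [apply U1|apply L1]. }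
  { intros k z Hz. apply mult_near_1; [|apply U1, Hz|apply L1, Hz].
    assert ((/ 2) ^ k <= 1) by (rewrite <- (pow1 k); apply pow_incr; lra). lra. }
  exists (fun z => Hbase z * h z)%C. split; [apply ap_factor_mult; assumption|split].
  - intros p Hp Fp.
    assert (KUL : forall k, kills f (fun z => U k z * L k z)%C p -> kills f (fun z => Hbase z * h z)%C p).
    { intros k K. apply (kills_ext f (fun z => h z * Hbase z)%C); [intros z; ring|].
      apply kills_mult; [apply (Kh k p Hp K)|apply Gb, Hp]. }
    destruct (Rle_or_lt (y - r) (Im p)) as [C1|C1]; [destruct (Rle_or_lt (Im p) (y + r)) as [C2|C2]|].
    + apply kills_mult; [apply Kb; [exact Fp|lra]|apply Gh, Hp].
    (* Descending from a stage beyond [p] finds the band that contains its height. *)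
    + assert (Fd : forall n, Im p < B1 n -> exists k, B (S k) <= Im p <= B (S (S k))).
      { induction n as [|n IH]; intros Hn; [lra|].
        destruct (Rle_or_lt (B1 n) (Im p)) as [C3|C3]; [exists n; simpl; lra|apply IH, C3]. }
      destruct (B13 (Im p) (proj2 Hp)) as [n Hn]. destruct (Fd n Hn) as [k Hk].
      apply (KUL k). apply kills_mult; [apply U1; [exact Fp|exact Hk]|apply L1, Hp].
    + assert (Fd : forall n, A1 n < Im p -> exists k, A (S (S k)) <= Im p <= A (S k)).
      { induction n as [|n IH]; intros Hn; [lra|].
        destruct (Rle_or_lt (Im p) (A1 n)) as [C3|C3]; [exists n; simpl; lra|apply IH, C3]. }
      destruct (A13 (Im p) (proj1 Hp)) as [n Hn]. destruct (Fd n Hn) as [k Hk].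
      apply (KUL k). apply (kills_ext f (fun z => L k z * U k z)%C); [intros z; ring|].
      apply kills_mult; [apply L1; [exact Fp|exact Hk]|apply U1, Hp].
  - exists z0. split; [exact Hz0|].
    assert (Nh0 : Cmod (h z0 - 1)%C <= / 10) by (apply Nh; simpl; lra).
    apply Cmult_neq_0; intros E; [rewrite E in Nb|rewrite E in Nh0];
      [replace (0 - 1)%C with (- (1))%C in Nb by ring; rewrite Cmod_opp, Cmod_1 in Nb
      |replace (0 - 1)%C with (- (1))%C in Nh0 by ring; rewrite Cmod_opp, Cmod_1 in Nh0]; lra.
Qed.

(** Integral almost periods of [f] are relatively dense, and control turns them into almost periods
    of [H]. *)
Lemma ap_factor_almost_periodic (a b : Rbar) (f : C -> Cbar) (H : C -> C) : meromorphic_almost_periodic a b f ->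
  (forall z, strip a b z -> holo H z) -> controlled a b f H -> analytic_almost_periodic a b H.
Proof.
  intros Hf HH HC. split.
  - intros z Hz. apply C_differentiable_holo, HH, Hz.
  - intros al be Hs eps Heps. destruct (HC al be Hs (eps / 2)) as [a1 [b1 [d [S1 [Hd K]]]]]; [lra|].
    destruct (integer_almost_periods a b f a1 b1 d Hf S1 Hd) as [Len [HLen KL]].
    exists Len. split; [exact HLen|]. intros t. destruct (KL t) as [k [Hk Hap]].
    exists (IZR k). split; [exact Hk|]. intros z [Z1 Z2]. simpl in Z1, Z2.
    apply Rle_lt_trans with (eps / 2); [apply (K k Hap); lra|lra].
Qed.

(** * The quotient representation *)

Lemma pole_product_extension (a b : Rbar) (f : C -> Cbar) (h : C -> C) (p : C) : meromorphic_on (strip a b) f ->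
  strip a b p -> f p = Cinf -> holo h p -> kills f h p ->
  (exists d, 0 < d /\ forall w, Cmod (w - p)%C < d -> holo h w) ->
  exists c, holo (fun z => if Ceq_dec z p then c else affine_part (f z) * h z)%C p.
Proof.
  intros Hf Hp Fp Hh [M [d [Hd K]]] [d1 [Hd1 H1]].
  destruct (meromorphic_pole a b f p Hf Hp Fp 0) as [d2 [Hd2 K2]].
  apply (Riemann_removable (fun z => affine_part (f z) * h z)%C p (Rmin d1 d2)).
  - apply Rmin_pos; assumption.
  - intros z Nz Hz. apply holo_mult.
    + apply K2; [exact Nz|]. eapply Rlt_le_trans; [exact Hz|apply Rmin_r].
    + apply H1. eapply Rlt_le_trans; [exact Hz|apply Rmin_l].
  - exists M, d. split; [exact Hd|]. intros w Nw Hw. rewrite Cmod_mult. apply K; assumption.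
Qed.

(** At a pole [g] takes the value supplied by Riemann's theorem. The values are chosen pole by pole,
    which is consistent because poles are isolated. *)
Lemma product_holo (a b : Rbar) (f : C -> Cbar) (h : C -> C) : meromorphic_on (strip a b) f ->
  (forall z, strip a b z -> holo h z) -> (forall p, strip a b p -> f p = Cinf -> kills f h p) ->
  exists g, (forall z, strip a b z -> holo g z) /\ forall z, f z <> Cinf -> g z = (affine_part (f z) * h z)%C.
Proof.
  intros Hf Hh Hk.
  set (v := fun p => epsilon (inhabits (RtoC 0)) (fun c => holo (fun z => if Ceq_dec z p then c else affine_part (f z) * h z)%C p)).
  set (g := fun z => match f z with Cinf => v z | Cfin w => (w * h z)%C end).
  assert (G : forall z, f z <> Cinf -> g z = (affine_part (f z) * h z)%C).
  { intros z N. unfold g. rewrite (finite_affine _ N). reflexivity. }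
  exists g. split; [|exact G]. intros p Hp.
  destruct (classic (f p = Cinf)) as [Fp|Fp].
  - assert (Near : exists d, 0 < d /\ forall w, Cmod (w - p)%C < d -> holo h w).
    { destruct (strip_open a b p Hp) as [d [Hd K]]. exists d. split; [exact Hd|]. intros w Hw. apply Hh, K.
      eapply Rle_lt_trans; [apply im_le_of_Cmod|exact Hw]. }
    assert (E := epsilon_spec (inhabits (RtoC 0)) _
      (pole_product_extension a b f h p Hf Hp Fp (Hh p Hp) (Hk p Hp Fp) Near)).
    fold (v p) in E. cbv beta in E. revert E. apply holo_ext_near.
    destruct (meromorphic_pole a b f p Hf Hp Fp 0) as [d [Hd K]].
    exists d. split; [exact Hd|]. intros w Hw. destruct (Ceq_dec w p) as [->|Nw].
    + unfold g. rewrite Fp. reflexivity.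
    + symmetry. apply G. apply K; assumption.
  - destruct (meromorphic_finite a b f p Hf Hp Fp) as [HA [d [Hd K]]].
    apply (holo_ext_near (fun z => affine_part (f z) * h z)%C).
    + exists d. split; [exact Hd|]. intros w Hw. symmetry. apply G, K, Hw.
    + apply holo_mult; [exact HA|apply Hh, Hp].
Qed.

(* On contours where [f] stays bounded the difference [g (z + k) - g z] is
   estimated factor by factor; the maximum principle carries the estimate inside. *)
Lemma product_controlled (a b : Rbar) (f : C -> Cbar) (g h : C -> C) : meromorphic_almost_periodic a b f ->
  ap_factor a b f h -> (forall z, strip a b z -> holo g z) ->
  (forall z, f z <> Cinf -> g z = (affine_part (f z) * h z)%C) -> controlled a b f g.
Proof.
  intros Hf [Hh [Bh Ch]] Hg Eg al be Hs eps Heps.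
  destruct (good_contour a b f al be Hf Hs) as [r [m [Hr [Hm GC]]]].
  assert (Hs0 := Hs). destruct Hs0 as [_ [Hab _]].
  assert (Hs' : inner_strip (al - r) (be + r) a b).
  { split; [|split; [lra|]].
    - apply ((proj1 (GC (0, al) ltac:(simpl; lra))) (0, al - r)). split; simpl; lra.
    - apply ((proj1 (GC (0, be) ltac:(simpl; lra))) (0, be + r)). split; simpl; lra. }
  destruct (Bh _ _ Hs') as [Mh HM].
  assert (HM0 : 0 <= Mh).
  { eapply Rle_trans; [apply Cmod_ge_0|apply (HM (0, al)); simpl; lra]. }
  destruct (Ch _ _ Hs' (eps * m / 2)) as [a1 [b1 [d1 [S1 [Hd1 K1]]]]].
  { apply Rdiv_lt_0_compat; [apply Rmult_lt_0_compat; assumption|lra]. }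
  (* Under an almost period with error at most [m'] the heights on the contour stay at least
     [m / 2]. *)
  set (m' := m / 2). assert (Hm' : 0 < m') by (unfold m'; lra).
  set (L := / m' + / (m' * m')).
  assert (HL : 0 < L).
  { unfold L. apply Rplus_lt_0_compat; apply Rinv_0_lt_compat; [exact Hm'|apply Rmult_lt_0_compat; exact Hm']. }
  (* This makes [L * d2 * (Mh + 1)] equal to [eps / 2]; the other half is the error [eps * m / 2] of
     [h] times the bound [/ m] for [f]. *)
  set (d2 := eps / 2 / (L * (Mh + 1))).
  assert (Hd2 : 0 < d2) by (apply Rdiv_lt_0_compat; [lra|apply Rmult_lt_0_compat; lra]).
  set (d := Rmin d1 (Rmin d2 m')).
  assert (Hd : 0 < d) by (repeat apply Rmin_pos; assumption).
  assert (dd1 : d <= d1) by apply Rmin_l.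
  assert (dd2 : d <= d2) by (eapply Rle_trans; [apply Rmin_r|apply Rmin_l]).
  assert (dd3 : d <= m') by (eapply Rle_trans; [apply Rmin_r|apply Rmin_r]).
  exists (Rmin (al - r) a1), (Rmax (be + r) b1), d.
  split; [apply inner_strip_union; assumption|split; [exact Hd|]].
  intros k Hk z Hz.
  assert (Hk1 : ap_set f a1 b1 d1 (IZR k)) by (revert Hk; apply ap_set_mono; [apply Rmin_r|apply Rmax_r|exact dd1]).
  assert (Hk2 : ap_set f (al - r) (be + r) d (IZR k)) by (revert Hk; apply ap_set_mono; [apply Rmin_l|apply Rmax_l|lra]).
  destruct (GC z Hz) as [_ [s [[Hs1 Hs2] Hc]]].
  assert (Box : forall w, sq z s w -> al - r <= Im w <= be + r) by (intros w [_ Hw]; lra).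
  assert (Shift : forall w : C, Im (w + IZR k)%C = Im w) by (intros [x y]; unfold Im, Cplus, RtoC; simpl; ring).
  apply (maximum_principle (fun u => g (u + IZR k) - g u)%C z s eps z Hs1).
  - intros w Hw. apply holo_minus; [apply holo_shift|]; apply Hg, (inner_strip_in _ _ _ _ _ Hs');
      [rewrite Shift|]; apply Box, Hw.
  - intros w Hw. assert (Bw := Box w (sqb_sq _ _ _ Hw)). assert (T1 := Hc w Hw).
    assert (Cl := Hk2 w Bw).
    assert (T2 : m' <= tS (f (w + IZR k)%C)).
    { destruct Cl as [Cl _]. apply Rabs_le_between in Cl. unfold m' in *. lra. }
    assert (Fin : forall u, 0 < tS u -> u <> Cinf) by (intros u P ->; simpl in P; lra).
    rewrite !Eg by (apply Fin; lra).
    set (A := affine_part (f (w + IZR k)%C)). set (A0 := affine_part (f w)).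
    assert (Q1 : Cmod (A - A0)%C <= L * d) by (apply sclose_affine; try assumption; unfold m'; lra).
    assert (Q2 : Cmod A0 <= / m) by (apply Cmod_affine_le; assumption).
    assert (Q3 : Cmod (h (w + IZR k)%C) <= Mh) by (apply HM; rewrite Shift; exact Bw).
    assert (Q4 := K1 k Hk1 w Bw).
    replace (A * h (w + IZR k) - A0 * h w)%C with ((A - A0) * h (w + IZR k) + A0 * (h (w + IZR k) - h w))%C by ring.
    eapply Rle_trans; [apply Cmod_triangle|]. rewrite !Cmod_mult.
    apply Rle_trans with (L * d2 * (Mh + 1) + / m * (eps * m / 2)).
    + apply Rplus_le_compat; apply Rmult_le_compat; try apply Cmod_ge_0; try assumption; [|lra].
      eapply Rle_trans; [exact Q1|]. apply Rmult_le_compat_l; lra.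
    + right. unfold d2. field. split; lra.
  - apply sq_center. lra.
Qed.

(** Near a pole [f] is unbounded, so a bounded product with [f] forces [h] to vanish there. Hence
    [f] is finite wherever [g / h] has to represent it. *)
Lemma pole_zero (a b : Rbar) (f : C -> Cbar) (h : C -> C) (p : C) : meromorphic_on (strip a b) f ->
  strip a b p -> f p = Cinf -> ccont h p -> kills f h p -> h p = RtoC 0.
Proof.
  intros Hf Hp Fp Hh [M [d [Hd K]]]. apply NNPP. intros N. assert (P := Cmod_neq0 _ N).
  destruct (ccont_nonzero_near h p Hh N) as [d1 [Hd1 K1]].
  destruct (meromorphic_pole a b f p Hf Hp Fp (2 * Rmax M 0 / Cmod (h p))) as [d2 [Hd2 K2]].
  set (e := Rmin d (Rmin d1 d2) / 2).
  assert (He : 0 < Rmin d (Rmin d1 d2)) by (repeat apply Rmin_pos; assumption).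
  assert (e1 := Rmin_l d (Rmin d1 d2)). assert (e2 := Rmin_r d (Rmin d1 d2)).
  assert (e3 := Rmin_l d1 d2). assert (e4 := Rmin_r d1 d2).
  assert (Hw : Cmod (p + e - p)%C = e).
  { replace (p + e - p)%C with (RtoC e) by ring. rewrite Cmod_R, Rabs_pos_eq; unfold e; lra. }
  assert (Nw : (p + e)%C <> p).
  { intros E. rewrite E in Hw. replace (p - p)%C with (RtoC 0) in Hw by ring. rewrite Cmod_0 in Hw. unfold e in Hw. lra. }
  specialize (K _ Nw ltac:(rewrite Hw; unfold e; lra)).
  specialize (K1 (p + e)%C ltac:(rewrite Hw; unfold e; lra)).
  destruct (K2 _ Nw ltac:(rewrite Hw; unfold e; lra)) as [_ [_ K3]].
  apply Rmult_lt_compat_r with (r := Cmod (h p) / 2) in K3; [|lra].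
  replace (2 * Rmax M 0 / Cmod (h p) * (Cmod (h p) / 2)) with (Rmax M 0) in K3 by (field; lra).
  assert (MM := Rmax_l M 0).
  assert (Q : Cmod (affine_part (f (p + e)%C)) * (Cmod (h p) / 2) <= Cmod (affine_part (f (p + e)%C)) * Cmod (h (p + e)%C))
    by (apply Rmult_le_compat_l; [apply Cmod_ge_0|exact K1]).
  lra.
Qed.

Theorem theorem7 :
  forall (a b : Rbar) (f : C -> Cbar),
    Rbar_lt a b ->
    meromorphic_almost_periodic a b f ->
    exists g h : C -> C,
      analytic_almost_periodic a b g /\
      analytic_almost_periodic a b h /\
      is_quotient_on (strip a b) f g h.
Proof.
  intros a b f Hab Hf. destruct (killing_factor a b f Hab Hf) as [h [Hh [Kh Nh]]].
  assert (Mf : meromorphic_on (strip a b) f) by apply Hf.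
  assert (Holoh : forall z, strip a b z -> holo h z) by apply Hh.
  destruct (product_holo a b f h Mf Holoh Kh) as [g [Hg Eg]].
  exists g, h. split; [|split; [|split; [exact Nh|]]].
  - apply (ap_factor_almost_periodic a b f); [exact Hf|exact Hg|].
    apply (product_controlled a b f g h); assumption.
  - apply (ap_factor_almost_periodic a b f); [exact Hf|exact Holoh|apply Hh].
  - intros z Hz N.
    assert (Fz : f z <> Cinf).
    { intros E. apply N. apply (pole_zero a b f h z Mf Hz E); [apply holo_ccont, Holoh, Hz|apply Kh; assumption]. }
    rewrite (Eg z Fz), (finite_affine _ Fz) at 1. f_equal. field. exact N.
Qed.
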